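(* Let $N\ge 2$ be an integer with $N\neq 6$, let $\zeta=e^{2\pi i/N}$, and let $\{Q_1,Q_2\}$ be a basis of the group $\mathbf{Z}/N\mathbf{Z}\oplus\mathbf{Z}/N\mathbf{Z}$. Then $$A(N)_{\mathbf{Q}(\zeta)}=\mathbf{Q}(\zeta)\big(\Lambda(\tau;Q_1,Q_2),\,j\big).$$
   Context: For $\tau$ in the complex upper half plane, $L_\tau=\mathbf{Z}+\mathbf{Z}\tau$ and $\wp(z;L_\tau)$ is the Weierstrass $\wp$-function of $L_\tau$. For $(r,s)\in\mathbf{Z}/N\mathbf{Z}\oplus\mathbf{Z}/N\mathbf{Z}$ put $\varphi_\tau((r,s))\equiv(r\tau+s)/N \pmod{L_\tau}$. For a basis $\{Q_1,Q_2\}$ of $\mathbf{Z}/N\mathbf{Z}\oplus\mathbf{Z}/N\mathbf{Z}$ define $$\Lambda(\tau;Q_1,Q_2)=\frac{\wp(\varphi_\tau(Q_1);L_\tau)-\wp(\varphi_\tau(Q_1+Q_2);L_\tau)}{\wp(\varphi_\tau(Q_2);L_\tau)-\wp(\varphi_\tau(Q_1+Q_2);L_\tau)}.$$ $\Gamma(N)$ is the principal congruence subgroup of level $N$ of $\mathrm{SL}_2(\mathbf{Z})$, $A(N)$ is the field of modular functions for $\Gamma(N)$, and $A(N)_{\mathbf{Q}(\zeta)}$ is the subfield of those functions whose Fourier expansions in $q=e^{2\pi i\tau/N}$ have all coefficients in $\mathbf{Q}(\zeta)$. $j$ is the elliptic modular invariant. *)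

(* Defs.v *)
From HB Require Import structures.
From mathcomp Require Import all_boot all_order all_algebra.
From mathcomp Require Import all_classical all_reals all_analysis.
From mathcomp Require Import complex.
From mathcomp.analysis.showcase Require Import summability.

Set Implicit Arguments.
Unset Strict Implicit.
Unset Printing Implicit Defensive.

Import Order.TTheory GRing.Theory Num.Theory numFieldNormedType.Exports.
Local Open Scope classical_set_scope.
Local Open Scope ring_scope.

(* The complex numbers are [R[i]], viewed as a normed space over themselves, so
   that [derivable f z 1] is complex differentiability at [z]. *)
HB.instance Definition _ (R : rcfType) :=
  NormedModule.copy R[i] R[i]^o.

Definition cexp {R : realType} (z : R[i]) : R[i] :=
  Complex (expR (complex.Re z) * cos (complex.Im z))
          (expR (complex.Re z) * sin (complex.Im z)).

(* [cexp2ipi z] is e^(2 pi i z). *)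
Definition cexp2ipi {R : realType} (z : R[i]) : R[i] :=
  cexp (Complex 0 (2 * pi) * z).

Definition upper_half_plane {R : realType} : set R[i] :=
  [set tau | 0 < complex.Im tau].

(** Lattice sums and the Weierstrass function *)

Definition lattice_pt {R : realType} (tau : R[i]) (m : int * int) : R[i] :=
  m.1%:~R + m.2%:~R * tau.

(* Unconditional sum over the nonzero points of Z + Z tau: the limit of the
   sums over finite subsets, along the inclusion order. *)
Definition lattice_sum {R : realType} (tau : R[i]) (F : R[i] -> R[i]) : R[i] :=
  summability.sum
    (fun m : int * int => if m == (0, 0) then 0 else F (lattice_pt tau m)).

Definition weierstrass_p {R : realType} (z tau : R[i]) : R[i] :=
  z ^- 2 + lattice_sum tau (fun omega => (z - omega) ^- 2 - omega ^- 2).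

Definition g2 {R : realType} (tau : R[i]) : R[i] :=
  60%:R * lattice_sum tau (fun omega => omega ^- 4).

Definition g3 {R : realType} (tau : R[i]) : R[i] :=
  140%:R * lattice_sum tau (fun omega => omega ^- 6).

(* j = 1728 g2^3 / (g2^3 - 27 g3^2), with 1728 = 12^3. *)
Definition j_invariant {R : realType} (tau : R[i]) : R[i] :=
  (12%:R * g2 tau) ^+ 3 / (g2 tau ^+ 3 - 27%:R * g3 tau ^+ 2).

(** The functions Lambda *)

(* The class of (r tau + s)/N modulo L_tau is represented using the least
   nonnegative residues of r and s; [weierstrass_p] is L_tau-periodic in [z].
   For 1 < N, ['Z_N] is Z/NZ. *)
Definition phi {R : realType} {N : nat} (tau : R[i]) (Q : 'Z_N * 'Z_N) : R[i] :=
  ((nat_of_ord Q.1)%:R * tau + (nat_of_ord Q.2)%:R) / N%:R.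

Definition is_basis {N : nat} (Q1 Q2 : 'Z_N * 'Z_N) : Prop :=
  forall P : 'Z_N * 'Z_N,
    exists! c : 'Z_N * 'Z_N, P = Q1 *+ nat_of_ord c.1 + Q2 *+ nat_of_ord c.2.

Definition Lambda {R : realType} {N : nat} (Q1 Q2 : 'Z_N * 'Z_N) (tau : R[i]) :
    R[i] :=
  (weierstrass_p (phi tau Q1) tau - weierstrass_p (phi tau (Q1 + Q2)) tau) /
  (weierstrass_p (phi tau Q2) tau - weierstrass_p (phi tau (Q1 + Q2)) tau).

(** Meromorphic functions on the upper half plane *)

(* A meromorphic function is represented by any total function
   [f : R[i] -> R[i]] that has the right values off a closed discrete subset of
   the upper half plane; values at poles and outside the half plane are
   irrelevant. [mero_eq] is equality of the meromorphic functions represented,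
   and all the sets of functions below are closed under it. *)
Definition mero_eq {R : realType} (f g : R[i] -> R[i]) : Prop :=
  forall tau, upper_half_plane tau -> \forall w \near tau^', f w = g w.

Definition meromorphic_at {R : realType} (f : R[i] -> R[i]) (z : R[i]) : Prop :=
  exists (k : nat) (g : R[i] -> R[i]),
    (\forall w \near z, derivable g w 1) /\
    (\forall w \near z^', f w = g w / (w - z) ^+ k).

Definition meromorphic {R : realType} : set (R[i] -> R[i]) :=
  [set f | forall tau, upper_half_plane tau -> meromorphic_at f tau].

(* Subfields of the field of meromorphic functions. Pointwise operations
   represent the field operations; since [x / 0 = 0], the pointwise quotient by
   a function that represents 0 represents 0. *)
Definition mero_subfield {R : realType} (F : set (R[i] -> R[i])) : Prop :=
  [/\ F `<=` meromorphic,
      forall f g, mero_eq f g -> F f -> F g,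
      F (fun=> 1),
      forall f g, F f -> F g -> F (fun tau => f tau - g tau) &
      forall f g, F f -> F g -> F (fun tau => f tau / g tau)].

(* The field K(S) of meromorphic functions, for K a set of constants. *)
Definition mero_adjoin {R : realType} (K : set R[i]) (S : set (R[i] -> R[i])) :
    set (R[i] -> R[i]) :=
  smallest mero_subfield ([set (fun=> c) | c in K] `|` S).

(** Modular functions *)

Definition SL2Z : set 'M[int]_2 := [set g | \det g = 1].

Definition Gamma (N : nat) : set 'M[int]_2 :=
  [set g | SL2Z g /\
    forall i k, (g i k = (1%:M : 'M[int]_2) i k %[mod N%:Z])%Z].

Definition moebius {R : realType} (g : 'M[int]_2) (tau : R[i]) : R[i] :=
  ((g 0 0)%:~R * tau + (g 0 1)%:~R) / ((g 1 0)%:~R * tau + (g 1 1)%:~R).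

(* f = \sum_(n >= 0) a_n q^(n - m) near i oo, where q = e^(2 pi i tau / N). *)
Definition fourier_expansion {R : realType} (N : nat) (f : R[i] -> R[i])
    (m : nat) (a : nat -> R[i]) : Prop :=
  exists2 Y : R, 0 < Y &
    forall tau : R[i], Y < complex.Im tau -> \forall w \near tau^',
      [series a n * cexp2ipi (w / N%:R) ^ (n%:Z - m%:Z)]_n @ \oo --> f w.

(* Every cusp is of the form g(i oo) with g in SL_2(Z). *)
Definition modular_function {R : realType} (N : nat) : set (R[i] -> R[i]) :=
  [set f | [/\ meromorphic f,
      forall g, Gamma N g -> mero_eq (f \o moebius g) f &
      forall g, SL2Z g ->
        exists m a, fourier_expansion N (f \o moebius g) m a]].

Definition zeta (R : realType) (N : nat) : R[i] := cexp2ipi (N%:R)^-1.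

Definition Qzeta (R : realType) (N : nat) : set R[i] :=
  smallest (fun K : set R[i] => divring_closed (mem K)) [set zeta R N].
Arguments Qzeta : clear implicits.

Definition modular_function_over {R : realType} (N : nat) (K : set R[i]) :
    set (R[i] -> R[i]) :=
  [set f | modular_function N f /\
    exists m a, fourier_expansion N f m a /\ forall n, K (a n)].

(* Main.v *)
(* Differences of values of the Weierstrass function at torsion points and the
   Eisenstein series have explicit expansions in q with coefficients in Q(zeta);
   this puts Lambda and j in the field on the left. The orders of Lambda at all
   cusps show, for N <> 6, that only elements of +-Gamma(N) fix Lambda, so the
   conjugates of Lambda under SL_2(Z/N)/{+-1} are distinct, and Lagrange
   interpolation over these conjugates writes every modular function of level N
   as a quotient of polynomials in Lambda with coefficients of level one. Siegel's
   bound on the order of vanishing at infinity of a modular form and a dimension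
   count make the level one functions rational in s = E6^2/E4^3 = 1 - 1728/j.
   Finally, f being a quotient of polynomials in Lambda and s is a linear relation
   over the complex numbers between the f Lambda^k s^l and the Lambda^k s^l; if
   the expansion of f is Q(zeta)-rational, such a relation splits into relations
   over Q(zeta). *)
From HB Require Import structures.
Require Import Defs.
From mathcomp Require Import all_boot all_order all_algebra.
From mathcomp Require Import all_classical all_reals all_analysis.
From mathcomp Require Import complex finmap ring lra zify.
From mathcomp.analysis.showcase Require Import summability.

Set Implicit Arguments.
Unset Strict Implicit.
Unset Printing Implicit Defensive.

Import Order.TTheory GRing.Theory Num.Theory numFieldNormedType.Exports.
Local Open Scope classical_set_scope.
Local Open Scope ring_scope.
Local Open Scope complex_scope.

(** * Complex differentiability and Goursat's theorem *)

(** The condition N <> 6 comes from the cusps where Lambda has large order. A matrix that preserves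
    all orders preserves the set of vectors of (Z/N)^2 where a prescribed large order occurs, and
    the argument needs such a vector (k, 0) with k a unit: k = (N-1)/2 for odd N, k = N/2 - 1 when 4
    divides N, and k = m - 2 for N = 2m with m odd, which degenerates to k = 1 when m = 3. The
    dimension count leaves much room: a form of weight 12n is made to vanish at infinity to order
    about 2n, whereas the weight allows only n. A crude form of Siegel's bound, with rational
    constants and pi >= 2, therefore takes the place of the valence formula and of contour
    integration around a fundamental domain. The complex analysis rests on one fact: the difference
    quotient of a holomorphic function is again holomorphic, with an explicit bound. Taylor
    coefficients are values of iterated difference quotients, so that their rationality over a
    subfield becomes algebra with these quotients. *)

Definition cn {R : rcfType} (z : R[i]) : R := complex.Re `|z|.
Arguments cn : simpl never.

Section ComplexNorm.
Variable R : realType.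
Implicit Types z w : R[i].

(** The norm of [R[i]] takes its values in [R[i]]; [cn] is the same number in the ordered field [R],
    where [lra] and suprema are available. *)
Lemma normcE z : `|z| = (cn z)%:C. Proof. by case: z. Qed.

Lemma cn_ge0 z : 0 <= cn z. Proof. by rewrite -lecR -normcE normr_ge0. Qed.

Lemma cnD z w : cn (z + w) <= cn z + cn w.
Proof. by rewrite -lecR rmorphD -!normcE ler_normD. Qed.

Lemma cnM z w : cn (z * w) = cn z * cn w.
Proof. by apply: complexI; rewrite rmorphM -!normcE normrM. Qed.

Lemma cnN z : cn (- z) = cn z.
Proof. by apply: complexI; rewrite -!normcE normrN. Qed.

Lemma cnBC z w : cn (z - w) = cn (w - z).
Proof. by rewrite -cnN opprB. Qed.

Lemma cnB z w : cn (z - w) <= cn z + cn w.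
Proof. by rewrite -(cnN w); exact: cnD. Qed.

Lemma cn_trans y z w : cn (z - w) <= cn (z - y) + cn (y - w).
Proof. by rewrite -[z - w](subrKA y); exact: cnD. Qed.

Lemma cn_lb z w : cn z - cn w <= cn (z - w).
Proof. by rewrite lerBlDr; have := cnD (z - w) w; rewrite subrK. Qed.

Lemma cn0 : cn (0 : R[i]) = 0.
Proof. by apply: complexI; rewrite -normcE normr0. Qed.

Lemma cn1 : cn (1 : R[i]) = 1.
Proof. by apply: complexI; rewrite -normcE normr1. Qed.

Lemma cn_eq0 z : (cn z == 0) = (z == 0).
Proof. by rewrite -(inj_eq (@complexI R)) -normcE normr_eq0. Qed.

Lemma cn_gt0 z : (0 < cn z) = (z != 0).
Proof. by rewrite lt_def cn_ge0 andbT cn_eq0. Qed.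

Lemma cnV z : cn z^-1 = (cn z)^-1.
Proof. by apply: complexI; rewrite -normcE normfV normcE fmorphV. Qed.

Lemma cnX z n : cn (z ^+ n) = cn z ^+ n.
Proof. by apply: complexI; rewrite -normcE normrX normcE rmorphXn. Qed.

Lemma cnR (x : R) : cn x%:C = `|x|.
Proof. by rewrite /cn /= expr0n /= addr0 sqrtr_sqr. Qed.

Lemma cn_nat n : cn (n%:R : R[i]) = n%:R.
Proof. by rewrite -(rmorph_nat (real_complex R)) cnR normr_nat. Qed.

Lemma cni : cn (Complex 0 1 : R[i]) = 1.
Proof. by rewrite /cn /= expr0n /= add0r expr1n sqrtr1. Qed.

Lemma Re_le_cn z : `|complex.Re z| <= cn z.
Proof.
case: z => a b; rewrite /cn /= -[leLHS]sqrtr_sqr ler_wsqrtr //.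
by rewrite lerDl sqr_ge0.
Qed.

Lemma Im_le_cn z : `|complex.Im z| <= cn z.
Proof.
case: z => a b; rewrite /cn /= -[leLHS]sqrtr_sqr ler_wsqrtr //.
by rewrite lerDr sqr_ge0.
Qed.

Lemma ImE_Complex (y : R) : Complex 0 y = Complex 0 1 * y%:C.
Proof. by rewrite /real_complex_def; simpc. Qed.

Lemma cn_le z : cn z <= `|complex.Re z| + `|complex.Im z|.
Proof.
case: z => a b; rewrite /= (_ : Complex a b = a%:C + Complex 0 b); last first.
  by rewrite /real_complex_def; simpc.
by apply: le_trans (cnD _ _) _; rewrite ImE_Complex cnM !cnR cni mul1r.
Qed.

Lemma cn_sqr z : cn z ^+ 2 = complex.Re z ^+ 2 + complex.Im z ^+ 2.
Proof. by case: z => a b; rewrite /cn /= sqr_sqrtr // addr_ge0 ?sqr_ge0. Qed.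

Lemma ReB z w : complex.Re (z - w) = complex.Re z - complex.Re w.
Proof. by case: z; case: w. Qed.

Lemma ImB z w : complex.Im (z - w) = complex.Im z - complex.Im w.
Proof. by case: z; case: w. Qed.

Lemma ReD z w : complex.Re (z + w) = complex.Re z + complex.Re w.
Proof. by case: z; case: w. Qed.

Lemma ImD z w : complex.Im (z + w) = complex.Im z + complex.Im w.
Proof. by case: z; case: w. Qed.

Lemma cn_sum (I : Type) (s : seq I) (P : pred I) (F : I -> R[i]) :
  cn (\sum_(i <- s | P i) F i) <= \sum_(i <- s | P i) cn (F i).
Proof.
elim/big_rec2: _ => [|i a b _ h]; first by rewrite cn0.
by apply: le_trans (cnD _ _) _; rewrite lerD2l.
Qed.

Lemma cn_small z : (forall e, 0 < e -> cn z <= e) -> z = 0.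
Proof.
move=> h; apply/eqP; rewrite -cn_eq0 eq_le cn_ge0 andbT leNgt; apply/negP => z0.
have := h (cn z / 2); rewrite divr_gt0 // => /(_ isT); lra.
Qed.

Lemma near_cnP z (P : R[i] -> Prop) : (\forall w \near z, P w) <->
  exists2 r : R, 0 < r & forall w, cn (w - z) < r -> P w.
Proof.
split.
  move=> /nbhs_normP[[e b] /= + H]; rewrite ltcE /= => /andP[/eqP b0 e0].
  exists e => // w wz; apply: H => /=.
  by rewrite distrC normcE ltcE /= b0 eqxx.
move=> [r r0 H]; apply/nbhs_normP; exists r%:C => /=; first by rewrite ltcR.
by move=> w /=; rewrite distrC normcE ltcR; apply: H.
Qed.

Lemma dnear_cnP z (P : R[i] -> Prop) : (\forall w \near z^', P w) <->
  exists2 r : R, 0 < r & forall w, w != z -> cn (w - z) < r -> P w.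
Proof.
split=> [/near_cnP[r r0 H]|[r r0 H]].
  by exists r => // w wz wr; apply: H.
by apply/near_cnP; exists r => // w wr /= wz; apply: H.
Qed.

Definition ctends (u : nat -> R[i]) l :=
  forall e : R, 0 < e -> exists n0, forall n, (n0 <= n)%N -> cn (u n - l) < e.

Lemma ctendsP (u : nat -> R[i]) l : u @ \oo --> l <-> ctends u l.
Proof.
split.
  move=> /cvgrPdist_lt H e e0; have e0' : 0 < e%:C by rewrite ltcR.
  have [N _ HN] := H _ e0'; exists N => n /HN /=.
  by rewrite distrC normcE ltcR.
move=> H; apply/cvgrPdist_lt => -[e b].
rewrite ltcE /= => /andP[/eqP -> e0].
have [N HN] := H e e0; exists N => // n /= /HN.
by rewrite distrC normcE -[e +i* _]/(e%:C) ltcR.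
Qed.

End ComplexNorm.

Section ComplexDerivative.
Variable R : realType.
Implicit Types (f g : R[i] -> R[i]) (z w l : R[i]).

Definition ccont g z := forall e : R, 0 < e ->
  exists2 d : R, 0 < d & forall w, cn (w - z) < d -> cn (g w - g z) < e.

Lemma ccont_near f g z (r : R) : 0 < r ->
  (forall w, cn (w - z) < r -> f w = g w) -> ccont f z -> ccont g z.
Proof.
move=> r0 fg fc e e0; have [d d0 H] := fc e e0.
exists (Num.min r d); first by rewrite lt_min r0.
move=> w; rewrite lt_min => /andP[wr wd].
by rewrite -!fg ?subrr ?cn0 //; exact: H.
Qed.

Lemma ccont_cst k z : ccont (fun=> k) z.
Proof. by move=> e e0; exists 1 => // w _; rewrite subrr cn0. Qed.

Lemma ccont_id z : ccont id z.
Proof. by move=> e e0; exists e. Qed.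

Lemma ccontD f g z : ccont f z -> ccont g z -> ccont (fun w => f w + g w) z.
Proof.
move=> fc gc e e0; have e2 : 0 < e / 2 by rewrite divr_gt0.
have [d d0 H] := fc _ e2; have [d' d0' H'] := gc _ e2.
exists (Num.min d d'); first by rewrite lt_min d0.
move=> w; rewrite lt_min => /andP[/H h /H' h']; rewrite opprD addrACA.
by apply: le_lt_trans (cnD _ _) _; lra.
Qed.

Lemma ccontN f z : ccont f z -> ccont (fun w => - f w) z.
Proof.
move=> fc e e0; have [d d0 H] := fc _ e0; exists d => // w /H.
by rewrite -opprD cnN.
Qed.

Lemma ccontB f g z : ccont f z -> ccont g z -> ccont (fun w => f w - g w) z.
Proof. by move=> fc gc; apply: ccontD => //; exact: ccontN. Qed.

Lemma ccontM f g z : ccont f z -> ccont g z -> ccont (fun w => f w * g w) z.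
Proof.
move=> fc gc e e0.
pose A := cn (f z) + 1; pose B := cn (g z) + 1.
have A0 : 0 < A by rewrite ltr_wpDl ?cn_ge0.
have B0 : 0 < B by rewrite ltr_wpDl ?cn_ge0.
have [d d0 H] := fc (Num.min 1 (e / (2 * B))) ltac:(by rewrite lt_min ltr01 divr_gt0 // mulr_gt0).
have [d' d0' H'] := gc (e / (2 * A)) ltac:(by rewrite divr_gt0 // mulr_gt0).
exists (Num.min d d'); first by rewrite lt_min d0.
move=> w; rewrite lt_min => /andP[/H + /H' h']; rewrite lt_min => /andP[h1 h2].
rewrite (_ : _ - _ = f w * (g w - g z) + (f w - f z) * g z); last by ring.
apply: le_lt_trans (cnD _ _) _; rewrite !cnM.
have fA : cn (f w) <= A.
  rewrite -[f w](subrK (f z)); apply: le_trans (cnD _ _) _.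
  by rewrite /A addrC lerD2l ltW.
have t1 : cn (f w) * cn (g w - g z) <= e / 2.
  apply: le_trans (ler_pM (cn_ge0 _) (cn_ge0 _) fA (ltW h')) _.
  by rewrite le_eqVlt; apply/orP; left; apply/eqP; field; rewrite gt_eqF.
have t2 : cn (f w - f z) * cn (g z) < e / 2.
  have t3 : cn (f w - f z) * B < e / 2.
    by rewrite -ltr_pdivlMr // -mulrA -invfM.
  apply: le_lt_trans t3; apply: ler_wpM2l; first exact: cn_ge0.
  by rewrite /B lerDl.
lra.
Qed.

Lemma ccontV f z : ccont f z -> f z != 0 -> ccont (fun w => (f w)^-1) z.
Proof.
move=> fc f0 e e0; have A0 : 0 < cn (f z) by rewrite cn_gt0.
set A := cn (f z) in A0.
have [d d0 H] := fc (Num.min (A / 2) (e * A ^+ 2 / 2))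
  ltac:(by rewrite lt_min !divr_gt0 // mulr_gt0 // exprn_gt0).
exists d => // w /H; rewrite lt_min => /andP[h1 h2].
have fA : A / 2 <= cn (f w).
  have := cn_lb (f z) (f z - f w); rewrite subKr cnBC.
  by rewrite -/A => h; lra.
have fw0 : 0 < cn (f w) by apply: lt_le_trans fA; rewrite divr_gt0.
rewrite (_ : _ - _ = (f z - f w) / (f w * f z)); last first.
  by field; rewrite f0 -cn_gt0 fw0.
rewrite cnM cnV cnM -/A cnBC ltr_pdivrMr ?mulr_gt0 //.
apply: lt_le_trans h2 _.
rewrite -mulrA ler_pM2l // expr2 mulrAC ler_pM2r //.
Qed.

Lemma ccontX f z n : ccont f z -> ccont (fun w => f w ^+ n) z.
Proof.
move=> fc; elim: n => [|n IH]; first exact: ccont_cst.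
apply: (@ccont_near (fun w => f w * f w ^+ n) _ _ 1) => //.
  by move=> w _; rewrite exprS.
exact: ccontM.
Qed.

Lemma ccont_comp f g z : ccont f z -> ccont g (f z) -> ccont (fun w => g (f w)) z.
Proof.
move=> fc gc e e0; have [d d0 H] := gc _ e0; have [d' d0' H'] := fc _ d0.
by exists d' => // w /H' /H.
Qed.

(* Caratheodory's form of the derivative, which makes the differentiation rules
   algebraic. *)
Definition cder g z l :=
  exists2 p, (forall w, g w = g z + p w * (w - z)) & p z = l /\ ccont p z.

Definition cdiff g z := exists l, cder g z l.

Definition dquo g z l w := if w == z then l else (g w - g z) / (w - z).

Lemma dquoE g z l w : g w = g z + dquo g z l w * (w - z).
Proof.
rewrite /dquo; case: eqVneq => [->|wz]; first by rewrite subrr mulr0 addr0.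
by rewrite divfK ?subr_eq0 // addrC subrK.
Qed.

Lemma cderE g z l : cder g z l <-> ccont (dquo g z l) z.
Proof.
split=> [[p E [pz pc]]|h]; last first.
  by exists (dquo g z l); [exact: dquoE|rewrite {1}/dquo eqxx].
apply: (@ccont_near p _ _ 1) => // w _; rewrite /dquo.
case: eqVneq => [-> //|wz].
by rewrite [in RHS](E w) [X in X / _]addrC addKr mulfK // subr_eq0.
Qed.

Lemma cder_cont g z l : cder g z l -> ccont g z.
Proof.
move=> [p E [pz pc]]; apply: (@ccont_near (fun w => g z + p w * (w - z)) _ _ 1) => //.
apply: ccontD; first exact: ccont_cst.
apply: ccontM => //; apply: ccontB; [exact: ccont_id|exact: ccont_cst].
Qed.

Lemma cdiff_cont g z : cdiff g z -> ccont g z.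
Proof. by move=> [l /cder_cont]. Qed.

Lemma cder_near f g z l (r : R) : 0 < r ->
  (forall w, cn (w - z) < r -> f w = g w) -> cder f z l -> cder g z l.
Proof.
move=> r0 fg /cderE h; apply/cderE; apply: (ccont_near r0 _ h) => w wr.
by rewrite /dquo !fg // subrr cn0.
Qed.

Lemma cdiff_near f g z (r : R) : 0 < r ->
  (forall w, cn (w - z) < r -> f w = g w) -> cdiff f z -> cdiff g z.
Proof. by move=> r0 fg [l h]; exists l; exact: (cder_near r0 fg h). Qed.

Lemma cder_ext f g z l : f =1 g -> cder f z l -> cder g z l.
Proof. by move=> fg; apply: (@cder_near _ _ _ _ 1). Qed.

Lemma cder_cst k z : cder (fun=> k) z 0.
Proof.
by exists (fun=> 0) => [w|]; [rewrite mul0r addr0|split=> //; exact: ccont_cst].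
Qed.

Lemma cder_id z : cder id z 1.
Proof.
exists (fun=> 1) => [w|]; first by rewrite mul1r addrC subrK.
by split=> //; exact: ccont_cst.
Qed.

Lemma cderD f g z l m : cder f z l -> cder g z m ->
  cder (fun w => f w + g w) z (l + m).
Proof.
move=> [p E [<- pc]] [q E' [<- qc]]; exists (fun w => p w + q w).
  by move=> w; rewrite {1}E {1}E'; ring.
by split=> //; exact: ccontD.
Qed.

Lemma cderM f g z l m : cder f z l -> cder g z m ->
  cder (fun w => f w * g w) z (l * g z + f z * m).
Proof.
move=> hf; have fc := cder_cont hf; move: hf => [p E [<- pc]] [q E' [<- qc]].
exists (fun w => p w * g z + f w * q w).
  by move=> w; rewrite {1}E' {1 2}E; ring.
split=> //; apply: ccontD; apply: ccontM => //; exact: ccont_cst.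
Qed.

Lemma cderZ k f z l : cder f z l -> cder (fun w => k * f w) z (k * l).
Proof.
move=> h; have := cderM (cder_cst k z) h.
by rewrite mul0r add0r.
Qed.

Lemma cderN f z l : cder f z l -> cder (fun w => - f w) z (- l).
Proof.
move=> /(cderZ (-1)); rewrite mulN1r; apply: cder_ext => w.
by rewrite mulN1r.
Qed.

Lemma cderB f g z l m : cder f z l -> cder g z m ->
  cder (fun w => f w - g w) z (l - m).
Proof. by move=> hf hg; apply: cderD => //; exact: cderN. Qed.

Lemma cder_comp f g z l m : cder f z l -> cder g (f z) m ->
  cder (fun w => g (f w)) z (m * l).
Proof.
move=> hf; have fc := cder_cont hf; move: hf => [p E [<- pc]] [q E' [<- qc]].
exists (fun w => q (f w) * p w).
  by move=> w; rewrite E' [X in _ * (X - _)]E; ring.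
by split=> //; apply: ccontM => //; exact: ccont_comp.
Qed.

Lemma cderV f z l : cder f z l -> f z != 0 ->
  cder (fun w => (f w)^-1) z (- l / f z ^+ 2).
Proof.
move=> hf f0; have fc := cder_cont hf.
have [d d0 H] : exists2 d : R, 0 < d & forall w, cn (w - z) < d -> f w != 0.
  have [d d0 H] := fc (cn (f z)) ltac:(by rewrite cn_gt0).
  exists d => // w /H; apply: contraTneq => ->.
  by rewrite sub0r cnN ltxx.
move: hf => /cderE h; apply/cderE.
apply: (@ccont_near (fun w => - dquo f z l w / (f w * f z)) _ _ d) => //.
  move=> w /H fw; rewrite /dquo; case: eqVneq => [->|wz]; first by rewrite expr2.
  by field; rewrite f0 fw subr_eq0 wz.
apply: ccontM; first exact: ccontN.
apply: ccontV; last exact: mulf_neq0.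
by apply: ccontM => //; exact: ccont_cst.
Qed.

Lemma cdiff_cst k z : cdiff (fun=> k) z. Proof. by exists 0; exact: cder_cst. Qed.
Lemma cdiff_id z : cdiff id z. Proof. by exists 1; exact: cder_id. Qed.
Lemma cdiffD f g z : cdiff f z -> cdiff g z -> cdiff (fun w => f w + g w) z.
Proof. by move=> [l h] [m h']; exists (l + m); exact: cderD. Qed.
Lemma cdiffN f z : cdiff f z -> cdiff (fun w => - f w) z.
Proof. by move=> [l h]; exists (- l); exact: cderN. Qed.
Lemma cdiffB f g z : cdiff f z -> cdiff g z -> cdiff (fun w => f w - g w) z.
Proof. by move=> [l h] [m h']; exists (l - m); exact: cderB. Qed.
Lemma cdiffM f g z : cdiff f z -> cdiff g z -> cdiff (fun w => f w * g w) z.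
Proof. by move=> [l h] [m h']; eexists; exact: cderM h h'. Qed.
Lemma cdiffV f z : cdiff f z -> f z != 0 -> cdiff (fun w => (f w)^-1) z.
Proof. by move=> [l h] f0; eexists; exact: cderV h f0. Qed.
Lemma cdiff_comp f g z : cdiff f z -> cdiff g (f z) -> cdiff (fun w => g (f w)) z.
Proof. by move=> [l h] [m h']; eexists; exact: cder_comp h h'. Qed.
Lemma cdiff_ext f g z : f =1 g -> cdiff f z -> cdiff g z.
Proof. by move=> fg [l h]; exists l; exact: cder_ext fg h. Qed.
Lemma cdiffX f z n : cdiff f z -> cdiff (fun w => f w ^+ n) z.
Proof.
move=> fc; elim: n => [|n IH]; first exact: cdiff_cst.
by apply: cdiff_ext (cdiffM fc IH) => w; rewrite exprS.
Qed.

Lemma derivable_cdiffP g z : derivable g z 1 <-> cdiff g z.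
Proof.
split.
  move=> /cvg_ex[l /cvgrPdist_lt H]; exists l; apply/cderE => e e0.
  have e0' : 0 < e%:C by rewrite ltcR.
  have /dnear_cnP[r r0 Hr] := H _ e0'; exists r => // w wr.
  rewrite /dquo eqxx; case: eqVneq => [_|wz]; first by rewrite subrr cn0.
  have := Hr (w - z); rewrite subr_eq0 subr0 wz => /(_ isT wr) /=.
  rewrite distrC normcE ltcR.
  by rewrite -[(w - z) *: 1]/((w - z) * 1) mulr1 subrK -[_ *: _]/(_ * _) mulrC.
move=> [l /cderE H]; apply/cvg_ex; exists l; apply/cvgrPdist_lt => -[e b].
rewrite ltcE /= => /andP[/eqP -> e0]; have [d d0 Hd] := H e e0.
apply/dnear_cnP; exists d => // h h0; rewrite subr0 => hd.
have := Hd (h + z); rewrite addrK => /(_ hd).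
rewrite /dquo eqxx -subr_eq0 addrK (negbTE h0) distrC normcE -[e +i* 0]/(e%:C) ltcR.
by rewrite -[h *: 1]/(h * 1) mulr1 -[_ *: _]/(_ * _) mulrC.
Qed.

End ComplexDerivative.

(** * Bisection of intervals and boxes *)

Section Bisection.
Variable R : realType.

Lemma half_pow_small (e : R) : 0 < e -> exists n, (2^-1) ^+ n < e.
Proof.
move=> e0; have := archi_boundP (ltW (_ : 0 < e^-1)); rewrite invr_gt0 => /(_ e0).
set k := Num.Def.archi_bound _ => h; exists k.
rewrite exprVn invf_plt ?posrE ?exprn_gt0 //.
by apply: lt_trans h _; rewrite -natrX ltr_nat ltn_expl.
Qed.

Lemma nested_intervals (X l : nat -> R) : (forall n, X n <= X n.+1) ->
  (forall n, X n.+1 + l n.+1 <= X n + l n) -> (forall n, 0 <= l n) ->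
  exists p, forall n, X n <= p <= X n + l n.
Proof.
move=> Xup Xdn l0.
have up m n : (m <= n)%N -> X m <= X n.
  elim: n => [|n IH]; first by rewrite leqn0 => /eqP ->.
  rewrite leq_eqVlt => /predU1P[-> //|]; rewrite ltnS => /IH h.
  exact: le_trans h _.
have dn m n : (m <= n)%N -> X n + l n <= X m + l m.
  elim: n => [|n IH]; first by rewrite leqn0 => /eqP ->.
  rewrite leq_eqVlt => /predU1P[-> //|]; rewrite ltnS => /IH.
  exact: le_trans.
have ub m n : X n <= X m + l m.
  case: (leqP n m) => mn.
    by apply: le_trans (up _ _ mn) _; rewrite lerDl.
  by apply: le_trans (dn _ _ (ltnW mn)); rewrite lerDl.
exists (sup (range X)) => n; apply/andP; split.
  apply: ub_le_sup; last by exists n.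
  by exists (X 0%N + l 0%N) => _ [m _ <-].
by apply: ge_sup => [|_ [m _ <-] //]; exists (X 0%N), 0%N.
Qed.

(** If the whole box is bad then one of the quarters of every bad box is bad, and nested bad boxes
    shrink to a point whose local hypothesis they contradict. This serves as compactness and as
    connectedness of a rectangle in the rest of the development. *)
Lemma box_ind (L H x0 y0 : R) (P : R -> R -> R -> Prop) : 0 < L -> 0 < H ->
  (forall x y s, 0 < s -> P x y (s / 2) -> P (x + L * (s / 2)) y (s / 2) ->
     P x (y + H * (s / 2)) (s / 2) -> P (x + L * (s / 2)) (y + H * (s / 2)) (s / 2) ->
     x0 <= x -> x + L * s <= x0 + L -> y0 <= y -> y + H * s <= y0 + H -> P x y s) ->
  (forall p q, x0 <= p <= x0 + L -> y0 <= q <= y0 + H ->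
     exists2 d, 0 < d & forall x y s, 0 < s < d -> x <= p <= x + L * s ->
       y <= q <= y + H * s -> x0 <= x -> x + L * s <= x0 + L -> y0 <= y ->
       y + H * s <= y0 + H -> P x y s) ->
  P x0 y0 1.
Proof.
move=> L0 H0 split_ loc; apply: contrapT => nP.
pose s n : R := (2^-1) ^+ n.
have s0 n : 0 < s n by rewrite exprn_gt0 // invr_gt0.
have sS n : s n.+1 = s n / 2 by rewrite /s exprSr.
pose good n (t : R * R) := [/\ x0 <= t.1, t.1 + L * s n <= x0 + L, y0 <= t.2,
  t.2 + H * s n <= y0 + H & ~ P t.1 t.2 (s n)].
pose Q (nt : nat * (R * R)) (u : R * R) := good nt.1 nt.2 ->
    [/\ good nt.1.+1 u,
      nt.2.1 <= u.1, u.1 + L * s nt.1.+1 <= nt.2.1 + L * s nt.1,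
      nt.2.2 <= u.2 & u.2 + H * s nt.1.+1 <= nt.2.2 + H * s nt.1].
(* The choice of a bad quarter is made total, with a dummy value on good boxes, so that it can be
   iterated by a plain fixpoint. *)
have [f fP] : {f & forall nt, Q nt (f nt)}.
  apply: choice => -[n [x y]]; rewrite /Q /=.
  case: (pselect (good n (x, y))) => [|ng]; last by exists (0, 0) => /ng.
  move=> [/= h1 h2 h3 h4 nPx].
  have Ls : 0 < L * s n.+1 by rewrite mulr_gt0.
  have Hs : 0 < H * s n.+1 by rewrite mulr_gt0.
  have Le : L * s n = L * s n.+1 + L * s n.+1 by rewrite sS; field.
  have He : H * s n = H * s n.+1 + H * s n.+1 by rewrite sS; field.
  have : [\/ ~ P x y (s n.+1), ~ P (x + L * s n.+1) y (s n.+1),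
      ~ P x (y + H * s n.+1) (s n.+1) | ~ P (x + L * s n.+1) (y + H * s n.+1) (s n.+1)].
    apply: contrapT => nall; apply: nPx; apply: split_ => //; rewrite -sS;
      by apply: contrapT => np; apply: nall; (do 1?[by constructor 1]);
         (do 1?[by constructor 2]); (do 1?[by constructor 3]); constructor 4.
  move: Ls Hs Le He; set a := L * s n.+1; set b := H * s n.+1 => Ls Hs Le He.
  case=> np; [exists (x, y)|exists (x + a, y)|exists (x, y + b)|exists (x + a, y + b)];
    move=> _; split=> /=; rewrite -/a -/b; try lra; split => //=; rewrite -/a -/b; lra.
pose t := fix t n := if n is m.+1 then f (m, t m) else (x0, y0).
have g n : good n (t n).
  elim: n => [|n IH]; last by have [] := fP (n, t n) IH.
  by split=> /=; rewrite ?lexx ?mulr1.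
have [p hp] : exists p, forall n, (t n).1 <= p <= (t n).1 + L * s n.
  apply: nested_intervals => n; last by rewrite mulr_ge0 ?ltW.
    by have [] := fP (n, t n) (g n).
  by have [] := fP (n, t n) (g n).
have [q hq] : exists q, forall n, (t n).2 <= q <= (t n).2 + H * s n.
  apply: nested_intervals => n; last by rewrite mulr_ge0 ?ltW.
    by have [] := fP (n, t n) (g n).
  by have [] := fP (n, t n) (g n).
have [d d0 Hd] : exists2 d, 0 < d & forall x y s, 0 < s < d -> x <= p <= x + L * s ->
       y <= q <= y + H * s -> x0 <= x -> x + L * s <= x0 + L -> y0 <= y ->
       y + H * s <= y0 + H -> P x y s.
  apply: loc; first by have := hp 0%N; rewrite /= mulr1.
  by have := hq 0%N; rewrite /= mulr1.
have [n sn] := half_pow_small d0.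
have [h1 h2 h3 h4] := g n; apply.
by apply: Hd => //; rewrite s0.
Qed.

End Bisection.

(** * Integrals of complex functions over an interval *)

Section Integral.
Variable R : realType.
Local Notation mu := (@lebesgue_measure R).

Definition icont (f : R -> R[i]) a b := forall x, a <= x <= b ->
  forall e, 0 < e -> exists2 d, 0 < d &
    forall y, a <= y <= b -> `|y - x| < d -> cn (f y - f x) < e.

Definition rint (f : R -> R) a b : R := \int[mu]_(x in `[a, b]) f x.

Definition cint (f : R -> R[i]) a b : R[i] :=
  Complex (rint (@complex.Re R \o f) a b) (rint (@complex.Im R \o f) a b).

Definition rintable (f : R -> R) a b := mu.-integrable `[a, b] (EFin \o f).

Lemma icont_rintable (p : R[i] -> R) f a b :
  (forall z w, `|p z - p w| <= cn (z - w)) -> icont f a b -> rintable (p \o f) a b.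
Proof.
move=> pl fc; apply: continuous_compact_integrable; first exact: segment_compact.
apply/subspace_continuousP => x; rewrite /= in_itv /= => xab.
apply/cvgrPdist_lt => e e0; have [d d0 H] := fc x xab e e0.
rewrite near_withinE; apply/nbhs_ballP; exists d => // y xy.
rewrite /= in_itv /= => yab; rewrite distrC.
apply: le_lt_trans (pl _ _) _; apply: H => //.
by rewrite distrC; exact: xy.
Qed.

Lemma icontRe f a b : icont f a b -> rintable (@complex.Re R \o f) a b.
Proof. by apply: icont_rintable => z w; rewrite -ReB Re_le_cn. Qed.

Lemma icontIm f a b : icont f a b -> rintable (@complex.Im R \o f) a b.
Proof. by apply: icont_rintable => z w; rewrite -ImB Im_le_cn. Qed.

Lemma rintable_cst k a b : rintable (fun=> k) a b.
Proof.
by apply: (@icontRe (fun=> k%:C) a b) => x _ e e0; exists 1 => // y _ _;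
  rewrite subrr cn0.
Qed.

Lemma rint_cst k (a b : R) : a <= b -> rint (fun=> k) a b = k * (b - a).
Proof.
move=> ab; rewrite /rint Rintegral_cst //= lebesgue_measure_itv /= lte_fin.
by case: ltP => //= ba; rewrite (_ : b = a) ?subrr //; apply/eqP; rewrite eq_le ab ba.
Qed.

Lemma rint_le f g a b : rintable f a b -> rintable g a b ->
  (forall x, a <= x <= b -> f x <= g x) -> rint f a b <= rint g a b.
Proof.
by move=> hf hg fg; apply: le_Rintegral => // x; rewrite /= in_itv /= => /fg.
Qed.

Lemma rint_near f k M (a b : R) : a <= b -> rintable f a b ->
  (forall x, a <= x <= b -> `|f x - k| <= M) ->
  `|rint f a b - k * (b - a)| <= M * (b - a).
Proof.
move=> ab hf fk; rewrite ler_distl -mulrBl -mulrDl -!rint_cst //; apply/andP; split.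
  apply: rint_le => // [|x /fk]; first exact: rintable_cst.
  by rewrite ler_distl => /andP[].
apply: rint_le => // [|x /fk]; first exact: rintable_cst.
by rewrite ler_distl => /andP[].
Qed.

Lemma rint_split f a m b : a <= m <= b -> rintable f a b ->
  rint f a b = rint f a m + rint f m b.
Proof.
move=> /andP[am mb] hf; have := @Rintegral_itvB R f (BLeft a) (BRight b) m hf.
rewrite !bnd_simp => /(_ am mb); rewrite Rintegral_itv_obnd_cbnd => [h|].
  by rewrite /rint -h addrC subrK.
by apply: integrableS hf => //; apply: subset_itvr; rewrite bnd_simp.
Qed.

Lemma cint_split f a m b : a <= m <= b -> icont f a b ->
  cint f a b = cint f a m + cint f m b.
Proof.
move=> amb fc; rewrite /cint.
rewrite (rint_split amb (icontRe fc)) (rint_split amb (icontIm fc)).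
by [].
Qed.

Lemma cint_ext f g a b : (forall x, a <= x <= b -> f x = g x) -> cint f a b = cint g a b.
Proof.
move=> fg; rewrite /cint /rint; congr Complex; apply: eq_Rintegral => x;
  by move=> /set_mem; rewrite /= in_itv /= => /fg ->.
Qed.

Lemma cintD f g a b : icont f a b -> icont g a b ->
  cint (fun x => f x + g x) a b = cint f a b + cint g a b.
Proof.
move=> fc gc; rewrite /cint; congr Complex; rewrite /rint.
  rewrite -RintegralD //; [|exact: icontRe|exact: icontRe].
  by apply: eq_Rintegral => x _ /=; rewrite ReD.
rewrite -RintegralD //; [|exact: icontIm|exact: icontIm].
by apply: eq_Rintegral => x _ /=; rewrite ImD.
Qed.

Lemma rintableZ (r : R) f a b : rintable f a b -> rintable (fun x => r * f x) a b.
Proof.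
move=> ih; rewrite /rintable (_ : EFin \o _ = fun x => (r%:E * (EFin \o f) x)%E).
  by apply: integrableZl.
by apply/funext => x /=; rewrite EFinM.
Qed.

Lemma cintZ k f a b : icont f a b -> cint (fun x => k * f x) a b = k * cint f a b.
Proof.
move=> fc; case: k => p q; rewrite /cint.
have iR : mu.-integrable `[a, b] (EFin \o (@complex.Re R \o f)) by exact: icontRe.
have iI : mu.-integrable `[a, b] (EFin \o (@complex.Im R \o f)) by exact: icontIm.
have iZ (r : R) h : mu.-integrable `[a, b] (EFin \o h) ->
    mu.-integrable `[a, b] (EFin \o (fun x => r * h x)).
  exact: (rintableZ r).
rewrite -[RHS]/(Complex (p * _ - q * _) (p * _ + q * _)); congr Complex.
  rewrite /rint -!RintegralZl // -RintegralB //; [|exact: iZ|exact: iZ].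
  by apply: eq_Rintegral => x _ /=; case: (f x).
rewrite /rint -!RintegralZl // -RintegralD //; [|exact: iZ|exact: iZ].
by apply: eq_Rintegral => x _ /=; case: (f x).
Qed.

(** Real and imaginary parts are estimated separately, whence the factor 2. *)
Lemma cint_near f k M (a b : R) : a <= b -> icont f a b ->
  (forall x, a <= x <= b -> cn (f x - k) <= M) ->
  cn (cint f a b - k * (b - a)%:C) <= 2 * M * (b - a).
Proof.
move=> ab fc fk; apply: le_trans (cn_le _) _.
rewrite ReB ImB [2 * M]mulr_natl mulr2n mulrDl.
have -> : complex.Re (k * (b - a)%:C) = complex.Re k * (b - a).
  by case: k {fk} => p q /=; rewrite mulr0 subr0.
have -> : complex.Im (k * (b - a)%:C) = complex.Im k * (b - a).
  by case: k {fk} => p q /=; rewrite mulr0 add0r.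
apply: lerD; apply: rint_near => //.
- exact: icontRe.
- by move=> x /fk; apply: le_trans; rewrite /= -ReB Re_le_cn.
- exact: icontIm.
- by move=> x /fk; apply: le_trans; rewrite /= -ImB Im_le_cn.
Qed.

Lemma Im_cint_ge f m (a b : R) : a <= b -> icont f a b ->
  (forall x, a <= x <= b -> m <= complex.Im (f x)) -> m * (b - a) <= complex.Im (cint f a b).
Proof.
move=> ab fc h; rewrite /= -rint_cst //; apply: rint_le => //; last exact: icontIm.
exact: rintable_cst.
Qed.

Lemma Re_cint_ge f m (a b : R) : a <= b -> icont f a b ->
  (forall x, a <= x <= b -> m <= complex.Re (f x)) -> m * (b - a) <= complex.Re (cint f a b).
Proof.
move=> ab fc h; rewrite /= -rint_cst //; apply: rint_le => //; last exact: icontRe.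
exact: rintable_cst.
Qed.

Lemma icont_hor g a b c : (forall x, a <= x <= b -> ccont g (Complex x c)) ->
  icont (fun x => g (Complex x c)) a b.
Proof.
move=> gc x xab e e0; have [d d0 H] := gc x xab e e0; exists d => // y _ yx.
apply: H; rewrite (_ : Complex y c - Complex x c = (y - x)%:C) ?cnR //.
by rewrite /real_complex_def; simpc.
Qed.

Lemma icont_ver g a b c : (forall x, a <= x <= b -> ccont g (Complex c x)) ->
  icont (fun x => g (Complex c x)) a b.
Proof.
move=> gc x xab e e0; have [d d0 H] := gc x xab e e0; exists d => // y _ yx.
apply: H; rewrite (_ : Complex c y - Complex c x = Complex 0 1 * (y - x)%:C).
  by rewrite cnM cni cnR mul1r.
by rewrite /real_complex_def; simpc.
Qed.

Lemma icontB f g a b : icont f a b -> icont g a b -> icont (fun x => f x - g x) a b.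
Proof.
move=> fc gc x xab e e0; have e2 : 0 < e / 2 by rewrite divr_gt0.
have [d d0 H] := fc x xab _ e2; have [d' d0' H'] := gc x xab _ e2.
exists (Num.min d d'); first by rewrite lt_min d0.
move=> y yab; rewrite lt_min => /andP[/(H y yab) h /(H' y yab) h'].
rewrite (_ : _ - _ = (f y - f x) - (g y - g x)); last by ring.
by apply: le_lt_trans (cnB _ _) _; lra.
Qed.

End Integral.

(** * Integrals over the boundary of a rectangle *)

Section Rectangles.
Variable R : realType.
Implicit Types (f g F : R[i] -> R[i]) (x y : R).

(** The counterclockwise contour integral. Opposite sides are paired under one integral sign,
    because a linear function has constant difference across them. *)
Definition rect_int g x0 x1 y0 y1 : R[i] :=
  cint (fun x => g (Complex x y0) - g (Complex x y1)) x0 x1 +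
  Complex 0 1 * cint (fun y => g (Complex x1 y) - g (Complex x0 y)) y0 y1.

Lemma rect_splitx g x0 xm x1 y0 y1 : x0 <= xm <= x1 ->
  (forall x, x0 <= x <= x1 -> ccont g (Complex x y0) /\ ccont g (Complex x y1)) ->
  (forall y, y0 <= y <= y1 -> [/\ ccont g (Complex x0 y), ccont g (Complex xm y) &
    ccont g (Complex x1 y)]) ->
  rect_int g x0 x1 y0 y1 = rect_int g x0 xm y0 y1 + rect_int g xm x1 y0 y1.
Proof.
move=> xm01 hh hv; rewrite /rect_int (cint_split xm01); last first.
  by apply: icontB; apply: icont_hor => x /hh [].
rewrite [X in _ = X]addrACA -mulrDr; congr (_ + _ * _).
rewrite -cintD; last 2 first.
- by apply: icontB; apply: icont_ver => y /hv [].
- by apply: icontB; apply: icont_ver => y /hv [].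
by apply: cint_ext => y _; ring.
Qed.

Lemma rect_splity g x0 x1 y0 ym y1 : y0 <= ym <= y1 ->
  (forall x, x0 <= x <= x1 -> [/\ ccont g (Complex x y0), ccont g (Complex x ym) &
    ccont g (Complex x y1)]) ->
  (forall y, y0 <= y <= y1 -> ccont g (Complex x0 y) /\ ccont g (Complex x1 y)) ->
  rect_int g x0 x1 y0 y1 = rect_int g x0 x1 y0 ym + rect_int g x0 x1 ym y1.
Proof.
move=> ym01 hh hv; rewrite /rect_int (cint_split ym01); last first.
  by apply: icontB; apply: icont_ver => x /hv [].
rewrite [X in _ = X]addrACA -mulrDr; congr (_ + _).
rewrite -cintD; last 2 first.
- by apply: icontB; apply: icont_hor => y /hh [].
- by apply: icontB; apply: icont_hor => y /hh [].
by apply: cint_ext => y _; ring.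
Qed.

(* A constant and a linear function have integral zero over the boundary of a
   rectangle, so only the size of the remainder matters. *)
Lemma rect_int_affine g c l z M x0 x1 y0 y1 : x0 <= x1 -> y0 <= y1 ->
  (forall x y, x0 <= x <= x1 -> y0 <= y <= y1 ->
     (x \in [:: x0; x1]) || (y \in [:: y0; y1]) -> ccont g (Complex x y) /\
     cn (g (Complex x y) - c - l * (Complex x y - z)) <= M) ->
  cn (rect_int g x0 x1 y0 y1) <= 4 * M * ((x1 - x0) + (y1 - y0)).
Proof.
move=> x01 y01 h.
have hx x : x0 <= x <= x1 -> forall y, y \in [:: y0; y1] -> ccont g (Complex x y) /\
    cn (g (Complex x y) - c - l * (Complex x y - z)) <= M.
  move=> hx y hy; apply: h => //; last by rewrite hy orbT.
  by move: hy; rewrite !inE => /orP[] /eqP ->; rewrite lexx ?y01.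
have hy y : y0 <= y <= y1 -> forall x, x \in [:: x0; x1] -> ccont g (Complex x y) /\
    cn (g (Complex x y) - c - l * (Complex x y - z)) <= M.
  move=> hy x hx'; apply: h => //; last by rewrite hx'.
  by move: hx'; rewrite !inE => /orP[] /eqP ->; rewrite lexx ?x01.
have i0 : icont (fun x => g (Complex x y0) - g (Complex x y1)) x0 x1.
  by apply: icontB; apply: icont_hor => x /hx H; have [] := H _ (mem_head _ _);
    have [] := H y1 ltac:(by rewrite !inE eqxx orbT).
have i1 : icont (fun y => g (Complex x1 y) - g (Complex x0 y)) y0 y1.
  by apply: icontB; apply: icont_ver => x /hy H; have [] := H _ (mem_head _ _);
    have [] := H x1 ltac:(by rewrite !inE eqxx orbT).
have e1 := @cint_near R _ (l * Complex 0 (y0 - y1)) (2 * M) _ _ x01 i0.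
have e2 := @cint_near R _ (l * Complex (x1 - x0) 0) (2 * M) _ _ y01 i1.
have : forall x, x0 <= x <= x1 ->
    cn (g (Complex x y0) - g (Complex x y1) - l * Complex 0 (y0 - y1)) <= 2 * M.
  move=> x /hx H; have [_ h0] := H _ (mem_head _ _).
  have [_ h1] := H y1 ltac:(by rewrite !inE eqxx orbT).
  have -> : Complex 0 (y0 - y1) = (Complex x y0 - z) - (Complex x y1 - z).
    by case: (z) => p q; simpc; congr Complex; ring.
  rewrite (_ : _ - _ = (g (Complex x y0) - c - l * (Complex x y0 - z)) -
    (g (Complex x y1) - c - l * (Complex x y1 - z))); last by ring.
  by apply: le_trans (cnB _ _) _; lra.
move=> /e1 b1 {e1}.
have : forall y, y0 <= y <= y1 ->
    cn (g (Complex x1 y) - g (Complex x0 y) - l * Complex (x1 - x0) 0) <= 2 * M.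
  move=> y /hy H; have [_ h0] := H _ (mem_head _ _).
  have [_ h1] := H x1 ltac:(by rewrite !inE eqxx orbT).
  have -> : Complex (x1 - x0) 0 = (Complex x1 y - z) - (Complex x0 y - z).
    by case: (z) => p q; simpc; congr Complex; ring.
  rewrite (_ : _ - _ = (g (Complex x1 y) - c - l * (Complex x1 y - z)) -
    (g (Complex x0 y) - c - l * (Complex x0 y - z))); last by ring.
  by apply: le_trans (cnB _ _) _; lra.
move=> /e2 b2 {e2}.
rewrite /rect_int; set A := cint _ x0 x1 in b1 *; set B := cint _ y0 y1 in b2 *.
have -> : A + Complex 0 1 * B = (A - l * Complex 0 (y0 - y1) * (x1 - x0)%:C) +
    Complex 0 1 * (B - l * Complex (x1 - x0) 0 * (y1 - y0)%:C).
  rewrite mulrBr addrACA -[LHS]addr0; congr (_ + _).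
  have e : Complex 0 (y0 - y1) * (x1 - x0)%:C + Complex 0 1 * (Complex (x1 - x0) 0 * (y1 - y0)%:C) = 0.
    by rewrite /real_complex_def; simpc; congr Complex; ring.
  rewrite -opprD -!mulrA [Complex 0 1 * (l * _)]mulrCA -mulrDr e mulr0 oppr0 //.
apply: le_trans (cnD _ _) _; rewrite cnM cni mul1r.
apply: le_trans (lerD b1 b2) _; rewrite le_eqVlt; apply/orP; left; apply/eqP; ring.
Qed.

Lemma rect_int_bound g M x0 x1 y0 y1 : x0 <= x1 -> y0 <= y1 ->
  (forall x y, x0 <= x <= x1 -> y0 <= y <= y1 ->
     (x \in [:: x0; x1]) || (y \in [:: y0; y1]) -> ccont g (Complex x y) /\
     cn (g (Complex x y)) <= M) ->
  cn (rect_int g x0 x1 y0 y1) <= 4 * M * ((x1 - x0) + (y1 - y0)).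
Proof.
move=> x01 y01 h; apply: (@rect_int_affine _ 0 0 0) => // x y hx hy hxy.
by rewrite subr0 mul0r subr0; exact: h.
Qed.

Lemma cn_Complex_rect x x' y y' : x <= x' -> y <= y' ->
  forall a b a' b', x <= a <= x' -> y <= b <= y' -> x <= a' <= x' -> y <= b' <= y' ->
  cn (Complex a b - Complex a' b') <= (x' - x) + (y' - y).
Proof.
move=> xx yy a b a' b' ha hb ha' hb'; apply: le_trans (cn_le _) _; apply: lerD.
  by rewrite /= ler_norml; lra.
by rewrite /= ler_norml; lra.
Qed.

(** The bound e s^2 for a box of scale s is additive under quartering, so [box_ind] reduces it to
    small boxes, where differentiability leaves a remainder that is small compared with the
    diameter. *)
Lemma goursat g x0 x1 y0 y1 : x0 < x1 -> y0 < y1 ->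
  (forall x y, x0 <= x <= x1 -> y0 <= y <= y1 -> cdiff g (Complex x y)) ->
  rect_int g x0 x1 y0 y1 = 0.
Proof.
move=> x01 y01 gd; pose L := x1 - x0; pose H := y1 - y0.
have L0 : 0 < L by rewrite subr_gt0.
have H0 : 0 < H by rewrite subr_gt0.
have gc x y : x0 <= x <= x1 -> y0 <= y <= y1 -> ccont g (Complex x y).
  by move=> hx hy; apply: cdiff_cont; exact: gd.
have ex : x0 + L = x1 by rewrite /L; ring.
have ey : y0 + H = y1 by rewrite /H; ring.
apply: cn_small => e e0.
have : cn (rect_int g x0 (x0 + L * 1) y0 (y0 + H * 1)) <= e * 1 ^+ 2.
  apply: (@box_ind R L H x0 y0 (fun x y s =>
    cn (rect_int g x (x + L * s) y (y + H * s)) <= e * s ^+ 2)) => //.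
    move=> x y s s0; set a := L * (s / 2); set b := H * (s / 2).
    have La : L * s = a + a by rewrite /a; field.
    have Hb : H * s = b + b by rewrite /b; field.
    have a0 : 0 < a by rewrite !mulr_gt0 // invr_gt0.
    have b0 : 0 < b by rewrite !mulr_gt0 // invr_gt0.
    rewrite La Hb ex ey => h1 h2 h3 h4 hx hx' hy hy'.
    have gc' t u : x <= t <= x + (a + a) -> y <= u <= y + (b + b) -> ccont g (Complex t u).
      move=> /andP[t1 t2] /andP[u1 u2]; apply: gc.
        by rewrite (le_trans hx t1) (le_trans t2 hx').
      by rewrite (le_trans hy u1) (le_trans u2 hy').
    have [xa xb xc xd] : [/\ x <= x + a, x + a <= x + (a + a), x <= x + (a + a) & 0 <= a].
      by clear -a0; split; lra.
    have [ya yb yc yd] : [/\ y <= y + b, y + b <= y + (b + b), y <= y + (b + b) & 0 <= b].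
      by clear -b0; split; lra.
    rewrite (@rect_splitx _ _ (x + a)); last 3 first.
    - by rewrite xa.
    - by move=> t ht; split; apply: gc'; rewrite ?lexx ?yc.
    - by move=> t ht; split; apply: gc'; rewrite ?lexx ?xa ?xb ?xc.
    rewrite (@rect_splity _ x _ _ (y + b)); last 3 first.
    - by rewrite ya.
    - by move=> t /andP[ht ht']; split; apply: gc'; rewrite ?lexx ?ya ?yb ?yc ?ht ?(le_trans ht' xb).
    - by move=> t ht; split; apply: gc'; rewrite ?lexx ?xa ?xb ?xc.
    rewrite (@rect_splity _ (x + a) _ _ (y + b)); last 3 first.
    - by rewrite ya.
    - by move=> t /andP[ht ht']; split; apply: gc'; rewrite ?lexx ?ya ?yb ?yc ?ht' ?(le_trans xa ht).
    - by move=> t ht; split; apply: gc'; rewrite ?lexx ?xa ?xb ?xc.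
    rewrite -!addrA in h1 h2 h3 h4.
    have -> : e * s ^+ 2 = (e * (s / 2) ^+ 2 + e * (s / 2) ^+ 2) +
      (e * (s / 2) ^+ 2 + e * (s / 2) ^+ 2) by field.
    apply: le_trans (cnD _ _) _; apply: lerD; apply: le_trans (cnD _ _) _; exact: lerD.
  rewrite ex ey => p q hp hq; have [l /cderE gl] := gd p q hp hq.
  (* The distance to the base point is at most s (L + H), and [rect_int_affine] multiplies the
     remainder by 4 s (L + H); the product is e s^2. *)
  have [d d0 Hd] := gl (e / (4 * (L + H) ^+ 2))
    ltac:(by rewrite divr_gt0 // mulr_gt0 // exprn_gt0 // addr_gt0).
  exists (d / (L + H)); first by rewrite divr_gt0 // addr_gt0.
  move=> x y s /andP[s0 sd] hxp hyq hx hx' hy hy'.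
  have Ls : 0 < L * s by rewrite mulr_gt0.
  have Hs : 0 < H * s by rewrite mulr_gt0.
  have sd' : s * (L + H) < d by rewrite -ltr_pdivlMr // addr_gt0.
  have := @rect_int_affine g (g (Complex p q)) l (Complex p q)
    (e / (4 * (L + H) ^+ 2) * (s * (L + H))) x (x + L * s) y (y + H * s).
  have -> : 4 * (e / (4 * (L + H) ^+ 2) * (s * (L + H))) *
    (x + L * s - x + (y + H * s - y)) = e * s ^+ 2.
    by field; rewrite gt_eqF // addr_gt0.
  apply; [lra|lra|] => a b ha hb _; split; first by apply: gc; lra.
  have ab : cn (Complex a b - Complex p q) <= s * (L + H).
    have := @cn_Complex_rect x (x + L * s) y (y + H * s) ltac:(lra) ltac:(lra) a b p q ha hb hxp hyq.
    by have -> : x + L * s - x + (y + H * s - y) = s * (L + H) by ring.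
  have := Hd (Complex a b) (le_lt_trans ab sd').
  rewrite {2}/dquo eqxx => hl.
  rewrite {1}(dquoE g (Complex p q) l (Complex a b)).
  rewrite (_ : _ - _ - _ = (dquo g (Complex p q) l (Complex a b) - l) *
     (Complex a b - Complex p q)); last by ring.
  by rewrite cnM; apply: ler_pM => //; rewrite ?cn_ge0 // ltW.
by rewrite !mulr1 expr1n mulr1 ex ey.
Qed.

(** Four rectangles that avoid the exceptional point are cut off, and [goursat] applies to each. *)
Lemma rect_int_center g x0 x1 y0 y1 a b (e : R) : 0 < e ->
  x0 < a - e -> a + e < x1 -> y0 < b - e -> b + e < y1 ->
  (forall x y, x0 <= x <= x1 -> y0 <= y <= y1 -> (x != a) || (y != b) -> cdiff g (Complex x y)) ->
  rect_int g x0 x1 y0 y1 = rect_int g (a - e) (a + e) (b - e) (b + e).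
Proof.
move=> e0 h1 h2 h3 h4 gd.
have gc x y : x0 <= x <= x1 -> y0 <= y <= y1 -> (x != a) || (y != b) -> ccont g (Complex x y).
  by move=> hx hy hn; apply: cdiff_cont; exact: gd.
have ne x : (x < a) || (a < x) -> (x != a) by case: ltgtP.
have ne' y : (y < b) || (b < y) -> (y != b) by case: ltgtP.
rewrite (@rect_splitx _ _ (a - e)); last 3 first.
- by lra.
- by move=> x hx; split; apply: gc; rewrite ?ne' ?orbT //; lra.
- by move=> y hy; split; apply: gc; rewrite ?ne ?orbT //; lra.
rewrite [in X in X + _]goursat ?add0r; last 3 first.
- by [].
- by lra.
- by move=> x y hx hy; apply: gd; rewrite ?ne ?orbT //; lra.
rewrite (@rect_splitx _ _ (a + e)); last 3 first.
- by lra.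
- by move=> x hx; split; apply: gc; rewrite ?ne' ?orbT //; lra.
- by move=> y hy; split; apply: gc; rewrite ?ne ?orbT //; lra.
rewrite [in X in _ + X]goursat ?addr0; last 3 first.
- by [].
- by lra.
- by move=> x y hx hy; apply: gd; rewrite ?ne ?orbT //; lra.
rewrite (@rect_splity _ _ _ _ (b - e)); last 3 first.
- by lra.
- by move=> x hx; split; apply: gc; rewrite ?ne' ?orbT //; lra.
- by move=> y hy; split; apply: gc; rewrite ?ne ?orbT //; lra.
rewrite [in X in X + _]goursat ?add0r; last 3 first.
- by lra.
- by [].
- by move=> x y hx hy; apply: gd; rewrite ?ne' ?orbT //; lra.
rewrite (@rect_splity _ _ _ _ (b + e)); last 3 first.
- by lra.
- by move=> x hx; split; apply: gc; rewrite ?ne' ?orbT //; lra.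
- by move=> y hy; split; apply: gc; rewrite ?ne ?orbT //; lra.
rewrite [in X in _ + X]goursat ?addr0 //.
- by lra.
- by move=> x y hx hy; apply: gd; rewrite ?ne' ?orbT //; lra.
Qed.

(** Near the exceptional point the function is bounded by some B, so the remaining square of half
    side e contributes at most 16 B e. *)
Lemma rect_int_removable g x0 x1 y0 y1 a b : x0 < a < x1 -> y0 < b < y1 ->
  (forall x y, x0 <= x <= x1 -> y0 <= y <= y1 -> (x != a) || (y != b) -> cdiff g (Complex x y)) ->
  ccont g (Complex a b) -> rect_int g x0 x1 y0 y1 = 0.
Proof.
move=> /andP[xa ax] /andP[yb by_] gd gc.
have [d d0 Hd] := gc 1 ltr01.
pose B := cn (g (Complex a b)) + 1.
have B0 : 0 < B by rewrite ltr_wpDl ?cn_ge0.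
apply: cn_small => r r0.
have [e [[e0 e1 e2] [e3 e4] [ed er]]] : exists e, [/\ [/\ 0 < e, x0 < a - e & a + e < x1],
    [/\ y0 < b - e & b + e < y1] & [/\ 4 * e < d & 16 * B * e <= r]].
  exists (Num.min (Num.min (Num.min ((a - x0) / 2) ((x1 - a) / 2))
    (Num.min ((b - y0) / 2) ((y1 - b) / 2))) (Num.min (d / 8) (r / (16 * B)))).
  set m := Num.min _ _; have : m <= m by [].
  rewrite {2}/m !le_min => /andP[/andP[/andP[m1 m2] /andP[m3 m4]] /andP[m5 m6]].
  have m0 : 0 < m.
    rewrite /m !lt_min !divr_gt0 ?subr_gt0 // mulr_gt0 //.
  clear -m0 m1 m2 m3 m4 m5 m6 d0 B0.
  split; split=> //; try lra.
  by rewrite mulrC -ler_pdivlMr // mulr_gt0.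
rewrite (rect_int_center e0 e1 e2 e3 e4 gd).
have := @rect_int_bound g B (a - e) (a + e) (b - e) (b + e).
have -> : 4 * B * (a + e - (a - e) + (b + e - (b - e))) = 16 * B * e by ring.
move=> h; apply: le_trans er; apply: h; [lra|lra|] => x y hx hy hb; split.
  apply: cdiff_cont; apply: gd; [lra|lra|].
  move: hb; rewrite !inE; case/orP => /orP[] /eqP ->; apply/orP.
  - by left; rewrite lt_eqF //; lra.
  - by left; rewrite gt_eqF //; lra.
  - by right; rewrite lt_eqF //; lra.
  - by right; rewrite gt_eqF //; lra.
have := @cn_Complex_rect (a - e) (a + e) (b - e) (b + e) ltac:(lra) ltac:(lra) x y a b hx hy ltac:(lra) ltac:(lra).
rewrite (_ : _ + _ = 4 * e); last by ring.
move=> /le_lt_trans /(_ ed) /Hd h'; rewrite /B.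
have := cn_lb (g (Complex x y)) (g (Complex a b)); lra.
Qed.

End Rectangles.

(** * Cauchy integrals over a square *)

Section Cauchy.
Variable R : realType.
Variables (z : R[i]) (h : R).
Hypothesis h0 : 0 < h.
Implicit Types (f g F : R[i] -> R[i]) (t w : R[i]).

Let zx := complex.Re z.
Let zy := complex.Im z.

Definition sq_int F := rect_int F (zx - h) (zx + h) (zy - h) (zy + h).

Definition on_sq t := zx - h <= complex.Re t <= zx + h /\ zy - h <= complex.Im t <= zy + h /\
  ((complex.Re t \in [:: zx - h; zx + h]) || (complex.Im t \in [:: zy - h; zy + h])).

Definition sq_cont F := forall t, on_sq t -> ccont F t.

Lemma on_sq_cn t : on_sq t -> h <= cn (t - z).
Proof.
move=> [_ [_]]; rewrite !inE => /orP[] H.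
  apply: le_trans (Re_le_cn _); rewrite ReB -/zx.
  case/orP: H => /eqP ->; rewrite ler_normr; apply/orP; [right|left]; lra.
apply: le_trans (Im_le_cn _); rewrite ImB -/zy.
case/orP: H => /eqP ->; rewrite ler_normr; apply/orP; [right|left]; lra.
Qed.

Lemma on_sq_cnV t : on_sq t -> (cn (t - z))^-1 <= h^-1.
Proof. by move=> /on_sq_cn ht; rewrite lef_pV2 ?posrE // (lt_le_trans h0 ht). Qed.

Lemma closed_sq_cn t : zx - h <= complex.Re t <= zx + h -> zy - h <= complex.Im t <= zy + h ->
  cn (t - z) ^+ 2 <= 2 * h ^+ 2.
Proof.
move=> hx hy; rewrite cn_sqr ReB ImB -/zx -/zy [2 * _]mulr_natl mulr2n.
apply: lerD; rewrite -real_normK ?num_real // ler_pXn2r ?nnegrE ?(ltW h0) ?normr_ge0 //.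
  by rewrite ler_norml; lra.
by rewrite ler_norml; lra.
Qed.

Lemma sq_side : zx - h <= zx + h /\ zy - h <= zy + h. Proof. by have := h0; split; lra. Qed.

Lemma on_sq_hor x y : zx - h <= x <= zx + h -> y \in [:: zy - h; zy + h] -> on_sq (Complex x y).
Proof.
move=> hx hy; split=> //; split; last by rewrite /= hy orbT.
by move: hy; rewrite /= !inE => /orP[] /eqP ->; have [_ hs] := sq_side; rewrite lexx hs.
Qed.

Lemma on_sq_ver x y : zy - h <= y <= zy + h -> x \in [:: zx - h; zx + h] -> on_sq (Complex x y).
Proof.
move=> hy hx; split; last by split=> //; rewrite /= hx.
by move: hx; rewrite /= !inE => /orP[] /eqP ->; have [hs _] := sq_side; rewrite lexx hs.
Qed.

Lemma sq_int_ext F f : (forall t, on_sq t -> F t = f t) -> sq_int F = sq_int f.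
Proof.
move=> E; rewrite /sq_int /rect_int; congr (_ + _ * _); apply: cint_ext => x hx.
  by rewrite !E //; apply: on_sq_hor; rewrite ?mem_head // !inE eqxx orbT.
by rewrite !E //; apply: on_sq_ver; rewrite ?mem_head // !inE eqxx orbT.
Qed.

Lemma sq_icont_hor F y : sq_cont F -> y \in [:: zy - h; zy + h] ->
  icont (fun x => F (Complex x y)) (zx - h) (zx + h).
Proof. by move=> Fc hy; apply: icont_hor => x hx; apply: Fc; exact: on_sq_hor. Qed.

Lemma sq_icont_ver F x : sq_cont F -> x \in [:: zx - h; zx + h] ->
  icont (fun y => F (Complex x y)) (zy - h) (zy + h).
Proof. by move=> Fc hx; apply: icont_ver => y hy; apply: Fc; exact: on_sq_ver. Qed.

Lemma sq_intD F f : sq_cont F -> sq_cont f ->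
  sq_int (fun t => F t + f t) = sq_int F + sq_int f.
Proof.
move=> Fc fc; rewrite /sq_int /rect_int [RHS]addrACA -mulrDr -!cintD.
- congr (_ + _ * _); apply: cint_ext => x _; ring.
- by apply: icontB; apply: sq_icont_ver => //; rewrite !inE eqxx ?orbT.
- by apply: icontB; apply: sq_icont_ver => //; rewrite !inE eqxx ?orbT.
- by apply: icontB; apply: sq_icont_hor => //; rewrite !inE eqxx ?orbT.
- by apply: icontB; apply: sq_icont_hor => //; rewrite !inE eqxx ?orbT.
Qed.

Lemma sq_intZ k F : sq_cont F -> sq_int (fun t => k * F t) = k * sq_int F.
Proof.
move=> Fc; rewrite /sq_int /rect_int mulrDr mulrCA; congr (_ + _ * _); rewrite -cintZ.
- by apply: cint_ext => x _; ring.
- by apply: icontB; apply: sq_icont_hor => //; rewrite !inE eqxx ?orbT.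
- by apply: cint_ext => x _; ring.
- by apply: icontB; apply: sq_icont_ver => //; rewrite !inE eqxx ?orbT.
Qed.

Lemma sq_contZ k F : sq_cont F -> sq_cont (fun t => k * F t).
Proof. by move=> Fc t /Fc tc; apply: ccontM => //; exact: ccont_cst. Qed.

Lemma sq_intB F f : sq_cont F -> sq_cont f ->
  sq_int (fun t => F t - f t) = sq_int F - sq_int f.
Proof.
move=> Fc fc; rewrite -[- sq_int f]mulN1r -sq_intZ // -sq_intD //; last exact: sq_contZ.
by apply: sq_int_ext => t _; rewrite mulN1r.
Qed.

Lemma sq_int_bound F M : sq_cont F -> (forall t, on_sq t -> cn (F t) <= M) ->
  cn (sq_int F) <= 16 * h * M.
Proof.
move=> Fc FM; have [s1 s2] := sq_side.
apply: le_trans (@rect_int_bound R F M _ _ _ _ s1 s2 _) _.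
  move=> x y hx hy hb; have ht : on_sq (Complex x y) by split.
  by split; [exact: Fc|exact: FM].
by rewrite le_eqVlt; apply/orP; left; apply/eqP; ring.
Qed.

Definition cauchy_int F w := sq_int (fun t => F t / (t - w)).

Definition in_sq w := zx - h < complex.Re w < zx + h /\ zy - h < complex.Im w < zy + h.

Lemma on_in_neq t w : on_sq t -> in_sq w -> t != w.
Proof.
move=> [_ [_ H]] [wx wy]; apply/eqP => E; move: H wx wy; rewrite E !inE.
by case/orP => /orP[] /eqP ->; rewrite ltxx ?andbF.
Qed.

Lemma ccont_quo F w t : ccont F t -> t != w -> ccont (fun t => F t / (t - w)) t.
Proof.
move=> Fc tw; apply: ccontM => //; apply: ccontV; last by rewrite subr_eq0.
by apply: ccontB; [exact: ccont_id|exact: ccont_cst].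
Qed.

Lemma sq_cont_quo F w : sq_cont F -> in_sq w -> sq_cont (fun t => F t / (t - w)).
Proof. by move=> Fc iw t ht; apply: ccont_quo; [exact: Fc|exact: on_in_neq iw]. Qed.

Lemma cauchy_int_bound F w M d : sq_cont F -> in_sq w -> 0 < d ->
  (forall t, on_sq t -> cn (F t) <= M) -> (forall t, on_sq t -> d <= cn (t - w)) ->
  cn (cauchy_int F w) <= 16 * h * (M / d).
Proof.
move=> Fc iw d0 FM dw; apply: sq_int_bound; first exact: sq_cont_quo.
move=> t ht; rewrite cnM cnV; apply: ler_pM; rewrite ?cn_ge0 ?invr_ge0 ?cn_ge0 //.
  exact: FM.
by rewrite lef_pV2 ?posrE // ?dw // (lt_le_trans d0 (dw _ ht)).
Qed.

(** The partial fraction identity for 1/(t - w) - 1/(t - v). It exhibits the difference quotient of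
    a Cauchy integral as a Cauchy integral again. *)
Lemma cauchy_intB F v w : sq_cont F -> in_sq v -> in_sq w ->
  cauchy_int F w - cauchy_int F v = (w - v) * cauchy_int (fun t => F t / (t - v)) w.
Proof.
move=> Fc iv iw; rewrite /cauchy_int -sq_intZ; last by do 2 apply: sq_cont_quo => //.
rewrite -sq_intB; [|exact: sq_cont_quo..].
apply: sq_int_ext => t ht; field.
by rewrite !subr_eq0 !on_in_neq.
Qed.

Lemma center_in : in_sq z. Proof. by have := h0; split; rewrite /zx /zy; lra. Qed.

Lemma ball_in_sq w : cn (w - z) < h -> in_sq w.
Proof.
move=> wh; split.
  have := le_lt_trans (Re_le_cn _) wh; rewrite ReB -/zx ltr_norml; lra.
have := le_lt_trans (Im_le_cn _) wh; rewrite ImB -/zy ltr_norml; lra.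
Qed.

Lemma cauchy_int_cont F M : sq_cont F -> (forall t, on_sq t -> cn (F t) <= M) ->
  ccont (cauchy_int F) z.
Proof.
move=> Fc FM e e0.
have M0 : 0 <= M.
  have hs : on_sq (Complex (zx - h) (zy - h)).
    by apply: on_sq_hor; rewrite ?mem_head // lexx /=; have [] := sq_side.
  exact: le_trans (cn_ge0 _) (FM _ hs).
pose K := 16 * h * (M / h / (h / 2)) + 1.
have h0' := ltW h0.
have K0 : 0 < K.
  by rewrite ltr_wpDl //; do ?apply: mulr_ge0; rewrite ?invr_ge0 ?divr_ge0.
exists (Num.min (h / 2) (e / K)); first by rewrite lt_min !divr_gt0.
move=> w; rewrite lt_min => /andP[w1 w2].
have iw : in_sq w by apply: ball_in_sq; lra.
rewrite cauchy_intB //; last exact: center_in.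
rewrite cnM; apply: le_lt_trans (_ : cn (w - z) * K < e); last by rewrite -ltr_pdivlMr.
apply: ler_wpM2l; first exact: cn_ge0.
apply: le_trans (_ : 16 * h * (M / h / (h / 2)) <= K); last by rewrite /K; lra.
have h2 : 0 < h / 2 by rewrite divr_gt0.
apply: (cauchy_int_bound _ iw h2).
- by apply: sq_cont_quo => //; exact: center_in.
- move=> t ht; rewrite cnM cnV; apply: ler_pM; rewrite ?cn_ge0 ?invr_ge0 ?cn_ge0 ?FM //.
  exact: on_sq_cnV.
- by move=> t ht; have := on_sq_cn ht; have := cn_trans w t z; lra.
Qed.

Lemma cauchy_int_cdiff F M : sq_cont F -> (forall t, on_sq t -> cn (F t) <= M) ->
  cdiff (cauchy_int F) z.
Proof.
move=> Fc FM; exists (cauchy_int (fun t => F t / (t - z)) z); apply/cderE.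
have Gc : sq_cont (fun t => F t / (t - z)).
  by apply: sq_cont_quo => //; exact: center_in.
have GM t : on_sq t -> cn (F t / (t - z)) <= M / h.
  move=> ht; rewrite cnM cnV; apply: ler_pM; rewrite ?cn_ge0 ?invr_ge0 ?cn_ge0 ?FM //.
  exact: on_sq_cnV.
apply: (ccont_near h0 _ (cauchy_int_cont Gc GM)) => w wh; rewrite /dquo.
case: eqVneq => [-> //|wz].
rewrite cauchy_intB //; [|exact: center_in|exact: ball_in_sq].
by rewrite mulrC mulKf // subr_eq0.
Qed.

(** The integral is 2 pi i, but a lower bound for its modulus allows division by it and avoids
    arctangents. On a small square of half side e around w, e/(u^2 + e^2) >= 1/(2e) for |u| <= e, so
    each pair of opposite sides contributes at least 2 to the imaginary part. *)
Lemma cauchy_kernel w : in_sq w -> 4 <= cn (cauchy_int (fun=> 1) w).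
Proof.
move=> [/andP[wx1 wx2] /andP[wy1 wy2]].
set a := complex.Re w in wx1 wx2 *; set b := complex.Im w in wy1 wy2 *.
have [e [e0 e1 e2 e3 e4]] : exists e, [/\ 0 < e, zx - h < a - e, a + e < zx + h, zy - h < b - e &
    b + e < zy + h].
  exists (Num.min (Num.min ((a - (zx - h)) / 2) ((zx + h - a) / 2))
    (Num.min ((b - (zy - h)) / 2) ((zy + h - b) / 2))).
  set m := Num.min _ _; have : m <= m by [].
  rewrite {2}/m !le_min => /andP[/andP[m1 m2] /andP[m3 m4]].
  have m0 : 0 < m by rewrite /m !lt_min !divr_gt0 ?subr_gt0.
  by clear -m0 m1 m2 m3 m4; split=> //; lra.
pose F t : R[i] := 1 / (t - w).
have nw t : t != w -> cdiff F t.
  move=> tw; apply: cdiffM; first exact: cdiff_cst.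
  apply: cdiffV; last by rewrite subr_eq0.
  by apply: cdiffB; [exact: cdiff_id|exact: cdiff_cst].
have neqw x y : (x != a) || (y != b) -> Complex x y != w.
  by rewrite eq_complex negb_and.
rewrite /cauchy_int /sq_int -/F (rect_int_center e0 e1 e2 e3 e4); last first.
  by move=> x y _ _ /neqw /nw.
apply: le_trans (le_trans (ler_norm _) (Im_le_cn _)).
rewrite /rect_int ImD.
have ne1 : b - e != b /\ b + e != b by split; apply/eqP; lra.
have ne2 : a - e != a /\ a + e != a by split; apply/eqP; lra.
have Fc x y : (x != a) || (y != b) -> ccont F (Complex x y).
  by move=> /neqw /nw /cdiff_cont.
have i1 : icont (fun x => F (Complex x (b - e)) - F (Complex x (b + e))) (a - e) (a + e).
  by apply: icontB; apply: icont_hor => x _; apply: Fc; rewrite ?ne1.1 ?ne1.2 orbT.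
have i2 : icont (fun x => F (Complex (a + e) x) - F (Complex (a - e) x)) (b - e) (b + e).
  by apply: icontB; apply: icont_ver => x _; apply: Fc; rewrite ?ne2.1 ?ne2.2.
have ww : w = Complex a b by rewrite /a /b; case: (w).
have FE x y : F (Complex x y) = Complex ((x - a) / ((x - a) ^+ 2 + (y - b) ^+ 2))
    (- ((y - b) / ((x - a) ^+ 2 + (y - b) ^+ 2))).
  by rewrite /F div1r ww.
have pos u : - e <= u <= e -> 0 < u ^+ 2 + e ^+ 2 /\ 1 / e <= 2 * (e / (u ^+ 2 + e ^+ 2)).
  move=> ue; have p : 0 < u ^+ 2 + e ^+ 2 by rewrite ltr_wpDl ?sqr_ge0 // exprn_gt0.
  split=> //; rewrite mulrA ler_pdivlMr // mulrC mulrA mulr1 ler_pdivrMr //.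
  have : u ^+ 2 <= e ^+ 2.
    rewrite -real_normK ?num_real // ler_pXn2r ?nnegrE ?(ltW e0) ?normr_ge0 //.
    by rewrite ler_norml; lra.
  rewrite expr2 => H; rewrite -mulrA -expr2; lra.
have I1 : 2 <= complex.Im (cint (fun x => F (Complex x (b - e)) - F (Complex x (b + e))) (a - e) (a + e)).
  have -> : (2 : R) = 1 / e * ((a + e) - (a - e)) by field; rewrite gt_eqF.
  apply: Im_cint_ge => //; first lra.
  move=> x hx; rewrite !FE ImB /=.
  have [p q] := pos (x - a) ltac:(lra).
  apply: le_trans q _; rewrite le_eqVlt; apply/orP; left; apply/eqP.
  have -> : (b - e - b) = - e by ring.
  have -> : (b + e - b) = e by ring.
  by field; rewrite gt_eqF // sqrrN gt_eqF.
have I2 : 2 <= complex.Re (cint (fun x => F (Complex (a + e) x) - F (Complex (a - e) x)) (b - e) (b + e)).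
  have -> : (2 : R) = 1 / e * ((b + e) - (b - e)) by field; rewrite gt_eqF.
  apply: Re_cint_ge => //; first lra.
  move=> x hx; rewrite !FE ReB /=.
  have [p q] := pos (x - b) ltac:(lra).
  rewrite addrC in p q.
  apply: le_trans q _; rewrite le_eqVlt; apply/orP; left; apply/eqP.
  have -> : (a - e - a) = - e by ring.
  have -> : (a + e - a) = e by ring.
  by rewrite sqrrN mulNr opprK mulr_natl mulr2n.
have im (k : R[i]) : complex.Im (Complex 0 1 * k) = complex.Re k.
  by case: (k) => p q /=; rewrite mul0r mul1r add0r.
by rewrite im; lra.
Qed.

(** The difference quotient of [g] at [w] is continuous there, so its integral vanishes by
    [rect_int_removable]. The kernel stays as a factor in place of 2 pi i. *)
Lemma cauchy_formula g w : in_sq w ->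
  (forall t, zx - h <= complex.Re t <= zx + h -> zy - h <= complex.Im t <= zy + h -> cdiff g t) ->
  cauchy_int g w = g w * cauchy_int (fun=> 1) w.
Proof.
move=> iw gd; have [wx wy] := iw.
have gc : sq_cont g by move=> t [tx [ty _]]; apply: cdiff_cont; exact: gd.
have [l gl] : cdiff g w by apply: gd; [move: wx|move: wy] => /andP[] /ltW -> /ltW ->.
have E : sq_int (dquo g w l) = 0.
  rewrite /sq_int (@rect_int_removable _ _ _ _ _ _ (complex.Re w) (complex.Im w)) //.
    move=> x y hx hy hxy.
    have xw : Complex x y != w by rewrite eq_complex negb_and.
    have c0 : 0 < cn (Complex x y - w) by rewrite cn_gt0 subr_eq0.
    apply: (@cdiff_near _ (fun t => (g t - g w) / (t - w)) _ _ _ c0).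
      move=> t; rewrite /dquo; case: eqVneq => // ->.
      by rewrite cnBC ltxx.
    apply: cdiffM; first by apply: cdiffB; [exact: gd|exact: cdiff_cst].
    apply: cdiffV; last by rewrite subr_eq0.
    by apply: cdiffB; [exact: cdiff_id|exact: cdiff_cst].
  by move/cderE: gl; case: (w) => p q.
apply/eqP; rewrite -subr_eq0 /cauchy_int -sq_intZ; last first.
  by apply: sq_cont_quo => // t _; exact: ccont_cst.
rewrite -sq_intB; first last.
- by apply: sq_contZ; apply: sq_cont_quo => // t _; exact: ccont_cst.
- exact: sq_cont_quo.
rewrite -E; apply/eqP; apply: sq_int_ext => t ht.
have tw := on_in_neq ht iw; rewrite /dquo (negbTE tw).
by rewrite mulrA mulr1 -mulrBl.
Qed.

End Cauchy.

(** * Holomorphy of difference quotients *)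

Section DifferenceQuotient.
Variable R : realType.
Implicit Types (f g : R[i] -> R[i]) (z w : R[i]).

Lemma ccont_unique f g z (r : R) : 0 < r ->
  (forall w, w != z -> cn (w - z) < r -> f w = g w) -> ccont f z -> ccont g z -> f z = g z.
Proof.
move=> r0 fg fc gc; apply/eqP; rewrite -subr_eq0; apply/eqP; apply: cn_small => e e0.
have e2 : 0 < e / 2 by rewrite divr_gt0.
have [d d0 H] := fc _ e2; have [d' d0' H'] := gc _ e2.
pose s := Num.min r (Num.min d d') / 2.
have s0 : 0 < s by rewrite divr_gt0 // !lt_min r0 d0.
have [sr sd sd'] : [/\ s < r, s < d & s < d'].
  have : Num.min r (Num.min d d') <= Num.min r (Num.min d d') by [].
  by rewrite {2}/Num.min !le_min => /andP[? /andP[? ?]]; rewrite /s; split; lra.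
have cs : cn ((z + s%:C) - z) = s by rewrite addrC addKr cnR gtr0_norm.
have zs : z + s%:C != z by rewrite -subr_eq0 -cn_eq0 cs gt_eqF.
have := H (z + s%:C); rewrite cs => /(_ sd) h1.
have := H' (z + s%:C); rewrite cs => /(_ sd') h2.
have E : f (z + s%:C) = g (z + s%:C) by apply: fg => //; rewrite cs.
rewrite E in h1; have := cn_trans (g (z + s%:C)) (f z) (g z); rewrite (cnBC (f z) (g (z + _))); lra.
Qed.

(** Off [z] the quotient equals a ratio of two Cauchy integrals, which are differentiable at the
    centre whatever their boundary data; continuity extends the equality to [z]. Iterating this
    theorem yields Taylor expansions with geometric bounds. *)
Theorem dquo_holo g z l (r M : R) : 0 < r -> (forall w, cn (w - z) < r -> cdiff g w) ->
  (forall w, cn (w - z) < r -> cn (g w) <= M) -> cder g z l ->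
  (forall w, cn (w - z) < r -> cdiff (dquo g z l) w) /\
  (forall w, cn (w - z) < r -> cn (dquo g z l w) <= 48 * M / r).
Proof.
(* Since 2 (2/3)^2 < 1 the closed square lies in the disc of radius r, and its boundary keeps
   distance r/6 from the disc of radius r/2. There each of the two terms of the numerator is at most
   96 M / r and the kernel is at least 4, which gives 48 M / r; outside that disc the trivial bound
   is smaller. *)
move=> r0 gd gM gl; pose h := 2 / 3 * r.
have h0 : 0 < h by rewrite /h; lra.
have M0 : 0 <= M by apply: le_trans (gM z _); rewrite ?cn_ge0 // subrr cn0.
have sq_r t : complex.Re z - h <= complex.Re t <= complex.Re z + h ->
    complex.Im z - h <= complex.Im t <= complex.Im z + h -> cn (t - z) < r.
  move=> hx hy; rewrite -(@ltr_pXn2r _ 2) ?nnegrE ?cn_ge0 ?(ltW r0) //.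
  apply: le_lt_trans (closed_sq_cn h0 hx hy) _; rewrite /h.
  have : 0 < r ^+ 2 by rewrite exprn_gt0.
  rewrite exprMn; lra.
have gc : sq_cont z h g by move=> t [tx [ty _]]; apply: cdiff_cont; apply: gd; exact: sq_r.
have gb t : on_sq z h t -> cn (g t) <= M by move=> [tx [ty _]]; apply: gM; exact: sq_r.
have oc : sq_cont z h (fun=> 1) by move=> t _; exact: ccont_cst.
have ob t : on_sq z h t -> cn (1 : R[i]) <= 1 by rewrite cn1.
have zin := center_in z h0.
pose q (F : R[i] -> R[i]) t := F t / (t - z).
have qc F : sq_cont z h F -> sq_cont z h (q F) by move=> Fc; exact: sq_cont_quo.
have qb F B : (forall t, on_sq z h t -> cn (F t) <= B) ->
    forall t, on_sq z h t -> cn (q F t) <= B / h.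
  move=> FB t ht; rewrite cnM cnV; apply: ler_pM; rewrite ?cn_ge0 ?invr_ge0 ?cn_ge0 ?FB //.
  exact: (on_sq_cnV h0 ht).
pose K w := cauchy_int z h (fun=> 1) w.
(* Subtracting [g z] times the identity for the kernel from the identity for [g] eliminates [K z]
   and leaves (g w - g z) K w = (w - z) N w. *)
pose N w := cauchy_int z h (q g) w - g z * cauchy_int z h (q (fun=> 1)) w.
have K4 w : cn (w - z) < h -> 4 <= cn (K w).
  by move=> wh; apply: cauchy_kernel => //; exact: ball_in_sq.
have Kn w : cn (w - z) < h -> K w != 0.
  by move=> /K4 k4; rewrite -cn_gt0; lra.
have E w : w != z -> cn (w - z) < h -> dquo g z l w = N w / K w.
  move=> wz wh; have iw := ball_in_sq wh.
  rewrite /dquo (negbTE wz).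
  have e1 := @cauchy_formula _ z h h0 g w iw (fun t hx hy => gd t (sq_r t hx hy)).
  have e2 := @cauchy_formula _ z h h0 g z zin (fun t hx hy => gd t (sq_r t hx hy)).
  have e3 := @cauchy_intB _ z h h0 g z w gc zin iw.
  have e4 := @cauchy_intB _ z h h0 (fun=> 1) z w oc zin iw.
  rewrite e1 e2 -/(K w) -/(K z) -/(q g) in e3; rewrite -/(K w) -/(K z) -/(q (fun=> 1)) in e4.
  apply/eqP; rewrite eqr_div ?subr_eq0 ?Kn //; apply/eqP.
  rewrite /N [RHS]mulrC mulrBr -e3 [_ * (g z * _)]mulrCA -e4; ring.
have Kd : cdiff K z by exact: cauchy_int_cdiff oc ob.
have Nd : cdiff N z.
  apply: cdiffB; first exact: (cauchy_int_cdiff h0 (qc _ gc) (qb _ _ gb)).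
  apply: cdiffM; first exact: cdiff_cst.
  exact: (cauchy_int_cdiff h0 (qc _ oc) (qb _ _ ob)).
have NKd : cdiff (fun w => N w / K w) z.
  by apply: cdiffM => //; apply: cdiffV => //; apply: Kn; rewrite subrr cn0.
have Ez : dquo g z l z = N z / K z.
  apply: (@ccont_unique _ (fun w => N w / K w) _ _ h0 E).
    by move/cderE: gl.
  exact: cdiff_cont.
have E' w : cn (w - z) < h -> dquo g z l w = N w / K w.
  by case: (eqVneq w z) => [-> _ //|wz]; exact: E.
split=> w wr.
  case: (eqVneq w z) => [->|wz].
    by apply: (cdiff_near h0 _ NKd) => v /E'.
  have c0 : 0 < cn (w - z) by rewrite cn_gt0 subr_eq0.
  apply: (@cdiff_near _ (fun t => (g t - g z) / (t - z)) _ _ _ c0).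
    move=> t; rewrite /dquo; case: eqVneq => // ->.
    by rewrite cnBC ltxx.
  apply: cdiffM; first by apply: cdiffB; [exact: gd|exact: cdiff_cst].
  apply: cdiffV; last by rewrite subr_eq0.
  by apply: cdiffB; [exact: cdiff_id|exact: cdiff_cst].
case: (ltP (cn (w - z)) (r / 2)) => wr2.
  have wh : cn (w - z) < h by rewrite /h; lra.
  have iw := ball_in_sq wh.
  have d0 : 0 < r / 6 by rewrite divr_gt0.
  have dw t : on_sq z h t -> r / 6 <= cn (t - w).
    move=> ht; have := on_sq_cn ht; have := cn_trans w t z; rewrite /h in wh *; lra.
  have b1 := cauchy_int_bound h0 (qc _ gc) iw d0 (qb _ _ gb) dw.
  have b2 := cauchy_int_bound h0 (qc _ oc) iw d0 (qb _ _ ob) dw.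
  rewrite E' // cnM cnV ler_pdivrMr ?cn_gt0 ?Kn //.
  apply: le_trans (_ : 48 * M / r * 4 <= _); last first.
    by apply: ler_wpM2l; [rewrite !mulr_ge0 ?invr_ge0 // ltW|exact: K4].
  apply: le_trans (cnB _ _) _; rewrite cnM.
  have gz : cn (g z) <= M by apply: gM; rewrite subrr cn0.
  have b3 : cn (g z) * cn (cauchy_int z h (q (fun=> 1)) w) <= M * (16 * h * (1 / h / (r / 6))).
    by apply: ler_pM => //; exact: cn_ge0.
  apply: le_trans (lerD b1 b3) _; rewrite le_eqVlt; apply/orP; left; apply/eqP.
  by rewrite /h; field; rewrite gt_eqF.
have wz : w != z.
  by apply/eqP => wz; move: wr2; rewrite wz subrr cn0; lra.
rewrite /dquo (negbTE wz) cnM cnV ler_pdivrMr; last by rewrite cn_gt0 subr_eq0.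
apply: le_trans (_ : 48 * M / r * (r / 2) <= _); last first.
  by apply: ler_wpM2l => //; rewrite !mulr_ge0 ?invr_ge0 // ltW.
apply: le_trans (cnB _ _) _.
have := gM w wr; have := gM z; rewrite subrr cn0 => /(_ r0) gz gw.
have -> : 48 * M / r * (r / 2) = 24 * M by field; rewrite gt_eqF.
lra.
Qed.

End DifferenceQuotient.

(** * Taylor expansions and orders of zeros *)

Section Limits.
Variable R : realType.
Implicit Types (u v : nat -> R[i]) (l m : R[i]).

Lemma ctends_unique u l m : ctends u l -> ctends u m -> l = m.
Proof.
move=> hl hm; apply/eqP; rewrite -subr_eq0; apply/eqP; apply: cn_small => e e0.
have e2 : 0 < e / 2 by rewrite divr_gt0.
have [n H] := hl _ e2; have [n' H'] := hm _ e2.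
have := H (maxn n n') (leq_maxl _ _); have := H' (maxn n n') (leq_maxr _ _).
have := cn_trans (u (maxn n n')) l m; rewrite (cnBC l (u _)); lra.
Qed.

Lemma ctends_ext u v l : (forall n, u n = v n) -> ctends u l -> ctends v l.
Proof. by move=> E h e e0; have [n H] := h e e0; exists n => k /H; rewrite E. Qed.

Lemma ctends_cst l : ctends (fun=> l) l.
Proof. by move=> e e0; exists 0%N => n _; rewrite subrr cn0. Qed.

Lemma ctendsD u v l m : ctends u l -> ctends v m -> ctends (fun n => u n + v n) (l + m).
Proof.
move=> hl hm e e0; have e2 : 0 < e / 2 by rewrite divr_gt0.
have [n H] := hl _ e2; have [n' H'] := hm _ e2.
exists (maxn n n') => k; rewrite geq_max => /andP[/H h /H' h'].
by rewrite opprD addrACA; apply: le_lt_trans (cnD _ _) _; lra.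
Qed.

Lemma ctendsZ k u l : ctends u l -> ctends (fun n => k * u n) (k * l).
Proof.
move=> h e e0; have k0 : 0 < cn k + 1 by rewrite ltr_wpDl ?cn_ge0.
have [n H] := h (e / (cn k + 1)) ltac:(by rewrite divr_gt0).
exists n => j /H; rewrite -mulrBr cnM ltr_pdivlMr // => hj.
by apply: le_lt_trans hj; rewrite mulrC ler_wpM2l ?cn_ge0 // lerDl.
Qed.

Lemma ctendsB u v l m : ctends u l -> ctends v m -> ctends (fun n => u n - v n) (l - m).
Proof.
move=> hl hm; rewrite -[- m]mulN1r.
by apply: ctends_ext (ctendsD hl (ctendsZ (-1) hm)) => n; rewrite mulN1r.
Qed.

Lemma ctends_shift u l k : ctends u l <-> ctends (fun n => u (n + k)%N) l.
Proof.
split=> h e e0; have [n H] := h e e0.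
  by exists n => j nj; apply: H; rewrite (leq_trans nj) // leq_addr.
exists (n + k)%N => j nj; rewrite -(subnK (leq_trans (leq_addl n k) nj)).
by apply: H; rewrite leq_subRL ?(leq_trans (leq_addl n k) nj) // addnC.
Qed.

Lemma ctends_le u l (B : R) : (exists n0, forall n, (n0 <= n)%N -> cn (u n) <= B) ->
  ctends u l -> cn l <= B.
Proof.
move=> [n0 uB] h; apply/ler_addgt0Pr => e e0; have [n H] := h e e0.
have := H _ (leq_maxl n n0); have := uB _ (leq_maxr n n0).
by have := cn_lb l (u (maxn n n0)); rewrite cnBC; lra.
Qed.

Definition psum u n : R[i] := \sum_(k < n) u k.
Definition csum u : R[i] := xget 0 [set l | ctends (psum u) l].

Lemma psumS u n : psum u n.+1 = psum u n + u n.
Proof. by rewrite /psum big_ord_recr. Qed.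

Lemma psumSl u n : psum u n.+1 = u 0%N + psum (fun k => u k.+1) n.
Proof. by rewrite /psum big_ord_recl. Qed.

Lemma psumZ a u n : psum (fun k => a * u k) n = a * psum u n.
Proof. by rewrite /psum mulr_sumr. Qed.

Lemma psumB u v n : psum (fun k => u k - v k) n = psum u n - psum v n.
Proof. by rewrite /psum -sumrB. Qed.

Lemma csumP u l : ctends (psum u) l -> csum u = l.
Proof.
move=> h; apply: (ctends_unique _ h).
exact: (xgetPex 0 (ex_intro _ l h)).
Qed.

Definition summ_by u (M : nat -> R) (B : R) :=
  (forall k, cn (u k) <= M k) /\ (forall n, \sum_(k < n) M k <= B).

Lemma summ_cvg u M B : summ_by u M B -> ctends (psum u) (csum u).
Proof.
move=> [uM MB].
suff [l h] : exists l, ctends (psum u) l by rewrite (csumP h).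
have real (p : R[i] -> R) : (forall z, `|p z| <= cn z) ->
    exists l : R, series (p \o u) @ \oo --> l.
  move=> pc; apply/cvg_ex; apply: normed_cvg.
  apply: nondecreasing_is_cvgn.
    apply: (@nondecreasing_series R (fun k => `|(p \o u) k|) xpredT 0%N) => k _ _.
    exact: normr_ge0.
  exists B => _ [n _ <-]; apply: le_trans (MB n).
  rewrite -(big_mkord xpredT M); apply: ler_sum => k _.
  exact: le_trans (pc _) (uM _).
have [a ha] := real (@complex.Re R) (@Re_le_cn R).
have [b hb] := real (@complex.Im R) (@Im_le_cn R).
exists (Complex a b) => e e0; have e2 : 0 < e / 2 by rewrite divr_gt0.
move/cvgrPdist_lt : ha => /(_ _ e2) [n _ H].
move/cvgrPdist_lt : hb => /(_ _ e2) [n' _ H'].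
exists (maxn n n') => k; rewrite geq_max => /andP[nk nk'].
apply: le_lt_trans (cn_le _) _; rewrite ReB ImB.
have RE : complex.Re (psum u k) = series (@complex.Re R \o u) k.
  rewrite /series /= big_mkord /psum.
  by elim/big_rec2: _ => // i x y _ <-; rewrite ReD.
have IE : complex.Im (psum u k) = series (@complex.Im R \o u) k.
  rewrite /series /= big_mkord /psum.
  by elim/big_rec2: _ => // i x y _ <-; rewrite ImD.
have h1 : `|a - series (@complex.Re R \o u) k| < e / 2 by exact: H.
have h2 : `|b - series (@complex.Im R \o u) k| < e / 2 by exact: H'.
rewrite RE IE /= distrC [X in _ + X]distrC; lra.
Qed.

Lemma summ_le u M B : summ_by u M B -> cn (csum u) <= B.
Proof.
move=> h; apply: ctends_le (summ_cvg h); exists 0%N => n _.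
apply: le_trans (cn_sum _ _ _) _; apply: le_trans (h.2 n).
by apply: ler_sum => k _; exact: h.1.
Qed.

Lemma geom_le (x : R) n : 0 <= x -> x < 1 -> \sum_(k < n) x ^+ k <= (1 - x)^-1.
Proof.
move=> x0 x1; have p : 0 < 1 - x by rewrite subr_gt0.
have h : (\sum_(k < n) x ^+ k) * (1 - x) = 1 - x ^+ n.
  elim: n => [|n IH]; first by rewrite big_ord0 mul0r expr0 subrr.
  by rewrite big_ord_recr /= mulrDl IH exprSr; ring.
by rewrite -[leRHS]mul1r ler_pdivlMr // h gerBl exprn_ge0.
Qed.

End Limits.

Section Taylor.
Variable R : realType.
Implicit Types (f g : R[i] -> R[i]) (z w : R[i]).

Definition holo_on z (r : R) g := forall w, cn (w - z) < r -> cdiff g w.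
Definition holo_at g z := exists2 r : R, 0 < r & holo_on z r g.
Definition near_eq z f g := exists2 r : R, 0 < r & forall w, cn (w - z) < r -> f w = g w.

Lemma near_eq_trans z f g h : near_eq z f g -> near_eq z g h -> near_eq z f h.
Proof.
move=> [r r0 H] [s s0 H']; exists (Num.min r s); first by rewrite lt_min r0.
by move=> w; rewrite lt_min => /andP[/H -> /H' ->].
Qed.

Lemma near_eq_at z f g : near_eq z f g -> f z = g z.
Proof. by move=> [r r0 H]; apply: H; rewrite subrr cn0. Qed.

Lemma cder_unique g z l m : cder g z l -> cder g z m -> l = m.
Proof.
move=> /cderE h /cderE h'.
have := @ccont_unique R (dquo g z l) (dquo g z m) z 1 ltr01 _ h h'.
rewrite /dquo !eqxx; apply=> w wz _.
by rewrite (negbTE wz).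
Qed.

Definition cderiv g z : R[i] := xget 0 [set l | cder g z l].

Lemma cderivE g z l : cder g z l -> cderiv g z = l.
Proof.
move=> h; apply: (cder_unique _ h).
exact: (xgetPex 0 (ex_intro _ l h)).
Qed.

Lemma cderivP g z : cdiff g z -> cder g z (cderiv g z).
Proof. by move=> [l h]; rewrite (cderivE h). Qed.

Definition tquo z g := dquo g z (cderiv g z).
(** The exact n-th Taylor remainder divided by (w - z)^n. Its value at [z] is the n-th Taylor
    coefficient, obtained without higher derivatives or factorials. *)
Definition tayf g z n := iter n (tquo z) g.
Definition tay g z n := tayf g z n z.

Lemma tayfS g z n : tayf g z n.+1 = tayf (tquo z g) z n.
Proof. by rewrite /tayf iterSr. Qed.

Lemma tayS g z n : tay g z n.+1 = tay (tquo z g) z n.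
Proof. by rewrite /tay tayfS. Qed.

Lemma tquoE g z w : g w = g z + tquo z g w * (w - z).
Proof. exact: dquoE. Qed.

Lemma tquo_holo g z (r M : R) : 0 < r -> holo_on z r g ->
  (forall w, cn (w - z) < r -> cn (g w) <= M) ->
  holo_on z r (tquo z g) /\ (forall w, cn (w - z) < r -> cn (tquo z g w) <= M * (48 / r)).
Proof.
move=> r0 gd gM; have gz : cdiff g z by apply: gd; rewrite subrr cn0.
have [h1 h2] := dquo_holo r0 gd gM (cderivP gz); split=> // w /h2.
by rewrite mulrCA mulrA.
Qed.

Lemma holo_at_bound g z : holo_at g z -> exists r M : R,
  [/\ 0 < r, 0 <= M, holo_on z r g & forall w, cn (w - z) < r -> cn (g w) <= M].
Proof.
move=> [r r0 gd]; have gz : ccont g z by apply: cdiff_cont; apply: gd; rewrite subrr cn0.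
have [d d0 H] := gz 1 ltr01.
exists (Num.min r d), (cn (g z) + 1); split.
- by rewrite lt_min r0.
- by rewrite addr_ge0 ?cn_ge0.
- by move=> w; rewrite lt_min => /andP[/gd].
- move=> w; rewrite lt_min => /andP[_ /H]; have := cn_lb (g w) (g z); lra.
Qed.

Lemma holo_at_tquo g z : holo_at g z -> holo_at (tquo z g) z.
Proof.
by move=> /holo_at_bound[r [M [r0 _ gd gM]]]; exists r => //; have [] := tquo_holo r0 gd gM.
Qed.

Lemma holo_at_tayf g z n : holo_at g z -> holo_at (tayf g z n) z.
Proof. by move=> h; elim: n => //= n IH; exact: holo_at_tquo. Qed.

Lemma tayf_bound g z (r M : R) n : 0 < r -> holo_on z r g ->
  (forall w, cn (w - z) < r -> cn (g w) <= M) ->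
  holo_on z r (tayf g z n) /\
  (forall w, cn (w - z) < r -> cn (tayf g z n w) <= M * (48 / r) ^+ n).
Proof.
move=> r0 gd gM; elim: n => [|n [IH1 IH2]]; first by split=> // w; rewrite mulr1; exact: gM.
by have [h1 h2] := tquo_holo r0 IH1 IH2; split=> // w /h2; rewrite -mulrA -exprSr.
Qed.

Lemma tayf_expand g z n w :
  g w = \sum_(k < n) tay g z k * (w - z) ^+ k + tayf g z n w * (w - z) ^+ n.
Proof.
elim: n => [|n IH]; first by rewrite big_ord0 add0r mulr1.
rewrite IH big_ord_recr /= -addrA; congr (_ + _).
by rewrite {1}(tquoE (tayf g z n) z w) mulrDl exprS mulrA.
Qed.

Lemma holo_at_near f g z : near_eq z f g -> holo_at f z -> holo_at g z.
Proof.
move=> [r r0 E] [s s0 fd]; pose m := Num.min r s.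
have m0 : 0 < m by rewrite lt_min r0.
exists m => // w wm; have wm' := wm; move: wm'; rewrite lt_min => /andP[wr ws].
have d0 : 0 < r - cn (w - z) by rewrite subr_gt0.
apply: (cdiff_near d0 _ (fd w ws)) => v hv; apply: E.
by have := cn_trans w v z; lra.
Qed.

Lemma near_eq_tquo f g z : near_eq z f g -> near_eq z (tquo z f) (tquo z g).
Proof.
move=> E; have Ez := near_eq_at E; move: E => [r r0 E]; exists r => // w wr.
have -> : tquo z f = dquo f z (cderiv g z).
  rewrite /tquo; congr dquo; rewrite /cderiv; congr xget; apply/funext => l.
  apply/propext; split; first exact: cder_near r0 E.
  by apply: (cder_near r0) => v /E.
by rewrite /tquo /dquo Ez (E w wr).
Qed.

Lemma near_eq_tayf f g z n : near_eq z f g -> near_eq z (tayf f z n) (tayf g z n).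
Proof. by move=> E; elim: n => //= n IH; exact: near_eq_tquo. Qed.

Lemma near_eq_tay f g z n : near_eq z f g -> tay f z n = tay g z n.
Proof. by move=> E; apply: near_eq_at; exact: near_eq_tayf. Qed.

(* To identify [tquo z g] it suffices to do so off [z], by continuity. *)
Lemma near_tquo g h z (r : R) : 0 < r -> holo_at g z -> ccont h z ->
  (forall w, w != z -> cn (w - z) < r -> g w = g z + h w * (w - z)) ->
  near_eq z (tquo z g) h.
Proof.
move=> r0 gh hc E; exists r => // w wr.
have E' v : v != z -> cn (v - z) < r -> tquo z g v = h v.
  move=> vz vr; have := tquoE g z v; rewrite (E v vz vr).
  by move=> /addrI/(mulIf (_ : v - z != 0)) -> //; rewrite subr_eq0.
case: (eqVneq w z) => [->|wz]; last exact: E'.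
apply: (ccont_unique r0 E') => //.
apply: cdiff_cont; have [s s0 sd] := holo_at_tquo gh.
by apply: sd; rewrite subrr cn0.
Qed.

Lemma holo_at_cont g z : holo_at g z -> ccont g z.
Proof. by move=> [r r0 gd]; apply: cdiff_cont; apply: gd; rewrite subrr cn0. Qed.

Lemma holo_at2 (P : R[i] -> R[i] -> R[i]) f g z :
  (forall w, cdiff f w -> cdiff g w -> cdiff (fun v => P (f v) (g v)) w) ->
  holo_at f z -> holo_at g z -> holo_at (fun w => P (f w) (g w)) z.
Proof.
move=> h [r r0 fd] [s s0 gd]; exists (Num.min r s); first by rewrite lt_min r0.
by move=> w; rewrite lt_min => /andP[/fd fw /gd gw]; exact: h.
Qed.

Lemma holo_atD f g z : holo_at f z -> holo_at g z -> holo_at (fun w => f w + g w) z.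
Proof. by apply: (@holo_at2 (fun a b => a + b)) => w; exact: cdiffD. Qed.
Lemma holo_atB f g z : holo_at f z -> holo_at g z -> holo_at (fun w => f w - g w) z.
Proof. by apply: (@holo_at2 (fun a b => a - b)) => w; exact: cdiffB. Qed.
Lemma holo_atM f g z : holo_at f z -> holo_at g z -> holo_at (fun w => f w * g w) z.
Proof. by apply: (@holo_at2 (fun a b => a * b)) => w; exact: cdiffM. Qed.
Lemma holo_at_cst k z : holo_at (fun=> k) z.
Proof. by exists 1 => // w _; exact: cdiff_cst. Qed.
Lemma holo_at_id z : holo_at id z.
Proof. by exists 1 => // w _; exact: cdiff_id. Qed.
Lemma holo_atX f z n : holo_at f z -> holo_at (fun w => f w ^+ n) z.
Proof. by move=> [r r0 fd]; exists r => // w /fd; exact: cdiffX. Qed.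

Lemma ccont_neq0 g z : ccont g z -> g z != 0 ->
  exists2 r : R, 0 < r & forall w, cn (w - z) < r -> g w != 0.
Proof.
move=> gc g0; have [d d0 H] := gc (cn (g z)) ltac:(by rewrite cn_gt0).
exists d => // w /H; apply: contraTneq => ->.
by rewrite sub0r cnN ltxx.
Qed.

Lemma holo_atV f z : holo_at f z -> f z != 0 -> holo_at (fun w => (f w)^-1) z.
Proof.
move=> fh f0; have [s s0 H] := ccont_neq0 (holo_at_cont fh) f0.
move: fh => [r r0 fd]; exists (Num.min r s); first by rewrite lt_min r0.
by move=> w; rewrite lt_min => /andP[/fd fw /H]; exact: cdiffV.
Qed.

Lemma holo_at_open g z : holo_at g z -> exists2 r : R, 0 < r &
  forall w, cn (w - z) < r -> holo_at g w.
Proof.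
move=> [r r0 gd]; exists r => // w wr; exists (r - cn (w - z)); first by rewrite subr_gt0.
by move=> v hv; apply: gd; have := cn_trans w v z; lra.
Qed.

Lemma holo_at_comp f g z : holo_at f z -> holo_at g (f z) -> holo_at (fun w => g (f w)) z.
Proof.
move=> fh [s s0 gd]; have [d d0 H] := holo_at_cont fh s0.
move: fh => [r r0 fd]; exists (Num.min r d); first by rewrite lt_min r0.
move=> w; rewrite lt_min => /andP[/fd fw /H /gd gw]; exact: cdiff_comp.
Qed.

(** If every Taylor coefficient vanishes, g is its own n-th remainder, which is at most M (48/r)^n
    |w - z|^n and so tends to 0 for |w - z| < r/96. Otherwise the remainder at the first nonzero
    coefficient is the cofactor. *)
Theorem zero_order g z : holo_at g z ->
  (exists2 r : R, 0 < r & forall w, cn (w - z) < r -> g w = 0) \/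
  exists k h, [/\ holo_at h z, h z != 0, forall w, g w = (w - z) ^+ k * h w &
    forall i, (i < k)%N -> tay g z i = 0].
Proof.
move=> gh; have [[k gk]|gall] := pselect (exists k, tay g z k != 0).
  right; have [k' gk' kmin] := ex_minnP (ex_intro (fun k => tay g z k != 0) k gk).
  have low i : (i < k')%N -> tay g z i = 0.
    by move=> ik; apply: contraTeq ik => /kmin; rewrite -leqNgt.
  exists k', (tayf g z k'); split=> //; first exact: holo_at_tayf.
  move=> w; rewrite {1}(tayf_expand g z k' w) big1 ?add0r 1?mulrC // => i _.
  by rewrite low ?mul0r.
left; have [r [M [r0 M0 gd gM]]] := holo_at_bound gh.
exists (r / 96); first by rewrite divr_gt0.
move=> w wr; apply: cn_small => e e0.
have c0 : cn (w - z) * (48 / r) <= 2^-1.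
  by rewrite mulrA ler_pdivrMr //; lra.
have [n Hn] := half_pow_small (divr_gt0 e0 (ltr_wpDl M0 ltr01)).
rewrite (tayf_expand g z n w) big1 ?add0r => [|i _]; last first.
  by case: (eqVneq (tay g z i) 0) => [->|h]; [rewrite mul0r|case: gall; exists i].
rewrite cnM cnX; have [_ /(_ w) hb] := tayf_bound n r0 gd gM.
apply: le_trans (ler_wpM2r _ (hb _)) _; first by rewrite exprn_ge0 ?cn_ge0.
  by move: wr; lra.
rewrite -mulrA -exprMn mulrC [48 / r * _]mulrC.
have h1 : (cn (w - z) * (48 / r)) ^+ n <= (2^-1) ^+ n.
  by rewrite lerXn2r ?nnegrE ?invr_ge0 // mulr_ge0 ?cn_ge0 // divr_ge0 // ltW.
have h2 : (2^-1) ^+ n * (M + 1) < e by rewrite -ltr_pdivlMr // ltr_wpDl.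
apply: le_trans (ltW h2); apply: ler_pM => //; last lra.
by rewrite exprn_ge0 // mulr_ge0 ?cn_ge0 // divr_ge0 // ltW.
Qed.

Theorem taylor_series g z (r M : R) : 0 < r -> holo_on z r g ->
  (forall w, cn (w - z) < r -> cn (g w) <= M) ->
  forall w, cn (w - z) < r / 96 -> ctends (psum (fun k => tay g z k * (w - z) ^+ k)) (g w).
Proof.
move=> r0 gd gM w wr e e0.
have M0 : 0 <= M by apply: le_trans (gM z _); rewrite ?cn_ge0 // subrr cn0.
have c0 : cn (w - z) * (48 / r) <= 2^-1.
  by rewrite mulrA ler_pdivrMr //; lra.
have [n Hn] := half_pow_small (divr_gt0 e0 (ltr_wpDl M0 ltr01)).
exists n => k nk; rewrite cnBC {1}(tayf_expand g z k w) addrC addKr.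
rewrite cnM cnX; have [_ /(_ w) hb] := tayf_bound k r0 gd gM.
apply: le_lt_trans (ler_wpM2r _ (hb _)) _; first by rewrite exprn_ge0 ?cn_ge0.
  by move: wr; lra.
rewrite -mulrA -exprMn mulrC [48 / r * _]mulrC.
have h1 : (cn (w - z) * (48 / r)) ^+ k <= (2^-1) ^+ n.
  apply: le_trans (_ : (2^-1) ^+ k <= _).
    by rewrite lerXn2r ?nnegrE ?invr_ge0 // mulr_ge0 ?cn_ge0 // divr_ge0 // ltW.
  by apply: ler_wiXn2l => //; lra.
have h2 : (2^-1) ^+ n * (M + 1) < e by rewrite -ltr_pdivlMr // ltr_wpDl.
apply: le_lt_trans h2; apply: ler_pM => //; last lra.
by rewrite exprn_ge0 // mulr_ge0 ?cn_ge0 // divr_ge0 // ltW.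
Qed.

Lemma quadratic_estimate g z (r M : R) : 0 < r -> holo_on z r g ->
  (forall w, cn (w - z) < r -> cn (g w) <= M) -> forall w, cn (w - z) < r ->
  cn (g w - g z - cderiv g z * (w - z)) <= M * (48 / r) ^+ 2 * cn (w - z) ^+ 2.
Proof.
move=> r0 gd gM w wr; have [_ /(_ w wr) hb] := tayf_bound 2 r0 gd gM.
have := tayf_expand g z 2 w; rewrite !big_ord_recl big_ord0 /= addr0 mulr1 expr1.
rewrite {1}/tay /= (_ : tay g z 1 = cderiv g z); last by rewrite /tay /= /tquo /dquo eqxx.
move=> E; have -> : g w - g z - cderiv g z * (w - z) = tayf g z 2 w * (w - z) ^+ 2.
  by rewrite -[tayf g z 2 w]/(tquo z (tquo z g) w) {1}E; ring.
by rewrite cnM cnX ler_wpM2r // exprn_ge0 // cn_ge0.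
Qed.

(** If g is not constant, write g w = g z + (w - z)^k u w with u z <> 0. Along the direction of a
    k-th root of g z / u z the increment is nearly a positive multiple of g z, so the modulus
    grows. *)
Theorem max_modulus g z (r : R) : 0 < r -> holo_at g z ->
  (forall w, cn (w - z) < r -> cn (g w) <= cn (g z)) ->
  exists2 s : R, 0 < s & forall w, cn (w - z) < s -> g w = g z.
Proof.
move=> r0 gh gmax; have [g0|g0] := eqVneq (g z) 0.
  exists r => // w /gmax; rewrite g0 cn0 => h.
  by apply/eqP; rewrite -cn_eq0 eq_le h cn_ge0.
have := @zero_order (fun w => g w - g z) z.
case; first by apply: holo_atB => //; exact: holo_at_cst.
  by move=> [s s0 H]; exists s => // w /H /eqP; rewrite subr_eq0 => /eqP.
move=> [k [u [uh u0 E _]]].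
have k0 : (0 < k)%N.
  rewrite lt0n; apply/eqP => k0; move: (E z); rewrite subrr k0 expr0 mul1r => /esym/eqP.
  by rewrite (negbTE u0).
pose a : R[i] := k.-root (g z / u z)%R.
have ak : a ^+ k = g z / u z by rewrite rootCK.
have a0 : a != 0.
  apply/eqP => a0; move: ak; rewrite a0 expr0n gtn_eqF // => /esym/eqP.
  by rewrite mulf_eq0 invr_eq0 (negbTE g0) (negbTE u0).
have u2 : 0 < cn (u z) / 2 by rewrite divr_gt0 // cn_gt0.
have [d d0 Hd] := holo_at_cont uh u2.
pose s := Num.min (Num.min r d) 1 / 2.
have s0 : 0 < s by rewrite divr_gt0 // !lt_min r0 d0 ltr01.
pose t := s / (cn a + 1).
have ca : 0 < cn a + 1 by rewrite ltr_wpDl ?cn_ge0.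
have t0 : 0 < t by rewrite divr_gt0.
pose w := z + t%:C * a.
have wz : cn (w - z) < s.
  rewrite /w addrC addKr cnM cnR gtr0_norm // /t mulrAC ltr_pdivrMr // ltr_pM2l //.
  by rewrite ltrDl.
have [sr sd] : s < r /\ s < d.
  have : Num.min (Num.min r d) 1 <= Num.min (Num.min r d) 1 by [].
  by rewrite {2}/Num.min !le_min => /andP[/andP[? ?] ?]; rewrite /s; split; lra.
have := gmax w (lt_trans wz sr).
have gw : g w = g z * (1 + (t ^+ k)%:C * (u w / u z)).
  have wzE : w - z = t%:C * a by rewrite /w addrC addKr.
  have := E w; rewrite wzE exprMn ak -rmorphXn => h.
  by rewrite -[g w](subrK (g z)) h; field; rewrite u0.
rewrite gw cnM -[leRHS]mulr1 ler_pM2l ?cn_gt0 //.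
have q : cn (u w / u z - 1) <= 2^-1.
  have -> : u w / u z - 1 = (u w - u z) / u z by field.
  rewrite cnM cnV ler_pdivrMr ?cn_gt0 // ltW // mulrC.
  by apply: Hd; apply: lt_trans wz sd.
have q' : 2^-1 <= complex.Re (u w / u z).
  have := Re_le_cn (u w / u z - 1); rewrite ReB ler_norml /= => h.
  lra.
have tk : 0 < t ^+ k by rewrite exprn_gt0.
have := le_trans (ler_norm _) (Re_le_cn (1 + (t ^+ k)%:C * (u w / u z))).
have -> : complex.Re (1 + (t ^+ k)%:C * (u w / u z)) = 1 + t ^+ k * complex.Re (u w / u z).
  by case: (u w / u z) => p q'' /=; rewrite mul0r subr0.
have : t ^+ k / 2 <= t ^+ k * complex.Re (u w / u z) by rewrite ler_pM2l.
lra.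
Qed.

End Taylor.

(** * Termwise differentiation of dominated series *)

Section MTest.
Variable R : realType.
Implicit Types (z w : R[i]).

(** The bounds on the second remainders of the terms are proportional to [M k], so they sum to a
    quadratic remainder for the whole series. *)
Lemma mtest_der (f : nat -> R[i] -> R[i]) z (r : R) (M : nat -> R) (B : R) : 0 < r ->
  (forall k, holo_on z r (f k)) -> (forall k w, cn (w - z) < r -> cn (f k w) <= M k) ->
  (forall n, \sum_(k < n) M k <= B) ->
  cder (fun w => csum (fun k => f k w)) z (csum (fun k => cderiv (f k) z)).
Proof.
move=> r0 fd fM MB; have z0 : cn (z - z) < r by rewrite subrr cn0.
have B0 : 0 <= B by have := MB 0%N; rewrite big_ord0.
have r48 : 0 <= 48 / r by rewrite divr_ge0 // ltW.
have sf w : cn (w - z) < r -> ctends (psum (fun k => f k w)) (csum (fun k => f k w)).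
  by move=> wr; apply: (@summ_cvg _ _ M B); split=> // k; exact: fM.
have sd : ctends (psum (fun k => cderiv (f k) z)) (csum (fun k => cderiv (f k) z)).
  apply: (@summ_cvg _ _ (fun k => M k * (48 / r)) (B * (48 / r))); split.
    move=> k; have [_ /(_ z z0)] := tquo_holo r0 (fd k) (fM k).
    by rewrite /tquo /dquo eqxx.
  by move=> n; rewrite -mulr_suml ler_wpM2r.
set F := fun w => csum _; set L := csum _ in sd *.
have est w : cn (w - z) < r -> cn (F w - F z - L * (w - z)) <= B * (48 / r) ^+ 2 * cn (w - z) ^+ 2.
  move=> wr; have h := ctendsB (ctendsB (sf w wr) (sf z z0)) (ctendsZ (w - z) sd).
  rewrite [L * _]mulrC; apply: ctends_le h; exists 0%N => n _.
  rewrite -psumZ -!psumB; apply: le_trans (cn_sum _ _ _) _.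
  rewrite -mulrA; apply: le_trans (ler_wpM2r _ (MB n)); last first.
    by rewrite mulr_ge0 // exprn_ge0 // cn_ge0.
  rewrite mulr_suml; apply: ler_sum => k _; rewrite [(w - z) * _]mulrC mulrA.
  exact: quadratic_estimate (fd k) (fM k) _ wr.
apply/cderE => e e0; pose K := B * (48 / r) ^+ 2 + 1.
have K0 : 0 < K by rewrite ltr_wpDl // mulr_ge0 // exprn_ge0.
exists (Num.min r (e / K)); first by rewrite lt_min r0 divr_gt0.
move=> w; rewrite lt_min => /andP[wr we]; rewrite /dquo eqxx.
case: eqVneq => [_|wz]; first by rewrite subrr cn0.
have wz0 : 0 < cn (w - z) by rewrite cn_gt0 subr_eq0.
have -> : (F w - F z) / (w - z) - L = (F w - F z - L * (w - z)) / (w - z).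
  by field; rewrite subr_eq0.
rewrite cnM cnV ltr_pdivrMr //; apply: le_lt_trans (est w wr) _.
rewrite [cn _ ^+ 2]expr2 mulrA ltr_pM2r //.
apply: le_lt_trans (_ : cn (w - z) * K < e); last by rewrite -ltr_pdivlMr.
by rewrite mulrC ler_wpM2l ?cn_ge0 // /K; lra.
Qed.

Lemma mtest_holo (f : nat -> R[i] -> R[i]) z (r : R) (M : nat -> R) (B : R) : 0 < r ->
  (forall k, holo_on z r (f k)) -> (forall k w, cn (w - z) < r -> cn (f k w) <= M k) ->
  (forall n, \sum_(k < n) M k <= B) ->
  forall w, cn (w - z) < r -> cder (fun w => csum (fun k => f k w)) w (csum (fun k => cderiv (f k) w)).
Proof.
move=> r0 fd fM MB w wr; have s0 : 0 < r - cn (w - z) by rewrite subr_gt0.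
have in_r v : cn (v - w) < r - cn (w - z) -> cn (v - z) < r.
  by move=> hv; have := cn_trans w v z; lra.
by apply: (mtest_der s0 _ _ MB) => k v /in_r; [exact: fd|exact: fM].
Qed.

End MTest.

(** * Local theory of meromorphic functions *)

Section Meromorphic.
Variable R : realType.
Implicit Types (f g : R[i] -> R[i]) (z w tau : R[i]).

Definition pnear z (P : R[i] -> Prop) :=
  exists2 r : R, 0 < r & forall w, w != z -> cn (w - z) < r -> P w.

Lemma pnearI z (P Q : R[i] -> Prop) : pnear z P -> pnear z Q -> pnear z (fun w => P w /\ Q w).
Proof.
move=> [r r0 H] [s s0 H']; exists (Num.min r s); first by rewrite lt_min r0.
by move=> w wz; rewrite lt_min => /andP[/(H w wz) ? /(H' w wz) ?].
Qed.

Lemma pnear_imp z (P Q : R[i] -> Prop) : (forall w, P w -> Q w) -> pnear z P -> pnear z Q.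
Proof. by move=> PQ [r r0 H]; exists r => // w wz wr; apply: PQ; exact: H. Qed.

Lemma pnear_all z (P : R[i] -> Prop) : (forall w, P w) -> pnear z P.
Proof. by move=> h; exists 1. Qed.

Lemma pnear_ex z (P : R[i] -> Prop) : pnear z P -> forall e : R, 0 < e ->
  exists w, [/\ w != z, cn (w - z) < e & P w].
Proof.
move=> [r r0 H] e e0; pose s := Num.min r e / 2.
have s0 : 0 < s by rewrite divr_gt0 // lt_min r0.
have [sr sd] : s < r /\ s < e.
  have : Num.min r e <= Num.min r e by [].
  by rewrite {2}/Num.min !le_min => /andP[? ?]; rewrite /s; split; lra.
have cs : cn ((z + s%:C) - z) = s by rewrite addrC addKr cnR gtr0_norm.
have zs : z + s%:C != z by rewrite -subr_eq0 -cn_eq0 cs gt_eqF.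
by exists (z + s%:C); rewrite cs; split=> //; apply: H; rewrite ?cs.
Qed.

Lemma pnear_open z (P : R[i] -> Prop) : pnear z P -> pnear z (fun w => pnear w P).
Proof.
move=> [r r0 H]; exists r => // w wz wr.
have d0 : 0 < Num.min (r - cn (w - z)) (cn (w - z)).
  by rewrite lt_min subr_gt0 wr cn_gt0 subr_eq0.
exists (Num.min (r - cn (w - z)) (cn (w - z))) => // v vw; rewrite lt_min => /andP[v1 v2].
apply: H; last by have := cn_trans w v z; lra.
by apply: contraTneq v2 => ->; rewrite cnBC ltxx.
Qed.

Lemma pnear_ball z (P : R[i] -> Prop) (r : R) : 0 < r ->
  (forall w, cn (w - z) < r -> P w) -> pnear z P.
Proof. by move=> r0 H; exists r => // w _; exact: H. Qed.

Definition mero f z := exists k g, holo_at g z /\ pnear z (fun w => f w = g w / (w - z) ^+ k).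

Lemma meromorphic_atP f z : meromorphic_at f z <-> mero f z.
Proof.
split=> [[k [g [/near_cnP[r r0 gd] /dnear_cnP[s s0 H]]]]|[k [g [[r r0 gd] [s s0 H]]]]].
  exists k, g; split; last by exists s.
  by exists r => // w /gd /derivable_cdiffP.
exists k, g; split; last by apply/dnear_cnP; exists s.
by apply/near_cnP; exists r => // w /gd /derivable_cdiffP.
Qed.

Lemma mero_pnear f g z : pnear z (fun w => f w = g w) -> mero f z -> mero g z.
Proof.
move=> E [k [h [hh H]]]; exists k, h; split=> //.
by apply: pnear_imp (pnearI E H) => w [-> ->].
Qed.

Lemma holo_mero f z : holo_at f z -> mero f z.
Proof.
by move=> fh; exists 0%N, f; split=> //; apply: pnear_all => w; rewrite expr0 divr1.
Qed.

Lemma mero_cst k z : mero (fun=> k) z.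
Proof. by apply: holo_mero; exact: holo_at_cst. Qed.

Lemma holo_at_sub z : holo_at (fun w => w - z) z.
Proof. by apply: holo_atB; [exact: holo_at_id|exact: holo_at_cst]. Qed.

Lemma mero_normal f z : mero f z -> pnear z (fun w => f w = 0) \/
  exists n m u, [/\ holo_at u z, u z != 0 & pnear z (fun w => f w = u w * (w - z) ^+ n / (w - z) ^+ m)].
Proof.
move=> [k [g [gh H]]]; have [[r r0 g0]|[n [u [uh u0 E _]]]] := zero_order gh.
  left; apply: pnear_imp (pnearI H (pnear_ball r0 g0)) => w [-> ->].
  by rewrite mul0r.
by right; exists n, k, u; split=> //; apply: pnear_imp H => w ->; rewrite E [_ * u w]mulrC.
Qed.

Lemma mero_dich f z : mero f z -> pnear z (fun w => f w = 0) \/ pnear z (fun w => f w != 0).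
Proof.
move=> /mero_normal[|[n [m [u [uh u0 H]]]]]; first by left.
right; have [r r0 ur] := ccont_neq0 (holo_at_cont uh) u0.
have [s s0 Hs] := pnearI H (pnear_ball r0 ur).
exists s => // w wz /(Hs w wz)[-> uw].
by rewrite !mulf_neq0 ?invr_eq0 // expf_neq0 // subr_eq0.
Qed.

Lemma mero2 (P : R[i] -> R[i] -> R[i]) f g z :
  (forall k l u v, holo_at u z -> holo_at v z ->
     exists h, holo_at h z /\ forall w, w != z -> P (u w / (w - z) ^+ k) (v w / (w - z) ^+ l) =
        h w / (w - z) ^+ (k + l)) ->
  mero f z -> mero g z -> mero (fun w => P (f w) (g w)) z.
Proof.
move=> h [k [u [uh [r r0 Hu]]]] [l [v [vh [s s0 Hv]]]].
have [q [qh E]] := h k l u v uh vh; exists (k + l)%N, q; split=> //.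
exists (Num.min r s); first by rewrite lt_min r0.
by move=> w wz; rewrite lt_min => /andP[/(Hu w wz) -> /(Hv w wz) ->]; exact: E.
Qed.

Lemma meroB f g z : mero f z -> mero g z -> mero (fun w => f w - g w) z.
Proof.
apply: (@mero2 (fun a b => a - b)) => k l u v uh vh.
exists (fun w => u w * (w - z) ^+ l - v w * (w - z) ^+ k); split.
  by apply: holo_atB; apply: holo_atM => //; apply: holo_atX; exact: holo_at_sub.
move=> w wz; have wz0 : w - z != 0 by rewrite subr_eq0.
by rewrite exprD; field; rewrite !expf_neq0.
Qed.

Lemma meroM f g z : mero f z -> mero g z -> mero (fun w => f w * g w) z.
Proof.
apply: (@mero2 (fun a b => a * b)) => k l u v uh vh.
exists (fun w => u w * v w); split; first exact: holo_atM.
by move=> w wz; rewrite exprD invfM mulrACA.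
Qed.

Lemma meroV f z : mero f z -> mero (fun w => (f w)^-1) z.
Proof.
move=> /mero_normal[H|[n [m [u [uh u0 H]]]]].
  apply: mero_pnear (mero_cst 0 z); apply: pnear_imp H => w ->.
  by rewrite invr0.
exists n, (fun w => (u w)^-1 * (w - z) ^+ m); split.
  apply: holo_atM; first exact: holo_atV.
  by apply: holo_atX; exact: holo_at_sub.
by apply: pnear_imp H => w ->; rewrite !invfM invrK [RHS]mulrAC.
Qed.

Lemma mero_div f g z : mero f z -> mero g z -> mero (fun w => f w / g w) z.
Proof. by move=> fm gm; apply: meroM => //; exact: meroV. Qed.

Lemma meroD f g z : mero f z -> mero g z -> mero (fun w => f w + g w) z.
Proof.
move=> fm gm; have := meroB fm (meroB (mero_cst 0 z) gm).
by apply: mero_pnear; apply: pnear_all => w; rewrite sub0r opprK.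
Qed.

Lemma mero_sum (I : Type) (s : seq I) (P : pred I) (F : I -> R[i] -> R[i]) z :
  (forall i, P i -> mero (F i) z) -> mero (fun w => \sum_(i <- s | P i) F i w) z.
Proof.
move=> h; elim: s => [|i s IH].
  by apply: mero_pnear (mero_cst 0 z); apply: pnear_all => w; rewrite big_nil.
case: (boolP (P i)) => Pi.
  by apply: mero_pnear (meroD (h i Pi) IH); apply: pnear_all => w; rewrite big_cons Pi.
by apply: mero_pnear IH; apply: pnear_all => w; rewrite big_cons (negbTE Pi).
Qed.

End Meromorphic.

(** * Meromorphic functions on the upper half plane *)

Section HalfPlane.
Variable R : realType.
Implicit Types (f g : R[i] -> R[i]) (z w tau : R[i]).

Definition Hp tau := 0 < complex.Im tau.

Lemma Hp_open tau : Hp tau -> exists2 r : R, 0 < r & forall w, cn (w - tau) < r -> Hp w.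
Proof.
move=> ht; exists (complex.Im tau) => // w hw.
have := le_lt_trans (Im_le_cn _) hw; rewrite ImB ltr_norml /Hp; lra.
Qed.

(** By [mero_dich] both the set of points near which f vanishes and its complement are open.
    [box_ind] shows that a rectangle containing both points lies in one of them: adjacent quarters
    share a corner, so they are of the same kind. *)
Theorem mero_identity f : (forall tau, Hp tau -> mero f tau) ->
  forall t0, Hp t0 -> pnear t0 (fun w => f w = 0) ->
  forall t1, Hp t1 -> pnear t1 (fun w => f w = 0).
Proof.
move=> fm t0 h0 z0 t1 h1; pose Z t := pnear t (fun w => f w = 0).
pose xm := Num.min (complex.Re t0) (complex.Re t1).
pose ym := Num.min (complex.Im t0) (complex.Im t1).
pose L := `|complex.Re t0 - complex.Re t1| + 1.
pose H := `|complex.Im t0 - complex.Im t1| + 1.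
have L0 : 0 < L by rewrite ltr_wpDl.
have H0 : 0 < H by rewrite ltr_wpDl.
have ym0 : 0 < ym by rewrite lt_min; apply/andP; split; [exact: h0|exact: h1].
pose P x y s := (forall a b, x <= a <= x + L * s -> y <= b <= y + H * s -> Z (Complex a b)) \/
  (forall a b, x <= a <= x + L * s -> y <= b <= y + H * s -> ~ Z (Complex a b)).
have : P xm ym 1.
  apply: (box_ind L0 H0).
    move=> x y s s0; rewrite /P; set u := L * (s / 2); set v := H * (s / 2).
    have Lu : L * s = u + u by rewrite /u; field.
    have Hv : H * s = v + v by rewrite /v; field.
    have s2 : 0 <= s / 2 by rewrite divr_ge0 // ltW.
    have u0 : 0 <= u by rewrite mulr_ge0 // ltW.
    have v0 : 0 <= v by rewrite mulr_ge0 // ltW.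
    rewrite Lu Hv => p1 p2 p3 p4 _ _ _ _.
    have c1 : x <= x + u <= x + u by rewrite lexx lerDl u0.
    have c2 : x + u <= x + u <= x + u + u by rewrite lexx lerDl u0.
    have d1 : y <= y + v <= y + v by rewrite lexx lerDl v0.
    have d2 : y + v <= y + v <= y + v + v by rewrite lexx lerDl v0.
    have cover (Q : R -> R -> Prop) :
      (forall a b, x <= a <= x + u -> y <= b <= y + v -> Q a b) ->
      (forall a b, x + u <= a <= x + u + u -> y <= b <= y + v -> Q a b) ->
      (forall a b, x <= a <= x + u -> y + v <= b <= y + v + v -> Q a b) ->
      (forall a b, x + u <= a <= x + u + u -> y + v <= b <= y + v + v -> Q a b) ->
      forall a b, x <= a <= x + (u + u) -> y <= b <= y + (v + v) -> Q a b.
      move=> q1 q2 q3 q4 a b; rewrite !addrA => /andP[a1 a2] /andP[b1 b2].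
      have [au|au] := leP a (x + u); have [bv|bv] := leP b (y + v).
      - by apply: q1; apply/andP.
      - by apply: q3; apply/andP; split=> //; exact: ltW.
      - by apply: q2; apply/andP; split=> //; exact: ltW.
      - by apply: q4; apply/andP; split=> //; exact: ltW.
    case: p1 => q1; [left|right]; apply: cover => //.
    - by case: p2 => // q2; case: (q2 _ _ c2 d1); exact: q1.
    - by case: p3 => // q2; case: (q2 _ _ c1 d2); exact: q1.
    - by case: p4 => // q2; case: (q2 _ _ c2 d2); exact: q1.
    - by case: p2 => // q2; case: (q1 _ _ c1 d1); exact: q2.
    - by case: p3 => // q2; case: (q1 _ _ c1 d1); exact: q2.
    - by case: p4 => // q2; case: (q1 _ _ c1 d1); exact: q2.
  move=> p q hp /andP[hq _].
  have hpq : Hp (Complex p q) by rewrite /Hp /=; apply: lt_le_trans hq.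
  have loc (Q : R[i] -> Prop) : Q (Complex p q) -> pnear (Complex p q) Q ->
    exists2 d, 0 < d & forall x y s : R, 0 < s < d -> x <= p <= x + L * s ->
      y <= q <= y + H * s -> forall a b, x <= a <= x + L * s -> y <= b <= y + H * s -> Q (Complex a b).
    move=> Q0 [r r0 Hr]; exists (r / (L + H)); first by rewrite divr_gt0 // addr_gt0.
    move=> x y s /andP[s0 sr] hx hy a b ha hb.
    case: (eqVneq (Complex a b) (Complex p q)) => [-> //|ne]; apply: Hr => //.
    have Ls : 0 <= L * s by rewrite mulr_ge0 // ltW.
    have Hs : 0 <= H * s by rewrite mulr_ge0 // ltW.
    apply: le_lt_trans (@cn_Complex_rect R x (x + L * s) y (y + H * s) _ _ a b p q ha hb hx hy) _.
    - by rewrite lerDl.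
    - by rewrite lerDl.
    have -> : x + L * s - x + (y + H * s - y) = s * (L + H) by ring.
    by rewrite -ltr_pdivlMr // addr_gt0.
  case: (mero_dich (fm _ hpq)) => zz.
    have [d d0 Hd] := loc Z zz (pnear_open zz); exists d => // x y s sd hx hy _ _ _ _.
    by left; exact: Hd.
  have nz w : pnear w (fun v => f v != 0) -> ~ Z w.
    move=> h h'; have [v [_ _ [/eqP v0 v1]]] := pnear_ex (pnearI h h') ltr01.
    exact: v0.
  have [d d0 Hd] := loc (fun w => ~ Z w) (nz _ zz) (pnear_imp nz (pnear_open zz)).
  by exists d => // x y s sd hx hy _ _ _ _; right; exact: Hd.
have inx t : t = t0 \/ t = t1 -> xm <= complex.Re t <= xm + L * 1 /\ ym <= complex.Im t <= ym + H * 1.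
  rewrite !mulr1 /xm /ym /L /H => -[] ->; rewrite !ge_min !lexx ?orbT /= !addrA !minElt; split.
  - by case: ltP => _; have := ler_norm (complex.Re t0 - complex.Re t1); have := normr_ge0 (complex.Re t0 - complex.Re t1); lra.
  - by case: ltP => _; have := ler_norm (complex.Im t0 - complex.Im t1); have := normr_ge0 (complex.Im t0 - complex.Im t1); lra.
  - by case: ltP => _; rewrite distrC; have := ler_norm (complex.Re t1 - complex.Re t0); have := normr_ge0 (complex.Re t1 - complex.Re t0); lra.
  - by case: ltP => _; rewrite distrC; have := ler_norm (complex.Im t1 - complex.Im t0); have := normr_ge0 (complex.Im t1 - complex.Im t0); lra.
have eta (t : R[i]) : t = Complex (complex.Re t) (complex.Im t) by case: t.
have [i0x i0y] := inx t0 (or_introl erefl); have [i1x i1y] := inx t1 (or_intror erefl).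
case=> HZ; first by rewrite (eta t1); exact: HZ.
by case: (HZ _ _ i0x i0y); rewrite -(eta t0).
Qed.

Lemma mero_eqP f g : mero_eq f g <-> forall tau, Hp tau -> pnear tau (fun w => f w = g w).
Proof.
split=> h tau ht; first by have /dnear_cnP := h tau ht.
by apply/dnear_cnP; exact: h.
Qed.

Lemma mero_nonzero f : (forall tau, Hp tau -> mero f tau) ->
  (exists2 t0, Hp t0 & ~ pnear t0 (fun w => f w = 0)) ->
  forall tau, Hp tau -> pnear tau (fun w => f w != 0).
Proof.
move=> fm [t0 h0 nz] tau ht; case: (mero_dich (fm tau ht)) => // z0.
by case: nz; exact: mero_identity z0 _ h0.
Qed.

End HalfPlane.

(** * The action of the modular group *)

Section ModularGroup.
Variable R : realType.
Implicit Types (f : R[i] -> R[i]) (z w tau : R[i]) (g h : 'M[int]_2).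

Lemma det2 (A : comPzRingType) (M : 'M[A]_2) : \det M = M 0 0 * M 1 1 - M 0 1 * M 1 0.
Proof.
rewrite (expand_det_row _ 0) !big_ord_recl big_ord0 /cofactor !det_mx11 !mxE /= addr0.
rewrite expr0 mul1r expr1 mulN1r mulrN; congr (_ * _ - _ * _); congr (M _ _); exact: val_inj.
Qed.

Lemma SL2Z_det g : SL2Z g -> g 0 0 * g 1 1 - g 0 1 * g 1 0 = 1.
Proof. by rewrite -det2. Qed.

Lemma SL2Z1 : SL2Z (1%:M : 'M[int]_2). Proof. exact: det1. Qed.
Lemma SL2ZM g h : SL2Z g -> SL2Z h -> SL2Z (g *m h).
Proof. by rewrite /SL2Z /= det_mulmx => -> ->; rewrite mulr1. Qed.
Lemma SL2ZV g : SL2Z g -> SL2Z (\adj g) /\ g *m \adj g = 1%:M /\ \adj g *m g = 1%:M.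
Proof.
move=> hg; have e1 := mul_mx_adj g; have e2 := mul_adj_mx g.
rewrite [\det g]hg in e1 e2; split=> //.
have := det_mulmx g (\adj g); rewrite e1 det1 [\det g]hg mul1r.
exact: esym.
Qed.

Definition mx22 (a b c d : int) : 'M[int]_2 :=
  \matrix_(i, j) if i == 0 then (if j == 0 then a else b) else (if j == 0 then c else d).

Lemma mx22_SL2Z a b c d : a * d - b * c = 1 -> SL2Z (mx22 a b c d).
Proof. by move=> h; rewrite /SL2Z /= det2 !mxE. Qed.

Lemma intC (n : int) : (n%:~R : R[i]) = (n%:~R)%:C.
Proof. by rewrite rmorph_int. Qed.

Definition mden g tau : R[i] := (g 1 0)%:~R * tau + (g 1 1)%:~R.

Lemma Im_intD (c d : int) tau : complex.Im (c%:~R * tau + d%:~R) = c%:~R * complex.Im tau.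
Proof. by rewrite !intC; case: tau => x y /=; rewrite mul0r !addr0. Qed.

Lemma mden_neq0 g tau : SL2Z g -> Hp tau -> mden g tau != 0.
Proof.
move=> hg ht; apply/eqP => E.
have /esym/eqP := congr1 (@complex.Im R) E; rewrite Im_intD eq_sym mulf_eq0 (gt_eqF ht) orbF intr_eq0.
move=> /eqP c0; move: E; rewrite /mden c0 mul0r add0r => /eqP; rewrite intr_eq0 => /eqP d0.
by have := SL2Z_det hg; rewrite c0 d0 !mulr0 subrr => /eqP.
Qed.

Lemma Im_div z w : complex.Im (z / w) =
  (complex.Im z * complex.Re w - complex.Re z * complex.Im w) / cn w ^+ 2.
Proof. by rewrite cn_sqr; case: z => p q; case: w => u v /=; ring. Qed.

Lemma Im_moebius g tau : SL2Z g ->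
  complex.Im (moebius g tau) = complex.Im tau / cn (mden g tau) ^+ 2.
Proof.
move=> hg; rewrite /moebius Im_div -/(mden g tau); congr (_ / _).
have /(congr1 (fun n : int => n%:~R : R)) := SL2Z_det hg.
rewrite rmorphB /= !rmorphM /= => D.
rewrite /mden !intC; case: tau => x y /=; rewrite !mul0r !subr0 !addr0.
have {}D : (_ : R) = 1 := D.
rewrite -[RHS]mulr1 -[X in _ = _ * X]D; ring.
Qed.

Lemma Hp_moebius g tau : SL2Z g -> Hp tau -> Hp (moebius g tau).
Proof.
move=> hg ht; rewrite /Hp Im_moebius // divr_gt0 // exprn_gt0 // cn_gt0.
exact: mden_neq0.
Qed.

Lemma moebius1 tau : moebius 1%:M tau = tau.
Proof. by rewrite /moebius !mxE /= mul0r mul1r add0r addr0 divr1. Qed.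

Lemma mulmx2E (g h : 'M[int]_2) i j : (g *m h) i j = g i 0 * h 0 j + g i 1 * h 1 j.
Proof.
rewrite mxE !big_ord_recl big_ord0 addr0; congr (_ * _ + _ * _); congr (_ _ _); exact: val_inj.
Qed.

Lemma mden_mul g h tau : SL2Z g -> SL2Z h -> Hp tau ->
  mden (g *m h) tau = mden g (moebius h tau) * mden h tau.
Proof.
move=> hg hh ht; have := mden_neq0 hh ht; rewrite /mden /moebius !mulmx2E -/(mden h tau).
rewrite !rmorphD /= !rmorphM /= => n0; rewrite /mden in n0 *.
by field.
Qed.

Lemma moebiusM g h tau : SL2Z g -> SL2Z h -> Hp tau ->
  moebius (g *m h) tau = moebius g (moebius h tau).
Proof.
move=> hg hh ht; have n0 := mden_neq0 hh ht.
have n1 := mden_neq0 (SL2ZM hg hh) ht.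
have n2 := mden_neq0 hg (Hp_moebius hh ht).
rewrite {1}/moebius -/(mden (g *m h) tau) {1}/moebius -/(mden g (moebius h tau)).
rewrite mden_mul // !mulmx2E !rmorphD /= !rmorphM /=.
rewrite {2}/moebius -/(mden h tau).
apply/eqP; rewrite eqr_div ?mulf_neq0 //; apply/eqP.
rewrite (_ : (g 0 0)%:~R * (((h 0 0)%:~R * tau + (h 0 1)%:~R) / mden h tau) + (g 0 1)%:~R =
  ((g 0 0)%:~R * ((h 0 0)%:~R * tau + (h 0 1)%:~R) + (g 0 1)%:~R * mden h tau) / mden h tau); last by field.
rewrite mulrCA mulrC -!mulrA; congr (_ * _).
rewrite mulVf // mulr1 /mden; ring.
Qed.

(** The numerator collapses because the determinant is 1. This gives injectivity on punctured
    neighbourhoods and the transport of poles by [moebius g]. *)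
Lemma moebiusB g z w : SL2Z g -> Hp z -> Hp w ->
  moebius g w - moebius g z = (w - z) / (mden g w * mden g z).
Proof.
move=> hg hz hw; have nz := mden_neq0 hg hz; have nw := mden_neq0 hg hw.
have /(congr1 (fun n : int => n%:~R : R[i])) := SL2Z_det hg.
rewrite rmorphB /= !rmorphM /= => D.
have {}D : (_ : R[i]) = 1 := D.
rewrite /moebius -!/(mden g _) -mulNr addf_div //; congr (_ / _).
rewrite -[RHS]mul1r -[1 in RHS]D /mden; ring.
Qed.

Lemma mden_cdiff g w : cdiff (mden g) w.
Proof.
apply: cdiffD; last exact: cdiff_cst.
by apply: cdiffM; [exact: cdiff_cst|exact: cdiff_id].
Qed.

Lemma moebius_cdiff g w : SL2Z g -> Hp w -> cdiff (moebius g) w.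
Proof.
move=> hg hw; apply: cdiffM; last first.
  by apply: cdiffV; [exact: mden_cdiff|exact: mden_neq0].
apply: cdiffD; last exact: cdiff_cst.
by apply: cdiffM; [exact: cdiff_cst|exact: cdiff_id].
Qed.

Lemma moebius_holo g w : SL2Z g -> Hp w -> holo_at (moebius g) w.
Proof.
move=> hg /Hp_open[r r0 H]; exists r => // v /H; exact: moebius_cdiff.
Qed.

Lemma pnear_moebius g z (P : R[i] -> Prop) : SL2Z g -> Hp z ->
  pnear (moebius g z) P -> pnear z (fun w => P (moebius g w)).
Proof.
move=> hg hz [r r0 H]; have [d d0 Hd] := cdiff_cont (moebius_cdiff hg hz) r0.
have [s s0 Hs] := Hp_open hz; exists (Num.min d s); first by rewrite lt_min d0.
move=> w wz; rewrite lt_min => /andP[/Hd wd /Hs ws]; apply: H => //.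
rewrite -subr_eq0 moebiusB // mulf_neq0 ?subr_eq0 // invr_eq0 mulf_neq0 //;
  exact: mden_neq0.
Qed.

Lemma mero_moebius g f z : SL2Z g -> Hp z -> mero f (moebius g z) ->
  mero (fun w => f (moebius g w)) z.
Proof.
move=> hg hz [k [u [uh H]]].
exists k, (fun w => u (moebius g w) * (mden g w * mden g z) ^+ k); split.
  apply: holo_atM; first by apply: holo_at_comp uh; exact: moebius_holo.
  apply: holo_atX; apply: holo_atM; last exact: holo_at_cst.
  by exists 1 => // w _; exact: mden_cdiff.
have [s s0 Hs] := Hp_open hz.
apply: pnear_imp (pnearI (pnear_moebius hg hz H) (pnear_ball s0 Hs)) => w [-> hw].
rewrite moebiusB // expr_div_n invfM invrK mulrA -mulrA [_^-1 * _]mulrC mulrA //.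
Qed.

Lemma mero_eq_moebius g f1 f2 : SL2Z g -> mero_eq f1 f2 ->
  mero_eq (fun w => f1 (moebius g w)) (fun w => f2 (moebius g w)).
Proof.
move=> hg /mero_eqP h; apply/mero_eqP => tau ht.
by apply: (@pnear_moebius g tau (fun w => f1 w = f2 w) hg ht); apply: h; exact: Hp_moebius.
Qed.

End ModularGroup.

(** * The complex exponential and the variable q *)

Section Exponential.
Variable R : realType.
Implicit Types (z w : R[i]).

Lemma real_der0 (f : R -> R) df : is_derive (0 : R) (1 : R) f df -> forall e, 0 < e ->
  exists2 d, 0 < d & forall x, `|x| < d -> `|f x - f 0 - df * x| <= e * `|x|.
Proof.
move=> [fd fv] e e0; have : (fun h => h^-1 *: (f (h *: 1 + 0) - f 0)) @ 0^' --> df.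
  by rewrite -fv; exact: fd.
move=> /cvgrPdist_lt /(_ e e0) /nbhs_ballP [d /= d0 H]; exists d => // x xd.
have [->|x0] := eqVneq x 0; first by rewrite mulr0 subrr subr0 normr0 mulr0.
have := H x; rewrite /ball /= sub0r normrN => /(_ xd x0).
rewrite addr0 -[x *: 1]/(x * 1) mulr1 -[_ *: _]/(_ * _) => h.
rewrite -ler_pdivrMr ?normr_gt0 // -normf_div ltW //; move: h; rewrite distrC.
by congr (`|_| < _); field.
Qed.

Lemma cexp0 : cexp (0 : R[i]) = 1.
Proof. by rewrite /cexp /= expR0 cos0 sin0 mulr1 mulr0. Qed.

Lemma cexpD z w : cexp (z + w) = cexp z * cexp w.
Proof.
case: z w => [a b] [c d]; rewrite /cexp /= expRD cosD sinD.
by rewrite -[RHS]/(Complex (_ * _ - _ * _) (_ * _ + _ * _)); congr Complex; ring.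
Qed.

Lemma cn_cexp z : cn (cexp z) = expR (complex.Re z).
Proof.
rewrite /cn /cexp /= !exprMn -mulrDr cos2Dsin2 mulr1 sqrtr_sqr ger0_norm // expR_ge0.
Qed.

Lemma cexp_neq0 z : cexp z != 0.
Proof. by rewrite -cn_gt0 cn_cexp expR_gt0. Qed.

(** The first order remainders of exp, cos and sin at 0 combine into the remainder of [cexp] by the
    identity [E] below; the constant 20 leaves ample slack for the resulting terms. *)
Lemma cder_cexp0 : cder (@cexp R) 0 1.
Proof.
apply/cderE => e e0.
have [s [s0 s1 es]] : exists s : R, [/\ 0 < s, s <= 1 & 20 * s <= e].
  exists (Num.min (e / 20) 1); rewrite lt_min divr_gt0 ?ltr01 // ge_min lexx orbT.
  split=> //; have : Num.min (e / 20) 1 <= e / 20 by rewrite ge_min lexx.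
  by lra.
have [d1 d10 H1] := real_der0 (is_derive_expR 0) s0.
have [d2 d20 H2] := real_der0 (is_derive_cos 0) s0.
have [d3 d30 H3] := real_der0 (is_derive_sin 0) s0.
exists (Num.min (Num.min d1 d2) (Num.min d3 s)); first by rewrite !lt_min d10 d20 d30 s0.
move=> w; rewrite subr0 !lt_min => /andP[/andP[w1 w2] /andP[w3 ws]].
rewrite /dquo eqxx; case: eqVneq => [_|w0]; first by rewrite subrr cn0.
have cw0 : 0 < cn w by rewrite cn_gt0.
rewrite subr0 cexp0 (_ : (cexp w - 1) / w - 1 = (cexp w - 1 - w) / w); last by field.
rewrite cnM cnV ltr_pdivrMr //.
set x := complex.Re w; set y := complex.Im w.
have xw : `|x| <= cn w by exact: Re_le_cn.
have yw : `|y| <= cn w by exact: Im_le_cn.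
have := H1 x (le_lt_trans xw w1); have := H2 y (le_lt_trans yw w2).
have := H3 y (le_lt_trans yw w3).
rewrite sin0 cos0 expR0 oppr0 mul0r !(subr0, addr0) !mul1r.
set r3 := sin y - y; set r2 := cos y - 1; set r1 := expR x - 1 - x => h3 h2 h1.
have k1 : `|r1| <= s * cn w by apply: le_trans h1 _; rewrite ler_wpM2l // ltW.
have k2 : `|r2| <= s * cn w by apply: le_trans h2 _; rewrite ler_wpM2l // ltW.
have k3 : `|r3| <= s * cn w by apply: le_trans h3 _; rewrite ler_wpM2l // ltW.
have cw1 : cn w <= 1 by lra.
have sc : s * cn w <= cn w by rewrite ler_piMl // ltW.
have e3 : `|expR x| <= 3.
  rewrite (_ : expR x = 1 + x + r1); last by rewrite /r1; ring.
  apply: le_trans (ler_normD _ _) _; apply: le_trans (lerD (ler_normD _ _) k1) _.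
  by rewrite normr1; lra.
have E : cexp w - 1 - w = Complex (expR x * r2 + r1) (expR x * r3 + (x + r1) * y).
  rewrite /cexp -/x -/y; have -> : w = Complex x y by rewrite /x /y; case: (w).
  rewrite -[X in X = _]/(Complex (_ - _ - _) (_ - _ - _)) /r1 /r2 /r3; congr Complex; ring.
rewrite E; apply: le_lt_trans (cn_le _) _; rewrite /=.
have t2 : `|expR x * r2| <= 3 * (s * cn w) by rewrite normrM; apply: ler_pM.
have t3 : `|expR x * r3| <= 3 * (s * cn w) by rewrite normrM; apply: ler_pM.
have t4 : `|(x + r1) * y| <= 2 * (s * cn w).
  rewrite normrM; apply: le_trans (_ : (2 * cn w) * s <= _); last first.
    by rewrite -mulrA [cn w * s]mulrC.
  apply: ler_pM => //; last lra.
  by apply: le_trans (ler_normD _ _) _; lra.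
have := ler_normD (expR x * r2) r1; have := ler_normD (expR x * r3) ((x + r1) * y).
have : 20 * (s * cn w) <= e * cn w by rewrite mulrA ler_pM2r.
have : 0 < s * cn w by rewrite mulr_gt0.
clear -k1 t2 t3 t4; lra.
Qed.

Lemma cder_cexp z : cder (@cexp R) z (cexp z).
Proof.
have h : cder (fun w => w - z) z 1.
  by have := cderB (cder_id z) (cder_cst z z); rewrite subr0.
have := @cder_comp R (fun w => w - z) (@cexp R) z 1 1 h.
rewrite subrr mulr1 => /(_ cder_cexp0) /(cderZ (cexp z)); rewrite mulr1.
by apply: cder_ext => w; rewrite -cexpD addrC subrK.
Qed.

Definition twopii : R[i] := Complex 0 (2 * pi).

Lemma twopii_neq0 : twopii != 0.
Proof. by rewrite eq_complex /= eqxx /= mulf_neq0 // gt_eqF // pi_gt0. Qed.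

Lemma e2D z w : cexp2ipi (z + w) = cexp2ipi z * cexp2ipi w.
Proof. by rewrite /cexp2ipi mulrDr cexpD. Qed.

Lemma e20 : cexp2ipi (0 : R[i]) = 1.
Proof. by rewrite /cexp2ipi mulr0 cexp0. Qed.

Lemma e2_1 : cexp2ipi (1 : R[i]) = 1.
Proof.
by rewrite /cexp2ipi mulr1 /cexp /= expR0 !mul1r mulr_natl cos2pi sin2pi.
Qed.

Lemma e2_neq0 z : cexp2ipi z != 0. Proof. exact: cexp_neq0. Qed.

Lemma e2N z : cexp2ipi (- z) = (cexp2ipi z)^-1.
Proof.
by apply: (mulfI (e2_neq0 z)); rewrite -e2D subrr e20 mulfV // e2_neq0.
Qed.

Lemma e2_nat n z : cexp2ipi (n%:R * z) = cexp2ipi z ^+ n.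
Proof.
elim: n => [|n IH]; first by rewrite mul0r e20 expr0.
by rewrite -natr1 mulrDl mul1r e2D IH exprSr.
Qed.

Lemma e2_natr n : cexp2ipi (n%:R : R[i]) = 1.
Proof. by rewrite -[n%:R]mulr1 e2_nat e2_1 expr1n. Qed.

Lemma e2_int (n : int) : cexp2ipi (n%:~R : R[i]) = 1.
Proof. by case: n => n; rewrite ?NegzE ?rmorphN /= ?e2N e2_natr ?invr1. Qed.

Lemma cn_e2 z : cn (cexp2ipi z) = expR (- (2 * pi * complex.Im z)).
Proof. by rewrite /cexp2ipi cn_cexp; case: z => a b /=; rewrite mul0r sub0r. Qed.

Lemma cder_e2 z : cder (@cexp2ipi R) z (twopii * cexp2ipi z).
Proof.
have h := cder_comp (cderZ twopii (cder_id z)) (cder_cexp (twopii * z)).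
by rewrite mulr1 mulrC in h.
Qed.

Lemma e2_cdiff z : cdiff (@cexp2ipi R) z. Proof. by eexists; exact: cder_e2. Qed.

Lemma e2_small (e : R) : 0 < e -> exists2 Y : R, 0 < Y &
  forall z, Y < complex.Im z -> cn (cexp2ipi z) < e.
Proof.
move=> e0; have p0 : 0 < 2 * pi :> R by rewrite mulr_gt0 // pi_gt0.
exists (e^-1 / (2 * pi)); first by rewrite divr_gt0 // invr_gt0.
move=> z hz; rewrite cn_e2 expRN invf_plt ?posrE ?expR_gt0 //.
apply: lt_le_trans (expR_ge1Dx _).
rewrite ltr_pdivrMr // mulrC in hz; lra.
Qed.

Definition qN (N : nat) z : R[i] := cexp2ipi (z / N%:R).

Lemma Im_divn (N : nat) z : complex.Im (z / N%:R) = complex.Im z / N%:R.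
Proof.
rewrite -(rmorph_nat (real_complex R)) -fmorphV; case: z => a b /=.
by rewrite mulr0 add0r.
Qed.

Lemma qN_small (N : nat) (e : R) : (0 < N)%N -> 0 < e -> exists2 Y : R, 0 < Y &
  forall z, Y < complex.Im z -> cn (qN N z) < e.
Proof.
move=> N0 e0; have [Y Y0 H] := e2_small e0; have N0' : 0 < N%:R :> R by rewrite ltr0n.
exists (Y * N%:R); first by rewrite mulr_gt0.
by move=> z hz; apply: H; rewrite Im_divn ltr_pdivlMr.
Qed.

Lemma qN_neq0 (N : nat) z : qN N z != 0. Proof. exact: e2_neq0. Qed.

Lemma qN_cdiff (N : nat) z : cdiff (qN N) z.
Proof.
apply: cdiff_comp (e2_cdiff _).
by apply: cdiffM; [exact: cdiff_id|exact: cdiff_cst].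
Qed.

Lemma qN_holo (N : nat) z : holo_at (qN N) z.
Proof. by exists 1 => // w _; exact: qN_cdiff. Qed.

End Exponential.

(** * Power series *)

Section PowerSeries.
Variable R : realType.
Implicit Types (a u : nat -> R[i]) (q w : R[i]).

Lemma ctends_terms_bounded u l : ctends (psum u) l -> exists2 B : R, 0 <= B & forall k, cn (u k) <= B.
Proof.
move=> /(_ 1 ltr01)[n H].
have small k : (n <= k)%N -> cn (u k) <= 2.
  move=> nk; have h1 := H k nk; have h2 := H k.+1 (leqW nk).
  rewrite (_ : u k = psum u k.+1 - psum u k); last by rewrite psumS addrC addKr.
  have := cn_trans l (psum u k.+1) (psum u k); rewrite (cnBC l (psum u k)); lra.
exists (2 + \sum_(k < n) cn (u k)).
  by rewrite addr_ge0 // sumr_ge0 // => k _; exact: cn_ge0.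
move=> k; have [nk|kn] := leqP n k.
  by apply: le_trans (small k nk) _; rewrite lerDl sumr_ge0 // => i _; exact: cn_ge0.
rewrite (bigD1 (Ordinal kn)) //= addrCA lerDl addr_ge0 // sumr_ge0 // => i _.
exact: cn_ge0.
Qed.

Definition powser a q := csum (fun k => a k * q ^+ k).

(** Boundedness of the terms at radius rho makes them geometric of ratio 1/2 at half that radius, so
    the M-test applies. *)
Lemma powser_facts a (rho B : R) : 0 < rho -> (forall k, cn (a k) * rho ^+ k <= B) ->
  holo_on 0 (rho / 2) (powser a) /\
  forall q, cn q < rho / 2 -> ctends (psum (fun k => a k * q ^+ k)) (powser a q).
Proof.
move=> rho0 aB; have B0 : 0 <= B.
  by apply: le_trans (aB 0%N); rewrite mulr_ge0 ?cn_ge0 // exprn_ge0 // ltW.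
have r0 : 0 < rho / 2 by rewrite divr_gt0.
have tb k q : cn (q - 0) < rho / 2 -> cn (a k * q ^+ k) <= B * (2^-1) ^+ k.
  rewrite subr0 cnM cnX => hq.
  apply: le_trans (_ : cn (a k) * (rho ^+ k * (2^-1) ^+ k) <= _).
    apply: ler_wpM2l; first exact: cn_ge0.
    by rewrite -exprMn lerXn2r ?nnegrE ?cn_ge0 // ltW // mulr_gt0 // invr_gt0.
  by rewrite mulrA ler_wpM2r ?exprn_ge0 ?invr_ge0.
have sb n : \sum_(k < n) B * (2^-1) ^+ k <= B * 2.
  rewrite -mulr_sumr ler_wpM2l //.
  have := @geom_le R (2^-1) n; have -> : (1 - 2^-1)^-1 = 2 :> R by field.
  by apply; [rewrite invr_ge0|rewrite invf_lt1 // ltr1n].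
have fd k : holo_on 0 (rho / 2) (fun q => a k * q ^+ k).
  by move=> q _; apply: cdiffM; [exact: cdiff_cst|apply: cdiffX; exact: cdiff_id].
split=> [q hq|q hq].
  by eexists; exact: (mtest_holo r0 fd tb sb hq).
apply: (@summ_cvg _ _ (fun k => B * (2^-1) ^+ k) (B * 2)); split=> // k.
by apply: tb; rewrite subr0.
Qed.

Lemma powser0 a : powser a 0 = a 0%N.
Proof.
apply: csumP => e e0; exists 1%N => n n0; rewrite /psum -(prednK n0) big_ord_recl expr0 mulr1 big1.
  by rewrite addr0 subrr cn0.
by move=> i _; rewrite expr0n mulr0.
Qed.

Lemma tquo_powser a (rho B : R) : 0 < rho -> (forall k, cn (a k) * rho ^+ k <= B) ->
  near_eq 0 (tquo 0 (powser a)) (powser (fun k => a k.+1)).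
Proof.
move=> rho0 aB; have [h1 h2] := powser_facts rho0 aB.
have aB' k : cn (a k.+1) * rho ^+ k <= B / rho.
  by rewrite ler_pdivlMr // -mulrA -exprSr.
have [h1' h2'] := powser_facts rho0 aB'.
have r0 : 0 < rho / 2 by rewrite divr_gt0.
apply: (near_tquo r0); first by exists (rho / 2).
  by apply: holo_at_cont; exists (rho / 2).
move=> w w0; rewrite subr0 => wr; rewrite powser0.
apply: ctends_unique (h2 w wr) _; apply/(ctends_shift _ _ 1).
have h := ctendsD (ctends_cst (a 0%N)) (ctendsZ w (h2' w wr)).
rewrite [_ * w]mulrC; apply: ctends_ext h => n.
by rewrite addn1 psumSl expr0 mulr1 -psumZ /psum; congr (_ + _); apply: eq_bigr => k _;
  rewrite exprS; ring.
Qed.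

Lemma tay_powser a (rho B : R) n : 0 < rho -> (forall k, cn (a k) * rho ^+ k <= B) ->
  tay (powser a) 0 n = a n.
Proof.
move=> rho0; elim: n a B => [|n IH] a B aB; first by rewrite /tay /= powser0.
rewrite tayS (near_eq_tay _ (tquo_powser rho0 aB)) (IH _ (B / rho)) // => k.
by rewrite ler_pdivlMr // -mulrA -exprSr.
Qed.

End PowerSeries.

(** * Expansions in q with coefficients in a subfield *)

Section SubfieldSets.
Variable R : realType.

Definition is_subfield (K : set R[i]) := [/\ K 1, forall x y, K x -> K y -> K (x - y) &
  forall x y, K x -> K y -> K (x / y)].

Variable K : set R[i].
Hypothesis KF : is_subfield K.

Lemma KB x y : K x -> K y -> K (x - y). Proof. by have [_ h _] := KF; exact: h. Qed.
Lemma Kdiv x y : K x -> K y -> K (x / y). Proof. by have [_ _ h] := KF; exact: h. Qed.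
Lemma K1 : K 1. Proof. by have [h _ _] := KF. Qed.
Lemma K0 : K 0. Proof. by rewrite -(subrr 1); apply: KB; exact: K1. Qed.
Lemma KN x : K x -> K (- x). Proof. by rewrite -sub0r; apply: KB; exact: K0. Qed.
Lemma KD x y : K x -> K y -> K (x + y).
Proof. by move=> hx hy; rewrite -[y]opprK; apply: KB => //; exact: KN. Qed.
Lemma KV x : K x -> K x^-1. Proof. by move=> hx; rewrite -div1r; apply: Kdiv => //; exact: K1. Qed.
Lemma KM x y : K x -> K y -> K (x * y).
Proof. by move=> hx hy; rewrite -[y]invrK; apply: Kdiv => //; exact: KV. Qed.
Lemma KX x n : K x -> K (x ^+ n).
Proof. by move=> hx; elim: n => [|n IH]; [exact: K1|rewrite exprS; exact: KM]. Qed.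
Lemma Knat n : K n%:R.
Proof. by elim: n => [|n IH]; [exact: K0|rewrite -natr1; apply: KD => //; exact: K1]. Qed.

End SubfieldSets.

Section KSeries.
Variable R : realType.
Implicit Types (f g F G H : R[i] -> R[i]) (q w : R[i]).

Lemma is_subfieldT : is_subfield (@setT R[i]). Proof. by []. Qed.

Variable K : set R[i].
Hypothesis KF : is_subfield K.

(** Germs at q = 0 with coefficients in K. Every closure property below is an identity for [tquo] of
    the compound function followed by induction on the index of the coefficient. *)
Definition kser H := holo_at H 0 /\ forall n, K (tay H 0 n).

Lemma kser_near F G : near_eq 0 F G -> kser F -> kser G.
Proof.
move=> E [Fh FK]; split; first exact: holo_at_near E Fh.
by move=> n; rewrite -(near_eq_tay n E).
Qed.

Lemma kser0 F : kser F -> K (F 0). Proof. by move=> [_ /(_ 0%N)]. Qed.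

Lemma kser_tquo F : kser F -> kser (tquo 0 F).
Proof.
by move=> [Fh FK]; split; [exact: holo_at_tquo|move=> n; rewrite -tayS; exact: FK].
Qed.

Lemma kser_tayf F n : kser F -> kser (tayf F 0 n).
Proof. by move=> h; elim: n => //= n IH; exact: kser_tquo. Qed.

Lemma tquo_cst c : near_eq 0 (tquo 0 (fun=> c)) (fun=> 0 : R[i]).
Proof.
apply: (near_tquo ltr01); [exact: holo_at_cst|exact: ccont_cst|].
by move=> w _ _; rewrite mul0r addr0.
Qed.

Lemma kser_cst c : K c -> kser (fun=> c).
Proof.
move=> Kc; split; first exact: holo_at_cst.
case=> [|n]; first by [].
rewrite tayS (near_eq_tay _ (tquo_cst c)).
elim: n => [|n IH]; first exact: K0.
by rewrite tayS (near_eq_tay _ (tquo_cst 0)).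
Qed.

Lemma tquo_lin c F G : holo_at F 0 -> holo_at G 0 ->
  near_eq 0 (tquo 0 (fun w => F w - c * G w)) (fun w => tquo 0 F w - c * tquo 0 G w).
Proof.
move=> Fh Gh; apply: (near_tquo ltr01).
- by apply: holo_atB => //; apply: holo_atM => //; exact: holo_at_cst.
- apply: ccontB; first by apply: holo_at_cont; exact: holo_at_tquo.
  by apply: ccontM; [exact: ccont_cst|apply: holo_at_cont; exact: holo_at_tquo].
- by move=> w _ _; rewrite {1}(tquoE F 0 w) {1}(tquoE G 0 w); ring.
Qed.

Lemma kser_lin c F G : K c -> kser F -> kser G -> kser (fun w => F w - c * G w).
Proof.
move=> Kc Fk Gk; split.
  apply: holo_atB; first by case: Fk.
  by apply: holo_atM; [exact: holo_at_cst|case: Gk].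
move=> n; elim: n F G Fk Gk => [|n IH] F G Fk Gk.
  by apply: KB => //; [exact: kser0|apply: KM => //; exact: kser0].
rewrite tayS (near_eq_tay _ (tquo_lin c (proj1 Fk) (proj1 Gk))).
by apply: IH; exact: kser_tquo.
Qed.

Lemma kserB F G : kser F -> kser G -> kser (fun w => F w - G w).
Proof.
move=> Fk Gk; apply: kser_near (kser_lin (K1 KF) Fk Gk).
by exists 1 => // w _; rewrite mul1r.
Qed.

Lemma kserD F G : kser F -> kser G -> kser (fun w => F w + G w).
Proof.
move=> Fk Gk; apply: kser_near (kser_lin (KN KF (K1 KF)) Fk Gk).
by exists 1 => // w _; rewrite mulN1r opprK.
Qed.

(** The Leibniz rule for difference quotients, tquo (F G) = tquo F * G + F 0 * tquo G. The second
    summand is written with -F 0 to match the form of [tquo_lin]. *)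
Lemma kserM F G : kser F -> kser G -> kser (fun w => F w * G w).
Proof.
move=> Fk Gk; split; first by apply: holo_atM; [case: Fk|case: Gk].
move=> n; elim: n F Fk => [|n IH] F Fk; first by apply: KM => //; exact: kser0.
have Fh := proj1 Fk; have Gh := proj1 Gk.
have E : near_eq 0 (tquo 0 (fun w => F w * G w)) (fun w => tquo 0 F w * G w - (- F 0) * tquo 0 G w).
  apply: (near_tquo ltr01); first exact: holo_atM.
    apply: ccontB; apply: ccontM; apply: holo_at_cont => //; try exact: holo_at_tquo.
    exact: holo_at_cst.
  by move=> w _ _; rewrite (tquoE F 0 w) (tquoE G 0 w); ring.
rewrite tayS (near_eq_tay _ E).
have TFk := kser_tquo Fk; have TGk := kser_tquo Gk.
have c0 : K (- F 0) by apply: KN => //; exact: kser0.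
have Ph : holo_at (fun w => tquo 0 F w * G w) 0 by apply: holo_atM => //; case: TFk.
have lin i A B : holo_at A 0 -> holo_at B 0 ->
    tay (fun w => A w - (- F 0) * B w) 0 i = tay A 0 i - (- F 0) * tay B 0 i.
  elim: i A B => [|i IHi] A B Ah Bh; first by [].
  by rewrite !tayS (near_eq_tay _ (tquo_lin _ Ah Bh)) IHi //; exact: holo_at_tquo.
rewrite lin //; last by case: TGk.
by apply: KB => //; [exact: IH|apply: KM => //; case: TGk].
Qed.

Lemma kserX F n : kser F -> kser (fun w => F w ^+ n).
Proof.
move=> Fk; elim: n => [|n IH].
  by apply: kser_near (kser_cst (K1 KF)); exists 1 => // w _; rewrite expr0.
by apply: kser_near (kserM Fk IH); exists 1 => // w _; rewrite exprS.
Qed.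

(** The difference quotient of F / G again has denominator G, with numerator tquo F - (F 0 / G 0)
    tquo G; hence the induction is on n with F general and G fixed. *)
Lemma kserV F G : kser F -> kser G -> G 0 != 0 -> kser (fun w => F w / G w).
Proof.
move=> Fk Gk G0; have Gh := proj1 Gk.
split; first by apply: holo_atM; [case: Fk|exact: holo_atV].
move=> n; elim: n F Fk => [|n IH] F Fk; first by apply: Kdiv => //; exact: kser0.
have Fh := proj1 Fk; pose c := F 0 / G 0.
have Kc : K c by apply: Kdiv => //; exact: kser0.
pose F' w := tquo 0 F w - c * tquo 0 G w.
have Fk' : kser F' by apply: kser_lin => //; exact: kser_tquo.
have [r r0 Hr] := ccont_neq0 (holo_at_cont Gh) G0.
have E : near_eq 0 (tquo 0 (fun w => F w / G w)) (fun w => F' w / G w).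
  apply: (near_tquo r0); first by apply: holo_atM => //; exact: holo_atV.
    by apply: ccontM; apply: holo_at_cont; [case: Fk'|exact: holo_atV].
  move=> w _ /Hr Gw; rewrite /F' /c.
  have := tquoE F 0 w; have := tquoE G 0 w; rewrite subr0 => EG EF.
  have -> : F 0 / G 0 + (tquo 0 F w - F 0 / G 0 * tquo 0 G w) / G w * w =
    (F 0 / G 0 * G w + (tquo 0 F w - F 0 / G 0 * tquo 0 G w) * w) / G w by field; rewrite Gw G0.
  by congr (_ / _); rewrite EF EG; field.
by rewrite tayS (near_eq_tay _ E); exact: IH.
Qed.

Lemma tquo_id : near_eq 0 (tquo 0 id) (fun=> 1 : R[i]).
Proof.
apply: (near_tquo ltr01); [exact: holo_at_id|exact: ccont_cst|].
by move=> w _ _; rewrite mul1r subr0 add0r.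
Qed.

Lemma kser_id : kser id.
Proof.
split; first exact: holo_at_id.
case=> [|n]; first exact: K0.
by rewrite tayS (near_eq_tay _ tquo_id); have [_] := kser_cst (K1 KF).
Qed.

Lemma kser_pow n : kser (fun w => w ^+ n). Proof. exact: (kserX n kser_id). Qed.

Lemma kser_sum (I : Type) (s : seq I) (P : pred I) (F : I -> R[i] -> R[i]) :
  (forall i, P i -> kser (F i)) -> kser (fun w => \sum_(i <- s | P i) F i w).
Proof.
move=> h; elim: s => [|i s IH].
  by apply: kser_near (kser_cst (K0 KF)); exists 1 => // w _; rewrite big_nil.
case: (boolP (P i)) => Pi.
  by apply: kser_near (kserD (h i Pi) IH); exists 1 => // w _; rewrite big_cons Pi.
by apply: kser_near IH; exists 1 => // w _; rewrite big_cons (negbTE Pi).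
Qed.

Lemma tay_addX F G H m n : holo_at F 0 -> holo_at G 0 -> holo_at H 0 ->
  near_eq 0 F (fun w => G w + w ^+ m * H w) -> (n < m)%N -> tay F 0 n = tay G 0 n.
Proof.
elim: n m F G => [|n IH] [//|m] F G Fh Gh Hh E nm.
  by have := near_eq_at E; rewrite expr0n mul0r addr0.
rewrite !tayS; apply: (IH m) => //; [exact: holo_at_tquo|exact: holo_at_tquo|].
apply: (near_eq_trans (near_eq_tquo E)); apply: (near_tquo ltr01).
- apply: holo_atD => //; apply: holo_atM => //; apply: holo_atX; exact: holo_at_id.
- apply: ccontD; first by apply: holo_at_cont; exact: holo_at_tquo.
  by apply: ccontM; [apply: ccontX; exact: ccont_id|exact: holo_at_cont].
- by move=> w _ _; rewrite {1}(tquoE G 0 w) expr0n mul0r exprSr; ring.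
Qed.

(** Adding a multiple of w^m does not change the coefficients below m. This transfers rationality
    from the finite truncations of an infinite series to its sum. *)
Lemma kser_approx F : holo_at F 0 ->
  (forall m, exists G H, [/\ kser G, holo_at H 0 & near_eq 0 F (fun w => G w + w ^+ m * H w)]) ->
  kser F.
Proof.
move=> Fh h; split=> // n; have [G [H [[Gh GK] Hh E]]] := h n.+1.
by rewrite (tay_addX Fh Gh Hh E).
Qed.

(** The cofactor is the iterated difference quotient at the first nonzero coefficient, which keeps
    its coefficients in K. *)
Lemma kser_order F : kser F -> near_eq 0 F (fun=> 0) \/
  exists k G, [/\ kser G, G 0 != 0 & forall w, F w = w ^+ k * G w].
Proof.
move=> Fk; have [ex|nex] := pselect (exists k, tay F 0 k != 0).
  right; have [k Fk0 kmin] := ex_minnP ex.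
  exists k, (tayf F 0 k); split=> //; first exact: kser_tayf.
  move=> w; rewrite {1}(tayf_expand F 0 k w) subr0 big1 ?add0r 1?mulrC // => i _.
  have -> : tay F 0 i = 0.
    by apply: contraTeq (ltn_ord i) => /kmin; rewrite -leqNgt.
  by rewrite mul0r.
left; have [[r r0 H]|[k [h [hh h0 E low]]]] := zero_order (proj1 Fk).
  by exists r.
case: nex; exists k; have Eh : near_eq 0 F (fun w => w ^+ k * h w).
  by exists 1 => // w _; rewrite E subr0.
have shift n G H : holo_at G 0 -> holo_at H 0 -> near_eq 0 G (fun w => w ^+ n * H w) -> tay G 0 n = H 0.
  elim: n G => [|n IH] G Gh Hh EG; first by have := near_eq_at EG; rewrite mul1r.
  rewrite tayS; apply: IH => //; first exact: holo_at_tquo.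
  apply: (near_eq_trans (near_eq_tquo EG)); apply: (near_tquo ltr01).
  - by apply: holo_atM => //; apply: holo_atX; exact: holo_at_id.
  - by apply: ccontM; [apply: ccontX; exact: ccont_id|exact: holo_at_cont].
  - by move=> w _ _; rewrite expr0n mul0r exprSr; ring.
by rewrite (shift _ _ _ (proj1 Fk) hh Eh).
Qed.

End KSeries.

(** * Fourier expansions and fields of modular functions *)

Section Fourier.
Variable R : realType.
Variable N : nat.
Hypothesis N0 : (0 < N)%N.
Implicit Types (f g : R[i] -> R[i]) (K : set R[i]).

Definition qlaurent K f := exists m H, kser K H /\ exists2 Y : R, 0 < Y &
  forall tau, Y < complex.Im tau -> pnear tau (fun w => f w = H (qN N w) / qN N w ^+ m).

Lemma fourier_psum (a : nat -> R[i]) m w n :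
  [series a n * cexp2ipi (w / N%:R) ^ (n%:Z - m%:Z)]_n n =
  (qN N w ^+ m)^-1 * psum (fun k => a k * qN N w ^+ k) n.
Proof.
rewrite /series /= big_mkord /psum mulr_sumr; apply: eq_bigr => k _.
rewrite -/(qN N w) expfzDr ?qN_neq0 // exprnN -exprnP; ring.
Qed.

(** Convergence of the series at a single point q0 bounds a_k |q0|^k, so the series defines a germ
    on |q| < |q0|/2 whose Taylor coefficients are the a_k. Conversely a germ is the sum of its
    Taylor series near 0. Working with germs makes the field operations available. *)
Theorem fourierP K f : (exists m a, fourier_expansion N f m a /\ forall n, K (a n)) <-> qlaurent K f.
Proof.
split.
  move=> [m [a [[Y Y0 H] Ka]]].
  have h1 : Y < complex.Im (Complex 0 (Y + 1) : R[i]) by rewrite /= ltrDl.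
  have /dnear_cnP/pnear_ex/(_ 1 ltr01) [w0 [_ _ /ctendsP cv]] := H _ h1.
  set q0 := qN N w0.
  have [B B0 HB] := ctends_terms_bounded (ctends_ext (fun n => esym (psumZ _ _ n))
    (ctends_ext (fourier_psum a m w0) cv)).
  have rho0 : 0 < cn q0 by rewrite cn_gt0 qN_neq0.
  have aB k : cn (a k) * cn q0 ^+ k <= B * cn q0 ^+ m.
    have := HB k; rewrite -/q0 !cnM cnV !cnX => h.
    by rewrite -ler_pdivrMr ?exprn_gt0 // mulrC.
  have [h2 h3] := powser_facts rho0 aB.
  have r0 : 0 < cn q0 / 2 by rewrite divr_gt0.
  exists m, (powser a); split.
    split; first by exists (cn q0 / 2).
    by move=> n; rewrite (tay_powser n rho0 aB).
  have [Y' Y0' HY'] := qN_small N0 r0.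
  exists (Num.max Y Y'); first by rewrite lt_max Y0.
  move=> tau; rewrite gt_max => /andP[t1 t2].
  have [r rr0 Hr] := (dnear_cnP _ _).1 (H tau t1).
  have s0 : 0 < complex.Im tau - Y' by rewrite subr_gt0.
  exists (Num.min r (complex.Im tau - Y')); first by rewrite lt_min rr0.
  move=> w wt; rewrite lt_min => /andP[/(Hr w wt)/ctendsP c1 wY].
  have wY' : Y' < complex.Im w.
    have := le_lt_trans (Im_le_cn _) wY; rewrite ImB ltr_norml; lra.
  apply: ctends_unique (ctends_ext (fourier_psum a m w) c1) _.
  by rewrite [X in ctends _ X]mulrC; apply: ctendsZ; apply: h3; exact: HY'.
move=> [m [H [[Hh HK] [Y Y0 E]]]]; exists m, (tay H 0); split=> //.
have [r [M [r0 M0 Hd HM]]] := holo_at_bound Hh.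
have r96 : 0 < r / 96 by rewrite divr_gt0.
have [Y' Y0' HY'] := qN_small N0 r96.
exists (Num.max Y Y'); first by rewrite lt_max Y0.
move=> tau; rewrite gt_max => /andP[/E[s s0 Hs] t2]; apply/dnear_cnP.
have u0 : 0 < complex.Im tau - Y' by rewrite subr_gt0.
exists (Num.min s (complex.Im tau - Y')); first by rewrite lt_min s0.
move=> w wt; rewrite lt_min => /andP[/(Hs w wt) -> wY].
have wY' : Y' < complex.Im w.
  have := le_lt_trans (Im_le_cn _) wY; rewrite ImB ltr_norml; lra.
apply/ctendsP; apply: ctends_ext (fun n => esym (fourier_psum _ m w n)) _.
rewrite mulrC; apply: ctendsZ.
have := taylor_series r0 Hd HM (_ : cn (qN N w - 0) < r / 96); rewrite !subr0; apply.
exact: HY'.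
Qed.

Lemma qlaurent_eq K f g (Y : R) : (forall tau, Y < complex.Im tau -> pnear tau (fun w => f w = g w)) ->
  qlaurent K f -> qlaurent K g.
Proof.
move=> E [m [H [Hk [Y' Y0 h]]]]; exists m, H; split=> //.
exists (Num.max Y Y'); first by rewrite lt_max Y0 orbT.
move=> tau; rewrite gt_max => /andP[/E e1 /h e2].
by apply: pnear_imp (pnearI e1 e2) => w [<- ->].
Qed.

Lemma qlaurentW K f : qlaurent K f -> qlaurent setT f.
Proof. by move=> [m [H [[Hh _] h]]]; exists m, H; split. Qed.

Lemma qlaurent_cst K c : is_subfield K -> K c -> qlaurent K (fun=> c).
Proof.
move=> KF Kc; exists 0%N, (fun=> c); split; first exact: kser_cst.
by exists 1 => // tau _; apply: pnear_all => w; rewrite expr0 divr1.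
Qed.

Lemma qlaurentB K f g : is_subfield K -> qlaurent K f -> qlaurent K g ->
  qlaurent K (fun w => f w - g w).
Proof.
move=> KF [m [H [Hk [Y Y0 h]]]] [m' [H' [Hk' [Y' Y0' h']]]].
exists (m + m')%N, (fun q => H q * q ^+ m' - H' q * q ^+ m); split.
  by apply: kserB => //; apply: kserM => //; exact: kser_pow.
exists (Num.max Y Y'); first by rewrite lt_max Y0.
move=> tau; rewrite gt_max => /andP[/h e1 /h' e2].
apply: pnear_imp (pnearI e1 e2) => w [-> ->].
by rewrite exprD; field; rewrite !expf_neq0 // qN_neq0.
Qed.

(** If the germ of the denominator vanishes, the pointwise quotient is 0 near infinity because x / 0
    = 0. Otherwise the exact power of q is moved into the order of the pole. *)
Lemma qlaurentV K f g : is_subfield K -> qlaurent K f -> qlaurent K g ->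
  qlaurent K (fun w => f w / g w).
Proof.
move=> KF [m [H [Hk [Y Y0 h]]]] [m' [H' [Hk' [Y' Y0' h']]]].
have [[r r0 Hr]|[k [G [Gk G0 E]]]] := kser_order Hk'.
  have [Y2 Y20 HY2] := qN_small N0 r0.
  apply: (@qlaurent_eq _ (fun=> 0) _ (Num.max Y' Y2)); last exact: qlaurent_cst (K0 KF).
  move=> tau; rewrite gt_max => /andP[/h'[s s0 Hs] t2].
  have u0 : 0 < complex.Im tau - Y2 by rewrite subr_gt0.
  exists (Num.min s (complex.Im tau - Y2)); first by rewrite lt_min s0.
  move=> w wt; rewrite lt_min => /andP[/(Hs w wt) -> wY].
  have wY' : Y2 < complex.Im w.
    have := le_lt_trans (Im_le_cn _) wY; rewrite ImB ltr_norml; lra.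
  by rewrite Hr ?subr0 ?mul0r ?invr0 ?mulr0 //; exact: HY2.
exists (m + k)%N, (fun q => H q / G q * q ^+ m'); split.
  by apply: kserM => //; [exact: kserV|exact: kser_pow].
exists (Num.max Y Y'); first by rewrite lt_max Y0.
move=> tau; rewrite gt_max => /andP[/h e1 /h' e2].
apply: pnear_imp (pnearI e1 e2) => w [-> ->].
by rewrite E exprD !invfM !invrK; ring.
Qed.

Lemma qlaurentD K f g : is_subfield K -> qlaurent K f -> qlaurent K g ->
  qlaurent K (fun w => f w + g w).
Proof.
move=> KF fq gq; have := qlaurentB KF fq (qlaurentB KF (qlaurent_cst KF (K0 KF)) gq).
by apply: (@qlaurent_eq _ _ _ 0) => tau _; apply: pnear_all => w; rewrite sub0r opprK.
Qed.

Lemma qlaurentM K f g : is_subfield K -> qlaurent K f -> qlaurent K g ->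
  qlaurent K (fun w => f w * g w).
Proof.
move=> KF fq gq; have := qlaurentV KF fq (qlaurentV KF (qlaurent_cst KF (K1 KF)) gq).
by apply: (@qlaurent_eq _ _ _ 0) => tau _; apply: pnear_all => w; rewrite div1r invrK.
Qed.

Lemma modular_functionP f : modular_function N f <->
  [/\ forall tau, Hp tau -> mero f tau,
    forall A, Gamma N A -> mero_eq (f \o moebius A) f &
    forall A, SL2Z A -> qlaurent setT (f \o moebius A)].
Proof.
split=> -[h1 h2 h3]; split=> //.
- by move=> tau ht; apply/meromorphic_atP; exact: h1.
- by move=> A /h3 [m [a h]]; apply/fourierP; exists m, a; split.
- by move=> tau ht; apply/meromorphic_atP; exact: h1.
- by move=> A /h3/fourierP[m [a [h _]]]; exists m, a.
Qed.

Lemma SL2Z_Gamma A : Gamma N A -> SL2Z A. Proof. by move=> []. Qed.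

Lemma modular_op (P : R[i] -> R[i] -> R[i]) f g :
  (forall f g z, mero f z -> mero g z -> mero (fun w => P (f w) (g w)) z) ->
  (forall f g, qlaurent setT f -> qlaurent setT g -> qlaurent setT (fun w => P (f w) (g w))) ->
  modular_function N f -> modular_function N g -> modular_function N (fun w => P (f w) (g w)).
Proof.
move=> hm hq /modular_functionP[f1 f2 f3] /modular_functionP[g1 g2 g3].
apply/modular_functionP; split.
- by move=> tau ht; apply: hm; [exact: f1|exact: g1].
- move=> A hA; apply/mero_eqP => tau ht.
  have /mero_eqP/(_ tau ht) e1 := f2 A hA; have /mero_eqP/(_ tau ht) e2 := g2 A hA.
  by apply: pnear_imp (pnearI e1 e2) => w /= [-> ->].
- by move=> A hA; apply: (hq _ _ (f3 A hA) (g3 A hA)).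
Qed.

Lemma modularB f g : modular_function N f -> modular_function N g ->
  modular_function N (fun w => f w - g w).
Proof.
apply: (@modular_op (fun a b => a - b)) => [f' g' z|f' g']; first exact: meroB.
exact: qlaurentB.
Qed.

Lemma modularV f g : modular_function N f -> modular_function N g ->
  modular_function N (fun w => f w / g w).
Proof.
apply: (@modular_op (fun a b => a / b)) => [f' g' z|f' g']; first exact: mero_div.
exact: qlaurentV.
Qed.

Lemma modular_cst (c : R[i]) : modular_function N (fun=> c).
Proof.
apply/modular_functionP; split.
- by move=> tau _; exact: mero_cst.
- by move=> A _; apply/mero_eqP => tau _; exact: pnear_all.
- by move=> A _; exact: qlaurent_cst.
Qed.

Lemma modular_mero_eq f g : mero_eq f g -> modular_function N f -> modular_function N g.
Proof.
move=> E /modular_functionP[f1 f2 f3]; have /mero_eqP E' := E.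
apply/modular_functionP; split.
- by move=> tau ht; apply: mero_pnear (E' tau ht) (f1 tau ht).
- move=> A hA; apply/mero_eqP => tau ht; have hA' := SL2Z_Gamma hA.
  have /mero_eqP/(_ tau ht) e1 := f2 A hA.
  have /mero_eqP/(_ tau ht) e2 := mero_eq_moebius hA' E.
  by apply: pnear_imp (pnearI (pnearI e1 e2) (E' tau ht)) => w /= [[<- <-] ->].
- move=> A hA; apply: (@qlaurent_eq _ _ _ 0) (f3 A hA) => tau ht.
  by have /mero_eqP := mero_eq_moebius hA E; exact.
Qed.

Theorem modular_function_over_subfield K : is_subfield K ->
  mero_subfield (modular_function_over N K : set (R[i] -> R[i])).
Proof.
move=> KF; split.
- by move=> f [[]].
- move=> f g E [fm fK]; split; first exact: modular_mero_eq E fm.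
  have {}fK : qlaurent K f by apply/fourierP.
  apply/fourierP; apply: (@qlaurent_eq _ _ _ 0) fK => tau ht.
  by have /mero_eqP := E; exact.
- by split; [exact: modular_cst|apply/fourierP; exact: qlaurent_cst (K1 KF)].
- move=> f g [fm fK] [gm gK]; split; first exact: modularB.
  by apply/fourierP; apply: qlaurentB => //; apply/fourierP.
- move=> f g [fm fK] [gm gK]; split; first exact: modularV.
  by apply/fourierP; apply: qlaurentV => //; apply/fourierP.
Qed.

Lemma modular_over_cst K c : is_subfield K -> K c ->
  modular_function_over N K (fun=> c : R[i]).
Proof.
by move=> KF Kc; split; [exact: modular_cst|apply/fourierP; exact: qlaurent_cst].
Qed.

End Fourier.

Section Cyclotomic.
Variables (R : realType) (N : nat).

Lemma Qzeta_subfield : is_subfield (Qzeta R N).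
Proof.
split=> [K [[h _ _] _]|x y hx hy K hK|x y hx hy K hK]; first exact: (set_mem h).
- have [[_ h _] _] := hK.
  exact: (set_mem (h x y (mem_set (hx K hK)) (mem_set (hy K hK)))).
- have [[_ _ h] _] := hK.
  exact: (set_mem (h x y (mem_set (hx K hK)) (mem_set (hy K hK)))).
Qed.

Lemma Qzeta_zeta : Qzeta R N (zeta R N).
Proof. by move=> K [_ h]; exact: h. Qed.

End Cyclotomic.

(** * Lipschitz-type formulas *)

Section IntegerSums.
Variable R : realType.
Implicit Types (z w : R[i]).

(** The integers are taken in pairs k, -k-1, following the two constructors of [int]; hence the
    shifts by one whenever a sum is symmetric in n and -n. *)
Definition zsum (u : int -> R[i]) : R[i] := csum (fun k => u (Posz k) + u (Negz k)).

Definition notint z := forall n : int, z + n%:~R != 0.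

Lemma absz_cn (n : int) : cn (n%:~R : R[i]) = `|n|%N%:R.
Proof. by case: n => n; rewrite ?NegzE ?rmorphN /= ?cnN cn_nat. Qed.

Lemma arch (x : R) : exists n, x < n%:R.
Proof.
exists (Num.Def.archi_bound `|x|); apply: le_lt_trans (ler_norm x) _.
exact: archi_boundP.
Qed.

Lemma finite_lb (f : nat -> R) : (forall k, 0 < f k) ->
  forall n, exists2 d : R, 0 < d & forall k, (k < n)%N -> d <= f k.
Proof.
move=> f0; elim=> [|n [d d0 H]]; first by exists 1.
exists (Num.min d (f n)); first by rewrite lt_min d0 f0.
by move=> k; rewrite ltnS leq_eqVlt => /predU1P[->|/H h]; rewrite ge_min ?lexx ?orbT // h.
Qed.

(** The finitely many small n have a positive minimum distance, and for the others |n| exceeds |z| +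
    1. The bound is uniform in w, as needed for termwise differentiation. *)
Lemma notint_lb z : notint z -> exists2 c : R, 0 < c & exists2 r : R, 0 < r &
  forall w, cn (w - z) < r -> forall n : int, c * (`|n|%N%:R + 1) <= cn (w + n%:~R).
Proof.
move=> hz; have [B hB] := arch (cn z + 1).
have [d1 d10 H1] := finite_lb (fun k => etrans (cn_gt0 _) (hz (Posz k))) B.
have [d2 d20 H2] := finite_lb (fun k => etrans (cn_gt0 _) (hz (Negz k))) B.
pose d := Num.min (Num.min d1 d2) 1.
have d0 : 0 < d by rewrite !lt_min d10 d20 ltr01.
have Hd n : d <= cn (z + n%:~R).
  have big (k : nat) (n' : int) : (B <= k)%N -> (k%:R : R) <= `|n'|%N%:R -> d <= cn (z + n'%:~R).
    move=> Bk kn; apply: le_trans (_ : 1 <= _); first by rewrite !ge_min lexx !orbT.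
    have := cn_lb (n'%:~R : R[i]) (- z); rewrite opprK cnN absz_cn (addrC _ z).
    have : (B%:R : R) <= k%:R by rewrite ler_nat.
    lra.
  case: n => n; have [nB|nB] := ltnP n B.
  - by apply: le_trans (H1 _ nB); rewrite !ge_min lexx.
  - exact: (big n).
  - by apply: le_trans (H2 _ nB); rewrite !ge_min lexx orbT.
  - by apply: (big n) => //=; rewrite ler_nat.
pose A := cn z + d; pose c := (1 + (A + 1) / (d / 2))^-1.
have A0 : 0 <= A by rewrite addr_ge0 ?cn_ge0 // ltW.
have c0 : 0 < 1 + (A + 1) / (d / 2).
  have dd : 0 < d / 2 by rewrite divr_gt0.
  by apply: ltr_pwDl; [exact: ltr01|apply: divr_ge0; [apply: addr_ge0|exact: ltW]].
exists c; first by rewrite invr_gt0.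
exists (d / 2); first by rewrite divr_gt0.
move=> w wz n; rewrite mulrC ler_pdivrMr //.
have h1 : d / 2 <= cn (w + n%:~R).
  have := cn_lb (z + n%:~R) (z - w); rewrite cnBC.
  rewrite (_ : z + n%:~R - (z - w) = w + n%:~R); last by ring.
  have := Hd n; rewrite (cnBC w z) in wz; rewrite (cnBC w z); lra.
have h2 : `|n|%N%:R - A <= cn (w + n%:~R).
  have := cn_lb (n%:~R : R[i]) (- w); rewrite opprK cnN absz_cn (addrC _ w).
  have := cn_lb w z; rewrite /A; lra.
rewrite mulrDr mulr1; have : A + 1 <= cn (w + n%:~R) * ((A + 1) / (d / 2)).
  rewrite mulrCA; apply: ler_peMr; first by rewrite addr_ge0.
  by rewrite ler_pdivlMr ?divr_gt0 // mul1r.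
lra.
Qed.

Lemma sum_inv_sq n : \sum_(j < n) (j.+1%:R ^- 2 : R) <= 2.
Proof.
suff h : \sum_(j < n) (j.+1%:R ^- 2 : R) <= 2 - 2 / n.+1%:R.
  by apply: le_trans h _; rewrite gerBl divr_ge0.
elim: n => [|n IH]; first by rewrite big_ord0 divr1 subrr.
rewrite big_ord_recr /=; apply: le_trans (lerD IH (lexx _)) _.
have n1 : 0 < n.+1%:R :> R by rewrite ltr0n.
have n2 : 0 < n.+2%:R :> R by rewrite ltr0n.
have e : (n.+2%:R : R) = n.+1%:R + 1 by rewrite -natr1.
rewrite -subr_ge0.
have -> : 2 - 2 / n.+2%:R - (2 - 2 / n.+1%:R + n.+1%:R ^- 2) =
   (n.+1%:R - 1) / (n.+1%:R ^+ 2 * n.+2%:R) :> R.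
  move: n1 n2; rewrite e; move: (n.+1%:R : R) => a a0 a1; field.
  by rewrite !gt_eqF.
by rewrite divr_ge0 ?mulr_ge0 ?exprn_ge0 ?subr_ge0 ?ler1n.
Qed.

Definition Sterm k z (n : int) : R[i] := (z + n%:~R) ^- k.
Definition Ssum k z := zsum (Sterm k z).

Lemma Sterm_bounds k z : (1 < k)%N -> notint z -> exists2 r : R, 0 < r & exists B : R,
  forall w, cn (w - z) < r -> notint w /\ forall j,
   cn (Sterm k w (Posz j) + Sterm k w (Negz j)) <= B * j.+1%:R ^- 2.
Proof.
move=> k1 hz; have [c c0 [r r0 H]] := notint_lb hz.
exists r => //; exists (c ^- k + c ^- k) => w wr; split.
  move=> n; rewrite -cn_gt0; apply: lt_le_trans (H w wr n).
  by rewrite mulr_gt0 // ltr_wpDl.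
have t (n : int) j : (j <= `|n|)%N -> cn (Sterm k w n) <= c ^- k * j.+1%:R ^- 2.
  move=> jn; rewrite /Sterm cnV cnX -invfM lef_pV2 ?posrE.
  - have a0 : 0 < j.+1%:R :> R by rewrite ltr0n.
    apply: le_trans (_ : (c * j.+1%:R) ^+ k <= _).
      rewrite exprMn ler_wpM2l ?exprn_ge0 ?(ltW c0) //.
      by rewrite ler_weXn2l // ler1n.
    rewrite lerXn2r ?nnegrE ?cn_ge0 ?mulr_ge0 ?(ltW c0) ?(ltW a0) //.
    apply: le_trans (H w wr n); rewrite ler_pM2l // natr1 ler_nat //.
  - rewrite exprn_gt0 //; apply: lt_le_trans (H w wr n).
    by rewrite mulr_gt0 // ltr_wpDl.
  - by rewrite mulr_gt0 ?exprn_gt0 // ltr0n.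
move=> j; apply: le_trans (cnD _ _) _; rewrite mulrDl; by apply: lerD; apply: t.
Qed.

Lemma Ssum_cvg k z : (1 < k)%N -> notint z ->
  ctends (psum (fun j => Sterm k z (Posz j) + Sterm k z (Negz j))) (Ssum k z).
Proof.
move=> k1 hz; have [r r0 [B H]] := Sterm_bounds k1 hz.
have [_ h] := H z ltac:(by rewrite subrr cn0).
have B0 : 0 <= B by have := h 0%N; rewrite expr1n invr1 mulr1; apply: le_trans; exact: cn_ge0.
apply: (@summ_cvg _ _ (fun j => B * j.+1%:R ^- 2) (B * 2)); split=> // n.
by rewrite -mulr_sumr ler_wpM2l // sum_inv_sq.
Qed.

Lemma cderX (f : R[i] -> R[i]) z l n : cder f z l ->
  cder (fun w => f w ^+ n.+1) z (n.+1%:R * f z ^+ n * l).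
Proof.
move=> h; elim: n => [|n IH].
  by rewrite expr0 mulr1 mul1r; apply: cder_ext h => w; rewrite expr1.
have := cderM h IH; rewrite (_ : _ + _ = n.+2%:R * f z ^+ n.+1 * l); last first.
  by rewrite -[n.+2%:R]natr1 [f z ^+ n.+1]exprS; ring.
by apply: cder_ext => w; rewrite -exprS.
Qed.

Lemma Sterm_der k z n : z + n%:~R != 0 ->
  cder (fun w => Sterm k.+1 w n) z (- k.+1%:R * Sterm k.+2 z n).
Proof.
move=> zn.
have h1 : cder (fun w => w + n%:~R) z 1.
  by have := cderD (cder_id z) (cder_cst n%:~R z); rewrite addr0.
have := cderX k (cderV h1 zn).
rewrite (_ : _ * _ * _ = - k.+1%:R * Sterm k.+2 z n); last first.
  by rewrite /Sterm -(addn2 k) exprD exprVn !invfM; ring.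
by apply: cder_ext => w; rewrite /Sterm exprVn.
Qed.

Lemma csumZ (a : R[i]) u l : ctends (psum u) l -> csum (fun k => a * u k) = a * l.
Proof. by move=> h; apply: csumP; apply: ctends_ext (ctendsZ a h) => n; rewrite psumZ. Qed.

Lemma Ssum_der k z : (0 < k)%N -> notint z ->
  cder (Ssum k.+1) z (- k.+1%:R * Ssum k.+2 z).
Proof.
move=> k0 hz; have [r r0 [B H]] := @Sterm_bounds k.+1 z k0 hz.
have B0 : 0 <= B.
  have [_ /(_ 0%N)] := H z ltac:(by rewrite subrr cn0).
  by rewrite expr1n invr1 mulr1; apply: le_trans; exact: cn_ge0.
pose f j w := Sterm k.+1 w (Posz j) + Sterm k.+1 w (Negz j).
have fder j w : notint w -> cder (f j) w (- k.+1%:R * (Sterm k.+2 w (Posz j) + Sterm k.+2 w (Negz j))).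
  by move=> hw; rewrite mulrDr; apply: cderD; exact: Sterm_der.
have := @mtest_der R f z r (fun j => B * j.+1%:R ^- 2) (B * 2) r0.
have -> : csum (fun j => cderiv (f j) z) = - k.+1%:R * Ssum k.+2 z.
  rewrite -(csumZ (- k.+1%:R) (@Ssum_cvg k.+2 z isT hz)); congr csum; apply/funext => j.
  by apply: cderivE; exact: fder.
apply.
- by move=> j w /H[hw _]; eexists; exact: fder.
- by move=> j w /H[_]; exact.
- by move=> n; rewrite -mulr_sumr ler_wpM2l // sum_inv_sq.
Qed.

Lemma notint_open z : notint z -> exists2 r : R, 0 < r & forall w, cn (w - z) < r -> notint w.
Proof. by move=> hz; have [r r0 [B H]] := @Sterm_bounds 2 z isT hz; exists r => // w /H[]. Qed.

(** The modulus forces z to be real; its fractional part t then satisfies cos (2 pi t) = 1, and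
    injectivity of cos on [0, pi] excludes 0 < t < 1, after reflection when t > 1/2. *)
Lemma notint_e2 z : notint z -> cexp2ipi z != 1.
Proof.
move=> hz; apply/eqP => E.
have p0 : 0 < pi :> R := pi_gt0 R.
have im0 : complex.Im z = 0.
  have := congr1 (@cn R) E; rewrite cn_e2 cn1 -{2}expR0 => /expR_inj/eqP.
  by rewrite oppr_eq0 !mulf_eq0 (gt_eqF p0) orbF pnatr_eq0 /= => /eqP.
pose x := complex.Re z; pose n := Num.floor x.
have [n1 n2] : (n%:~R : R) <= x /\ x < n%:~R + 1.
  by have := floor_itv x; rewrite /n rmorphD /= => /andP[].
pose t := x - n%:~R.
have zt : z + (- n)%:~R = t%:C.
  by rewrite rmorphN /= intC -rmorphN /= /t /x; case: (z) im0 => a b /= ->; rewrite /real_complex_def; simpc.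
have e1 : cos (2 * pi * t) = 1.
  have : cexp2ipi (z + (- n)%:~R) = 1 :> R[i] by rewrite e2D E e2_int mulr1.
  rewrite zt /cexp2ipi /cexp /= !mul0r !mulr0 subrr add0r expR0 !mul1r => -[] -> //.
have t0 : t != 0.
  by have := hz (- n); rewrite zt; apply: contraNneq => ->.
have tpos : 0 < t by rewrite lt_def t0 /t subr_ge0.
have t1 : t < 1 by rewrite /t; lra.
have pt : 0 < pi * t by rewrite mulr_gt0.
have pt1 : pi * t < pi by rewrite -{2}[pi]mulr1 ltr_pM2l.
have [h|h] := leP t (2^-1).
  have /(@cos_inj R) : cos (2 * pi * t) = cos 0 by rewrite e1 cos0.
  rewrite !in_itv /= lexx (ltW p0) => /(_ _ isT) h'.
  have : pi * t <= pi * 2^-1 by rewrite ler_pM2l.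
  move=> ?; suff: pi * t <= 0 by rewrite leNgt pt.
  have h2 : 2 * pi * t = 0; [apply: h'; apply/andP; split; lra|lra].
have : cos (2 * pi - 2 * pi * t) = cos 0.
  by rewrite cosB mulr_natl cos2pi sin2pi mul1r mul0r addr0 -mulr_natl e1 cos0.
move=> /(@cos_inj R); rewrite !in_itv /= lexx (ltW p0) => /(_ _ isT) h'.
have : pi * 2^-1 < pi * t by rewrite ltr_pM2l.
move=> ?; suff: pi <= pi * t by rewrite leNgt pt1.
have h2 : 2 * pi - 2 * pi * t = 0; [apply: h'; apply/andP; split; lra|lra].
Qed.

End IntegerSums.

(** * The partial fraction expansion of pi^2 / sin^2 *)

Section Herglotz.
Variable R : realType.
Implicit Types (z w u : R[i]).

(** This is pi^2 / sin^2 (pi z) written in u = e^(2 pi i z), the form from which q-expansions are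
    read off. *)
Definition Tcot z : R[i] := twopii R ^+ 2 * (cexp2ipi z / (1 - cexp2ipi z) ^+ 2).

Lemma TcotD1 z : Tcot (z + 1) = Tcot z.
Proof. by rewrite /Tcot e2D e2_1 mulr1. Qed.

Lemma ratP2_dup (u : R[i]) : u != 1 -> u != -1 ->
  u / (1 - u) ^+ 2 + - u / (1 + u) ^+ 2 = 4%:R * (u ^+ 2 / (1 - u ^+ 2) ^+ 2).
Proof.
move=> h1 h2; have a : 1 - u != 0 by rewrite subr_eq0 eq_sym.
have b : 1 + u != 0 by rewrite addrC -[1]opprK subr_eq0.
have c : 1 - u ^+ 2 != 0.
  by rewrite (_ : 1 - u ^+ 2 = (1 - u) * (1 + u)) ?mulf_neq0 //; ring.
by field; rewrite a b c.
Qed.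

Lemma e2_half : cexp2ipi (2^-1 : R[i]) = -1.
Proof.
have -> : (2^-1 : R[i]) = (2^-1 : R)%:C by rewrite fmorphV rmorph_nat.
rewrite /cexp2ipi (_ : _ * _ = Complex 0 pi); last first.
  by rewrite /real_complex_def; simpc; congr Complex; field.
rewrite /cexp /= expR0 cospi sinpi !mul1r.
by apply/eqP; rewrite eq_complex /= oppr0 !eqxx.
Qed.

Lemma notint_half z : notint z -> notint (z / 2) /\ notint ((z + 1) / 2).
Proof.
move=> hz; split=> n; apply/eqP => E.
  have := hz (2 * n); rewrite rmorphM /= => /eqP; apply.
  by have -> : z + 2%:~R * n%:~R = 2 * (z / 2 + n%:~R) by [field]; rewrite E mulr0.
have := hz (2 * n + 1); rewrite rmorphD rmorphM /= => /eqP; apply.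
have -> : z + (2%:~R * n%:~R + 1%:~R) = 2 * ((z + 1) / 2 + n%:~R) by field.
by rewrite E mulr0.
Qed.

Lemma Tcot_dup z : notint z -> Tcot (z / 2) + Tcot ((z + 1) / 2) = 4%:R * Tcot z.
Proof.
move=> hz; have [h1 h2] := notint_half hz.
rewrite /Tcot; set u := cexp2ipi (z / 2).
have E1 : cexp2ipi ((z + 1) / 2) = - u.
  by rewrite mulrDl e2D mul1r e2_half mulrN1.
have E2 : cexp2ipi z = u ^+ 2.
  by rewrite expr2 -e2D; congr cexp2ipi; field.
have u1 := notint_e2 h1; have u2 := notint_e2 h2.
rewrite E1 in u2 *; rewrite E2 opprK -mulrDr ratP2_dup //; first by ring.
by rewrite -eqr_oppLR.
Qed.

Lemma notintD1 z : notint z -> notint (z + 1).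
Proof. by move=> hz n; rewrite -addrA -(rmorphD (intmul (1 : R[i])) 1 n); exact: hz. Qed.

Lemma inv_sq_tends z (s : R[i]) : cn s = 1 -> ctends (fun n => (z + s * n%:R) ^- 2) 0.
Proof.
move=> s1 e e0; have [B HB] := arch (cn z + 1 + e^-1).
exists B => n Bn; rewrite subr0 cnV cnX.
have nB : (B%:R : R) <= n%:R by rewrite ler_nat.
have h : 1 + e^-1 < cn (z + s * n%:R).
  by have := cn_lb (s * n%:R) (- z); rewrite opprK cnN cnM s1 mul1r cn_nat (addrC _ z); lra.
have ei : 0 < e^-1 by rewrite invr_gt0.
rewrite invf_plt ?posrE ?exprn_gt0 //; last by lra.
apply: lt_le_trans (_ : 1 + e^-1 <= _); first by lra.
apply: le_trans (ltW h) _; rewrite expr2 ler_peMl //; lra.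
Qed.

Lemma Ssum2D1 z : notint z -> Ssum 2 (z + 1) = Ssum 2 z.
Proof.
move=> hz; have hz1 := notintD1 hz.
have c1 := @Ssum_cvg R 2 z isT hz; have c2 := @Ssum_cvg R 2 (z + 1) isT hz1.
have l := ctendsB (inv_sq_tends z (cn1 R)) (@inv_sq_tends z (-1) ltac:(by rewrite cnN cn1)).
apply: ctends_unique c2 _; rewrite -[Ssum 2 z]addr0 -(subrr 0).
apply: ctends_ext (ctendsD c1 l) => n; rewrite mul1r mulN1r.
elim: n => [|n IH]; first by rewrite /psum !big_ord0 add0r subr0 addr0 subrr.
rewrite !psumS -IH /Sterm !NegzE !rmorphN /= -!pmulrn -!natr1.
rewrite (_ : z + 1 + n%:R = z + (n%:R + 1)); last by ring.
rewrite (_ : z + 1 - (n%:R + 1) = z - n%:R); last by ring.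
ring.
Qed.

Lemma Ssum2_dup z : notint z -> Ssum 2 (z / 2) + Ssum 2 ((z + 1) / 2) = 4%:R * Ssum 2 z.
Proof.
move=> hz; have [h1 h2] := notint_half hz.
have c0 := ctendsZ 4%:R (@Ssum_cvg R 2 z isT hz).
have c1 := @Ssum_cvg R 2 _ isT h1; have c2 := @Ssum_cvg R 2 _ isT h2.
apply: ctends_unique (ctendsD c1 c2) _ => e e0; have [B HB] := c0 e e0.
exists B => n Bn; have := HB n.*2 ltac:(by rewrite -addnn (leq_trans Bn) // leq_addr).
congr (cn (_ - _) < e); elim: n {Bn} => [|n IH]; first by rewrite /psum !big_ord0 mulr0 addr0.
rewrite doubleS !psumS !mulrDr IH /Sterm !NegzE !rmorphN /= -!pmulrn.
rewrite -[n.+1%:R]natr1 -[n.*2.+2%:R]natr1 -[n.*2.+1%:R]natr1 -muln2 natrM.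
have sq (a b : R[i]) : a * 2 = b -> a ^- 2 = 4%:R * b ^- 2.
  move=> <-; have [->|a0] := eqVneq a 0; first by rewrite mul0r !expr0n /= invr0 mulr0.
  by field.
rewrite (sq (z / 2 + n%:R) (z + n%:R * 2)); last by field.
rewrite (sq (z / 2 - (n%:R + 1)) (z - (n%:R * 2 + 1 + 1))); last by field.
rewrite (sq ((z + 1) / 2 + n%:R) (z + (n%:R * 2 + 1))); last by field.
rewrite (sq ((z + 1) / 2 - (n%:R + 1)) (z - (n%:R * 2 + 1))); last by field.
ring.
Qed.

(** With |Re z| <= 1/2 the real part gives |z + n| >= (n + 1)/4 for n >= 1 and |z - (j + 1)| >= (j +
    1)/2. Thus each pair is at most (4^2 + 2^2) (j + 1)^-2, and the inverse squares sum to at most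
    2. *)
Lemma Ssum2_near0 z : notint z -> `|complex.Re z| <= 2^-1 -> cn (Ssum 2 z - z ^- 2) <= 40.
Proof.
move=> hz; rewrite ler_norml => /andP[r1 r2].
have c := ctendsB (@Ssum_cvg R 2 z isT hz) (ctends_cst (z ^- 2)).
pose t j := (if j == 0%N then 0 else Sterm 2 z (Posz j)) + Sterm 2 z (Negz j).
apply: ctends_le c; exists 1%N => -[//|n] _.
have -> : psum (fun j => Sterm 2 z (Posz j) + Sterm 2 z (Negz j)) n.+1 - z ^- 2 = psum t n.+1.
  rewrite !psumSl {1}/t /= add0r (_ : Sterm 2 z 0 = z ^- 2); last by rewrite /Sterm addr0.
  rewrite -[X in _ = _ + X]/(psum (fun k => Sterm 2 z (Posz k.+1) + Sterm 2 z (Negz k.+1)) n).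
  ring.
have inv_sq (a : R[i]) (d : R) j : 0 < d -> d * j.+1%:R <= cn a -> cn (a ^- 2) <= d ^- 2 * j.+1%:R ^- 2.
  move=> d0 h; have mp : 0 < j.+1%:R :> R by rewrite ltr0n.
  have ca : 0 < cn a by apply: lt_le_trans h; rewrite mulr_gt0.
  rewrite cnV cnX -invfM lef_pV2 ?posrE ?mulr_gt0 ?exprn_gt0 //.
  by rewrite -exprMn lerXn2r ?nnegrE ?cn_ge0 ?mulr_ge0 ?(ltW d0).
have tb j : cn (t j) <= 20 * j.+1%:R ^- 2.
  have e1 : (j.+1%:R : R) = j%:R + 1 by rewrite -natr1.
  have j0 : 0 <= j%:R :> R by [].
  have -> : (20 : R) = (4^-1) ^- 2 + (2^-1) ^- 2 by rewrite !exprVn !invrK; ring.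
  rewrite mulrDl; apply: le_trans (cnD _ _) _; apply: lerD.
    case: j e1 j0 => [|j] e1 j0 /=; first by rewrite cn0 mulr_ge0 // invr_ge0 exprn_ge0 // invr_ge0.
    apply: inv_sq; first by rewrite invr_gt0.
    apply: le_trans (le_trans (ler_norm _) (Re_le_cn _)).
    rewrite ReD -pmulrn -(rmorph_nat (real_complex R)) /= e1.
    have : 1 <= j.+1%:R :> R by rewrite ler1n.
    lra.
  apply: inv_sq; first by rewrite invr_gt0.
  rewrite -cnN; apply: le_trans (le_trans (ler_norm _) (Re_le_cn _)).
  have -> : - (z + (Negz j)%:~R) = - z + (j.+1%:R)%:C.
    by rewrite opprD NegzE rmorphN opprK rmorph_nat.
  rewrite ReD /= e1.
  have -> : complex.Re (- z) = - complex.Re z by case: (z).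
  lra.
apply: le_trans (cn_sum _ _ _) _; apply: le_trans (_ : \sum_(j < n.+1) 20 * j.+1%:R ^- 2 <= _).
  by apply: ler_sum => j _; exact: tb.
have -> : (40 : R) = 20 * 2 by ring.
by rewrite -mulr_sumr ler_wpM2l // sum_inv_sq.
Qed.

Lemma e2_holo z : holo_at (@cexp2ipi R) z.
Proof. by exists 1 => // w _; exact: e2_cdiff. Qed.

Lemma e2_near0 : exists2 r : R, 0 < r & forall z, z != 0 -> cn z < r -> notint z.
Proof.
exists 1 => // z z0 z1 n; rewrite -cn_gt0.
have [->|n0] := eqVneq n 0; first by rewrite addr0 cn_gt0.
have := cn_lb (n%:~R : R[i]) (- z); rewrite opprK cnN absz_cn (addrC _ z).
have : 1 <= `|n|%N%:R :> R by rewrite ler1n absz_gt0.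
lra.
Qed.

(* The cotangent-type function is even, so its double pole at 0 has no residue. *)
Lemma Tcot_near0 : exists r B : R, 0 < r /\
  forall z, z != 0 -> cn z < r -> cn (Tcot z - z ^- 2) <= B.
Proof.
pose e := @cexp2ipi R; pose v z := tquo 0 e z / twopii R.
have t0 := twopii_neq0 R.
have eh : holo_at e 0 := e2_holo 0.
have v0 : v 0 = 1.
  have de : cderiv e 0 = twopii R.
    by rewrite (cderivE (cder_e2 0)) e20 mulr1.
  by rewrite /v /tquo /dquo eqxx de mulfV.
have vh : holo_at v 0.
  by apply: holo_atM; [exact: holo_at_tquo|exact: holo_at_cst].
have vE z : 1 - e z = - twopii R * z * v z.
  have := tquoE e 0 z; rewrite subr0 /e e20 => ->.
  by rewrite /v; field.
pose p z := e z / v z ^+ 2.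
have v0n : v 0 != 0 by rewrite v0 oner_eq0.
have ph : holo_at p 0.
  apply: holo_atM => //; apply: holo_atV; first exact: holo_atX.
  by rewrite v0 expr1n oner_eq0.
have p0 : p 0 = 1 by rewrite /p v0 /e e20 expr1n divr1.
have [r1 r10 H1] := e2_near0.
have [r2 r20 H2] := ccont_neq0 (holo_at_cont vh) v0n.
have pT z : z != 0 -> cn z < r2 -> Tcot z = p z / z ^+ 2.
  move=> z0 zr; have vz : v z != 0 by apply: H2; rewrite subr0.
  rewrite /Tcot -/(e z) vE /p; field.
  by rewrite t0 z0 vz.
have Teven z : notint z -> Tcot (- z) = Tcot z.
  move=> hz; have e1 := notint_e2 hz; have e0 := e2_neq0 z.
  rewrite /Tcot e2N; congr (_ * _); field.
  by rewrite e0 /= !subr_eq0 e1 eq_sym e1.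
have pev z : cn z < Num.min r1 r2 -> p (- z) = p z.
  rewrite lt_min => /andP[z1 z2]; have [->|z0] := eqVneq z 0; first by rewrite oppr0.
  have := Teven z (H1 z z0 z1); rewrite !pT ?oppr_eq0 ?cnN // sqrrN => /mulIf; apply.
  by rewrite invr_eq0 expf_neq0.
pose q := tquo 0 p; have qh : holo_at q 0 by exact: holo_at_tquo.
have qE z : p z = 1 + q z * z by have := tquoE p 0 z; rewrite p0 subr0.
have q0 : q 0 = 0.
  have N0 : holo_at (fun z : R[i] => - z) 0.
    by exists 1 => // w _; apply: cdiffN; exact: cdiff_id.
  have cN : ccont (fun z => q z + q (- z)) 0.
    apply: ccontD; first exact: holo_at_cont.
    apply: (@ccont_comp _ (fun z => - z)); first exact: holo_at_cont.
    by rewrite oppr0; exact: holo_at_cont.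
  have m0 : 0 < Num.min r1 r2 by rewrite lt_min r10.
  have := @ccont_unique R (fun z => q z + q (- z)) (fun=> 0) 0 _ m0 _ cN (ccont_cst 0 0).
  rewrite oppr0 => H; have {H} : q 0 + q 0 = 0.
    apply: H => z z0; rewrite addr0 => zr.
    have := pev z zr; rewrite !qE => /addrI E.
    by apply: (mulIf z0); rewrite mul0r mulrDl -E mulrN addNr.
  by rewrite -mulr2n => /eqP; rewrite mulrn_eq0 /= => /eqP.
have [r3 [B [r30 B0 _ HB]]] := holo_at_bound (holo_at_tquo qh).
exists (Num.min r2 r3), B; split; first by rewrite lt_min r20.
move=> z z0; rewrite lt_min => /andP[z2 z3].
rewrite pT // qE (_ : q z = tquo 0 q z * z); last first.
  by have := tquoE q 0 z; rewrite q0 subr0 add0r.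
rewrite (_ : _ - _ = tquo 0 q z); last by field.
by apply: HB; rewrite subr0.
Qed.

Definition Dcot z : R[i] := Ssum 2 z - Tcot z.

Lemma Ssum2_cont z : notint z -> ccont (Ssum 2) z.
Proof. by move=> hz; apply: cder_cont; exact: (@Ssum_der R 1 z isT hz). Qed.

Lemma Tcot_cont z : notint z -> ccont Tcot z.
Proof.
move=> hz; apply: ccontM; first exact: ccont_cst.
have ec : ccont (@cexp2ipi R) z by apply: cdiff_cont; exact: e2_cdiff.
apply: ccontM => //; apply: ccontV.
  by apply: ccontX; apply: ccontB => //; exact: ccont_cst.
by rewrite expf_neq0 // subr_eq0 eq_sym notint_e2.
Qed.

(** Both functions behave like z^-2 at 0 up to a bounded error, so their difference is locally
    bounded at every point of the box; [box_ind] makes the bound global. *)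
Lemma Dcot_box (Y : R) : 0 < Y -> exists M : R, forall z, notint z ->
  `|complex.Re z| <= 2^-1 -> `|complex.Im z| <= Y -> cn (Dcot z) <= M.
Proof.
move=> Y0; pose P x y s := exists M : R, forall a b, x <= a <= x + 1 * s ->
  y <= b <= y + (2 * Y) * s -> notint (Complex a b) -> cn (Dcot (Complex a b)) <= M.
have Y2 : 0 < 2 * Y by rewrite mulr_gt0.
have : P (- 2^-1) (- Y) 1.
  apply: (box_ind ltr01 Y2).
    move=> x y s s0 [M1 H1] [M2 H2] [M3 H3] [M4 H4] _ _ _ _.
    exists (Num.max (Num.max M1 M2) (Num.max M3 M4)) => a b.
    move: H1 H2 H3 H4; set u := 1 * (s / 2); set v := 2 * Y * (s / 2).
    have Lu : 1 * s = u + u by rewrite /u; field.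
    have Hv : 2 * Y * s = v + v by rewrite /v; field.
    rewrite Lu Hv !addrA => H1 H2 H3 H4 /andP[a1 a2] /andP[b1 b2] ni; rewrite !le_max.
    have [au|au] := leP a (x + u); have [bv|bv] := leP b (y + v).
    - by rewrite H1 ?a1 ?b1.
    - by rewrite H3 ?a1 ?(ltW bv) ?orbT.
    - by rewrite H2 ?b1 ?(ltW au) ?orbT.
    - by rewrite H4 ?(ltW au) ?(ltW bv) ?orbT.
  move=> p q hp hq.
  have key : exists r B : R, 0 < r /\ forall w, cn (w - Complex p q) < r -> notint w ->
      `|complex.Re w| <= 2^-1 -> cn (Dcot w) <= B.
    have [/eqP pq0|pq0] := boolP (Complex p q == 0).
      have [r [B [r0 HB]]] := Tcot_near0; exists r, (40 + B); split=> // w.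
      rewrite pq0 subr0 => wr ni re; have w0 : w != 0 by have := ni 0; rewrite addr0.
      rewrite (_ : Dcot w = (Ssum 2 w - w ^- 2) - (Tcot w - w ^- 2)); last by rewrite /Dcot; ring.
      by apply: le_trans (cnB _ _) _; apply: lerD; [exact: Ssum2_near0|exact: HB].
    have ni : notint (Complex p q).
      move=> n; have [->|n0] := eqVneq n 0; first by rewrite addr0.
      rewrite -cn_gt0; apply: lt_le_trans (Re_le_cn _); rewrite ReD intC /= normr_gt0.
      apply/eqP => E; have : 1 <= `|n%:~R : R|.
        by rewrite -intr_norm ler1z -gtz0_ge1 normr_gt0.
      rewrite (_ : n%:~R = - p) ?normrN; last by apply/eqP; rewrite -addr_eq0 addrC; apply/eqP.
      have : `|p| <= 2^-1 by rewrite ler_norml; lra.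
      lra.
    have dc : ccont Dcot (Complex p q) by apply: ccontB; [exact: Ssum2_cont|exact: Tcot_cont].
    have [d d0 Hd] := dc 1 ltr01; exists d, (cn (Dcot (Complex p q)) + 1); split=> // w /Hd h _ _.
    by have := cn_lb (Dcot w) (Dcot (Complex p q)); lra.
  have [r [B [r0 HB]]] := key; exists (r / (1 + 2 * Y)); first by rewrite divr_gt0 // addr_gt0.
  move=> x y s /andP[s0 sr] hx hy x1 x2 y1 y2; exists B => a b ha hb ni.
  have ss : 0 <= 1 * s by rewrite mul1r ltW.
  have Ys : 0 <= 2 * Y * s by rewrite mulr_ge0 ?ltW.
  apply: HB => //; last by rewrite /= ler_norml; lra.
  apply: le_lt_trans (@cn_Complex_rect R x (x + 1 * s) y (y + 2 * Y * s) _ _ a b p q ha hb hx hy) _.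
  - by rewrite lerDl.
  - by rewrite lerDl.
  have -> : x + 1 * s - x + (y + 2 * Y * s - y) = s * (1 + 2 * Y) by ring.
  by rewrite -ltr_pdivlMr // addr_gt0.
move=> [M HM]; exists M => z ni; rewrite !ler_norml => /andP[h1 h2] /andP[h3 h4].
have ez : z = Complex (complex.Re z) (complex.Im z) by case: (z).
by rewrite ez; apply: HM; rewrite -?ez //; lra.
Qed.

Lemma Dcot_periodic z (n : int) : notint z -> notint (z + n%:~R) /\ Dcot (z + n%:~R) = Dcot z.
Proof.
have D1 w : notint w -> notint (w + 1) /\ Dcot (w + 1) = Dcot w.
  by move=> hw; split; [exact: notintD1|rewrite /Dcot Ssum2D1 // TcotD1].
have Dn w (k : nat) : notint w -> notint (w + k%:R) /\ Dcot (w + k%:R) = Dcot w.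
  move=> hw; elim: k => [|k [IH1 IH2]]; first by rewrite addr0.
  by have [h1 h2] := D1 _ IH1; rewrite -natr1 addrA h2.
move=> hz; have hzn : notint (z + n%:~R).
  by move=> m; rewrite -addrA -(rmorphD (intmul (1 : R[i])) n m); exact: hz.
split=> //; case: n hzn => n hzn; first by have [] := Dn z n hz.
have [_ <-] := Dn _ n.+1 hzn.
by rewrite NegzE rmorphN /= subrK.
Qed.

(** Herglotz's trick. The difference D has period 1, is bounded on each strip |Im| <= Y, and
    satisfies D(z/2) + D((z + 1)/2) = 4 D(z). Halving preserves the strip, so any bound M for D
    improves to M/2, and D = 0. *)
Theorem Herglotz z : notint z -> Ssum 2 z = Tcot z.
Proof.
move=> hz; pose Y := `|complex.Im z| + 1.
have Y0 : 0 < Y by rewrite ltr_wpDl.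
have [M HM] := Dcot_box Y0.
have strip w : notint w -> `|complex.Im w| <= Y -> cn (Dcot w) <= M.
  move=> hw hY; pose n := Num.floor (complex.Re w + 2^-1).
  have [n1 n2] : (n%:~R : R) <= complex.Re w + 2^-1 /\ complex.Re w + 2^-1 < n%:~R + 1.
    by have := floor_itv (complex.Re w + 2^-1); rewrite /n rmorphD /= => /andP[].
  have [h1 <-] := Dcot_periodic (- n) hw; apply: HM => //.
    by rewrite ReD rmorphN /= intC /= ler_norml; lra.
  by rewrite ImD rmorphN /= intC /= oppr0 addr0.
have M0 : 0 <= M by apply: le_trans (cn_ge0 _) (strip z hz _); rewrite /Y lerDl.
have halve k w : notint w -> `|complex.Im w| <= Y -> cn (Dcot w) <= M * (2^-1) ^+ k.
  elim: k w => [|k IH] w hw hY; first by rewrite mulr1; exact: strip.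
  have [h1 h2] := notint_half hw.
  have E : Dcot w = (Dcot (w / 2) + Dcot ((w + 1) / 2)) / 4%:R.
    apply: (mulIf (_ : 4%:R != 0 :> R[i])); first by rewrite pnatr_eq0.
    rewrite divfK ?pnatr_eq0 // mulrC /Dcot mulrBr -Ssum2_dup // -Tcot_dup //; ring.
  have im2 v : complex.Im (v / 2 : R[i]) = complex.Im v / 2 by exact: Im_divn.
  have hY2 v : complex.Im v = complex.Im w -> `|complex.Im (v / 2 : R[i])| <= Y.
    by move=> e; rewrite im2 e normrM [X in _ * X]ger0_norm ?invr_ge0 //; have := normr_ge0 (complex.Im w); lra.
  have b1 := IH _ h1 (hY2 w erefl).
  have b2 := IH _ h2 (hY2 (w + 1) ltac:(by rewrite ImD /= addr0)).
  rewrite E cnM cnV cn_nat ler_pdivrMr // exprSr.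
  apply: le_trans (cnD _ _) _; apply: le_trans (lerD b1 b2) _.
  by rewrite le_eqVlt; apply/orP; left; apply/eqP; field.
apply/eqP; rewrite -subr_eq0; apply/eqP; apply: cn_small => e e0.
have [k Hk] := half_pow_small (divr_gt0 e0 (ltr_wpDl M0 ltr01)).
apply: le_trans (halve k z hz _) _; first by rewrite /Y lerDl.
have h2 : (2^-1) ^+ k * (M + 1) < e by rewrite -ltr_pdivlMr // ltr_wpDl.
apply: le_trans (ltW h2); rewrite mulrC; apply: ler_wpM2l; last lra.
by rewrite exprn_ge0 // invr_ge0.
Qed.

End Herglotz.

(** * Row sums of higher weight and even zeta values *)

Section EisensteinRows.
Variable R : realType.
Implicit Types (z w u : R[i]).

(** Horner evaluation of a coefficient list, constant term first. Explicit lists let [field]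
    normalise each derivative of [rat]. *)
Fixpoint hr (s : seq R[i]) u : R[i] := if s is a :: s' then hr s' u * u + a else 0.
Fixpoint dhr (s : seq R[i]) u : R[i] := if s is a :: s' then dhr s' u * u + hr s' u else 0.

Lemma cder_hr s u : cder (hr s) u (dhr s u).
Proof.
elim: s => [|a s IH] /=; first exact: cder_cst.
have := cderD (cderM IH (cder_id u)) (cder_cst a u).
by rewrite addr0 mulr1.
Qed.

Definition rat s n u := hr s u / (1 - u) ^+ n.

Lemma cder_rat s n u : u != 1 ->
  cder (rat s n.+1) u ((dhr s u * (1 - u) + n.+1%:R * hr s u) / (1 - u) ^+ n.+2).
Proof.
move=> u1; have u0 : 1 - u != 0 by rewrite subr_eq0 eq_sym.
have h1 : cder (fun v => 1 - v) u (-1).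
  by have := cderB (cder_cst 1 u) (cder_id u); rewrite sub0r.
have h2 := cderV (cderX n h1) (expf_neq0 n.+1 u0).
have := cderM (cder_hr s u) h2.
rewrite (_ : _ + _ = (dhr s u * (1 - u) + n.+1%:R * hr s u) / (1 - u) ^+ n.+2) //.
rewrite mulrN1 opprK [in RHS]exprS; move: (expf_neq0 n u0).
by rewrite !exprS; move: ((1 - u) ^+ n) => x x0; field; rewrite x0 u0.
Qed.

Definition esr (l : seq nat) : seq R[i] := [seq n%:R | n <- l].

(** Differentiation of the formula of weight k: the left side becomes -k times the sum of weight k +
    1, and on the right d/dz acts as 2 pi i u d/du. *)
Lemma Ssum_step k c s n : (1 < k)%N ->
  (forall z, notint z -> Ssum k z = c * rat s n.+1 (cexp2ipi z)) -> forall z, notint z ->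
  Ssum k.+1 z = - (c * twopii R / k%:R) * (cexp2ipi z *
    ((dhr s (cexp2ipi z) * (1 - cexp2ipi z) + n.+1%:R * hr s (cexp2ipi z)) / (1 - cexp2ipi z) ^+ n.+2)).
Proof.
case: k => // k k1 H z hz; have [r r0 Hr] := notint_open hz.
have d1 : cder (Ssum k.+1) z (- k.+1%:R * Ssum k.+2 z) by exact: Ssum_der.
have d2 := cderZ c (cder_comp (cder_e2 z) (cder_rat s n (notint_e2 hz))).
have d3 := cder_near r0 (fun w wr => H w (Hr w wr)) d1.
have E := cder_unique d3 d2.
have k0 : k.+1%:R != 0 :> R[i] by rewrite pnatr_eq0.
apply: (mulfI (_ : - k.+1%:R != 0 :> R[i])); first by rewrite oppr_eq0.
rewrite E; move: (_ / (1 - _) ^+ n.+2) => X; field.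
by rewrite nat1r k0.
Qed.

Lemma Ssum2E z : notint z -> Ssum 2 z = twopii R ^+ 2 * rat (esr [:: 0; 1]%N) 2 (cexp2ipi z).
Proof. by move=> hz; rewrite Herglotz // /Tcot /rat /=; congr (_ * (_ / _)); ring. Qed.

(** The numerators here and below are u times the Eulerian polynomials 1 + u, 1 + 4u + u^2, and so
    on, as they arise from iterating u d/du on u/(1 - u)^2. *)
Lemma Ssum3E z : notint z -> Ssum 3 z =
  - (twopii R ^+ 3 / 2%:R) * rat (esr [:: 0; 1; 1]%N) 3 (cexp2ipi z).
Proof.
move=> hz; have u0 : 1 - cexp2ipi z != 0 by rewrite subr_eq0 eq_sym notint_e2.
rewrite (Ssum_step _ Ssum2E) // /rat /=; move: u0; move: (cexp2ipi z) => u u0.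
by field.
Qed.

Lemma Ssum4E z : notint z -> Ssum 4 z =
  twopii R ^+ 4 / 6%:R * rat (esr [:: 0; 1; 4; 1]%N) 4 (cexp2ipi z).
Proof.
move=> hz; have u0 : 1 - cexp2ipi z != 0 by rewrite subr_eq0 eq_sym notint_e2.
rewrite (Ssum_step _ Ssum3E) // /rat /=; move: u0; move: (cexp2ipi z) => u u0.
by field.
Qed.

Lemma Ssum5E z : notint z -> Ssum 5 z =
  - (twopii R ^+ 5 / 24%:R) * rat (esr [:: 0; 1; 11; 11; 1]%N) 5 (cexp2ipi z).
Proof.
move=> hz; have u0 : 1 - cexp2ipi z != 0 by rewrite subr_eq0 eq_sym notint_e2.
rewrite (Ssum_step _ Ssum4E) // /rat /=; move: u0; move: (cexp2ipi z) => u u0.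
by field.
Qed.

Lemma Ssum6E z : notint z -> Ssum 6 z =
  twopii R ^+ 6 / 120%:R * rat (esr [:: 0; 1; 26; 66; 26; 1]%N) 6 (cexp2ipi z).
Proof.
move=> hz; have u0 : 1 - cexp2ipi z != 0 by rewrite subr_eq0 eq_sym notint_e2.
rewrite (Ssum_step _ Ssum5E) // /rat /=; move: u0; move: (cexp2ipi z) => u u0.
by field.
Qed.

Definition Zsum k : R[i] := zsum (fun n => if n == 0 then 0 else (n%:~R : R[i]) ^- k).

Lemma notint_halfR : notint (2^-1 : R[i]).
Proof.
move=> n; apply/eqP => E.
have : ((1 + 2 * n)%:~R : R[i]) = 0.
  by rewrite rmorphD rmorphM /= -(mulr0 2) -E; field.
by move=> /eqP; rewrite intr_eq0 => /eqP; lia.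
Qed.

(** [Zsum k] is 2 zeta(k). The sum at z = 1/2 runs over the odd integers up to the factor 2^k, and
    removing the even terms leaves the factor 1 - 2^-k. As e^(2 pi i z) = -1 at 1/2, the closed
    forms above then evaluate zeta(4) and zeta(6). *)
Lemma Zsum_facts k : (1 < k)%N -> ~~ odd k ->
  ctends (psum (fun j => (if Posz j == 0 then 0 else ((Posz j)%:~R : R[i]) ^- k) + (Negz j)%:~R ^- k)) (Zsum k) /\
  (2 ^+ k - 1) * Zsum k = Ssum k (2^-1).
Proof.
move=> k1 ke; pose a j : R[i] := j.+1%:R ^- k.
have ab : summ_by a (fun j => j.+1%:R ^- 2) 2.
  split=> [j|n]; last exact: sum_inv_sq.
  rewrite /a cnV cnX cn_nat lef_pV2 ?posrE ?exprn_gt0 ?ltr0n //.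
  by rewrite ler_weXn2l // ler1n.
have cA := summ_cvg ab; set A := csum a in cA.
have negX (x : R[i]) : (- x) ^+ k = x ^+ k by rewrite exprNn -signr_odd (negbTE ke) mul1r.
have cZ : ctends (psum (fun j => (if Posz j == 0 then 0 else ((Posz j)%:~R : R[i]) ^- k) + (Negz j)%:~R ^- k)) (A + A).
  apply/(ctends_shift _ _ 1).
  have cA1 := (ctends_shift _ _ 1).1 cA.
  apply: ctends_ext (ctendsD cA cA1) => n; rewrite !addn1.
  elim: n => [|n IH]; first by rewrite !psumS /psum !big_ord0 /a /= NegzE rmorphN negX !add0r.
  rewrite psumS [psum a n.+2]psumS [RHS]psumS -IH /a /= NegzE rmorphN negX /=.
  by rewrite -!pmulrn; ring.
split; first by rewrite /Zsum /zsum (csumP cZ).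
rewrite /Zsum /zsum (csumP cZ).
have cS := @Ssum_cvg R k _ k1 notint_halfR.
have p2 : (2 : R[i]) ^+ k != 0 by rewrite expf_neq0 // pnatr_eq0.
have odd_part : ctends (fun n => 2 * 2 ^+ k * (psum a n.*2 - 2 ^- k * psum a n)) (2 * 2 ^+ k * (A - 2 ^- k * A)).
  apply: ctendsZ; apply: ctendsB; last exact: ctendsZ.
  move=> e e0; have [B HB] := cA e e0; exists B => n Bn; apply: HB.
  by rewrite -addnn (leq_trans Bn) // leq_addr.
have E : Ssum k (2^-1) = 2 * 2 ^+ k * (A - 2 ^- k * A).
  apply: ctends_unique cS _; apply: ctends_ext odd_part => n.
  elim: n => [|n IH]; first by rewrite /psum !big_ord0 mulr0 subrr mulr0.
  rewrite [RHS]psumS -IH doubleS [psum a n.*2.+2]psumS [psum a n.*2.+1]psumS [psum a n.+1]psumS.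
  have h1 : Sterm k (2^-1 : R[i]) (Posz n) = 2 ^+ k * (n.*2.+1%:R) ^- k.
    have -> : (n.*2.+1%:R : R[i]) = 2 * (2^-1 + n%:R).
      by rewrite -natr1 -muln2 natrM; field.
    by rewrite /Sterm -pmulrn exprMn invfM mulrA mulfV // mul1r.
  have h2 : Sterm k (2^-1 : R[i]) (Negz n) = 2 ^+ k * (n.*2.+1%:R) ^- k.
    have -> : (n.*2.+1%:R : R[i]) = 2 * - (2^-1 + (Negz n)%:~R).
      by rewrite NegzE rmorphN /= -natr1 -muln2 natrM -pmulrn -natr1; field.
    by rewrite /Sterm exprMn negX invfM mulrA mulfV // mul1r.
  have h3 : a n.*2.+1 = 2 ^- k * a n.
    rewrite /a (_ : (n.*2.+2%:R : R[i]) = 2 * n.+1%:R) ?exprMn ?invfM //.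
    by rewrite -doubleS -muln2 natrM mulrC.
  rewrite h1 h2 h3 -[n.*2.+1%:R ^- k]/(a n.*2); move: (a n.*2) (a n) => x y; ring.
by rewrite E; field.
Qed.

Lemma Zsum4 : Zsum 4 = twopii R ^+ 4 / 720%:R.
Proof.
have [_] := @Zsum_facts 4 isT isT; rewrite Ssum4E; last exact: notint_halfR.
rewrite e2_half /rat /= => E.
apply: (mulfI (_ : 2 ^+ 4 - 1 != 0 :> R[i])).
  by rewrite (_ : _ - _ = 15%:R) ?pnatr_eq0 //; ring.
by rewrite E; field.
Qed.

Lemma Zsum6 : Zsum 6 = - (twopii R ^+ 6 / (120%:R * 252%:R)).
Proof.
have [_] := @Zsum_facts 6 isT isT; rewrite Ssum6E; last exact: notint_halfR.
rewrite e2_half /rat /= => E.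
apply: (mulfI (_ : 2 ^+ 6 - 1 != 0 :> R[i])).
  by rewrite (_ : _ - _ = 63%:R) ?pnatr_eq0 //; ring.
by rewrite E; field.
Qed.

End EisensteinRows.

(** * Unconditional lattice sums *)

Section Unconditional.
Variable R : realType.

Definition usum (I : choiceType) (x : I -> R[i]) (S : R[i]) :=
  forall e : R, 0 < e -> exists A : {fset I}, forall B : {fset I}, (A `<=` B)%fset ->
    cn (\sum_(i <- B) x i - S) < e.

Lemma usum_sum (I : choiceType) (x : I -> R[i]) S : usum x S -> summability.sum x = S.
Proof.
move=> h; have pf := @totally_filter I.
apply: (@cvg_lim R[i]); first exact: norm_hausdorff.
apply/cvgrPdist_lt => -[e b]; rewrite ltcE /= => /andP[/eqP -> e0].
have [A HA] := h e e0; exists A => // B /= AB.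
rewrite distrC normcE -[e +i* 0]/(e%:C) ltcR /partial_sum.
rewrite /partial_sum.
have -> : (\sum_(i : B) x (val i)) = \sum_(i <- B) x i by rewrite big_seq_fsetE.
exact: HA.
Qed.

Lemma usum_reindex (I : choiceType) (x : I -> R[i]) S (f g : I -> I) :
  cancel f g -> cancel g f -> usum x S -> usum (fun i => x (f i)) S.
Proof.
move=> fK gK h e e0; have [A HA] := h e e0; exists (g @` A)%fset => B AB.
have := HA (f @` B)%fset; rewrite big_imfset /=; last by move=> i j _ _; exact: can_inj fK _ _.
apply; apply/fsubsetP => i iA; apply/imfsetP; exists (g i) => //=.
by apply: (fsubsetP AB); apply/imfsetP; exists i.
Qed.

Definition zr (n : nat) : seq int := [seq Posz k | k <- iota 0 n] ++ [seq Negz k | k <- iota 0 n].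

Definition zidx (i : int) : nat := match i with Posz k => k | Negz k => k end.

Lemma mem_zr n i : (i \in zr n) = (zidx i < n)%N.
Proof.
rewrite mem_cat; case: i => k /=.
  rewrite mem_map ?mem_iota ?add0n ?orbF //; last by move=> a b [].
  by rewrite [X in _ || X](_ : _ = false) ?orbF //; apply/negP => /mapP[j _].
rewrite [X in X || _](_ : _ = false) ?orFb; last by apply/negP => /mapP[j _].
by rewrite mem_map ?mem_iota ?add0n //; move=> a b [].
Qed.

Lemma uniq_zr n : uniq (zr n).
Proof.
rewrite cat_uniq !map_inj_uniq ?iota_uniq ?andbT /=; try by move=> a b [].
by apply/hasPn => _ /mapP[j _ ->]; apply/negP => /mapP[k _].
Qed.

Lemma sum_zr (V : nmodType) (u : int -> V) n :
  \sum_(i <- zr n) u i = \sum_(k < n) (u (Posz k) + u (Negz k)).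
Proof.
rewrite big_cat !big_map big_split /=; congr (_ + _).
  by rewrite -(big_mkord xpredT (fun k => u (Posz k))) /index_iota subn0.
by rewrite -(big_mkord xpredT (fun k => u (Negz k))) /index_iota subn0.
Qed.

(** A weight of cubic decay that telescopes: summing 2 W over one index gives at most (a + 1)^-2,
    which is again summable over the other. *)
Definition W (a : nat) : R := (a.+1%:R * a.+2%:R * a.+3%:R)^-1.

Lemma W_ge0 a : 0 <= W a. Proof. by rewrite invr_ge0 !mulr_ge0. Qed.

Lemma sum_W a n : \sum_(k < n) 2 * W (a + k) <= a.+1%:R ^- 2.
Proof.
have pos b : 0 < b.+1%:R :> R by rewrite ltr0n.
have h : \sum_(k < n) 2 * W (a + k) = (a.+1%:R * a.+2%:R)^-1 - ((a + n).+1%:R * (a + n).+2%:R)^-1.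
  elim: n => [|n IH]; first by rewrite big_ord0 addn0 subrr.
  rewrite big_ord_recr /= IH /W addnS.
  have e1 b : (b.+2%:R : R) = b.+1%:R + 1 by rewrite -natr1.
  have := pos (a + n)%N; have := pos (a + n).+1; have := pos (a + n).+2.
  rewrite !e1 -natr1; move: (((a + n).+1)%:R : R) => x x2 x1 x0.
  by field; rewrite !gt_eqF.
rewrite h; apply: le_trans (_ : (a.+1%:R * a.+2%:R)^-1 <= _).
  by rewrite gerBl invr_ge0 mulr_ge0.
by rewrite lef_pV2 ?posrE ?mulr_gt0 ?exprn_gt0 // expr2 ler_pM2l // ler_nat.
Qed.

Definition wt (p : int * int) : R := W (zidx p.1 + zidx p.2).

Definition bx a b : seq (int * int) := [seq (n, m) | m <- zr a, n <- zr b].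

Lemma mem_bx a b p : (p \in bx a b) = (zidx p.2 < a)%N && (zidx p.1 < b)%N.
Proof.
case: p => n m /=; rewrite -!mem_zr; apply/allpairsP/andP => [[[m' n'] /= [h1 h2 [-> ->]]] //|[h1 h2]].
by exists (m, n).
Qed.

Lemma uniq_bx a b : uniq (bx a b).
Proof. by apply: allpairs_uniq; rewrite ?uniq_zr // => -[m n] [m' n'] _ _ [-> ->]. Qed.

Lemma sum_bx (V : nmodType) (F : int * int -> V) a b :
  \sum_(p <- bx a b) F p = \sum_(m <- zr a) \sum_(n <- zr b) F (n, m).
Proof. by rewrite /bx big_allpairs_dep. Qed.

Definition Tot a : R := \sum_(p <- bx a a) wt p.

Lemma sum_sub (s t : seq (int * int)) (F : int * int -> R) : uniq s -> uniq t ->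
  {subset s <= t} -> (forall p, 0 <= F p) -> \sum_(p <- s) F p <= \sum_(p <- t) F p.
Proof.
move=> us ut st F0; rewrite [leRHS](bigID (mem s)) /=.
rewrite -[X in _ <= X + _]big_filter [X in _ <= X + _](perm_big s) /=; last first.
  apply: uniq_perm; rewrite ?filter_uniq // => p; rewrite mem_filter.
  by case ps : (p \in s) => //=; rewrite st.
by rewrite lerDl sumr_ge0.
Qed.

Lemma wt_ge0 p : 0 <= wt p. Proof. exact: W_ge0. Qed.

Lemma Tot_le a : Tot a <= 4.
Proof.
rewrite /Tot sum_bx; apply: le_trans (_ : \sum_(m <- zr a) (zidx m).+1%:R ^- 2 <= _).
  apply: ler_sum => m _; rewrite sum_zr /=; apply: le_trans (sum_W (zidx m) a).
  by apply: ler_sum => k _; rewrite /wt /= addnC mulr_natl mulr2n.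
rewrite sum_zr /= big_split /=; have -> : (4 : R) = 2 + 2 by ring.
by apply: lerD; exact: sum_inv_sq.
Qed.

Variables (F : int * int -> R[i]) (K : R).
Hypothesis K0 : 0 <= K.
Hypothesis FW : forall p, cn (F p) <= K * wt p.

Definition row m := zsum (fun n => F (n, m)).

Lemma row_summ m : summ_by (fun k => F (Posz k, m) + F (Negz k, m))
  (fun k => K * (2 * W (zidx m + k))) (K * (zidx m).+1%:R ^- 2).
Proof.
split=> [k|n]; last by rewrite -mulr_sumr ler_wpM2l // sum_W.
apply: le_trans (cnD _ _) _; rewrite [2 * _]mulr_natl mulr2n mulrDr addnC.
by apply: lerD; exact: FW.
Qed.

Lemma rows_summ : summ_by (fun k => row (Posz k) + row (Negz k))
  (fun k => K * (2 * k.+1%:R ^- 2)) (K * 4).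
Proof.
split=> [k|n]; last first.
  rewrite -mulr_sumr ler_wpM2l // -mulr_sumr; have -> : (4 : R) = 2 * 2 by ring.
  by rewrite ler_wpM2l // sum_inv_sq.
apply: le_trans (cnD _ _) _; rewrite [2 * _]mulr_natl mulr2n mulrDr.
by apply: lerD; [exact: (summ_le (row_summ (Posz k)))|exact: (summ_le (row_summ (Negz k)))].
Qed.

Lemma sum_dist (s : seq (int * int)) M : uniq s -> {subset bx M M <= s} ->
  cn (\sum_(p <- s) F p - \sum_(p <- bx M M) F p) <= K * (sup (range Tot) - Tot M).
Proof.
move=> us sub.
have [a ha] : exists a, {subset s <= bx a a}.
  elim: s {us sub} => [|p s [a IH]]; first by exists 0%N.
  exists (maxn a (maxn (zidx p.1).+1 (zidx p.2).+1)) => q; rewrite inE mem_bx => /predU1P[->|/IH].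
    by rewrite !leq_max !ltnSn !orbT.
  by rewrite mem_bx !leq_max => /andP[-> ->].
have part (V : zmodType) (G : int * int -> V) (t : seq (int * int)) : uniq t -> {subset bx M M <= t} ->
    \sum_(p <- t) G p - \sum_(p <- bx M M) G p = \sum_(p <- t | p \notin bx M M) G p.
  move=> ut subt; rewrite (bigID (mem (bx M M))) /= -[X in X + _ - _]big_filter (perm_big (bx M M)).
    by rewrite addrC addKr.
  apply: uniq_perm; rewrite ?filter_uniq ?uniq_bx // => p; rewrite mem_filter.
  by case ps : (p \in bx M M) => //=; rewrite subt.
rewrite part //; apply: le_trans (cn_sum _ _ _) _.
apply: le_trans (_ : K * \sum_(p <- s | p \notin bx M M) wt p <= _).
  by rewrite mulr_sumr; apply: ler_sum => p _; exact: FW.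
apply: ler_wpM2l => //.
apply: le_trans (_ : Tot a - Tot M <= _); last first.
  rewrite lerD2r; apply: ub_le_sup; last by exists a.
  by exists 4 => _ [b _ <-]; exact: Tot_le.
rewrite /Tot part ?uniq_bx //; last by move=> p /sub /ha.
rewrite -big_filter -[leRHS]big_filter; apply: sum_sub; rewrite ?filter_uniq ?uniq_bx //.
  by move=> p; rewrite !mem_filter => /andP[-> /ha ->].
exact: wt_ge0.
Qed.

(** Outside a large box the total weight is small, uniformly over finite sets, so both the finite
    partial sums and the iterated sum are close to the sum over that box. The definitions use
    unconditional sums, whereas q-expansions come from summing each row first. *)
Theorem usum_rows : usum F (zsum row).
Proof.
move=> e e0; have K1 : 0 < 2 * (K + 1) by rewrite mulr_gt0 // ltr_wpDl.
have [M HM] : exists M, sup (range Tot) - Tot M < e / (2 * (K + 1)).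
  have hs : has_sup (range Tot).
    by split; [exists (Tot 0), 0%N|exists 4 => _ [b _ <-]; exact: Tot_le].
  have [_ [M _ <-] h] := sup_adherent (divr_gt0 e0 K1) hs.
  by exists M; lra.
have small : K * (sup (range Tot) - Tot M) < e / 2.
  have t0 : 0 <= sup (range Tot) - Tot M.
    rewrite subr_ge0; apply: ub_le_sup; last by exists M.
    by exists 4 => _ [b _ <-]; exact: Tot_le.
  have h : (sup (range Tot) - Tot M) * (K + 1) < e / 2.
    rewrite -ltr_pdivlMr ?ltr_wpDl // -mulrA -invfM //.
  by apply: le_lt_trans h; rewrite mulrC ler_wpM2l // lerDl.
have lim : cn (zsum row - \sum_(p <- bx M M) F p) <= K * (sup (range Tot) - Tot M).
  have cr := ctendsB (summ_cvg rows_summ) (ctends_cst (\sum_(p <- bx M M) F p)).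
  apply: ctends_le cr; exists M => a Ma.
  have -> : psum (fun k => row (Posz k) + row (Negz k)) a = \sum_(m <- zr a) row m.
    by rewrite sum_zr.
  have rc : ctends (fun b => \sum_(m <- zr a) \sum_(n <- zr b) F (n, m)) (\sum_(m <- zr a) row m).
    elim: (zr a) => [|m s IH].
      by rewrite big_nil; apply: ctends_ext (ctends_cst 0) => n; rewrite big_nil.
    rewrite big_cons; have h := summ_cvg (row_summ m).
    apply: ctends_ext (ctendsD h IH) => b; rewrite big_cons; congr (_ + _).
    by rewrite sum_zr.
  apply: ctends_le (ctendsB rc (ctends_cst _)); exists M => b Mb.
  rewrite -sum_bx; apply: sum_dist; first exact: uniq_bx.
  move=> p; rewrite !mem_bx => /andP[h1 h2].
  by rewrite (leq_trans h1) // (leq_trans h2).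
exists (seq_fset tt (bx M M)) => B AB.
apply: le_lt_trans (cn_trans (\sum_(p <- bx M M) F p) _ _) _; rewrite (cnBC _ (zsum row)).
have : cn (\sum_(p <- B) F p - \sum_(p <- bx M M) F p) <= K * (sup (range Tot) - Tot M).
  apply: sum_dist; first exact: fset_uniq.
  by move=> p pb; apply: (fsubsetP AB); rewrite seq_fsetE.
lra.
Qed.

End Unconditional.

Section UsumAlgebra.
Variables (R : realType) (I : choiceType).
Implicit Types (x y : I -> R[i]).

Lemma usum_ext x y S : x =1 y -> usum x S -> usum y S.
Proof. by move=> xy; have -> : y = x by apply/funext => i; rewrite xy. Qed.

Lemma usumD x y S T : usum x S -> usum y T -> usum (fun i => x i + y i) (S + T).
Proof.
move=> hx hy e e0; have e2 : 0 < e / 2 by rewrite divr_gt0.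
have [A HA] := hx _ e2; have [B HB] := hy _ e2; exists (A `|` B)%fset => C; rewrite fsubUset => /andP[h1 h2].
rewrite big_split /= opprD addrACA; apply: le_lt_trans (cnD _ _) _.
by have := HA _ h1; have := HB _ h2; lra.
Qed.

Lemma usumZ x S (c : R[i]) : usum x S -> usum (fun i => c * x i) (c * S).
Proof.
move=> hx e e0; have c1 : 0 < cn c + 1 by rewrite ltr_wpDl // cn_ge0.
have [A HA] := hx _ (divr_gt0 e0 c1); exists A => B /HA.
rewrite ltr_pdivlMr // -mulr_sumr -mulrBr cnM => h.
by apply: le_lt_trans h; rewrite mulrC ler_wpM2l ?cn_ge0 // lerDl.
Qed.

Lemma usum_unique x S T : usum x S -> usum x T -> S = T.
Proof. by move=> /usum_sum <- /usum_sum <-. Qed.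

Lemma usum_point (i0 : I) (a : R[i]) : usum (fun i => if i == i0 then a else 0) a.
Proof.
move=> e e0; exists [fset i0]%fset => B; rewrite fsub1set => iB.
rewrite (big_rem i0) //= eqxx big1_seq ?addr0 ?subrr ?cn0 // => i.
rewrite andTb mem_rem_uniq ?fset_uniq // inE => /andP[h _].
by rewrite (negbTE h).
Qed.

End UsumAlgebra.

(** * Eisenstein series and the Weierstrass function as functions of the lattice *)

Section Lattice.
Variable R : realType.
Implicit Types (tau z w : R[i]) (p : int * int) (g : 'M[int]_2).

Lemma lattice_lb tau : Hp tau -> exists2 c : R, 0 < c &
  forall n m : int, c * (`|n| + `|m|)%N%:R <= cn (lattice_pt tau (n, m)).
Proof.
move=> y0; set y := complex.Im tau in y0.
have t0 := cn_ge0 tau; have D : 0 < y + 1 + cn tau by move: y0; rewrite /Hp => ?; lra.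
exists (y / (y + 1 + cn tau)) => [|n m]; first by rewrite divr_gt0.
have im : `|m|%N%:R * y <= cn (lattice_pt tau (n, m)).
  apply: le_trans (Im_le_cn _); rewrite /lattice_pt /= addrC Im_intD normrM (gtr0_norm y0).
  by rewrite -cnR -intC absz_cn.
have re : `|n|%N%:R <= cn (lattice_pt tau (n, m)) + `|m|%N%:R * cn tau.
  rewrite -!absz_cn -cnM.
  have -> : (n%:~R : R[i]) = lattice_pt tau (n, m) - m%:~R * tau by rewrite /lattice_pt /= addrK.
  exact: cnB.
rewrite mulrAC ler_pdivrMr // natrD; move: im re; move: (cn (lattice_pt _ _)) => X im re.
have m0 : 0 <= `|m|%N%:R :> R by [].
have h1 := ler_wpM2l (ltW y0) re; have h2 := ler_wpM2r t0 im.
nra.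
Qed.

Lemma zidx_absz (n : int) : (zidx n <= `|n|)%N.
Proof. by case: n => k //=; rewrite NegzE abszN /=. Qed.

(** With l = |n| + |m| >= 1 each factor a + i of the weight is at most (i + 1) l, and 2 * 3 * 4 =
    24. *)
Lemma wt_lb (n m : int) : (n, m) != (0, 0) -> ((`|n| + `|m|)%N%:R ^- 3 : R) <= 24 * wt R (n, m).
Proof.
move=> h; set l := (`|n| + `|m|)%N.
have l0 : (0 < l)%N.
  rewrite lt0n addn_eq0 !absz_eq0; apply: contra h => /andP[/eqP -> /eqP ->].
  by rewrite eqxx.
rewrite /wt /W /=; set a := (_ + _)%N.
have al : (a <= l)%N by rewrite leq_add // zidx_absz.
rewrite ler_pdivlMr ?mulr_gt0 ?ltr0n // mulrC ler_pdivrMr ?exprn_gt0 ?ltr0n //.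
rewrite -natrX -!natrM ler_nat.
apply: leq_trans (_ : (2 * l) * (3 * l) * (4 * l) <= _)%N; last first.
  by rewrite (_ : l ^ 3 = l * l * l)%N ?expnS ?expn0 //; lia.
by rewrite !leq_mul //; lia.
Qed.

Lemma lattice_pow_bound k tau : (2 < k)%N -> Hp tau -> exists2 K : R, 0 <= K & forall p,
  p != (0, 0) -> cn (lattice_pt tau p) ^- k <= K * wt R p.
Proof.
move=> k2 ht; have [c c0 Hc] := lattice_lb ht.
exists (c ^- k * 24) => [|[n m] h]; first by rewrite mulr_ge0 // invr_ge0 exprn_ge0 // ltW.
have l1 : 1 <= (`|n| + `|m|)%N%:R :> R.
  rewrite ler1n lt0n addn_eq0 !absz_eq0; apply: contra h => /andP[/eqP -> /eqP ->].
  by rewrite eqxx.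
rewrite -mulrA; apply: le_trans (ler_wpM2l _ (wt_lb h)); last by rewrite invr_ge0 exprn_ge0 // ltW.
have l0 : 0 < (`|n| + `|m|)%N%:R :> R by apply: lt_le_trans l1.
have cl := mulr_gt0 c0 l0.
apply: le_trans (_ : (c * (`|n| + `|m|)%N%:R) ^- k <= _).
  rewrite lef_pV2 ?posrE ?exprn_gt0 //; first by rewrite lerXn2r ?nnegrE ?cn_ge0 ?Hc // ltW.
  exact: lt_le_trans cl (Hc _ _).
rewrite exprMn invfM ler_wpM2l ?invr_ge0 ?exprn_ge0 ?(ltW c0) //.
by rewrite lef_pV2 ?posrE ?exprn_gt0 // ler_weXn2l.
Qed.

Lemma lattice_pt_neq0 tau p : Hp tau -> p != (0, 0) -> lattice_pt tau p != 0.
Proof.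
case: p => n m ht h; have [c c0 Hc] := lattice_lb ht; rewrite -cn_gt0.
apply: lt_le_trans (Hc n m); rewrite mulr_gt0 // ltr0n lt0n addn_eq0 !absz_eq0.
by apply: contra h => /andP[/eqP -> /eqP ->]; rewrite eqxx.
Qed.

Definition eis_term k tau p : R[i] := if p == (0, 0) then 0 else lattice_pt tau p ^- k.
Definition eis k tau : R[i] := lattice_sum tau (fun w => w ^- k).

Lemma eis_usum k tau : (2 < k)%N -> Hp tau ->
  usum (eis_term k tau) (eis k tau) /\ eis k tau = zsum (row (eis_term k tau)).
Proof.
move=> k2 ht; have [K K0 HK] := lattice_pow_bound k2 ht.
have h : usum (eis_term k tau) (zsum (row (eis_term k tau))).
  apply: (usum_rows K0) => p; rewrite /eis_term; case: eqP => [_|/eqP h].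
    by rewrite cn0 mulr_ge0 // wt_ge0.
  by rewrite cnV cnX HK.
by rewrite /eis /lattice_sum (usum_sum h).
Qed.

(* The right action of [g] on the coordinates of a lattice point. *)
Definition lact g p : int * int :=
  (p.1 * g 1 1 + p.2 * g 0 1, p.1 * g 1 0 + p.2 * g 0 0).
Definition lactV g p : int * int :=
  (p.1 * g 0 0 - p.2 * g 0 1, p.2 * g 1 1 - p.1 * g 1 0).

Lemma lactK g : SL2Z g -> cancel (lact g) (lactV g) /\ cancel (lactV g) (lact g).
Proof.
move=> /SL2Z_det d; split=> -[n m]; rewrite /lact /lactV /=; congr pair.
- by rewrite -[RHS]mulr1 -d; ring.
- by rewrite -[RHS]mulr1 -d; ring.
- by rewrite -[RHS]mulr1 -d; ring.
- by rewrite -[RHS]mulr1 -d; ring.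
Qed.

Lemma lact_eq0 g p : SL2Z g -> (lact g p == (0, 0)) = (p == (0, 0)).
Proof.
move=> hg; have [h _] := lactK hg.
have e : lact g (0, 0) = (0, 0) by rewrite /lact /= !mul0r addr0.
by rewrite -[in LHS]e (inj_eq (can_inj h)).
Qed.

Lemma lattice_moebius g tau p : SL2Z g -> Hp tau ->
  lattice_pt (moebius g tau) p = lattice_pt tau (lact g p) / mden g tau.
Proof.
move=> hg ht; have d0 := mden_neq0 hg ht; apply: (mulIf d0); rewrite mulfVK //.
rewrite /lattice_pt /lact /= /moebius mulrDl -mulrA mulfVK // /mden !rmorphD !rmorphM /=.
by ring.
Qed.

(** Unconditional summation allows the lattice points to be permuted by [lact g], after which every
    term carries the same factor. *)
Lemma eis_moebius k g tau : (2 < k)%N -> SL2Z g -> Hp tau ->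
  eis k (moebius g tau) = mden g tau ^+ k * eis k tau.
Proof.
move=> k2 hg ht; have [h1 _] := eis_usum k2 (Hp_moebius hg ht).
have [h2 _] := eis_usum k2 ht; have [e1 e2] := lactK hg.
apply: (usum_unique h1); apply: usum_ext (usumZ _ (usum_reindex e1 e2 h2)) => p.
rewrite /eis_term lact_eq0 // lattice_moebius //; case: ifP => _; first by rewrite mulr0.
by rewrite exprMn invfM exprVn invrK mulrC.
Qed.

(** A uniform distance from the lattice, rather than z being no lattice point, so that the constants
    in the bound on the terms can be written down. *)
Definition offl tau z := exists2 d : R, 0 < d & forall p, d <= cn (z - lattice_pt tau p).

Lemma offl_neq tau z p : offl tau z -> z - lattice_pt tau p != 0.
Proof. by move=> [d d0 H]; rewrite -cn_gt0; apply: lt_le_trans (H p). Qed.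

Lemma offl_neq0 tau z : offl tau z -> z != 0.
Proof. by move/(@offl_neq _ _ (0, 0)); rewrite /lattice_pt /= mul0r addr0 subr0. Qed.

Definition wp_term z tau p : R[i] :=
  if p == (0, 0) then 0 else (z - lattice_pt tau p) ^- 2 - lattice_pt tau p ^- 2.

(** The difference of the two squares equals z (2w - z) / (w^2 (z - w)^2), which has cubic decay
    once |w| is compared with |z - w| through the factor k. *)
Lemma wp_term_bound z tau : Hp tau -> offl tau z ->
  exists2 K : R, 0 <= K & forall p, cn (wp_term z tau p) <= K * wt R p.
Proof.
move=> ht [d d0 Hd]; have [K K0 HK] := @lattice_pow_bound 3 tau isT ht.
have [c c0 Hc] := lattice_lb ht; have z0 := cn_ge0 z.
pose k := (1 + cn z / d).
have k0 : 0 < k by rewrite ltr_pwDl // divr_ge0 // ltW.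
exists (cn z * (2 + cn z / c) * k ^+ 2 * K) => [|p].
  by rewrite !mulr_ge0 ?exprn_ge0 ?addr_ge0 ?divr_ge0 // ltW.
rewrite /wp_term; case: eqP => [_|/eqP h].
  by rewrite cn0 !mulr_ge0 ?wt_ge0 ?exprn_ge0 ?addr_ge0 ?divr_ge0 // ltW.
rewrite -(mulrA _ K); apply: le_trans (_ : cn z * (2 + cn z / c) * k ^+ 2 * cn (lattice_pt tau p) ^- 3 <= _); last first.
  by apply: ler_wpM2l (HK p h); rewrite !mulr_ge0 ?exprn_ge0 ?addr_ge0 ?divr_ge0 // ltW.
have w0 := lattice_pt_neq0 ht h.
have wc : c <= cn (lattice_pt tau p).
  move: h; case: p {w0} => n m h; apply: le_trans (Hc n m); rewrite ler_peMr ?(ltW c0) //.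
  rewrite ler1n lt0n addn_eq0 !absz_eq0; apply: contra h => /andP[/eqP -> /eqP ->].
  by rewrite eqxx.
have dz := Hd p; move: w0 wc dz; move: (lattice_pt tau p) => w w0 wc dz {h Hd HK Hc}.
have zw0 : z - w != 0 by rewrite -cn_gt0; apply: lt_le_trans dz.
have -> : (z - w) ^- 2 - w ^- 2 = z * (2 * w - z) / (w ^+ 2 * (z - w) ^+ 2).
  by field; rewrite w0 zw0.
have cw : 0 < cn w by rewrite cn_gt0.
have cz : 0 < cn (z - w) by rewrite cn_gt0.
have wk : cn w <= cn (z - w) * k.
  rewrite /k mulrDr mulr1 mulrCA.
  have a : cn w <= cn (z - w) + cn z by have := cn_lb w z; rewrite cnBC; lra.
  have b : cn z <= cn z * (cn (z - w) / d) by rewrite ler_peMr // ler_pdivlMr // mul1r.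
  by apply: le_trans a _; rewrite lerD2l.
rewrite !cnM cnV cnM !cnX ler_pdivrMr ?mulr_gt0 ?exprn_gt0 //.
have n1 : cn (2 * w - z) <= cn w * (2 + cn z / c).
  apply: le_trans (cnB _ _) _; rewrite cnM (cn_nat R 2) mulrDr mulrC lerD2l mulrCA.
  by rewrite ler_peMr // ler_pdivlMr // mul1r.
have sq : cn w ^+ 2 <= cn (z - w) ^+ 2 * k ^+ 2.
  by rewrite -exprMn lerXn2r ?nnegrE ?mulr_ge0 ?cn_ge0 // ltW.
have e : 0 <= cn z * (2 + cn z / c) / cn w.
  by rewrite !mulr_ge0 ?invr_ge0 ?addr_ge0 ?divr_ge0 // ltW.
apply: le_trans (ler_wpM2l z0 n1) _.
have := ler_wpM2l e sq; rewrite (_ : _ / cn w * cn w ^+ 2 = cn z * (cn w * (2 + cn z / c))); last first.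
  by field; rewrite !gt_eqF.
move=> h; apply: le_trans h _; rewrite le_eqVlt; apply/orP; left; apply/eqP.
by field; rewrite !gt_eqF.
Qed.

Lemma wp_usum z tau : Hp tau -> offl tau z ->
  usum (wp_term z tau) (weierstrass_p z tau - z ^- 2).
Proof.
move=> ht hz; have [K K0 HK] := wp_term_bound ht hz; have h := usum_rows K0 HK.
by rewrite /weierstrass_p addrC addKr /lattice_sum (usum_sum h).
Qed.

Lemma lattice_ptN tau p : lattice_pt tau (- p.1, - p.2) = - lattice_pt tau p.
Proof. by rewrite /lattice_pt /= !rmorphN /= mulNr opprD. Qed.

Lemma offlN tau z : offl tau z -> offl tau (- z).
Proof.
move=> [d d0 H]; exists d => // p; have := H (- p.1, - p.2).
by rewrite lattice_ptN -opprD cnN opprK.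
Qed.

Lemma wpN z tau : Hp tau -> offl tau z -> weierstrass_p (- z) tau = weierstrass_p z tau.
Proof.
move=> ht hz; have h1 := wp_usum ht (offlN hz).
have oppK : cancel (fun p : int * int => (- p.1, - p.2)) (fun p => (- p.1, - p.2)).
  by move=> [n m] /=; rewrite !opprK.
have h2 := usum_reindex oppK oppK (wp_usum ht hz).
have := @usum_unique _ _ _ _ _ h1 (usum_ext _ h2); rewrite sqrrN => /(_ _)/addIr; apply.
move=> [n m]; rewrite /wp_term -[RHS]/(if _ then _ else _) !xpair_eqE !oppr_eq0 /=.
case: ifP => // _; rewrite (lattice_ptN tau (n, m)) opprK sqrrN.
by rewrite -[(z + _) ^+ 2]sqrrN opprD.
Qed.

Lemma offl_moebius g tau z : SL2Z g -> Hp tau -> offl tau z ->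
  offl (moebius g tau) (z / mden g tau).
Proof.
move=> hg ht [d d0 H]; have n0 := mden_neq0 hg ht.
exists (d / cn (mden g tau)) => [|p]; first by rewrite divr_gt0 // cn_gt0.
by rewrite lattice_moebius // -mulrBl cnM cnV ler_pM2r ?invr_gt0 ?cn_gt0.
Qed.

Lemma wp_moebius g tau z : SL2Z g -> Hp tau -> offl tau z ->
  weierstrass_p (z / mden g tau) (moebius g tau) = mden g tau ^+ 2 * weierstrass_p z tau.
Proof.
move=> hg ht hz; have n0 := mden_neq0 hg ht; have z0 := offl_neq0 hz.
have h1 := wp_usum (Hp_moebius hg ht) (offl_moebius hg ht hz).
have [e1 e2] := lactK hg.
have h2 := usumZ (mden g tau ^+ 2) (usum_reindex e1 e2 (wp_usum ht hz)).
have := @usum_unique _ _ _ _ _ h1 (usum_ext _ h2); rewrite mulrBr.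
rewrite (_ : mden g tau ^+ 2 / z ^+ 2 = (z / mden g tau) ^- 2); last first.
  by field; rewrite n0 z0.
move=> /(_ _)/addIr; apply=> p; rewrite /wp_term lact_eq0 //; case: eqP => [_|/eqP p0]; first by rewrite mulr0.
have a := offl_neq (lact g p) hz.
have b : lattice_pt tau (lact g p) != 0 by rewrite lattice_pt_neq0 // lact_eq0.
rewrite lattice_moebius // -mulrBl; move: a b; move: (lattice_pt _ _) => w a b.
by field; rewrite n0 a b.
Qed.

Lemma offl_notint tau z (m : int) : offl tau z -> notint (m%:~R * tau - z).
Proof.
move=> hz n; have := offl_neq (n, m) hz.
have -> : m%:~R * tau - z + n%:~R = - (z - lattice_pt tau (n, m)) by rewrite /lattice_pt /=; ring.
by rewrite oppr_eq0.
Qed.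

(** In a difference of two values the terms omega^-2 cancel, and the sum of (z - omega)^-2 over a
    row is [Ssum 2], evaluated by [Herglotz]. For a single value the rows would retain the constants
    omega^-2. *)
Theorem wpB_rows z z' tau : Hp tau -> offl tau z -> offl tau z' ->
  weierstrass_p z tau - weierstrass_p z' tau =
  zsum (fun m => Tcot (m%:~R * tau - z) - Tcot (m%:~R * tau - z')).
Proof.
move=> ht hz hz'; have [K K0 HK] := wp_term_bound ht hz.
have [K' K0' HK'] := wp_term_bound ht hz'.
pose G p := (z - lattice_pt tau p) ^- 2 - (z' - lattice_pt tau p) ^- 2.
have GE p : G p = wp_term z tau p + -1 * wp_term z' tau p +
    (if p == (0, 0) then z ^- 2 - z' ^- 2 else 0).
  rewrite /G /wp_term mulN1r; case: eqP => [->|_]; last by ring.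
  by rewrite /lattice_pt /= mul0r addr0 !subr0 add0r.
have u1 : usum G (weierstrass_p z tau - weierstrass_p z' tau).
  have h := usumD (usumD (wp_usum ht hz) (usumZ (-1) (wp_usum ht hz')))
    (usum_point (0 : int, 0 : int) (z ^- 2 - z' ^- 2)).
  have -> : weierstrass_p z tau - weierstrass_p z' tau = weierstrass_p z tau - z ^- 2 +
     -1 * (weierstrass_p z' tau - z' ^- 2) + (z ^- 2 - z' ^- 2) by ring.
  by apply: usum_ext h => p; rewrite GE.
pose C := cn (z ^- 2 - z' ^- 2); have C0 : 0 <= C by exact: cn_ge0.
have u2 : usum G (zsum (row G)).
  (* The weight at the origin is 1/6, so 6 C covers the extra term at (0, 0). *)
  apply: (@usum_rows _ _ (K + K' + 6 * C)) => [|p]; first by rewrite !addr_ge0 // mulr_ge0.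
  rewrite GE; apply: le_trans (cnD _ _) _; rewrite mulrDl lerD //.
    by rewrite mulN1r mulrDl; apply: le_trans (cnB _ _) _; apply: lerD.
  case: eqP => [->|_]; last by rewrite cn0 !mulr_ge0 // wt_ge0.
  rewrite /wt /W /= addn0 -/C (_ : (1 * 2 * 3)^-1 = 6^-1); last by congr (_^-1); ring.
  by rewrite mulrAC mulfV ?mul1r.
rewrite (usum_unique u1 u2); congr zsum; apply/funext => m; rewrite /row.
have n1 := offl_notint m hz; have n2 := offl_notint m hz'.
rewrite -!Herglotz //; apply: csumP.
apply: ctends_ext (ctendsB (@Ssum_cvg R 2 _ isT n1) (@Ssum_cvg R 2 _ isT n2)) => n.
rewrite -psumB /psum; apply: eq_bigr => j _.
have E (x : R[i]) (k : int) : Sterm 2 (m%:~R * tau - x) k = (x - lattice_pt tau (k, m)) ^- 2.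
  rewrite /Sterm /lattice_pt /= -[in RHS]sqrrN; congr (_ ^- 2); ring.
by rewrite !E /G; ring.
Qed.

Lemma wp_per1 z tau (n : int) : Hp tau -> offl tau z -> offl tau (z + n%:~R) ->
  weierstrass_p (z + n%:~R) tau = weierstrass_p z tau.
Proof.
move=> ht h1 h2; apply/eqP; rewrite -subr_eq0 (wpB_rows ht h2 h1); apply/eqP.
rewrite (_ : (fun m => _) = fun=> 0); last first.
  apply/funext => m; rewrite opprD addrA /Tcot -rmorphN e2D e2_int mulr1 subrr //.
apply: csumP; apply: ctends_ext (ctends_cst 0) => k.
by rewrite /psum big1 // => j _; rewrite addr0.
Qed.

(** The inversion tau -> -1/tau turns a translation by m tau into one by an integer, where [wp_per1]
    applies through the periodicity of [Tcot]. *)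
Lemma wp_pertau z tau (m : int) : Hp tau -> offl tau z -> offl tau (z + m%:~R * tau) ->
  weierstrass_p (z + m%:~R * tau) tau = weierstrass_p z tau.
Proof.
move=> ht h1 h2; pose g := mx22 0 (-1) 1 0.
have hg : SL2Z g by apply: mx22_SL2Z.
have gt : mden g tau = tau by rewrite /mden !mxE /= mul1r addr0.
have t0 : tau != 0 by rewrite -gt mden_neq0.
have := wp_moebius hg ht h2; have := wp_moebius hg ht h1; rewrite gt => e1 e2.
have o1 := offl_moebius hg ht h1; have o2 := offl_moebius hg ht h2.
move: e2 o2; rewrite gt mulrDl mulfK // => e2 o2.
move: e2; rewrite wp_per1 //; last 2 first.
- exact: Hp_moebius.
- by move: o1; rewrite gt.
by rewrite e1 => /mulfI -> //; rewrite expf_neq0.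
Qed.

End Lattice.

(** * Values at N-torsion points *)

Section TorsionPoints.
Variables (R : realType) (N : nat).
Hypothesis N0 : (0 < N)%N.
Implicit Types (tau : R[i]) (r s : int) (g : 'M[int]_2).

Definition tpt tau r s : R[i] := (r%:~R * tau + s%:~R) / N%:R.
Definition nontriv r s := ~~ ((N %| r)%Z && (N %| s)%Z).
Definition wpt r s tau : R[i] := weierstrass_p (tpt tau r s) tau.

Lemma Nneq0 : N%:R != 0 :> R[i]. Proof. by rewrite pnatr_eq0 -lt0n. Qed.

Lemma tpt_offl tau r s : Hp tau -> nontriv r s -> offl tau (tpt tau r s).
Proof.
move=> ht rs; have [c c0 Hc] := lattice_lb ht; have n0 := Nneq0.
exists (c / N%:R) => [|[n m]]; first by rewrite divr_gt0 // ltr0n.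
have -> : tpt tau r s - lattice_pt tau (n, m) = lattice_pt tau (s - N%:Z * n, r - N%:Z * m) / N%:R.
  by rewrite /tpt /lattice_pt /= !rmorphB !rmorphM /= -!pmulrn; field.
rewrite cnM cnV cn_nat ler_pM2r ?invr_gt0 ?ltr0n //; apply: le_trans (Hc _ _).
rewrite ler_peMr ?(ltW c0) // ler1n lt0n addn_eq0 !absz_eq0; apply: contra rs => /andP[/eqP a /eqP b].
move/eqP: a; move/eqP: b; rewrite !subr_eq0 => /eqP -> /eqP ->.
by rewrite !dvdz_mulr.
Qed.

Lemma nontriv_mod r s r' s' : (r = r' %[mod N])%Z -> (s = s' %[mod N])%Z -> nontriv r s = nontriv r' s'.
Proof. have E x : (N %| x)%Z = ((x %% N)%Z == 0) by apply/dvdz_mod0P/eqP.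
by move=> h1 h2; rewrite /nontriv !E h1 h2.
Qed.

Lemma wpt_mod r s r' s' tau : (r = r' %[mod N])%Z -> (s = s' %[mod N])%Z -> nontriv r s ->
  Hp tau -> wpt r s tau = wpt r' s' tau.
Proof.
move=> h1 h2 rs ht; have rs' := rs; rewrite (nontriv_mod h1 h2) in rs'.
have /dvdzP[m em] : (N %| r - r')%Z by rewrite -eqz_mod_dvd; apply/eqP.
have /dvdzP[n en] : (N %| s - s')%Z by rewrite -eqz_mod_dvd; apply/eqP.
have n0 := Nneq0.
have er : r = r' + m * N by rewrite -em; ring.
have es : s = s' + n * N by rewrite -en; ring.
have e : tpt tau r s = tpt tau r' s' + m%:~R * tau + n%:~R.
  by rewrite /tpt er es !rmorphD !rmorphM /= -!pmulrn; field.
have e' : tpt tau r s' = tpt tau r' s' + m%:~R * tau.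
  by rewrite /tpt er !rmorphD !rmorphM /= -!pmulrn; field.
have rs1 : nontriv r s' by rewrite -(nontriv_mod erefl h2).
have o := tpt_offl ht rs; have o' := tpt_offl ht rs'; have o1 := tpt_offl ht rs1.
rewrite /wpt e wp_per1 -?e' //; last by rewrite e' -e.
by rewrite e' wp_pertau // -e'.
Qed.

Lemma wpt_opp r s tau : nontriv r s -> Hp tau -> wpt (- r) (- s) tau = wpt r s tau.
Proof.
move=> rs ht; rewrite /wpt -(wpN ht (tpt_offl ht rs)); congr weierstrass_p.
by rewrite /tpt !rmorphN /= mulNr -opprD mulNr.
Qed.

Lemma nontriv_act g r s : SL2Z g -> nontriv r s ->
  nontriv (r * g 0 0 + s * g 1 0) (r * g 0 1 + s * g 1 1).
Proof.
move=> /SL2Z_det d; apply: contra => /andP[h1 h2].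
have -> : r = (r * g 0 0 + s * g 1 0) * g 1 1 - (r * g 0 1 + s * g 1 1) * g 1 0.
  by rewrite -[LHS]mulr1 -d; ring.
rewrite rpredB ?dvdz_mulr //=.
have -> : s = (r * g 0 1 + s * g 1 1) * g 0 0 - (r * g 0 0 + s * g 1 0) * g 0 1.
  by rewrite -[LHS]mulr1 -d; ring.
by rewrite rpredB ?dvdz_mulr.
Qed.

Lemma wpt_moebius g r s tau : SL2Z g -> nontriv r s -> Hp tau ->
  wpt r s (moebius g tau) =
  mden g tau ^+ 2 * wpt (r * g 0 0 + s * g 1 0) (r * g 0 1 + s * g 1 1) tau.
Proof.
move=> hg rs ht; have d0 := mden_neq0 hg ht.
rewrite /wpt -wp_moebius //; last by apply: tpt_offl => //; exact: nontriv_act.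
congr weierstrass_p; rewrite /tpt /moebius -/(mden g tau); have n0 := Nneq0.
move: d0; rewrite !rmorphD !rmorphM /= /mden => d0.
by field; rewrite n0 d0.
Qed.

End TorsionPoints.

(** * Expansions of the Weierstrass function and of Eisenstein series *)

Section LambertSeries.
Variable R : realType.
Implicit Types (q w : R[i]) (s : seq R[i]) (c d : nat -> R[i]) (a b : nat -> nat).

Lemma hr_bound s : exists2 B : R, 0 <= B & forall u, cn u <= 1 -> cn (hr s u) <= B.
Proof.
elim: s => [|x s [B B0 HB]]; first by exists 0 => // u _; rewrite /= cn0.
exists (B + cn x) => [|u u1]; first by rewrite addr_ge0 // cn_ge0.
apply: le_trans (cnD _ _) _; rewrite lerD2r cnM; apply: le_trans (HB u u1).
by rewrite ler_piMr ?cn_ge0.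
Qed.

Lemma csum_split (u : nat -> R[i]) l m : ctends (psum u) l ->
  csum u = psum u m + csum (fun j => u (m + j)%N).
Proof.
move=> h; have h1 := (ctends_shift _ _ m).1 h; rewrite (csumP h).
rewrite (_ : csum (fun j => u (m + j)%N) = l - psum u m); first by rewrite addrC subrK.
apply: csumP; apply: ctends_ext (ctendsB h1 (ctends_cst (psum u m))) => n.
by rewrite addnC /psum big_split_ord /= [LHS]addrC addrA addNr add0r.
Qed.

(** A common shape for all expansions that follow: Lambert series in which |c j| and |d j| are at
    most 1 and a j >= j. These conditions dominate the j-th term by rho^j times a constant on |q| <=
    rho. *)
Definition lterm s n c d a b j q : R[i] := c j * q ^+ a j * rat s n (d j * q ^+ b j).
Definition Lser s n c d a b q : R[i] := csum (fun j => lterm s n c d a b j q).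

Definition Lser_ok c d a b :=
  [/\ forall j, cn (c j) <= 1, forall j, cn (d j) <= 1, forall j, (j <= a j)%N & forall j, (0 < b j)%N].

Lemma lt1_neq1 q : cn q < 1 -> 1 - q != 0.
Proof. by move=> h; rewrite subr_eq0; apply/eqP => E; rewrite -E cn1 ltxx in h. Qed.

Lemma cn_dq (x : R[i]) (b : nat) q (rho : R) : cn x <= 1 -> (0 < b)%N -> cn q <= rho -> rho <= 1 -> cn (x * q ^+ b) <= rho.
Proof.
move=> x1 b0 q1 r1; rewrite cnM cnX; apply: le_trans (_ : 1 * cn q <= _); last by rewrite mul1r.
apply: ler_pM; rewrite ?exprn_ge0 ?cn_ge0 //.
by rewrite -[leRHS]expr1 ler_wiXn2l ?cn_ge0 //; exact: le_trans r1.
Qed.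

Lemma cdiff_hr s q : cdiff (hr s) q. Proof. by exists (dhr s q); exact: cder_hr. Qed.

Lemma cdiff_rat s n q : 1 - q != 0 -> cdiff (rat s n) q.
Proof.
move=> h; apply: cdiffM; first exact: cdiff_hr.
apply: cdiffV; last by rewrite expf_neq0.
by apply: cdiffX; apply: cdiffB; [exact: cdiff_cst|exact: cdiff_id].
Qed.

Section Fixed.
Variables (s : seq R[i]) (n : nat) (c d : nat -> R[i]) (a b : nat -> nat).
Hypothesis ok : Lser_ok c d a b.

Lemma lterm_cdiff j q : cn q < 1 -> cdiff (lterm s n c d a b j) q.
Proof.
case: ok => c1 d1 a1 b1 q1; apply: cdiffM.
  by apply: cdiffM; [exact: cdiff_cst|apply: cdiffX; exact: cdiff_id].
apply: (@cdiff_comp _ (fun w => d j * w ^+ b j)).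
  by apply: cdiffM; [exact: cdiff_cst|apply: cdiffX; exact: cdiff_id].
by apply: cdiff_rat; apply: lt1_neq1; apply: (le_lt_trans _ q1); apply: cn_dq => //; exact: ltW.
Qed.

Lemma lterm_bound (rho : R) : 0 <= rho -> rho < 1 -> exists2 B : R, 0 <= B &
  forall j q, cn q <= rho -> cn (lterm s n c d a b j q) <= rho ^+ j * B.
Proof.
case: ok => c1 d1 a1 b1 r0 r1; have [B B0 HB] := hr_bound s.
have r10 : 0 < 1 - rho by rewrite subr_gt0.
exists (B / (1 - rho) ^+ n) => [|j q q1]; first by rewrite divr_ge0 // exprn_ge0 // ltW.
have u1 : cn (d j * q ^+ b j) <= rho by apply: cn_dq => //; exact: ltW.
rewrite /lterm /rat !cnM cnV !cnX; move: u1; move: (d j * q ^+ b j) => u u1.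
apply: ler_pM; rewrite ?mulr_ge0 ?invr_ge0 ?exprn_ge0 ?cn_ge0 //.
  apply: le_trans (_ : 1 * cn q ^+ a j <= _); first by rewrite ler_wpM2r ?exprn_ge0 ?cn_ge0.
  rewrite mul1r; apply: le_trans (_ : cn q ^+ j <= _).
    by rewrite ler_wiXn2l ?cn_ge0 //; apply: le_trans q1 (ltW r1).
  by rewrite lerXn2r ?nnegrE ?cn_ge0.
apply: ler_pM; rewrite ?invr_ge0 ?exprn_ge0 ?cn_ge0 //.
  by apply: HB; apply: le_trans u1 (ltW r1).
have h : 1 - rho <= cn (1 - u) by have := cn_lb 1 u; rewrite cn1; lra.
have h0 : 0 < cn (1 - u) by lra.
by rewrite lef_pV2 ?posrE ?exprn_gt0 // lerXn2r ?nnegrE ?cn_ge0 // ltW.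
Qed.

Lemma Lser_facts q : cn q < 1 ->
  ctends (psum (fun j => lterm s n c d a b j q)) (Lser s n c d a b q) /\ holo_at (Lser s n c d a b) q.
Proof.
move=> q1; have q0 := cn_ge0 q; pose rho := (1 + cn q) / 2.
have r1 : rho < 1 by rewrite /rho; lra.
have qr : cn q < rho by rewrite /rho; lra.
have r0 : 0 <= rho by lra.
have [B B0 HB] := lterm_bound r0 r1.
have sumB m : \sum_(k < m) rho ^+ k * B <= (1 - rho)^-1 * B.
  by rewrite -mulr_suml ler_wpM2r // geom_le.
split.
  apply: (@summ_cvg _ _ (fun k => rho ^+ k * B) ((1 - rho)^-1 * B)).
  by split=> // k; apply: HB; exact: ltW.
have rq : 0 < rho - cn q by rewrite subr_gt0.
have near w : cn (w - q) < rho - cn q -> cn w < rho.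
  by move=> h; have := cn_lb w q; lra.
exists (rho - cn q) => // w wq; exists (csum (fun k => cderiv (lterm s n c d a b k) w)).
apply: (@mtest_holo _ (lterm s n c d a b) q _ (fun k => rho ^+ k * B) _ rq _ _ sumB) => //.
  by move=> k v /near vr; apply: lterm_cdiff; lra.
by move=> k v /near vr; apply: HB; exact: ltW.
Qed.

Lemma Lser_factor M q : cn q < 1 ->
  Lser s n c d (fun j => M + a j)%N b q = q ^+ M * Lser s n c d a b q.
Proof.
move=> q1; have [h _] := Lser_facts q1; rewrite -(csumZ _ h); congr csum.
by apply/funext => j; rewrite /lterm exprD; ring.
Qed.

End Fixed.

Lemma Lser_shift_ok c d a b m : Lser_ok c d a b -> Lser_ok (fun j => c (m + j)%N)
  (fun j => d (m + j)%N) (fun j => a (m + j) - m)%N (fun j => b (m + j)%N).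
Proof. by case=> c1 d1 a1 b1; split=> // j; have := a1 (m + j)%N; lia. Qed.

(** The tail after m terms is q^m times a series of the same shape, because a (m + j) >= m + j. This
    is the decomposition that [kser_approx] asks for. *)
Lemma Lser_split s n c d a b m q : Lser_ok c d a b -> cn q < 1 -> Lser s n c d a b q =
  \sum_(j < m) lterm s n c d a b j q +
  q ^+ m * Lser s n (fun j => c (m + j)%N) (fun j => d (m + j)%N) (fun j => a (m + j) - m)%N (fun j => b (m + j)%N) q.
Proof.
move=> ok q1; have [h _] := Lser_facts s n ok q1; rewrite {1}/Lser (csum_split m h); congr (_ + _).
have [h' _] := Lser_facts s n (Lser_shift_ok m ok) q1; rewrite -(csumZ _ h'); congr csum.
have [_ _ a1 _] := ok.
have am j : (m <= a (m + j))%N by apply: leq_trans (a1 (m + j)%N); rewrite leq_addr.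
apply/funext => j; rewrite /lterm -{1}(subnKC (am j)) exprD; ring.
Qed.

Lemma near1 (F G : R[i] -> R[i]) : (forall q, cn q < 1 -> F q = G q) -> near_eq 0 F G.
Proof. by move=> h; exists 1 => // q; rewrite subr0; exact: h. Qed.

Section Coefficients.
Variable K : set R[i].
Hypothesis KF : is_subfield K.

Lemma kser_rat s n F : (forall i, K s`_i) -> kser K F -> F 0 = 0 -> kser K (fun q => rat s n (F q)).
Proof.
move=> Ks kF F0; apply: (kserV KF); last by rewrite F0 subr0 expr1n oner_neq0.
  elim: s Ks => [|x s IH] Ks; first exact: (kser_cst KF (K0 KF)).
  apply: (kserD KF); last exact: (kser_cst KF (Ks 0%N)).
  by apply: (kserM KF) => //; apply: IH => i; exact: (Ks i.+1).
by apply: (kserX KF); apply: (kserB KF) => //; exact: (kser_cst KF (K1 KF)).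
Qed.

Lemma kser_mono (x : R[i]) k : K x -> kser K (fun q => x * q ^+ k).
Proof. by move=> Kx; apply: (kserM KF); [exact: (kser_cst KF)|exact: (kser_pow KF)]. Qed.

Lemma kser_Lser s n c d a b : Lser_ok c d a b -> (forall i, K s`_i) ->
  (forall j, K (c j)) -> (forall j, K (d j)) -> kser K (Lser s n c d a b).
Proof.
move=> ok Ks Kc Kd; have z1 : cn (0 : R[i]) < 1 by rewrite cn0.
apply: kser_approx; first by have [_] := Lser_facts s n ok z1.
move=> m; exists (fun q => \sum_(j < m) lterm s n c d a b j q).
exists (Lser s n (fun j => c (m + j)%N) (fun j => d (m + j)%N) (fun j => a (m + j) - m)%N (fun j => b (m + j)%N)).
split; last by apply: near1 => q q1; exact: Lser_split.
  apply: (kser_sum KF) => j _; apply: (kserM KF); first exact: kser_mono.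
  apply: kser_rat => //; first exact: kser_mono.
  by case: ok => _ _ _ /(_ j) b0; rewrite expr0n gtn_eqF // mulr0.
by have [_] := Lser_facts s n (Lser_shift_ok m ok) z1.
Qed.

End Coefficients.
End LambertSeries.

(** * The q-expansion at torsion points *)

Section TorsionExpansion.
Variables (R : realType) (N : nat).
Hypothesis N0 : (0 < N)%N.
Implicit Types (tau q : R[i]) (r s : nat).
Local Notation ze := (zeta R N).
Local Notation P2 := (rat (esr R [:: 0; 1]%N) 2).
Local Notation P1 := (rat (esr R [:: 1]%N) 2).

Lemma P2E (u : R[i]) : P2 u = u * P1 u.
Proof. by rewrite /rat /=; ring. Qed.

Lemma P2V (u : R[i]) : P2 u^-1 = P2 u.
Proof.
have [->|u0] := eqVneq u 0; first by rewrite invr0.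
have [->|u1] := eqVneq u 1; first by rewrite invr1.
have a : 1 - u != 0 by rewrite subr_eq0 eq_sym.
rewrite /rat /=; have b : 1 - u^-1 != 0 by rewrite subr_eq0 eq_sym invr_eq1.
have -> : 1 - u^-1 = - (1 - u) / u by field.
by field; rewrite a u0.
Qed.

Lemma ze_unit k : cn (ze ^+ k) = 1.
Proof.
rewrite cnX /zeta cn_e2 (_ : complex.Im _ = 0) ?mulr0 ?oppr0 ?expR0 ?expr1n //.
by rewrite -(rmorph_nat (real_complex R)) -fmorphV.
Qed.

Lemma ze_neq0 k : ze ^+ k != 0.
Proof. by rewrite -cn_gt0 ze_unit. Qed.

Lemma ze_pow k : ze ^+ k = cexp2ipi (k%:R / N%:R).
Proof. by rewrite /zeta -e2_nat. Qed.

Lemma ze_eq1 k : ~~ (N %| k)%N -> ze ^+ k != 1.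
Proof.
move=> h; rewrite ze_pow; apply: notint_e2 => n; apply/eqP => E.
have n0 := Nneq0 R N0.
have : ((k%:Z + N%:Z * n)%:~R : R[i]) = 0.
  rewrite rmorphD rmorphM /= -!pmulrn; transitivity (N%:R * (k%:R / N%:R + n%:~R : R[i])); first by field.
  by rewrite E mulr0.
move=> /eqP; rewrite intr_eq0 addr_eq0 => /eqP E'.
have : (N%:Z %| k%:Z)%Z by rewrite E' rpredN dvdz_mulr.
by rewrite dvdzE /= (negbTE h).
Qed.

Lemma ze_inj k l : (k < N)%N -> (l < N)%N -> ze ^+ k = ze ^+ l -> k = l.
Proof.
wlog kl : k l / (k <= l)%N.
  by move=> H kN lN e; case: (leqP k l) => [|/ltnW] h; [exact: H|apply/esym; exact: H].
move=> kN lN; rewrite -(subnKC kl) exprD -{1}[ze ^+ k]mulr1 => /mulfI => /(_ (ze_neq0 k)) e.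
case: (boolP (N %| l - k)%N) => [|/ze_eq1]; last by rewrite -e eqxx.
have [->|p] := posnP (l - k)%N; first by rewrite addn0.
by move=> /(dvdn_leq p); lia.
Qed.

(** With z = (r tau + s)/N, row 0 contributes P2(zeta^s q^r), the rows m > 0 have u = zeta^-s q^(mN
    - r), and the rows m < 0 have 1/u = zeta^s q^(|m|N + r), where P2 is invariant under u -> 1/u.
    The factor u of P2(u) = u P1(u) is moved into the monomial of the Lambert term. *)
Definition XT r s q : R[i] := P2 (ze ^+ s * q ^+ r) +
  (Lser (esr R [:: 1]%N) 2 (fun=> (ze ^+ s)^-1) (fun=> (ze ^+ s)^-1) (fun j => j.+1 * N - r)%N (fun j => j.+1 * N - r)%N q +
   Lser (esr R [:: 1]%N) 2 (fun=> ze ^+ s) (fun=> ze ^+ s) (fun j => j.+1 * N + r)%N (fun j => j.+1 * N + r)%N q).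

Lemma XT_ok r s : (r < N)%N ->
  Lser_ok (fun=> (ze ^+ s)^-1) (fun=> (ze ^+ s)^-1) (fun j => j.+1 * N - r)%N (fun j => j.+1 * N - r)%N /\
  Lser_ok (fun=> ze ^+ s) (fun=> ze ^+ s) (fun j => j.+1 * N + r)%N (fun j => j.+1 * N + r)%N.
Proof.
move=> rN; split; split=> j; rewrite ?cnV ?ze_unit ?invr1 //.
- by rewrite mulSn; have := leq_mul (leqnn j) N0; lia.
- by rewrite mulSn; lia.
- by rewrite mulSn; have := leq_mul (leqnn j) N0; lia.
- by rewrite mulSn; lia.
Qed.

Definition adm r s := (r < N)%N && ~~ ((r == 0%N) && (N %| s)%N).

Lemma adm_neq1 r s q : adm r s -> cn q < 1 -> 1 - ze ^+ s * q ^+ r != 0.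
Proof.
move=> /andP[rN h] q1; case: r rN h => [|r] rN h.
  by rewrite expr0 mulr1 subr_eq0 eq_sym ze_eq1.
apply: lt1_neq1; apply: (le_lt_trans _ q1); apply: cn_dq; rewrite ?ze_unit //.
exact: ltW.
Qed.

Lemma XT_holo r s q : adm r s -> cn q < 1 -> holo_at (XT r s) q.
Proof.
move=> h q1; have /andP[rN _] := h; have [ok1 ok2] := XT_ok s rN.
apply: holo_atD; last by apply: holo_atD; [have [_] := Lser_facts (esr R [:: 1]%N) 2 ok1 q1|have [_] := Lser_facts (esr R [:: 1]%N) 2 ok2 q1].
have l0 : 0 < 1 - cn q by rewrite subr_gt0.
exists (1 - cn q) => // w wq; have w1 : cn w < 1 by have := cn_lb w q; lra.
apply: (@cdiff_comp _ (fun w => ze ^+ s * w ^+ r)).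
  by apply: cdiffM; [exact: cdiff_cst|apply: cdiffX; exact: cdiff_id].
by apply: cdiff_rat; exact: adm_neq1.
Qed.

Lemma Kesr (K : set R[i]) l : is_subfield K -> forall i, K (esr R l)`_i.
Proof.
move=> KF i; case: (ltnP i (size l)) => h; first by rewrite (nth_map 0%N) //; exact: Knat.
by rewrite nth_default ?size_map //; exact: K0.
Qed.

Lemma XT_kser r s : adm r s -> kser (Qzeta R N) (XT r s).
Proof.
have KF := Qzeta_subfield R N; have Kz k : Qzeta R N (ze ^+ k) by apply: (KX KF); exact: Qzeta_zeta.
have KzV k : Qzeta R N (ze ^+ k)^-1 by apply: (KV KF).
move=> h; have /andP[rN h0] := h; have [ok1 ok2] := XT_ok s rN.
apply: (kserD KF); last by apply: (kserD KF); apply: (kser_Lser KF) => //; exact: Kesr.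
case: r rN h h0 {ok1 ok2} => [|r] rN h h0.
  apply: (kser_near (F := fun=> P2 (ze ^+ s))); last apply: (kser_cst KF).
    by apply: near1 => q _; rewrite expr0 mulr1.
  rewrite /rat /=; apply: (Kdiv KF); last by apply: (KX KF); apply: (KB KF) => //; exact: K1.
  by rewrite mul0r add0r mul1r addr0.
apply: (kser_rat KF); first exact: Kesr.
  exact: (kser_mono KF).
by rewrite expr0n mulr0.
Qed.

Lemma qN_lt1 tau : Hp tau -> cn (qN N tau) < 1.
Proof.
move=> ht; rewrite /qN cn_e2 -expR0 ltr_expR oppr_lt0 mulr_gt0 ?mulr_gt0 ?pi_gt0 //.
by rewrite Im_divn divr_gt0 // ltr0n.
Qed.

Lemma qN_pow tau k : qN N tau ^+ k = cexp2ipi (k%:R * tau / N%:R).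
Proof. by rewrite /qN -e2_nat mulrA. Qed.

Theorem wptB_XT r s r' s' tau : adm r s -> adm r' s' -> Hp tau ->
  wpt N r s tau - wpt N r' s' tau =
  twopii R ^+ 2 * (XT r s (qN N tau) - XT r' s' (qN N tau)).
Proof.
have ntr k l : adm k l -> nontriv N k l.
  move=> /andP[kN h]; apply: contra h => /andP[]; rewrite !dvdzE /= => h1 ->.
  by rewrite andbT eqn0Ngt; apply/negP => p; have := dvdn_leq p h1; rewrite leqNgt kN.
move=> h h' ht; have rs := ntr _ _ h; have rs' := ntr _ _ h'.
rewrite /wpt (wpB_rows ht (tpt_offl N0 ht rs) (tpt_offl N0 ht rs')).
set q := qN N tau; have q1 : cn q < 1 := qN_lt1 ht.
have n0 := Nneq0 R N0.
have main k l : adm k l -> ctends (psum (fun j => Tcot ((Posz j)%:~R * tau - tpt N tau k l) +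
    Tcot ((Negz j)%:~R * tau - tpt N tau k l))) (twopii R ^+ 2 * XT k l q).
  move=> adm_kl; have /andP[kN _] := adm_kl; have [ok1 ok2] := XT_ok l kN.
  have [c1 _] := Lser_facts (esr R [:: 1]%N) 2 ok1 q1.
  have [c2 _] := Lser_facts (esr R [:: 1]%N) 2 ok2 q1.
  have T j : Tcot (R := R) j = twopii R ^+ 2 * P2 (cexp2ipi j).
    by rewrite /Tcot /rat /=; congr (_ * (_ / _)); ring.
  have e1 : cexp2ipi (tpt N tau k l) = ze ^+ l * q ^+ k.
    rewrite ze_pow qN_pow -e2D /tpt -!pmulrn; congr cexp2ipi; field.
    by rewrite n0.
  have ep j : cexp2ipi ((Posz j.+1)%:~R * tau - tpt N tau k l) = (ze ^+ l)^-1 * q ^+ (j.+1 * N - k).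
    have kj : (k <= j.+1 * N)%N by rewrite mulSn; lia.
    rewrite e2D e2N e1 invfM mulrCA; congr (_ * _); apply: (mulIf (expf_neq0 k (qN_neq0 N tau))).
    rewrite -mulrA mulVf ?expf_neq0 ?qN_neq0 // mulr1 -exprD subnK // qN_pow.
    by rewrite -pmulrn natrM mulrAC mulfK // .
  have en j : cexp2ipi ((Negz j)%:~R * tau - tpt N tau k l) = (ze ^+ l * q ^+ (j.+1 * N + k))^-1.
    rewrite e2D e2N e1 exprD mulrCA [in RHS]invfM; congr (_ / _).
    by rewrite NegzE rmorphN /= mulNr e2N qN_pow -pmulrn natrM mulrAC mulfK.
  (* In [zsum] row 0 is paired with row -1 and row j + 1 with row -j-2, so the series of negative
     rows runs one term ahead. *)
  have c3 := (ctends_shift _ _ 1).1 c2.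
  have c := ctendsZ (twopii R ^+ 2) (ctendsD (ctends_cst (P2 (ze ^+ l * q ^+ k))) (ctendsD c1 c3)).
  apply/(ctends_shift _ _ 1); apply: ctends_ext c => n; rewrite addn1.
  elim: n => [|n IH].
    rewrite !psumS /psum !big_ord0 !add0r !T mul0r sub0r e2N e1 P2V -mulrDr; congr (_ * (_ + _)).
    by rewrite en P2V P2E /lterm !mulrA.
  rewrite [RHS]psumS -IH [psum _ n.+1 in LHS]psumS [psum _ n.+2 in LHS]psumS.
  by rewrite !T ep en P2V !P2E /lterm; ring.
rewrite mulrBr; apply: csumP; apply: ctends_ext (ctendsB (main _ _ h) (main _ _ h')) => n.
by rewrite -psumB; congr psum; apply/funext => j; rewrite opprD addrACA.
Qed.

End TorsionExpansion.

(** * The q-expansions of E4, E6 and j *)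

Section EisensteinExpansion.
Variables (R : realType) (N : nat).
Hypothesis N0 : (0 < N)%N.
Implicit Types (tau q u : R[i]) (s : seq R[i]).
Local Notation ze := (zeta R N).

Lemma hr0 s : hr s 0 = s`_0.
Proof. by case: s => [|x s] /=; rewrite ?mulr0 ?add0r. Qed.

Lemma Lser0 s n c d a b : Lser_ok c d a b -> a 0%N = 0%N -> (forall j, (0 < a j.+1)%N) ->
  Lser s n c d a b 0 = c 0%N * s`_0.
Proof.
move=> [_ _ _ b1] a0 a1; apply: csumP => e e0; exists 1%N => -[//|m] _.
rewrite psumSl /lterm a0 expr0 mulr1 /rat expr0n gtn_eqF ?b1 // mulr0 hr0 subr0 expr1n divr1.
rewrite /psum big1 ?addr0 ?subrr ?cn0 // => j _.
by rewrite expr0n gtn_eqF ?a1 // mulr0 mul0r.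
Qed.

Lemma holo_split (G : R[i] -> R[i]) : holo_at G 0 ->
  exists2 h, holo_at h 0 & forall q, G q = G 0 + q * h q.
Proof.
move=> hG; exists (tquo 0 G); first exact: holo_at_tquo.
by move=> q; rewrite {1}(tquoE G 0 q) subr0 (mulrC q).
Qed.

(** With u = q^(N(j+1)) and A the Eulerian numerator, u A(u)/(1 - u)^k is the sum of m^(k-1) u^m.
    Hence [q ^+ N * Eq l k q] is the divisor sum series of sigma_(k-1) in q^N = e^(2 pi i tau). *)
Definition Eq (l : seq nat) n q : R[i] :=
  Lser (esr R l) n (fun=> 1) (fun=> 1) (fun j => j * N)%N (fun j => j.+1 * N)%N q.

Lemma Eq_ok : Lser_ok (fun=> 1 : R[i]) (fun=> 1) (fun j => j * N)%N (fun j => j.+1 * N)%N.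
Proof. by split=> j; rewrite ?cn1 // ?leq_pmulr // muln_gt0. Qed.

Lemma Eq_holo l n q : cn q < 1 -> holo_at (Eq l n) q.
Proof. by move=> q1; have [_] := Lser_facts (esr R l) n Eq_ok q1. Qed.

Definition E4q q : R[i] := 1 + 240%:R * (q ^+ N * Eq [:: 1; 4; 1]%N 4 q).
Definition E6q q : R[i] := 1 - 504%:R * (q ^+ N * Eq [:: 1; 26; 66; 26; 1]%N 6 q).

Lemma qpow_holo m q : holo_at (fun w : R[i] => w ^+ m) q.
Proof. by apply: holo_atX; exact: holo_at_id. Qed.

Lemma E4q_holo q : cn q < 1 -> holo_at E4q q.
Proof.
move=> q1; apply: holo_atD; first exact: holo_at_cst.
by apply: holo_atM; [exact: holo_at_cst|apply: holo_atM; [exact: qpow_holo|exact: Eq_holo]].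
Qed.

Lemma E6q_holo q : cn q < 1 -> holo_at E6q q.
Proof.
move=> q1; apply: holo_atB; first exact: holo_at_cst.
by apply: holo_atM; [exact: holo_at_cst|apply: holo_atM; [exact: qpow_holo|exact: Eq_holo]].
Qed.

Lemma Eq_kser K l n : is_subfield K -> kser K (Eq l n).
Proof.
by move=> KF; apply: (kser_Lser KF) => [||_|_]; [exact: Eq_ok|exact: Kesr|exact: K1|exact: K1].
Qed.

Lemma E4q_kser K : is_subfield K -> kser K E4q.
Proof.
move=> KF; apply: (kserD KF); first exact: (kser_cst KF (K1 KF)).
by apply: (kserM KF); [exact: (kser_cst KF (Knat KF _))|apply: (kserM KF); [exact: kser_pow|exact: Eq_kser]].
Qed.

Lemma E6q_kser K : is_subfield K -> kser K E6q.
Proof.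
move=> KF; apply: (kserB KF); first exact: (kser_cst KF (K1 KF)).
by apply: (kserM KF); [exact: (kser_cst KF (Knat KF _))|apply: (kserM KF); [exact: kser_pow|exact: Eq_kser]].
Qed.

Lemma E4q0 : E4q 0 = 1.
Proof. by rewrite /E4q expr0n gtn_eqF // mul0r mulr0 addr0. Qed.

Lemma E6q0 : E6q 0 = 1.
Proof. by rewrite /E6q expr0n gtn_eqF // mul0r mulr0 subr0. Qed.

(* The expansion of the discriminant starts with 1728 q^N, since 3*240 + 2*504 = 1728. *)
Lemma Delta_lead : exists G, [/\ holo_at G 0, G 0 != 0 &
  forall q, cn q < 1 -> E4q q ^+ 3 - E6q q ^+ 2 = q ^+ N * G q].
Proof.
pose a := Eq [:: 1; 4; 1]%N 4; pose b := Eq [:: 1; 26; 66; 26; 1]%N 6.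
have z1 : cn (0 : R[i]) < 1 by rewrite cn0.
have ha : holo_at a 0 by exact: Eq_holo.
have hb : holo_at b 0 by exact: Eq_holo.
have hq := qpow_holo N 0.
exists (fun q => 240%:R * a q * (3%:R + 3%:R * (240%:R * (q ^+ N * a q)) + (240%:R * (q ^+ N * a q)) ^+ 2)
  + 504%:R * b q * (2%:R - 504%:R * (q ^+ N * b q))); split.
- have hA : holo_at (fun q => 240%:R * (q ^+ N * a q)) 0.
    by apply: holo_atM; [exact: holo_at_cst|exact: holo_atM].
  have hB : holo_at (fun q => 504%:R * (q ^+ N * b q)) 0.
    by apply: holo_atM; [exact: holo_at_cst|exact: holo_atM].
  apply: holo_atD.
    apply: holo_atM; first by apply: holo_atM => //; exact: holo_at_cst.
    apply: holo_atD; last exact: holo_atX.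
    by apply: holo_atD; [exact: holo_at_cst|apply: holo_atM => //; exact: holo_at_cst].
  apply: holo_atM; first by apply: holo_atM => //; exact: holo_at_cst.
  by apply: holo_atB => //; exact: holo_at_cst.
- have a0 : a 0 = 1.
    by rewrite /a /Eq Lser0 ?mul1r //; [exact: Eq_ok|move=> j; rewrite muln_gt0].
  have b0 : b 0 = 1.
    by rewrite /b /Eq Lser0 ?mul1r //; [exact: Eq_ok|move=> j; rewrite muln_gt0].
  have Z : (0 : R[i]) ^+ N = 0 by rewrite expr0n gtn_eqF.
  have Z2 : (0 : R[i]) ^+ 2 = 0 by rewrite expr0n.
  have P (k l : nat) : (0 < k)%N -> k%:R * 3%:R + l%:R * 2%:R != 0 :> R[i].
    by move=> k0; rewrite -!natrM -natrD pnatr_eq0 addn_eq0 muln_eq0 gtn_eqF.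
  by rewrite a0 b0 Z !mul0r !mulr0 Z2 !addr0 subr0 !mulr1; apply: P.
- move=> q q1; rewrite /E4q /E6q -/a -/b; move: (a q) (b q) (q ^+ N) => x y z.
  by move: (240%:R : R[i]) (504%:R : R[i]) => k l; ring.
Qed.

Lemma Im_notint tau : complex.Im tau != 0 -> notint tau.
Proof.
move=> h n; apply: contra h => /eqP E.
have : complex.Im (tau + n%:~R) = 0 by rewrite E.
by rewrite ImD intC /= addr0 => ->.
Qed.

Lemma row_eis0 k tau : row (eis_term k tau) 0 = Zsum R k.
Proof.
rewrite /row /Zsum; congr zsum; apply/funext => n; rewrite /eis_term xpair_eqE eqxx andbT.
by case: eqP => // _; rewrite /lattice_pt /= mul0r addr0.
Qed.

Lemma row_eis k tau (m : int) : m != 0 -> row (eis_term k tau) m = Ssum k (m%:~R * tau).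
Proof.
move=> m0; rewrite /row /Ssum; congr zsum; apply/funext => n.
by rewrite /eis_term xpair_eqE (negbTE m0) andbF /Sterm addrC.
Qed.

Lemma eis_sum k tau (X : nat -> R[i]) L : (2 < k)%N -> Hp tau -> ctends (psum X) L ->
  (forall j, Ssum k ((Posz j.+1)%:~R * tau) = X j) ->
  (forall j, Ssum k ((Negz j)%:~R * tau) = X j) -> eis k tau = Zsum R k + 2%:R * L.
Proof.
move=> k2 ht cX h1 h2; have [_ ->] := eis_usum k2 ht; apply: csumP.
have c := ctendsD (ctends_cst (Zsum R k)) (ctendsD cX ((ctends_shift _ _ 1).1 cX)).
rewrite [2%:R * L]mulr_natl mulr2n; apply/(ctends_shift _ _ 1).
apply: ctends_ext c => n; rewrite addn1.
elim: n => [|n IH].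
  by rewrite !psumS /psum !big_ord0 !add0r row_eis0 row_eis // h2.
rewrite [RHS]psumS -IH [psum X n.+1 in LHS]psumS [psum X n.+2 in LHS]psumS.
by rewrite !row_eis // h2 h1; ring.
Qed.

Lemma inv1B u : u != 0 -> 1 - u^-1 = - (1 - u) / u.
Proof. by move=> u0; field. Qed.

(** The numerator is palindromic. In even weight the rows m and -m therefore have equal sums, which
    produces the factor 2 in [eis_sum]. *)
Lemma rat4V u : u != 0 -> 1 - u != 0 ->
  rat (esr R [:: 0; 1; 4; 1]%N) 4 u^-1 = rat (esr R [:: 0; 1; 4; 1]%N) 4 u.
Proof. by move=> u0 u1; rewrite /rat /= inv1B //; field; rewrite u0 u1. Qed.

Lemma rat6V u : u != 0 -> 1 - u != 0 ->
  rat (esr R [:: 0; 1; 26; 66; 26; 1]%N) 6 u^-1 = rat (esr R [:: 0; 1; 26; 66; 26; 1]%N) 6 u.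
Proof. by move=> u0 u1; rewrite /rat /= inv1B //; field; rewrite u0 u1. Qed.

Lemma eis_Eq k (C : R[i]) l tau : (2 < k)%N -> Hp tau ->
  (forall z, notint z -> Ssum k z = C * rat (esr R (0%N :: l)) k (cexp2ipi z)) ->
  (forall u, u != 0 -> 1 - u != 0 -> rat (esr R (0%N :: l)) k u^-1 = rat (esr R (0%N :: l)) k u) ->
  eis k tau = Zsum R k + 2%:R * (C * (qN N tau ^+ N * Eq l k (qN N tau))).
Proof.
move=> k2 ht HS HV; set q := qN N tau; have q1 : cn q < 1 := qN_lt1 N0 ht.
have [c _] := Lser_facts (esr R l) k Eq_ok q1.
have qe : q ^+ N = cexp2ipi tau.
  by rewrite qN_pow mulrAC mulfV ?mul1r // pnatr_eq0 -lt0n.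
have im (m : int) : m != 0 -> notint (m%:~R * tau).
  move=> m0; apply: Im_notint; rewrite -[_ * tau]addr0 -[0](mulr0z (1 : R[i])) Im_intD.
  by rewrite mulf_neq0 ?intr_eq0 // gt_eqF.
have e (j : nat) : cexp2ipi ((Posz j.+1)%:~R * tau) = q ^+ (j.+1 * N).
  by rewrite mulnC exprM qe -e2_nat.
have R0 u : rat (esr R (0%N :: l)) k u = u * rat (esr R l) k u.
  by rewrite /rat /= addr0 mulrA (mulrC u).
pose X j := C * rat (esr R (0%N :: l)) k (q ^+ (j.+1 * N)).
have cX : ctends (psum X) (C * (q ^+ N * Eq l k q)).
  apply: ctends_ext (ctendsZ C (ctendsZ (q ^+ N) c)) => n; rewrite -!psumZ; congr psum.
  by apply/funext => j; rewrite /X R0 /lterm !mul1r mulSn exprD !mulrA.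
apply: (eis_sum k2 ht cX) => j; first by rewrite (HS _ (im (Posz j.+1) isT)) e.
rewrite (HS _ (im (Negz j) isT)) (_ : cexp2ipi _ = (q ^+ (j.+1 * N))^-1); last by rewrite NegzE rmorphN /= mulNr e2N -e.
rewrite /X HV //.
  by rewrite expf_neq0 // qN_neq0.
apply: lt1_neq1; apply: (le_lt_trans _ q1); rewrite -[q ^+ _]mul1r; apply: cn_dq => //.
- by rewrite cn1.
- by rewrite muln_gt0.
- exact: ltW.
Qed.

Theorem eis4E tau : Hp tau -> eis 4 tau = twopii R ^+ 4 / 720%:R * E4q (qN N tau).
Proof.
move=> ht; rewrite (@eis_Eq 4 _ _ _ isT ht (@Ssum4E R) rat4V) Zsum4 /E4q.
rewrite (_ : 720%:R = 3%:R * 240%:R :> R[i]); last by rewrite -natrM.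
have k0 : 240%:R != 0 :> R[i] by rewrite pnatr_eq0.
move: (240%:R : R[i]) k0 => k k0; move: (qN N tau ^+ N * _) => x; field.
by rewrite k0.
Qed.

Theorem eis6E tau : Hp tau -> eis 6 tau = - (twopii R ^+ 6 / (120%:R * 252%:R)) * E6q (qN N tau).
Proof.
move=> ht; rewrite (@eis_Eq 6 _ _ _ isT ht (@Ssum6E R) rat6V) Zsum6 /E6q.
rewrite (_ : 504%:R = 2%:R * 252%:R :> R[i]); last by rewrite -natrM.
have k0 : 252%:R != 0 :> R[i] by rewrite pnatr_eq0.
move: (252%:R : R[i]) k0 => k k0; move: (qN N tau ^+ N * _) => x; field.
by rewrite k0.
Qed.

Theorem j_invariantE tau : Hp tau -> j_invariant tau =
  12%:R ^+ 3 * E4q (qN N tau) ^+ 3 / (E4q (qN N tau) ^+ 3 - E6q (qN N tau) ^+ 2).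
Proof.
move=> ht; rewrite /j_invariant /g2 /g3 -!/(eis _ tau) eis4E // eis6E //.
move: (E4q _) (E6q _) => a b; have t0 := twopii_neq0 R; move: (twopii R) t0 => t t0.
have e1 : 60%:R * (t ^+ 4 / 720%:R * a) = t ^+ 4 * a / 12%:R.
  rewrite (_ : 720%:R = 60%:R * 12%:R :> R[i]); last by rewrite -natrM.
  have k0 : 60%:R != 0 :> R[i] by rewrite pnatr_eq0.
  by move: (60%:R : R[i]) k0 => k k0; field; rewrite k0.
have e2 : 140%:R * (- (t ^+ 6 / (120%:R * 252%:R)) * b) = - (t ^+ 6 * b / 6%:R ^+ 3).
  rewrite (_ : 140%:R = 20%:R * 7%:R :> R[i]); last by rewrite -natrM.
  rewrite (_ : 120%:R = 20%:R * 6%:R :> R[i]); last by rewrite -natrM.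
  rewrite (_ : 252%:R = 7%:R * 6%:R ^+ 2 :> R[i]); last by rewrite -natrX -natrM.
  have k0 : 20%:R != 0 :> R[i] by rewrite pnatr_eq0.
  by move: (20%:R : R[i]) k0 => k k0; field; rewrite k0.
rewrite e1 e2.
have -> : (t ^+ 4 * a / 12%:R) ^+ 3 - 27%:R * (- (t ^+ 6 * b / 6%:R ^+ 3)) ^+ 2
  = t ^+ 12 / 12%:R ^+ 3 * (a ^+ 3 - b ^+ 2) by field.
rewrite invfM; move: ((a ^+ 3 - b ^+ 2)^-1) => X; field.
by rewrite t0.
Qed.

Definition F4 tau := E4q (qN N tau).
Definition F6 tau := E6q (qN N tau).

Lemma F4_moebius g tau : SL2Z g -> Hp tau -> F4 (moebius g tau) = mden g tau ^+ 4 * F4 tau.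
Proof.
move=> hg ht; have := eis_moebius (isT : (2 < 4)%N) hg ht.
rewrite !eis4E ?Hp_moebius // mulrCA => /mulfI; apply.
by rewrite mulf_neq0 ?invr_eq0 ?pnatr_eq0 // expf_neq0 // twopii_neq0.
Qed.

Lemma F6_moebius g tau : SL2Z g -> Hp tau -> F6 (moebius g tau) = mden g tau ^+ 6 * F6 tau.
Proof.
move=> hg ht; have := eis_moebius (isT : (2 < 6)%N) hg ht.
rewrite !eis6E ?Hp_moebius // mulrCA => /mulfI; apply.
rewrite oppr_eq0 mulf_neq0 ?expf_neq0 ?twopii_neq0 // invr_eq0.
Qed.

Lemma F4_holo tau : Hp tau -> holo_at F4 tau.
Proof.
by move=> ht; apply: holo_at_comp; [exact: qN_holo|apply: E4q_holo; exact: qN_lt1].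
Qed.

Lemma F6_holo tau : Hp tau -> holo_at F6 tau.
Proof.
by move=> ht; apply: holo_at_comp; [exact: qN_holo|apply: E6q_holo; exact: qN_lt1].
Qed.

End EisensteinExpansion.

(** * Leading terms of differences of torsion values *)

Section LeadingTerms.
Variables (R : realType) (N : nat).
Hypothesis N0 : (0 < N)%N.
Implicit Types (q u : R[i]) (r s : nat).
Local Notation ze := (zeta R N).
Local Notation P2 := (rat (esr R [:: 0; 1]%N) 2).
Local Notation P1 := (rat (esr R [:: 1]%N) 2).

(** The coefficient of q^r in [XT] for 2r <= N. The row m = 1 starts at q^(N - r), which reaches the
    exponent r exactly when 2r = N and then adds zeta^-s; for r = 0 the whole constant row
    counts. *)
Definition lam r s : R[i] :=
  if r == 0%N then P2 (ze ^+ s) else if (2 * r == N)%N then ze ^+ s + (ze ^+ s)^-1 else ze ^+ s.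

Lemma XT_lead r s : adm N r s -> (2 * r <= N)%N -> exists h, holo_at h 0 /\
  near_eq 0 (XT N r s) (fun q => q ^+ r * (lam r s + q * h q)).
Proof.
move=> h rN2; have /andP[rN _] := h; have [ok1 ok2] := XT_ok R N0 s rN.
have z1 : cn (0 : R[i]) < 1 by rewrite cn0.
set x := ze ^+ s.
pose A := Lser (esr R [:: 1]%N) 2 (fun=> x^-1) (fun=> x^-1) (fun j => j * N)%N (fun j => j.+1 * N - r)%N.
pose B := Lser (esr R [:: 1]%N) 2 (fun=> x) (fun=> x) (fun j => j * N + r)%N (fun j => j.+1 * N + r)%N.
have okA : Lser_ok (fun=> x^-1) (fun=> x^-1) (fun j => j * N)%N (fun j => j.+1 * N - r)%N.
  by case: ok1 => a1 a2 a3 a4; split=> // j; exact: leq_pmulr.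
have okB : Lser_ok (fun=> x) (fun=> x) (fun j => j * N + r)%N (fun j => j.+1 * N + r)%N.
  by case: ok2 => a1 a2 a3 a4; split=> // j; rewrite (leq_trans (leq_pmulr j N0)) // leq_addr.
have [_ hA] := Lser_facts (esr R [:: 1]%N) 2 okA z1.
have [_ hB] := Lser_facts (esr R [:: 1]%N) 2 okB z1.
have A0 : A 0 = x^-1.
  have aj j : (0 < j.+1 * N)%N by rewrite muln_gt0.
  by rewrite /A (Lser0 _ _ okA _ aj) // mulr1.
have E q : cn q < 1 -> XT N r s q = P2 (x * q ^+ r) + (q ^+ (N - r) * A q + q ^+ N * B q).
  have e1 : (fun j => j.+1 * N - r)%N = (fun j => N - r + j * N)%N.
    by apply/funext => j; rewrite mulSn; lia.
  have e2 : (fun j => j.+1 * N + r)%N = (fun j => N + (j * N + r))%N.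
    by apply/funext => j; rewrite mulSn addnA.
  by move=> q1; rewrite /XT -(Lser_factor _ _ okA) // -(Lser_factor _ _ okB) // e1 e2.
have [a ha HA] := holo_split hA.
rewrite -/A A0 in HA.
have [r0|r0] := posnP r.
  exists (fun q => q ^+ N.-1 * (A q + B q)); split.
    by apply: holo_atM; [exact: qpow_holo|exact: holo_atD].
  apply: near1 => q q1; rewrite E // /lam r0 /= subn0 expr0 mulr1 mul1r -{1 2}(prednK N0) !exprS; ring.
have hP : holo_at (fun q => P1 (x * q ^+ r)) 0.
  have KF := is_subfieldT R; have [hh _] : kser setT (fun q => P1 (x * q ^+ r)) => //.
  by apply: (kser_rat KF) => //; [exact: (kser_mono KF)|rewrite expr0n gtn_eqF // mulr0].
have [p hp HP] := holo_split hP.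
have P0 : P1 (x * 0 ^+ r) = 1 by rewrite expr0n gtn_eqF // mulr0 /rat /= mul0r add0r subr0 expr1n divr1.
have [rN'|rN'] := eqVneq (2 * r)%N N.
  exists (fun q => x * p q + a q + q ^+ r.-1 * B q); split.
    apply: holo_atD; last by apply: holo_atM; [exact: qpow_holo|].
    by apply: holo_atD => //; apply: holo_atM => //; exact: holo_at_cst.
  apply: near1 => q q1; rewrite E // /lam gtn_eqF // rN' eqxx P2E HP P0 HA -/x.
  have -> : (N - r)%N = r by lia.
  have -> : N = (r + (r.-1).+1)%N by lia.
  rewrite exprD exprS; ring.
exists (fun q => x * p q + q ^+ (N - 2 * r).-1 * A q + q ^+ (N - r).-1 * B q); split.
  apply: holo_atD; last by apply: holo_atM; [exact: qpow_holo|].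
  apply: holo_atD; last by apply: holo_atM; [exact: qpow_holo|].
  by apply: holo_atM => //; exact: holo_at_cst.
apply: near1 => q q1; rewrite E // /lam gtn_eqF // (negbTE rN') P2E HP P0 -/x.
have e1 : (N - r)%N = (r + ((N - 2 * r).-1).+1)%N by lia.
have e2 : N = (r + ((N - r).-1).+1)%N by lia.
have p1 : q ^+ (N - r) = q ^+ r * (q * q ^+ (N - 2 * r).-1) by rewrite -exprS -exprD -e1.
have p2 : q ^+ N = q ^+ r * (q * q ^+ (N - r).-1) by rewrite -exprS -exprD -e2.
rewrite p1 p2; ring.
Qed.

Lemma lam_neq0 r s : adm N r s -> (2 * r < N)%N -> lam r s != 0.
Proof.
move=> h rN; rewrite /lam; have [r0|r0] := eqVneq r 0%N; last first.
  by rewrite ltn_eqF // (ze_neq0 R N s).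
move: h; rewrite r0 /adm eqxx /= N0 /= => h.
rewrite /rat /= mul0r add0r mul1r addr0 mulf_neq0 ?(ze_neq0 R N s) ?invr_eq0 ?expf_neq0 //.
by rewrite subr_eq0 eq_sym ze_eq1.
Qed.

(** The excluded case says that the two points agree up to sign. When r = r' the leading
    coefficients could cancel: for x = zeta^s and y = zeta^s' their equality means x = y, or (x -
    y)(1 - xy) = 0 in the two symmetric cases r = 0 and 2r = N. *)
Lemma XT_diff r s r' s' : adm N r s -> adm N r' s' -> (2 * r <= N)%N -> (2 * r' <= N)%N ->
  (s < N)%N -> (s' < N)%N -> (r <= r')%N ->
  ~~ ((r == r') && ((s == s') || ((r == 0%N) || (2 * r == N)%N) && (N %| s + s')%N)) ->
  exists G, [/\ holo_at G 0, G 0 != 0 &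
    near_eq 0 (fun q => XT N r s q - XT N r' s' q) (fun q : R[i] => q ^+ r * G q)].
Proof.
move=> h h' rN rN' sN sN' rr ne.
have [u [hu [e e0 He]]] := XT_lead h rN; have [v [hv [e' e0' He']]] := XT_lead h' rN'.
exists (fun q => (lam r s + q * u q) - q ^+ (r' - r) * (lam r' s' + q * v q)); split.
- by apply: holo_atB; [|apply: holo_atM; first exact: qpow_holo]; apply: holo_atD;
    do ?[exact: holo_at_cst|apply: holo_atM => //; exact: holo_at_id].
- rewrite !mul0r !addr0; have [E|d] := posnP (r' - r)%N; last first.
    by rewrite expr0n gtn_eqF // mul0r subr0 lam_neq0 //; lia.
  have {E rr} E : r' = r by lia.
  subst r'; rewrite subnn mul1r subr_eq0; apply: contra ne => /eqP L; rewrite eqxx /=.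
  have [//|ss /=] := eqVneq s s'; move: L; rewrite /lam.
  have xy : ze ^+ s - ze ^+ s' != 0.
    by rewrite subr_eq0; apply: contra ss => /eqP /(ze_inj N0 sN sN') ->.
  have conc : 1 - ze ^+ s * ze ^+ s' = 0 -> (N %| s + s')%N.
    rewrite -exprD; case: (boolP (N %| s + s')%N) => // /ze_eq1 -/(_ R) k /eqP.
    by rewrite subr_eq0 eq_sym => /eqP K; rewrite K eqxx in k; apply: k.
  have [r0|r0] := eqVneq r 0%N.
    move: h h'; rewrite r0 /adm /= N0 /= => hs hs'.
    have x1 := ze_eq1 R N0 hs; have y1 := ze_eq1 R N0 hs'.
    move=> L; apply: conc; move: L xy x1 y1; rewrite /rat /= !mul0r !add0r !mul1r !addr0.
    move: (ze ^+ s) (ze ^+ s') => x y L xy x1 y1.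
    have x1' : 1 - x != 0 by rewrite subr_eq0 eq_sym.
    have y1' : 1 - y != 0 by rewrite subr_eq0 eq_sym.
    apply: (mulfI xy); rewrite mulr0.
    have := congr1 (fun t => t * ((1 - x) ^+ 2 * (1 - y) ^+ 2)) L.
    have -> : x / (1 - x) ^+ 2 * ((1 - x) ^+ 2 * (1 - y) ^+ 2) = x * (1 - y) ^+ 2 by field.
    have -> : y / (1 - y) ^+ 2 * ((1 - x) ^+ 2 * (1 - y) ^+ 2) = y * (1 - x) ^+ 2 by field.
    move=> /eqP; rewrite -subr_eq0 => /eqP <-; ring.
  case: eqP => [_ L|_ /(ze_inj N0 sN sN') E /=]; last by rewrite E eqxx in ss.
  apply: conc; have x0 := ze_neq0 R N s; have y0 := ze_neq0 R N s'.
  move: L xy x0 y0; move: (ze ^+ s) (ze ^+ s') => x y L xy x0 y0.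
  apply: (mulfI xy); rewrite mulr0.
  have := congr1 (fun t => t * (x * y)) L.
  have -> : (x + x^-1) * (x * y) = x * x * y + y by field.
  have -> : (y + y^-1) * (x * y) = x * y * y + x by field.
  move=> /eqP; rewrite -subr_eq0 => /eqP K; rewrite -oppr0 -K; ring.
- exists (Num.min e e'); first by rewrite lt_min e0.
  move=> q; rewrite subr0 lt_min => /andP[q1 q2]; rewrite He ?subr0 // He' ?subr0 //.
  by rewrite -{1}(subnKC rr) exprD; ring.
Qed.

End LeadingTerms.

(** * Level-N matrices preserving the orders of Lambda at the cusps *)

Section TorsionCharacterization.
Variable n : nat.
Local Notation N := n.+2.
Local Notation Z := 'Z_n.+2.
Implicit Types (a b p q r s x y : Z).

(** The distance of k from 0 in Z/N. The difference of the values at P and Q has order min(dz P.1,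
    dz Q.1) in q, so [mind] gives the orders of the numerator and the denominator of Lambda. *)
Definition dz (k : nat) : nat := minn k (N - k).
Definition mind a b : nat := minn (dz a) (dz (a + b)%R).
(** Equality of the orders mind a b - mind b a and mind a' b' - mind b' a' of two Lambda quotients,
    rearranged to avoid subtraction in [nat]. *)
Definition same_order a b a' b' := (mind a b + mind b' a' = mind a' b' + mind b a)%N.

Lemma Zval_lt x : (x < N)%N. Proof. exact: ltn_ord. Qed.

Lemma ZvalD x y : (nat_of_ord (x + y)%R = x + y \/ nat_of_ord (x + y)%R + N = x + y)%N.
Proof.
have /= -> : nat_of_ord (x + y) = ((x + y) %% N)%N by [].
have := Zval_lt x; have := Zval_lt y; case: (ltnP (x + y)%N N) => h hx hy.
  by left; rewrite modn_small.
right; rewrite -{1}(subnK h) modnDr modn_small; lia.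
Qed.

Lemma Zval_nat k : (k < N)%N -> nat_of_ord (k%:R : Z) = k.
Proof. by move=> h; rewrite val_Zp_nat // modn_small. Qed.

Lemma Zval_eq x k : nat_of_ord x = k -> x = k%:R.
Proof. by move=> <-; rewrite natr_Zp. Qed.

Lemma ZN : (N%:R : Z) = 0.
Proof. exact: pchar_Zp. Qed.

Lemma Zopp (k l : nat) : (k + l = N)%N -> (l%:R : Z) = - k%:R.
Proof. by move=> h; apply/eqP; rewrite -addr_eq0 -natrD addnC h ZN. Qed.

Lemma Zmul1 (k l c : nat) : (k * l = N * c + 1)%N -> (k%:R * l%:R : Z) = 1.
Proof. by move=> h; rewrite -natrM h natrD natrM ZN mul0r add0r. Qed.

(** For N = 2k + 1 the order k is the largest possible, and it is attained only at plus or minus (k,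
    0). *)
Lemma class_odd k (a b c : nat) : N = (2 * k + 1)%N -> (a < N)%N -> (b < N)%N -> (c < N)%N ->
  (c = a + b \/ c + N = a + b)%N -> (minn (dz a) (dz c) = k + minn (dz b) (dz c))%N ->
  b = 0%N /\ (a = k \/ a = k.+1).
Proof. rewrite /dz; lia. Qed.

(** The top order h belongs to (h, 0), where h is no unit; the next order h - 1 is used because h -
    1 is a unit modulo 2h when h is even. *)
Lemma class_even h (a b c : nat) : N = (2 * h)%N -> (2 <= h)%N -> (a < N)%N -> (b < N)%N -> (c < N)%N ->
  (c = a + b \/ c + N = a + b)%N -> (minn (dz a) (dz c) = h.-1 + minn (dz b) (dz c))%N ->
  b = 0%N /\ (a = h.-1 \/ a = h.+1).
Proof. rewrite /dz; lia. Qed.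

(** For odd m the number m - 1 is even, hence no unit modulo 2m, while m - 2 is one. The price is
    that the order m - 2 occurs, up to sign, at three vectors: (m - 2, 0), (m - 1, 1) and (m, 1). *)
Lemma class_sing m (a b c : nat) : N = (2 * m)%N -> (5 <= m)%N -> (a < N)%N -> (b < N)%N -> (c < N)%N ->
  (c = a + b \/ c + N = a + b)%N -> (minn (dz a) (dz c) = (m - 2) + minn (dz b) (dz c))%N ->
  b = 0%N /\ (a = (m - 2)%N \/ a = (m + 2)%N) \/ b = 1%N /\ (a = m.-1 \/ a = m) \/
  b = (N - 1)%N /\ (a = m.+1 \/ a = m).
Proof. rewrite /dz; lia. Qed.

(** These are the vectors that lift to first columns of matrices in SL_2(Z), that is, the ones that
    correspond to cusps. *)
Definition unimod a b := exists u w : Z, u * a + w * b = 1.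

Section Fixed.
Variables (p q r s : Z).
Hypothesis det1 : p * s - q * r = 1.
Hypothesis Hv : forall a b, unimod a b -> same_order (p * a + q * b) (r * a + s * b) a b.

Lemma axis_image (k : nat) : (k < N)%N -> (exists w : Z, k%:R * w = 1) ->
  (mind (p * k%:R)%R (r * k%:R)%R = dz k + mind (r * k%:R)%R (p * k%:R)%R)%N.
Proof.
move=> kN [w hw]; have U : unimod k%:R 0 by exists w, 0; rewrite mul0r addr0 mulrC.
have d0 : dz 0 = 0%N by rewrite /dz min0n.
have v0 : nat_of_ord (0 : Z) = 0%N by [].
have := Hv U; rewrite /same_order /mind !mulr0 !addr0 !add0r Zval_nat // v0.
by rewrite minnn d0 min0n addn0.
Qed.

Lemma axis_fixed (k l : nat) : (k + l = N)%N -> (k < N)%N -> (exists w : Z, k%:R * w = 1) ->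
  (nat_of_ord (r * k%:R : Z)%R = 0%N /\ (nat_of_ord (p * k%:R : Z) = k \/ nat_of_ord (p * k%:R : Z) = l)) ->
  r = 0 /\ (p = 1 \/ p = -1).
Proof.
move=> kl kN [w hw] [h1 h2].
have cancel x y : x * k%:R = y * k%:R -> x = y.
  by move=> e; rewrite -[x]mulr1 -[y]mulr1 -hw !mulrA e.
split; first by apply: cancel; rewrite mul0r (Zval_eq h1).
case: h2 => /Zval_eq e; [left|right]; apply: cancel; first by rewrite mul1r.
by rewrite mulN1r e; exact: Zopp.
Qed.

Lemma same_val a b : (nat_of_ord (a + b)%R < N)%N /\
  (nat_of_ord (a + b)%R = a + b \/ nat_of_ord (a + b)%R + N = a + b)%N.
Proof. by split; [exact: Zval_lt|exact: ZvalD]. Qed.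

Lemma mindC a b : mind b a = minn (dz b) (dz (a + b)%R).
Proof. by rewrite /mind addrC. Qed.

Lemma first_column_odd k : N = (2 * k + 1)%N -> r = 0 /\ (p = 1 \/ p = -1).
Proof.
move=> Nk; have k0 : (0 < k)%N by lia.
have kw : exists w : Z, k%:R * w = 1.
  exists (- 2%:R); apply/eqP; rewrite mulrN eqr_oppLR -addr_eq0 -natrM -[1]/(1%:R) -natrD.
  by rewrite (_ : (k * 2 + 1)%N = N) ?ZN //; lia.
have kN : (k < N)%N by lia.
have := axis_image kN kw; rewrite [mind (r * _) _]mindC /mind => h.
have [cl cc] := same_val (p * k%:R) (r * k%:R).
apply: (@axis_fixed k k.+1) => //; first by lia.
apply: (class_odd Nk _ _ cl cc); rewrite ?Zval_lt //.
by rewrite h /dz; lia.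
Qed.

Lemma first_column_4 t : N = (4 * t)%N -> r = 0 /\ (p = 1 \/ p = -1).
Proof.
move=> Nt; have t0 : (0 < t)%N by lia.
set k := (2 * t).-1.
have kw : exists w : Z, k%:R * w = 1.
  (* (2t - 1)^2 = 4t (t - 1) + 1, so k is its own inverse. *)
  by exists k%:R; apply: (@Zmul1 _ _ (t - 1)); rewrite /k Nt; case: (t) t0 => // u _; rewrite subn1 /=; nia.
have kN : (k < N)%N by lia.
have := axis_image kN kw; rewrite [mind (r * _) _]mindC /mind => h.
have [cl cc] := same_val (p * k%:R) (r * k%:R).
apply: (@axis_fixed k (2 * t).+1) => //; first by lia.
apply: (@class_even (2 * t) _ _ _ _ _ _ _ cl cc); rewrite ?Zval_lt //; try lia.
by rewrite h /dz; lia.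
Qed.

Lemma det_image (a b a' b' : Z) :
  (p * a + q * b) * (r * a' + s * b') - (r * a + s * b) * (p * a' + q * b') = a * b' - b * a'.
Proof. by rewrite -[RHS]mul1r -det1; ring. Qed.

(** The three vectors of order m - 2 are permuted up to sign, and determinants single out the first:
    it has determinant M - 2 with each of the others, whereas those have determinant -1 with each
    other. *)
Lemma first_column_sing m : N = (2 * m)%N -> odd m -> (5 <= m)%N -> r = 0 /\ (p = 1 \/ p = -1).
Proof.
move=> Nm om m5; set k := (m - 2)%N.
have kw : exists w : Z, k%:R * w = 1.
  (* The inverse of m - 2 modulo 2m is linear in t, with a formula that depends on m modulo 4. *)
  have [[t et]|[t et]] : (exists t, m = (4 * t).+1) \/ (exists t, m = (4 * t + 3)%N).
    have := divn_eq m 4; have := ltn_pmod m (isT : 0 < 4)%N; move: (m %/ 4)%N (m %% 4)%N => u w w4 e.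
    have : (w = 1 \/ w = 3)%N by lia.
    by case=> w1; [left|right]; exists u; lia.
  - exists (6 * t + 1)%N%:R; apply: (@Zmul1 _ _ (3 * t - 1)); rewrite /k Nm et.
    case: t et => [|u] et; first by rewrite et in m5.
    have -> : ((4 * u.+1).+1 - 2 = 4 * u + 3)%N by lia.
    have -> : (3 * u.+1 - 1 = 3 * u + 2)%N by lia.
    nia.
  - exists (2 * t + 1)%N%:R; apply: (@Zmul1 _ _ t); rewrite /k Nm et; nia.
have kN : (k < N)%N by rewrite /k; lia.
pose M : Z := m%:R; have km : (k%:R : Z) = M - 2%:R by rewrite natrB //; lia.
have S a b : unimod a b -> (mind a b = k + mind b a)%N ->
    exists2 eps : Z, eps = 1 \/ eps = -1 &
    [\/ p * a + q * b = eps * (M - 2%:R) /\ r * a + s * b = 0,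
        p * a + q * b = eps * (M - 1) /\ r * a + s * b = eps |
        p * a + q * b = eps * M /\ r * a + s * b = eps].
  move=> ab hab; have := Hv ab; rewrite /same_order hab.
  set A := p * a + q * b; set B := r * a + s * b => e.
  have {e} : (mind A B = k + mind B A)%N by lia.
  rewrite [mind B A]mindC /mind => h; have [cl cc] := same_val A B.
  have [[b0 []]|[[b0 []]|[b0 []]]] := class_sing Nm m5 (Zval_lt A) (Zval_lt B) cl cc h;
    rewrite (Zval_eq b0) => /Zval_eq ->.
  - by exists 1; [left|apply: Or31; rewrite mul1r -km].
  - exists (-1); [by right|apply: Or31; rewrite mulN1r -km; split=> //].
    by apply: Zopp; rewrite /k; lia.
  - by exists 1; [left|apply: Or32; rewrite !mul1r -subn1 natrB //; lia].
  - by exists 1; [left|apply: Or33; rewrite !mul1r].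
  - exists (-1); [by right|apply: Or32; rewrite mulN1r; split].
      by rewrite -[1](_ : 1%:R = 1) // -natrB ?subn1; [apply: Zopp; lia|lia].
    by rewrite (@Zopp 1 (N - 1)) //; lia.
  - exists (-1); [by right|apply: Or33; rewrite mulN1r; split].
      by apply: Zopp; lia.
    by rewrite (@Zopp 1 (N - 1)) //; lia.
have v1 : nat_of_ord (M - 1 : Z) = m.-1.
  by rewrite /M -[1](_ : 1%:R = 1) // -natrB ?subn1 ?Zval_nat //; lia.
have vM : nat_of_ord M = m by rewrite /M Zval_nat //; lia.
have vk : nat_of_ord (M - 2%:R : Z) = k by rewrite -km Zval_nat.
have vo : nat_of_ord (1 : Z) = 1%N by [].
have v2 : nat_of_ord (M + 1 : Z) = m.+1.
  by rewrite /M -[1](_ : 1%:R = 1) // -natrD addn1 Zval_nat //; lia.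
have m0 : (mind (M - 2%:R)%R 0%R = k + mind 0%R (M - 2%:R)%R)%N.
  by rewrite /mind addr0 add0r vk /dz /=; lia.
have m1 : (mind (M - 1)%R 1%R = k + mind 1%R (M - 1)%R)%N.
  have E : 1 + (M - 1) = M by rewrite addrC subrK.
  by rewrite /mind subrK E v1 vM vo /dz; lia.
have m2 : (mind M 1%R = k + mind 1%R M)%N.
  by rewrite /mind (addrC 1) v2 vM vo /dz; lia.
have [w hw] := kw; rewrite km in hw.
have S0 := S (M - 2%:R) 0 (ex_intro _ w (ex_intro _ 0 _)) m0.
have S1 := S (M - 1) 1 (ex_intro _ 0 (ex_intro _ 1 _)) m1.
have S2 := S M 1 (ex_intro _ 0 (ex_intro _ 1 _)) m2.
have {S0} [|e0 s0 S0] := S0; first by rewrite mul0r addr0 mulrC.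
have {S1} [|e1 s1 S1] := S1; first by rewrite mul0r add0r mulr1.
have {S2} [|e2 s2 S2] := S2; first by rewrite mul0r add0r mulr1.
have D01 := det_image (M - 2%:R) 0 (M - 1) 1; have D02 := det_image (M - 2%:R) 0 M 1.
have D12 := det_image (M - 1) 1 M 1.
have k0 : M - 2%:R != 0 :> Z.
  by apply/eqP => /(congr1 (@nat_of_ord _)); rewrite vk /=; lia.
have k1 : M - 2%:R != 1 :> Z.
  by apply/eqP => /(congr1 (@nat_of_ord _)); rewrite vk vo /k; clear -m5; lia.
have kn1 : M - 2%:R != -1 :> Z.
  apply/eqP => E.
  have := congr1 (@nat_of_ord _) E; rewrite vk [X in _ = X](_ : _ = n.+1); first by lia.
  by rewrite -(@Zopp 1 n.+1) ?add1n // Zval_nat.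
(* For m >= 5 the number M - 2 is none of 0, 1, -1, and these are the only determinants between
   vectors of the form plus or minus (M, 1) or (M - 1, 1). *)
have bad e e' (x : Z) : (e = 1 \/ e = -1) -> (e' = 1 \/ e' = -1) ->
    [\/ x = 0, x = 1 | x = -1] -> e * e' * x != M - 2%:R.
  move=> [->|->] [->|->] [->|->|->]; rewrite ?mulrNN ?mulrN ?mulNr ?mulr0 ?mul1r ?mulr1 ?opprK eq_sym ?oppr0 //.
have two y (e' : Z) c d : (e' = 1 \/ e' = -1) ->
    (p * (M - 2%:R) + q * 0 = e0 * (y + M) /\ r * (M - 2%:R) + s * 0 = e0) -> (y = 0 \/ y = -1) ->
    (p * (M - 2%:R) + q * 0) * d - (r * (M - 2%:R) + s * 0) * c = (M - 2%:R) * 1 - 0 * (M - 1) ->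
    (c = e' * (M - 1) \/ c = e' * M) -> d = e' -> False.
  move=> he' [-> ->] y01 D hc hd; have := bad e0 e' (y + 1) s0 he'.
  have := bad e0 e' y s0 he'.
  have E1 : e0 * (y + M) * d - e0 * c = M - 2%:R by rewrite D; ring.
  case: hc => hc; rewrite hc hd in E1.
    have <- : e0 * (y + M) * e' - e0 * (e' * (M - 1)) = e0 * e' * (y + 1) by ring.
    rewrite E1 eqxx => _ h; suff : false by []. 
    by apply: h; case: y01 => ->; [apply: Or32; rewrite add0r|apply: Or31; rewrite addNr].
  have <- : e0 * (y + M) * e' - e0 * (e' * M) = e0 * e' * y by ring.
  rewrite E1 eqxx => h _; suff : false by [].
  by apply: h; case: y01 => ->; [apply: Or31|apply: Or33].
(* If the image of (M - 2, 0) had second coordinate 1 or -1, the determinants would force the images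
   of both other vectors to have second coordinate 0, contradicting their determinant -1. *)
have bad0 (y : Z) : (y = 0 \/ y = -1) ->
    (p * (M - 2%:R) + q * 0 = e0 * (y + M) /\ r * (M - 2%:R) + s * 0 = e0) -> False.
  move=> hy h0.
  have z1 : r * (M - 1) + s * 1 = 0.
    case: S1 => [[_ ->]//|[c d]|[c d]]; exfalso.
      exact: (two y e1 _ _ s1 h0 hy D01 (or_introl c) d).
    exact: (two y e1 _ _ s1 h0 hy D01 (or_intror c) d).
  have z2 : r * M + s * 1 = 0.
    have D02' : (p * (M - 2%:R) + q * 0) * (r * M + s * 1) - (r * (M - 2%:R) + s * 0) * (p * M + q * 1) = (M - 2%:R) * 1 - 0 * (M - 1).
      by rewrite D02; ring.
    case: S2 => [[_ ->]//|[c d]|[c d]]; exfalso.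
      exact: (two y e2 _ _ s2 h0 hy D02' (or_introl c) d).
    exact: (two y e2 _ _ s2 h0 hy D02' (or_intror c) d).
  move: D12; rewrite z1 z2 mulr0 mul0r subrr => /eqP.
  have -> : (M - 1) * 1 - 1 * M = - (1 : Z) by ring.
  by rewrite eq_sym oppr_eq0 oner_eq0.
case: S0 => [[c d]|[c d]|[c d]].
- move: c d; rewrite !mulr0 !addr0 => c d.
  have can x y : x * (M - 2%:R) = y * (M - 2%:R) -> x = y.
    by move=> e; rewrite -[x]mulr1 -[y]mulr1 -hw !mulrA e.
  by split; [apply: can; rewrite mul0r|rewrite (can _ _ c)].
- by case: (bad0 (-1)); [right|split=> //; rewrite c addrC].
- by case: (bad0 0); [left|split=> //; rewrite c add0r].
Qed.

Theorem first_column : N != 6%N -> r = 0 /\ (p = 1 \/ p = -1).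
Proof.
move=> N6; have E := odd_double_half N; case o: (odd N) E => E.
  by apply: (@first_column_odd N./2); rewrite -[LHS]E; lia.
have E2 := odd_double_half N./2; case o2: (odd N./2) E2 => E2; last first.
  by apply: (@first_column_4 N./2./2); rewrite -[LHS]E -E2; lia.
case: (ltnP 4 N./2) => h; first by apply: (@first_column_sing N./2) => //; rewrite -[LHS]E; lia.
(* Here [N./2] is odd and at most 4; the value 3 is the excluded level 6. *)
have N2 : N = 2%N.
  have : N./2 = 1%N.
    move/eqP: N6; move: E E2 h; rewrite -!muln2 /= add0n; move: (N./2) => H; move: (H./2) => H2.
    by move=> E E2 h N6; lia.
  by move=> h1; rewrite -[LHS]E h1.
have kw : exists w : Z, 1%:R * w = 1 by exists 1; rewrite mulr1.
have := @axis_image 1 isT kw; rewrite [mind (r * _) _]mindC /mind => h1.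
have [cl cc] := same_val (p * 1%:R) (r * 1%:R).
apply: (@axis_fixed 1 n.+1) => //.
have := Zval_lt (p * 1%:R); have := Zval_lt (r * 1%:R); move: h1 cl cc.
move: (nat_of_ord (p * 1%:R)) (nat_of_ord (r * 1%:R)) (nat_of_ord (p * 1%:R + r * 1%:R)) => A B C.
by rewrite /dz; move: N2 => [->]; lia.
Qed.

End Fixed.

(** Exchanging the two coordinates replaces Lambda by its inverse and keeps the condition on orders,
    so [first_column] also determines the second column. *)
Theorem order_preserving p q r s : N != 6%N -> p * s - q * r = 1 ->
  (forall a b, unimod a b -> same_order (p * a + q * b) (r * a + s * b) a b) ->
  [/\ q = 0, r = 0, p = s & p = 1 \/ p = -1].
Proof.
move=> N6 d H; have [r0 p1] := first_column d H N6.
have [q0 s1] : q = 0 /\ (s = 1 \/ s = -1).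
  apply: (@first_column s r q p _ _ N6); first by rewrite -d; ring.
  move=> a b [u [w e]]; have e' : w * b + u * a = 1 by rewrite addrC.
  have := H b a (ex_intro _ w (ex_intro _ u e')); rewrite /same_order (addrC (p * b)) (addrC (r * b)) => h.
  by rewrite addnC -h addnC.
split=> //; move: d; rewrite q0 r0 mul0r subr0.
by case: p1 => ->; rewrite ?mul1r ?mulN1r => <-; rewrite ?opprK.
Qed.

End TorsionCharacterization.

(** * The functions Lambda *)

Section LambdaModular.
Variables (R : realType) (n : nat).
Local Notation N := n.+2.
Local Notation Z := 'Z_n.+2.
Implicit Types (tau q : R[i]) (P Q : Z * Z) (g : 'M[int]_2).

Definition wz Q : R[i] -> R[i] := wpt N (Posz (nat_of_ord Q.1)) (Posz (nat_of_ord Q.2)).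

Definition ract Q g : Z * Z :=
  (Q.1 * (g 0 0)%:~R + Q.2 * (g 1 0)%:~R, Q.1 * (g 0 1)%:~R + Q.2 * (g 1 1)%:~R).

Lemma Zint_mod (z : int) : (Posz (nat_of_ord (z%:~R : Z)) = z %[mod N])%Z.
Proof.
have h (k : nat) : (Posz (nat_of_ord (k%:R : Z)) = k %[mod N])%Z.
  by rewrite val_Zp_nat // -modz_nat modz_mod.
case: z => k; first exact: h.
rewrite NegzE rmorphN /=; apply/eqP; rewrite eqz_mod_dvd opprK.
have e : (N %| Posz (nat_of_ord (- k.+1%:R : Z)) + Posz (nat_of_ord (k.+1%:R : Z)))%Z.
  rewrite -PoszD dvdzE /= ; have := ZvalD (- k.+1%:R) (k.+1%:R : Z).
  by rewrite addNr => -[<-|<-]; rewrite ?dvdn0 ?dvdn_addr.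
have := h k.+1 => /eqP; rewrite eqz_mod_dvd => e2.
rewrite (_ : _ + k.+1%:Z = (Posz (nat_of_ord (- k.+1%:R : Z)) + Posz (nat_of_ord (k.+1%:R : Z))) - (Posz (nat_of_ord (k.+1%:R : Z)) - k.+1%:Z)); last by ring.
exact: rpredB.
Qed.

Lemma Zint_val (x : Z) (z : int) : x = z%:~R -> (Posz (nat_of_ord x) = z %[mod N])%Z.
Proof. by move=> ->; exact: Zint_mod. Qed.

Lemma Zint_opp (x : Z) : - x = (- Posz (nat_of_ord x))%:~R.
Proof. by rewrite mulrNz -pmulrn natr_Zp. Qed.

Lemma adm_neq0 Q : Q != 0 -> adm N Q.1 Q.2.
Proof.
move=> h; rewrite /adm Zval_lt /=; apply: contra h => /andP[/eqP a b].
have b0 : nat_of_ord Q.2 = 0%N.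
  have := Zval_lt Q.2; case: (posnP (nat_of_ord Q.2)) => // p; have := dvdn_leq p b; lia.
by case: Q a b0 {b} => x y /= a b; apply/eqP; congr pair; apply: val_inj.
Qed.

Lemma adm_nontriv (k l : nat) : adm N k l -> nontriv N k l.
Proof.
move=> /andP[kN h]; apply: contra h => /andP[]; rewrite !dvdzE /= => h1 ->.
by rewrite andbT eqn0Ngt; apply/negP => p; have := dvdn_leq p h1; rewrite leqNgt kN.
Qed.

Lemma wz_moebius Q g tau : Q != 0 -> SL2Z g -> Hp tau ->
  wz Q (moebius g tau) = mden g tau ^+ 2 * wz (ract Q g) tau.
Proof.
move=> /adm_neq0/adm_nontriv h hg ht; rewrite /wz wpt_moebius //; congr (_ * _).
apply: wpt_mod => //; last exact: nontriv_act.
  by apply/esym/Zint_val; rewrite /ract rmorphD !rmorphM /= -!pmulrn !natr_Zp.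
by apply/esym/Zint_val; rewrite /ract rmorphD !rmorphM /= -!pmulrn !natr_Zp.
Qed.

Lemma wz_opp Q tau : Q != 0 -> Hp tau -> wz (- Q) tau = wz Q tau.
Proof.
move=> /adm_neq0/adm_nontriv h ht; rewrite /wz -(wpt_opp _ h ht) //; apply/esym.
apply: wpt_mod => //; first by apply/esym/Zint_val; exact: Zint_opp.
  by apply/esym/Zint_val; exact: Zint_opp.
by rewrite /nontriv !rpredN.
Qed.

Lemma wzB_XT Q P tau : Q != 0 -> P != 0 -> Hp tau -> wz Q tau - wz P tau =
  twopii R ^+ 2 * (XT N Q.1 Q.2 (qN N tau) - XT N P.1 P.2 (qN N tau)).
Proof. by move=> /adm_neq0 h /adm_neq0 h' ht; exact: wptB_XT. Qed.

Definition LamT P1 P2 tau : R[i] :=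
  (wz P1 tau - wz (P1 + P2) tau) / (wz P2 tau - wz (P1 + P2) tau).

Lemma Lambda_LamT (Q1 Q2 : Z * Z) tau : Lambda Q1 Q2 tau = LamT Q1 Q2 tau.
Proof. by []. Qed.

Definition unitdet P Q := exists e : Z, (P.1 * Q.2 - P.2 * Q.1) * e = 1.

Lemma ractD P Q g : ract (P + Q) g = ract P g + ract Q g.
Proof. by rewrite /ract /=; congr pair; rewrite /=; ring. Qed.

Lemma unitdet_act P Q g : SL2Z g -> unitdet P Q -> unitdet (ract P g) (ract Q g).
Proof.
move=> /SL2Z_det d [e he]; exists e; rewrite -[RHS]he -[RHS]mulr1 -[1](rmorph1 (intmul (1 : Z))) -d.
by rewrite rmorphB !rmorphM /= /ract /=; ring.
Qed.

Lemma unitdet_rel P Q (x y : Z) : unitdet P Q -> x * P.1 + y * Q.1 = 0 -> x * P.2 + y * Q.2 = 0 ->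
  x = 0 /\ y = 0.
Proof.
move=> [e he] h1 h2; split.
  rewrite -[x]mulr1 -he (_ : x * _ = ((x * P.1 + y * Q.1) * Q.2 - (x * P.2 + y * Q.2) * Q.1) * e); last by ring.
  by rewrite h1 h2; ring.
rewrite -[y]mulr1 -he (_ : y * _ = ((x * P.2 + y * Q.2) * P.1 - (x * P.1 + y * Q.1) * P.2) * e); last by ring.
by rewrite h1 h2; ring.
Qed.

Lemma unitdet_indep P Q (x y : Z) S : unitdet P Q -> (x = 1 \/ y = 1) ->
  S = (x * P.1 + y * Q.1, x * P.2 + y * Q.2) -> S != 0.
Proof.
move=> u xy -> ; apply/eqP => E; have [x0 y0] := unitdet_rel u (congr1 fst E) (congr1 snd E).
by case: xy => E1; [move: x0|move: y0]; rewrite E1 => /eqP; rewrite oner_eq0.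
Qed.

Lemma unitdet_facts P Q : unitdet P Q ->
  [/\ P != 0, Q != 0, P + Q != 0 & [/\ P != P + Q, P != - (P + Q), Q != P + Q & Q != - (P + Q)]].
Proof.
move=> u; have I x y S := @unitdet_indep P Q x y S u; case: P Q I u => p1 p2 [q1 q2] /= I _.
split; last split.
- by apply: (I 1 0); [left|congr pair; ring].
- by apply: (I 0 1); [right|congr pair; ring].
- by apply: (I 1 1); [left|congr pair; rewrite /=; ring].
- by rewrite eq_sym -subr_eq0; apply: (I 0 1); [right|congr pair; rewrite /=; ring].
- by rewrite -subr_eq0; apply: (I 2%:R 1); [right|congr pair; rewrite /=; ring].
- by rewrite eq_sym -subr_eq0; apply: (I 1 0); [left|congr pair; rewrite /=; ring].
- by rewrite -subr_eq0; apply: (I 1 2%:R); [left|congr pair; rewrite /=; ring].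
Qed.

Lemma LamT_moebius P Q g tau : unitdet P Q -> SL2Z g -> Hp tau ->
  LamT P Q (moebius g tau) = LamT (ract P g) (ract Q g) tau.
Proof.
move=> u hg ht; have [p0 q0 s0 _] := unitdet_facts u.
rewrite /LamT !wz_moebius // -!mulrBr -ractD invfM mulrACA mulfV ?mul1r //.
by rewrite expf_neq0 // mden_neq0.
Qed.

Lemma LamT_XT P Q tau : unitdet P Q -> Hp tau -> LamT P Q tau =
  (XT N P.1 P.2 (qN N tau) - XT N (P + Q).1 (P + Q).2 (qN N tau)) /
  (XT N Q.1 Q.2 (qN N tau) - XT N (P + Q).1 (P + Q).2 (qN N tau)).
Proof.
move=> u ht; have [p0 q0 s0 _] := unitdet_facts u.
rewrite /LamT !wzB_XT // invfM mulrACA mulfV ?mul1r //.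
by rewrite expf_neq0 // twopii_neq0.
Qed.

Lemma XTqN_holo P tau : P != 0 -> Hp tau -> holo_at (fun w => XT N P.1 P.2 (qN N w) : R[i]) tau.
Proof.
move=> /adm_neq0 h ht; apply: holo_at_comp; first exact: qN_holo.
by apply: XT_holo => //; exact: qN_lt1.
Qed.

Lemma qlaurent_kser (K : set R[i]) (H : R[i] -> R[i]) : kser K H -> qlaurent N K (fun w => H (qN N w)).
Proof.
move=> kH; exists 0%N, H; split=> //; exists 1 => // tau _; apply: pnear_all => w.
by rewrite expr0 divr1.
Qed.

Lemma qlaurent_Hp (K : set R[i]) (f g : R[i] -> R[i]) : (forall tau, Hp tau -> f tau = g tau) ->
  qlaurent N K f -> qlaurent N K g.
Proof.
move=> h; apply: (@qlaurent_eq _ _ K f g 0) => tau ht.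
by have [r r0 Hr] := Hp_open ht; apply: (pnear_ball r0) => w /Hr /h.
Qed.

Lemma LamT_mero P Q tau : unitdet P Q -> Hp tau -> mero (LamT P Q) tau.
Proof.
move=> u ht; have [p0 q0 s0 _] := unitdet_facts u; have [r r0 Hr] := Hp_open ht.
apply: mero_pnear (mero_div (holo_mero (holo_atB (XTqN_holo p0 ht) (XTqN_holo s0 ht)))
  (holo_mero (holo_atB (XTqN_holo q0 ht) (XTqN_holo s0 ht)))).
by apply: (pnear_ball r0) => w /Hr hw; rewrite LamT_XT.
Qed.

Lemma LamT_qlaurent P Q : unitdet P Q -> qlaurent N (Qzeta R N) (LamT P Q).
Proof.
move=> u; have [/adm_neq0 p0 /adm_neq0 q0 /adm_neq0 s0 _] := unitdet_facts u.
have KF := Qzeta_subfield R N.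
have k (S : Z * Z) : adm N S.1 S.2 -> kser (Qzeta R N) (XT N (nat_of_ord S.1) (nat_of_ord S.2)) by exact: XT_kser.
have h1 := qlaurent_kser (kserB KF (k _ p0) (k _ s0)).
have h2 := qlaurent_kser (kserB KF (k _ q0) (k _ s0)).
have h := qlaurentV (isT : (0 < N)%N) KF h1 h2.
by apply: (qlaurent_Hp _ h) => tau ht; rewrite LamT_XT.
Qed.

Lemma ract_Gamma Q g : Gamma N g -> ract Q g = Q.
Proof.
move=> [_ H]; have E i k : ((g i k)%:~R : Z) = ((1%:M : 'M[int]_2) i k)%:~R.
  have := H i k => /eqP; rewrite eqz_mod_dvd => /dvdzP[c hc].
  apply/eqP; rewrite -subr_eq0 -rmorphB hc rmorphM /= -pmulrn.
  by rewrite (ZN n) mulr0.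
by case: Q => x y; rewrite /ract !E !mxE /= !mulr1 !mulr0 addr0 add0r.
Qed.

Theorem LamT_modular P Q : unitdet P Q -> modular_function_over N (Qzeta R N) (LamT P Q).
Proof.
move=> u; split; last by apply/fourierP => //; exact: LamT_qlaurent.
apply/modular_functionP => //; split=> [tau|A hA|A hA]; first exact: LamT_mero.
  apply/mero_eqP => tau ht; have [r r0 Hr] := Hp_open ht; apply: (pnear_ball r0) => w /Hr hw.
  by rewrite /= LamT_moebius ?ract_Gamma //; exact: SL2Z_Gamma hA.
apply: qlaurent_Hp (qlaurentW (LamT_qlaurent (unitdet_act hA u))) => tau ht.
by rewrite /= LamT_moebius.
Qed.

Definition nrm Q : Z * Z := if (2 * Q.1 <= N)%N then Q else - Q.

Lemma Zval_opp (x : Z) : (0 < x)%N -> nat_of_ord (- x) = (N - x)%N.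
Proof.
by move=> x0; have := ZvalD (- x) x; rewrite addNr; have := Zval_lt x; have /= := Zval_lt (- x); case: (ZvalD (- x) x) => _; lia.
Qed.

Lemma nrm_val Q : nat_of_ord (nrm Q).1 = dz n (nat_of_ord Q.1).
Proof.
rewrite /nrm /dz; case: ifP => h; first by have := Zval_lt Q.1; lia.
have x0 : (0 < Q.1)%N by move: h; case: (nat_of_ord Q.1) => //.
transitivity (N - Q.1)%N; first exact: (Zval_opp x0).
by move: h; have := Zval_lt Q.1; lia.
Qed.

Lemma nrm_pm Q : nrm Q = Q \/ nrm Q = - Q.
Proof. by rewrite /nrm; case: ifP; [left|right]. Qed.

(** Both points are replaced by the representatives [nrm] of their classes modulo sign, whose first
    coordinate is at most N/2 and equals [dz]; then [XT_diff] applies, since the points differ up to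
    sign. *)
Lemma wz_order P Q : P != 0 -> Q != 0 -> P != Q -> P != - Q ->
  exists G, [/\ holo_at G 0, G 0 != 0 & exists2 Y : R, 0 < Y & forall tau, Y < complex.Im tau ->
    wz P tau - wz Q tau = qN N tau ^+ minn (dz n P.1) (dz n Q.1) * G (qN N tau)].
Proof.
wlog le : P Q / (dz n P.1 <= dz n Q.1)%N.
  move=> W p0 q0 h1 h2; case/orP: (leq_total (dz n P.1) (dz n Q.1)) => h; first exact: (W P Q h p0 q0 h1 h2).
  have n1 : Q != P by rewrite eq_sym.
  have n2 : Q != - P by apply: contra h2 => /eqP ->; rewrite opprK.
  have [G [hG G0 [Y Y0 HY]]] := W Q P h q0 p0 n1 n2.
  exists (fun q => - G q); split; rewrite ?oppr_eq0 //.
    by apply: holo_at_near (holo_atB (holo_at_cst 0 0) hG); exists 1 => // w _; rewrite sub0r.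
  by exists Y => // tau hY; rewrite minnC mulrN -HY // opprB.
move=> p0 q0 h1 h2.
have neg0 S : S != 0 -> nrm S != 0 by move=> S0; case: (nrm_pm S) => ->; rewrite ?oppr_eq0.
have a1 := adm_neq0 (neg0 _ p0); have a2 := adm_neq0 (neg0 _ q0).
have b1 : (2 * (nrm P).1 <= N)%N by rewrite nrm_val /dz; have := Zval_lt P.1; lia.
have b2 : (2 * (nrm Q).1 <= N)%N by rewrite nrm_val /dz; have := Zval_lt Q.1; lia.
have le' : ((nrm P).1 <= (nrm Q).1)%N by rewrite !nrm_val.
have d1 : nrm P != nrm Q.
  by case: (nrm_pm P) => ->; case: (nrm_pm Q) => ->; rewrite ?eqr_opp // eqr_oppLR.
have d2 : nrm P != - nrm Q.
  by case: (nrm_pm P) => ->; case: (nrm_pm Q) => ->; rewrite ?opprK ?eqr_opp // eqr_oppLR ?opprK.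
have ne : ~~ (((nrm P).1 == (nrm Q).1 :> nat) && (((nrm P).2 == (nrm Q).2 :> nat) ||
    (((nrm P).1 == 0%N :> nat) || (2 * (nrm P).1 == N)%N) && (N %| (nrm P).2 + (nrm Q).2)%N)).
  move: d1 d2; case: (nrm P) (nrm Q) => x y [x' y'] /= d1 d2.
  apply/negP => /andP[/eqP xx /orP[/eqP yy|/andP[hx hy]]].
    by move/eqP: d1; apply; congr pair; exact: val_inj.
  move/eqP: d2; apply; congr pair.
    rewrite -(val_inj xx) -[x]natr_Zp; case/orP: hx => [/eqP ->|/eqP hx]; first by rewrite oppr0.
    by apply/eqP; rewrite -addr_eq0 -natrD addnn -mul2n hx (ZN n).
  apply/eqP; rewrite -addr_eq0 -[y]natr_Zp -[y']natr_Zp -natrD.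
  by case/dvdnP: hy => c ->; rewrite natrM (ZN n) mulr0.
have [G [hG G0 [r r0 HG]]] := @XT_diff R N isT _ _ _ _ a1 a2 b1 b2 (Zval_lt _) (Zval_lt _) le' ne.
exists (fun q => twopii R ^+ 2 * G q); split.
- by apply: holo_atM => //; exact: holo_at_cst.
- by rewrite mulf_neq0 // expf_neq0 // twopii_neq0.
have [Y Y0 HY] := qN_small (isT : (0 < N)%N) r0; exists Y => // tau hY.
have ht : Hp tau by apply: lt_trans hY.
have w0 S : S != 0 -> wz (nrm S) tau = wz S tau.
  by move=> S0; case: (nrm_pm S) => -> //; rewrite wz_opp.
rewrite -(w0 P) // -(w0 Q) // wzB_XT ?neg0 // HG ?subr0 ?HY // nrm_val (minn_idPl le).
by rewrite mulrCA.
Qed.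

Lemma qpow_order (U V : R[i] -> R[i]) e f (Y : R) : holo_at U 0 -> holo_at V 0 -> U 0 != 0 -> V 0 != 0 ->
  (forall tau, Y < complex.Im tau -> pnear tau (fun w => qN N w ^+ e * U (qN N w) = qN N w ^+ f * V (qN N w))) -> e = f.
Proof.
wlog lef : U V e f / (e <= f)%N.
  move=> W hU hV U0 V0 H; case: (leqP e f) => [|/ltnW] h; first exact: (W U V).
  by apply/esym; apply: (W V U) => // tau hY; apply: pnear_imp (H tau hY) => w ->.
move=> hU hV U0 V0 H; have [k0|k0] := posnP (f - e)%N; first by lia.
have c : ccont (fun q => U q - q ^+ (f - e) * V q) 0.
  by apply: holo_at_cont; apply: holo_atB => //; apply: holo_atM => //; exact: qpow_holo.
have [|r r0 Hr] := ccont_neq0 c; first by rewrite expr0n gtn_eqF // mul0r subr0.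
have [Y' Y0' HY'] := qN_small (isT : (0 < N)%N) r0.
pose y := Num.max Y Y' + 1.
have hy : Y < complex.Im (Complex 0 y : R[i]) by rewrite /= /y ltr_pwDr // le_max lexx.
have [w [_ w1 E]] := pnear_ex (H _ hy) ltr01.
have hw : Y' < complex.Im w.
  have := le_lt_trans (Im_le_cn _) w1; rewrite ImB /= ltr_norml => /andP[h _].
  have : Y' <= Num.max Y Y' by rewrite le_max lexx orbT.
  by move: h; rewrite /y; lra.
have := Hr (qN N w); rewrite subr0 => /(_ (HY' _ hw)); move: E; rewrite -{1}(subnKC lef) exprD -mulrA.
by move=> /(mulfI (expf_neq0 e (qN_neq0 N w))) ->; rewrite subrr eqxx.
Qed.

(** Cross multiplying the two quotients near infinity leaves an equality between powers of q times
    germs that do not vanish at 0, and [qpow_order] compares the exponents. *)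
Lemma LamT_order P Q P' Q' : unitdet P Q -> unitdet P' Q' -> mero_eq (LamT P Q) (LamT P' Q') ->
  same_order P.1 Q.1 P'.1 Q'.1.
Proof.
move=> u u' /mero_eqP H; have [p0 q0 s0 [h1 h2 h3 h4]] := unitdet_facts u.
have [p0' q0' s0' [h1' h2' h3' h4']] := unitdet_facts u'.
have [A [hA A0 [Y1 Y1p HA]]] := wz_order p0 s0 h1 h2.
have [B [hB B0 [Y2 Y2p HB]]] := wz_order q0 s0 h3 h4.
have [C [hC C0 [Y3 Y3p HC]]] := wz_order p0' s0' h1' h2'.
have [D [hD D0 [Y4 Y4p HD]]] := wz_order q0' s0' h3' h4'.
have [rB rB0 nB] := ccont_neq0 (holo_at_cont hB) B0.
have [rD rD0 nD] := ccont_neq0 (holo_at_cont hD) D0.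
have [Y5 Y5p HY5] := qN_small (isT : (0 < N)%N) rB0.
have [Y6 Y6p HY6] := qN_small (isT : (0 < N)%N) rD0.
pose Y := Y1 + Y2 + Y3 + Y4 + Y5 + Y6.
have mD (S S' : Z * Z) : minn (dz n S.1) (dz n (S + S').1) = mind S.1 S'.1 by [].
have mD' (S S' : Z * Z) : minn (dz n S'.1) (dz n (S + S').1) = mind S'.1 S.1 by rewrite /mind addrC.
rewrite /same_order -(mD P Q) -(mD' P Q) -(mD P' Q') -(mD' P' Q').
apply: (@qpow_order (fun q => A q * D q) (fun q => C q * B q) _ _ Y).
- exact: holo_atM.
- exact: holo_atM.
- exact: mulf_neq0.
- exact: mulf_neq0.
move=> tau hY; have ht : Hp tau by apply: lt_trans hY; rewrite /Y !addr_gt0.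
have near : pnear tau (fun w => Y < complex.Im w).
  exists (complex.Im tau - Y); first by rewrite subr_gt0.
  move=> w _ hw; have := le_lt_trans (Im_le_cn _) hw; rewrite ImB ltr_norml => /andP[h _].
  by lra.
apply: pnear_imp (pnearI near (H _ ht)) => w [hw].
have [l1 [l2 [l3 [l4 [l5 l6]]]]] : Y1 < complex.Im w /\ Y2 < complex.Im w /\ Y3 < complex.Im w /\
    Y4 < complex.Im w /\ Y5 < complex.Im w /\ Y6 < complex.Im w.
  by move: hw; rewrite /Y; clear -Y1p Y2p Y3p Y4p Y5p Y6p; lra.
rewrite /LamT HA // HB // HC // HD //.
have b0 := nB (qN N w); rewrite subr0 HY5 // in b0; have {b0} b0 := b0 isT.
have d0 := nD (qN N w); rewrite subr0 HY6 // in d0; have {d0} d0 := d0 isT.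
move: b0 d0; move: (qN_neq0 N w) => q0w; move: (A _) (B _) (C _) (D _) => a b c d b0 d0.
rewrite !exprD => /eqP; rewrite eqr_div ?mulf_neq0 ?expf_neq0 // => /eqP E.
by move: E; move: (_ ^+ _) (_ ^+ _) (_ ^+ _) (_ ^+ _) => x y z t E; rewrite mulrACA E; ring.
Qed.

(** It suffices to change b modulo N so that it becomes coprime to a. With t the part of a prime to
    b, b + tN works: a prime dividing a and b does not divide t, nor N by unimodularity, while a
    prime dividing a but not b divides t. *)
Lemma SL2Z_column (a b : nat) : (exists u w : Z, u * a%:R + w * b%:R = 1) ->
  exists B, [/\ SL2Z B, ((B 0 0)%:~R : Z) = a%:R & ((B 1 0)%:~R : Z) = b%:R].
Proof.
wlog [a0 b0] : a b / (0 < a)%N /\ (0 < b)%N.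
  (* Adding N to both entries makes them positive without changing their classes. *)
  move=> W [u [w h]]; have e k : ((k + N)%:R : Z) = k%:R by rewrite natrD (ZN n) addr0.
  have [||B [h1 h2 h3]] := W (a + N)%N (b + N)%N.
  - by rewrite !addnS.
  - by exists u, w; rewrite !e.
  by exists B; split; rewrite ?h2 ?h3 ?e.
move=> [u [w h]]; pose t := (a`_(\pi(b)^'))%N.
have cop : coprime a (b + t * N).
  rewrite /coprime; apply/negPn/negP => g1.
  have gp : (0 < gcdn a (b + t * N))%N by rewrite gcdn_gt0 a0.
  have pp : prime (pdiv (gcdn a (b + t * N))) by rewrite pdiv_prime //; case: (gcdn _ _) g1 gp => [|[|]].
  have := pdiv_dvd (gcdn a (b + t * N)); rewrite dvdn_gcd; move: (pdiv _) pp => p pp /andP[pa pb].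
  case: (boolP (p %| b)%N) => hb.
    have pt : coprime p t.
      rewrite prime_coprime //; apply/negP => /(dvdn_trans _) pt.
      have := part_pnat (negn \pi(b)) a => /pnatP -/(_ (part_gt0 _ _) p pp).
      by rewrite /t in pt; move=> /(_ (pt _ (dvdnn _))); rewrite inE /= mem_primes pp b0 hb.
    have pN : (p %| N)%N.
      by move: pb; rewrite dvdn_addr // Gauss_dvdr.
    have : ((nat_of_ord u * a + nat_of_ord w * b)%N%:R : Z) = 1 by rewrite natrD !natrM !natr_Zp.
    move/(congr1 (@nat_of_ord _)); rewrite val_Zp_nat // => E.
    have : (p %| (nat_of_ord u * a + nat_of_ord w * b) %% N)%N.
      by rewrite /dvdn modn_dvdm //; apply: dvdn_add; apply: dvdn_mull.
    by rewrite E /= dvdn1 => /eqP p1; rewrite p1 in pp.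
  have : (p %| t)%N.
    have := partnC \pi(b) a0; rewrite -/t => E; move: pa; rewrite -E Euclid_dvdM // => /orP[|//].
    move=> pa; have := part_pnat \pi(b) a => /pnatP -/(_ (part_gt0 _ _) p pp pa).
    by rewrite inE mem_primes (negbTE hb) !andbF.
  by move=> pt; move: pb; rewrite dvdn_addl ?dvdn_mulr // (negbTE hb).
have /coprimezP[[x y] /= xy] : coprimez a (b + t * N)%N by rewrite coprimezE.
exists (mx22 a (- y) (b + t * N)%N x); split.
- by apply: mx22_SL2Z; rewrite -xy; ring.
- by rewrite mxE.
- by rewrite mxE /= -pmulrn natrD natrM (ZN n) mulr0 addr0.
Qed.

(** If g fixes Lambda, then composing with any C in SL_2(Z) shows that the orders of the two sides
    agree at every cusp. In the coordinates of the basis this is the hypothesis of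
    [order_preserving]. *)
Theorem LamT_injective Q1 Q2 g : N != 6%N -> unitdet Q1 Q2 -> SL2Z g ->
  mero_eq (LamT Q1 Q2 \o moebius g) (LamT Q1 Q2) ->
  exists2 eps : Z, eps = 1 \/ eps = -1 &
    forall i k, ((g i k)%:~R : Z) = eps * ((1%:M : 'M[int]_2) i k)%:~R.
Proof.
move=> N6 u hg H; have [e he] := u; have dg := SL2Z_det hg.
case: Q1 Q2 u he H => m1 m2 [m3 m4] u /= he H.
pose a : Z := (g 0 0)%:~R; pose b : Z := (g 0 1)%:~R; pose c : Z := (g 1 0)%:~R; pose d : Z := (g 1 1)%:~R.
have det1 : a * d - b * c = 1 by rewrite /a /b /c /d -!rmorphM -rmorphB dg.
pose x1 := m1 * a + m2 * c; pose x2 := m1 * b + m2 * d.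
pose x3 := m3 * a + m4 * c; pose x4 := m3 * b + m4 * d.
(* p, q, r, s are the entries of M g M^-1, where M has rows Q1 and Q2 and e is the inverse of its
   determinant. *)
pose p := e * (x1 * m4 - x2 * m3); pose q := e * (x2 * m1 - x1 * m2).
pose r := e * (x3 * m4 - x4 * m3); pose s := e * (x4 * m1 - x3 * m2).
have dpq : p * s - q * r = 1.
  rewrite (_ : _ - _ = ((m1 * m4 - m2 * m3) * e) ^+ 2 * (a * d - b * c)).
    by rewrite he det1 expr1n mulr1.
  by rewrite /p /q /r /s /x1 /x2 /x3 /x4; ring.
have key A B : unimod A B -> same_order (p * A + q * B) (r * A + s * B) A B.
  (* (y1, y2) = M^-1 (A, B) is taken as first column of C, so that the first coordinates of Q1 and
     Q2 acted on by C are A and B. *)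
  move=> [v [w vw]]; pose y1 := e * (m4 * A - m2 * B); pose y2 := e * (m1 * B - m3 * A).
  have [|C [hC C1 C2]] := @SL2Z_column (nat_of_ord y1) (nat_of_ord y2).
    exists (v * m1 + w * m3), (v * m2 + w * m4); rewrite !natr_Zp -vw.
    rewrite -[RHS]mulr1 -he /y1 /y2; ring.
  rewrite natr_Zp in C1; rewrite natr_Zp in C2.
  have E1 : (ract (m1, m2) C).1 = A.
    by rewrite /ract /= C1 C2 -[RHS]mulr1 -he /y1 /y2; ring.
  have E2 : (ract (m3, m4) C).1 = B.
    by rewrite /ract /= C1 C2 -[RHS]mulr1 -he /y1 /y2; ring.
  have E3 : (ract (ract (m1, m2) g) C).1 = p * A + q * B.
    rewrite /ract /= C1 C2 -/a -/b -/c -/d -/x1 -/x2 /y1 /y2 /p /q; ring.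
  have E4 : (ract (ract (m3, m4) g) C).1 = r * A + s * B.
    rewrite /ract /= C1 C2 -/a -/b -/c -/d -/x3 -/x4 /y1 /y2 /r /s; ring.
  suff : same_order (ract (ract (m1, m2) g) C).1 (ract (ract (m3, m4) g) C).1
      (ract (m1, m2) C).1 (ract (m3, m4) C).1 by rewrite E1 E2 E3 E4.
  apply: LamT_order.
  - exact: unitdet_act hC (unitdet_act hg u).
  - exact: unitdet_act hC u.
  have /mero_eqP h1 := mero_eq_moebius hC H; apply/mero_eqP => tau ht.
  have [rr rr0 Hr] := Hp_open ht.
  apply: pnear_imp (pnearI (pnear_ball rr0 Hr) (h1 _ ht)) => w0 [hw0].
  rewrite /= LamT_moebius ?Hp_moebius // => E.
  by move: E; rewrite (LamT_moebius (unitdet_act hg u) hC hw0) (LamT_moebius u hC hw0).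
have [q0 r0 ps p1] := order_preserving N6 dpq key.
exists p => //.
have Ea : a = (p * m1 * m4 + q * m3 * m4 - r * m1 * m2 - s * m2 * m3) * e.
  rewrite -[LHS]mulr1 -[1 in LHS](expr1n _ 2) -he /p /q /r /s /x1 /x2 /x3 /x4; ring.
have Eb : b = (p * m2 * m4 + q * m4 * m4 - r * m2 * m2 - s * m2 * m4) * e.
  rewrite -[LHS]mulr1 -[1 in LHS](expr1n _ 2) -he /p /q /r /s /x1 /x2 /x3 /x4; ring.
have Ec : c = (r * m1 * m1 + s * m1 * m3 - p * m1 * m3 - q * m3 * m3) * e.
  rewrite -[LHS]mulr1 -[1 in LHS](expr1n _ 2) -he /p /q /r /s /x1 /x2 /x3 /x4; ring.
have Ed : d = (r * m1 * m2 + s * m1 * m4 - p * m2 * m3 - q * m3 * m4) * e.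
  rewrite -[LHS]mulr1 -[1 in LHS](expr1n _ 2) -he /p /q /r /s /x1 /x2 /x3 /x4; ring.
move: Ea Eb Ec Ed; rewrite q0 r0 -ps => Ea Eb Ec Ed.
have Ea' : a = p by rewrite Ea -[RHS]mulr1 -he; ring.
have Eb' : b = 0 by rewrite Eb; ring.
have Ec' : c = 0 by rewrite Ec; ring.
have Ed' : d = p by rewrite Ed -[RHS]mulr1 -he; ring.
move=> i k; rewrite mxE.
case: (unliftP 0 i) => [i'|] ->; case: (unliftP 0 k) => [k'|] ->; rewrite ?(ord1 i') ?(ord1 k') /=.
- by rewrite mulr1 -Ed' /d; congr ((g _ _)%:~R); apply: val_inj.
- by rewrite mulr0 -Ec' /c; congr ((g _ _)%:~R); apply: val_inj.
- by rewrite mulr0 -Eb' /b; congr ((g _ _)%:~R); apply: val_inj.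
- by rewrite mulr1 -Ea'.
Qed.

Lemma basis_unitdet (Q1 Q2 : Z * Z) : is_basis Q1 Q2 -> unitdet Q1 Q2.
Proof.
move=> hb; have [[c1 c2] [h1 _]] := hb (1, 0); have [[d1 d2] [h2 _]] := hb (0, 1).
have fstM (Q : Z * Z) k : (Q *+ k).1 = Q.1 *+ k by elim: k => // k IH; rewrite !mulrS /= IH.
have sndM (Q : Z * Z) k : (Q *+ k).2 = Q.2 *+ k by elim: k => // k IH; rewrite !mulrS /= IH.
have E (x y : Z) : x *+ nat_of_ord y = x * y by rewrite -mulr_natr natr_Zp.
have := congr1 fst h1; have := congr1 snd h1; have := congr1 fst h2; have := congr1 snd h2.
rewrite /= !fstM !sndM !E /= => e4 e3 e2 e1.
exists (c1 * d2 - c2 * d1).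
rewrite (_ : _ * _ = (Q1.1 * c1 + Q2.1 * c2) * (Q1.2 * d1 + Q2.2 * d2) - (Q1.2 * c1 + Q2.2 * c2) * (Q1.1 * d1 + Q2.1 * d2)); last by ring.
by rewrite -e1 -e2 -e3 -e4 mulr1 mul0r subr0.
Qed.

End LambdaModular.

(** * Siegel's vanishing bound *)

Section Compactness.
Variable R : realType.
Implicit Types (z w p : R[i]) (phi : R[i] -> R).

Definition in_box (x0 y0 L H : R) z := (x0 <= complex.Re z <= x0 + L) && (y0 <= complex.Im z <= y0 + H).

(** Compactness with an explicit witness: local witnesses are merged by [comb], instantiated by a
    maximum for bounds and by concatenation for lists of factors. *)
Lemma box_cover (A : Type) (comb : A -> A -> A) (good : A -> R[i] -> Prop) (x0 y0 L H : R) :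
  0 < L -> 0 < H -> (forall a b w, good a w -> good (comb a b) w) ->
  (forall a b w, good b w -> good (comb a b) w) ->
  (forall p, in_box x0 y0 L H p -> exists a, exists2 d : R, 0 < d &
     forall w, in_box x0 y0 L H w -> cn (w - p) < d -> good a w) ->
  exists a, forall w, in_box x0 y0 L H w -> good a w.
Proof.
move=> L0 H0 gl gr loc.
have := @box_ind R L H x0 y0 (fun x y s => exists a, forall w, in_box x0 y0 L H w ->
  in_box x y (L * s) (H * s) w -> good a w) L0 H0.
move=> /(_ _ _)[||a Ha]; last 1 first.
- by exists a => w hw; apply: Ha => //; rewrite !mulr1.
- have e (u l s : R) : u + l * (s / 2) + l * (s / 2) = u + l * s by field.
  move=> x y s s0 [a1 G1] [a2 G2] [a3 G3] [a4 G4] _ _ _ _.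
  exists (comb (comb a1 a2) (comb a3 a4)) => w hw /andP[/andP[c1 c2] /andP[b1 b2]].
  have [hx|hx] := lerP (complex.Re w) (x + L * (s / 2)); have [hy|hy] := lerP (complex.Im w) (y + H * (s / 2)).
  + by apply/gl/gl/G1; rewrite // /in_box c1 b1 hx hy.
  + by apply/gr/gl/G3; rewrite // /in_box c1 hx (ltW hy) /= e.
  + by apply/gl/gr/G2; rewrite // /in_box b1 hy (ltW hx) /= andbT e.
  + by apply/gr/gr/G4; rewrite // /in_box (ltW hx) (ltW hy) /= !e c2.
- move=> p q hp hq; have [|a [d d0 Hd]] := loc (Complex p q); first by rewrite /in_box /= hp hq.
  have LH : 0 < L + H by rewrite addr_gt0.
  exists (d / (2 * (L + H))); first by rewrite divr_gt0 // mulr_gt0.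
  move=> x y s /andP[s0 sd] px qy _ _ _ _; exists a => w hw /andP[wx wy]; apply: Hd => //.
  have Ls : 0 < L * s by rewrite mulr_gt0.
  have Hs : 0 < H * s by rewrite mulr_gt0.
  have xl : x <= x + L * s by rewrite lerDl ltW.
  have yl : y <= y + H * s by rewrite lerDl ltW.
  case: w wx wy hw => a' b' /= wx wy hw; apply: le_lt_trans (cn_Complex_rect xl yl wx wy px qy) _.
  move: sd; rewrite ltr_pdivlMr ?mulr_gt0 // => sd.
  by clear -sd Ls Hs s0; nra.
Qed.

Lemma box_bound (x0 y0 L H : R) phi (G : R -> Prop) : 0 < L -> 0 < H ->
  (forall a b, G a -> G b -> G (Num.max a b)) ->
  (forall p, in_box x0 y0 L H p -> exists2 B, G B & exists2 d : R, 0 < d &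
     forall w, in_box x0 y0 L H w -> cn (w - p) < d -> phi w <= B) ->
  exists2 B, G B & forall w, in_box x0 y0 L H w -> phi w <= B.
Proof.
move=> L0 H0 Gmax loc.
have [|||[B GB] HB] := @box_cover {B | G B}
  (fun a b => exist _ (Num.max (sval a) (sval b)) (Gmax _ _ (svalP a) (svalP b)))
  (fun a w => phi w <= sval a) x0 y0 L H L0 H0; last by exists B.
- by move=> [a Ga] [b Gb] w /= h; rewrite le_max h.
- by move=> [a Ga] [b Gb] w /= h; rewrite le_max h orbT.
- by move=> p /loc[B GB hB]; exists (exist _ B GB).
Qed.

(** If the supremum were not attained, every point would have a neighbourhood bounded strictly below
    it, and compactness would give a global bound below the supremum. Semicontinuity is the right
    generality because [strip_max] applies this to a discontinuous function. *)
Lemma usc_max (x0 y0 L H : R) phi : 0 < L -> 0 < H ->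
  (forall p, in_box x0 y0 L H p -> forall e : R, 0 < e -> exists2 d : R, 0 < d &
     forall w, in_box x0 y0 L H w -> cn (w - p) < d -> phi w <= phi p + e) ->
  exists2 p, in_box x0 y0 L H p & forall w, in_box x0 y0 L H w -> phi w <= phi p.
Proof.
move=> L0 H0 usc.
have [B _ HB] : exists2 B, True & forall w, in_box x0 y0 L H w -> phi w <= B.
  apply: (@box_bound x0 y0 L H phi (fun=> True) L0 H0) => // p hp.
  by exists (phi p + 1) => //; exact: usc.
pose E := [set phi w | w in [set w | in_box x0 y0 L H w]].
have c0 : in_box x0 y0 L H (Complex x0 y0) by rewrite /in_box /= !lexx !lerDl !ltW.
have hs : has_sup E.
  by split; [exists (phi (Complex x0 y0)), (Complex x0 y0)|exists B => _ [w hw <-]; exact: HB].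
have ub w : in_box x0 y0 L H w -> phi w <= sup E.
  by move=> hw; apply: ub_le_sup; [case: hs|exists w].
case: (pselect (exists2 p, in_box x0 y0 L H p & phi p = sup E)) => [[p hp e]|no].
  by exists p => // w hw; rewrite e ub.
have [B' B'S HB'] : exists2 B, B < sup E & forall w, in_box x0 y0 L H w -> phi w <= B.
  apply: (@box_bound x0 y0 L H phi (fun b => b < sup E) L0 H0) => [a b ha hb|p hp].
    by rewrite gt_max ha hb.
  have lt : phi p < sup E.
    by rewrite lt_neqAle ub // andbT; apply/eqP => e; apply: no; exists p.
  exists ((phi p + sup E) / 2); first by lra.
  have [|d d0 Hd] := usc p hp ((sup E - phi p) / 2); first by lra.
  by exists d => // w hw wp; apply: le_trans (Hd w hw wp) _; lra.
have : sup E <= B' by apply: ge_sup; [case: hs|move=> _ [w hw <-]; exact: HB'].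
by rewrite leNgt B'S.
Qed.

End Compactness.

(** * The maximum principle on a periodic half strip *)

Section StripMaximum.
Variable R : realType.
Implicit Types (z w p tau : R[i]).

Lemma int_shift (x : R) : exists n : int, 0 <= x + n%:~R <= 1.
Proof.
exists (- Num.floor x); have := floor_itv x; rewrite rmorphD rmorphN /= => /andP[h1 h2].
by apply/andP; split; lra.
Qed.

(** If the bound failed, the maximum of the modulus would be attained above the boundary line. At a
    maximum point of greatest height the maximum principle makes psi locally constant, so a slightly
    higher point is also a maximum. Only the modulus is assumed periodic, because psi will carry a
    factor e^(-2 pi i V tau) with V real. *)
Theorem strip_max (psi : R[i] -> R[i]) (y1 A : R) : 0 <= A ->
  (forall tau, y1 <= complex.Im tau -> holo_at psi tau) ->
  (forall tau (n : int), y1 <= complex.Im tau -> cn (psi (tau + n%:~R)) = cn (psi tau)) ->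
  (forall e : R, 0 < e -> exists Y : R, forall tau, Y < complex.Im tau -> cn (psi tau) < e) ->
  (forall tau, complex.Im tau = y1 -> cn (psi tau) <= A) ->
  forall tau, y1 <= complex.Im tau -> cn (psi tau) <= A.
Proof.
move=> A0 hol per dec bnd t0 ht0; rewrite leNgt; apply/negP => big.
have e0 : 0 < cn (psi t0) by apply: le_lt_trans big.
have [Y HY] := dec _ e0.
pose H := Num.max Y y1 + 1 - y1.
have Ym : Y <= Num.max Y y1 /\ y1 <= Num.max Y y1 by rewrite !le_max !lexx orbT.
have H0 : 0 < H by rewrite /H; case: Ym; lra.
pose box := in_box 0 y1 1 H.
have boxI w : box w -> y1 <= complex.Im w by case/andP => _ /andP[].
have cont w : y1 <= complex.Im w -> forall e : R, 0 < e -> exists2 d : R, 0 < d &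
    forall v, cn (v - w) < d -> `|cn (psi v) - cn (psi w)| < e.
  move=> hw e e1; have [d d0 Hd] := holo_at_cont (hol w hw) e1; exists d => // v /Hd h.
  apply: le_lt_trans h; rewrite ler_norml; have := cn_lb (psi v) (psi w).
  by have := cn_lb (psi w) (psi v); rewrite (cnBC (psi w)); lra.
have [p bp Mp] : exists2 p, box p & forall w, box w -> cn (psi w) <= cn (psi p).
  apply: usc_max => // p bp e e1; have [d d0 Hd] := cont p (boxI p bp) e e1.
  by exists d => // w _ /Hd; rewrite ltr_norml => /andP[_]; lra.
have Mall w : y1 <= complex.Im w -> cn (psi w) <= cn (psi p).
  move=> hw; have [n /andP[n0 n1]] := int_shift (complex.Re w).
  have cmp v : box v -> cn (psi v) <= cn (psi p) by exact: Mp.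
  have key v : y1 <= complex.Im v -> complex.Im v <= y1 + H -> cn (psi v) <= cn (psi p).
    move=> v1 v2; have [k /andP[k0 k1]] := int_shift (complex.Re v).
    rewrite -(per v k) //; apply: Mp; rewrite /box /in_box ReD ImD intC /= !addr0 add0r.
    by rewrite k0 k1 v1 v2.
  case: (lerP (complex.Im w) (y1 + H)) => h; first exact: key.
  have t0p : cn (psi t0) <= cn (psi p).
    apply: key => //; rewrite leNgt; apply/negP => h0.
    by have := HY t0; rewrite ltxx => /(_ _)/notF; apply; move: h0; rewrite /H; case: Ym; lra.
  by apply: le_trans (ltW (HY w _)) t0p; move: h; rewrite /H; case: Ym; lra.
have t0p := Mall t0 ht0.
(* The height on the set where the maximum is attained, and a value below every height elsewhere; it
   is upper semicontinuous because that set is closed. *)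
pose phi w := if cn (psi w) == cn (psi p) then complex.Im w else y1 - 1.
have [s bs Ms] : exists2 s, box s & forall w, box w -> phi w <= phi s.
  apply: usc_max => // s bs e e1; rewrite /phi; have [E|ne] := eqVneq (cn (psi s)) (cn (psi p)).
    exists e => // w bw ws; case: ifP => _; last by have := boxI s bs; lra.
    by have := le_lt_trans (Im_le_cn _) ws; rewrite ImB ltr_norml => /andP[_]; lra.
  have g : 0 < `|cn (psi s) - cn (psi p)| by rewrite normr_gt0 subr_eq0.
  have [d d0 Hd] := cont s (boxI s bs) _ g; exists d => // w bw /Hd h.
  case: eqP => [E|_]; last by lra.
  by move: h; rewrite E distrC ltxx.
have Es : cn (psi s) = cn (psi p).
  have := Ms p bp; rewrite /phi eqxx; case: eqP => // _; have := boxI p bp; lra.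
have s1 : y1 < complex.Im s.
  rewrite lt_neqAle boxI // andbT; apply/eqP => E; have := bnd s (esym E).
  by rewrite Es leNgt (lt_le_trans big t0p).
have [r r0 Hr] : exists2 r : R, 0 < r & forall w, cn (w - s) < r -> y1 <= complex.Im w.
  exists (complex.Im s - y1); first by rewrite subr_gt0.
  move=> w hw; have := le_lt_trans (Im_le_cn _) hw; rewrite ImB ltr_norml => /andP[]; lra.
have [d d0 Hd] := max_modulus r0 (hol s (boxI s bs)) (fun w wr => eq_ind_r (fun x => cn (psi w) <= x) (Mall w (Hr w wr)) Es).
have sY : complex.Im s <= Num.max Y y1.
  rewrite leNgt; apply/negP => h; have h1 : cn (psi s) < cn (psi t0) by apply: HY; case: Ym; lra.
  by move: h1; rewrite Es ltNge t0p.
pose t := Num.min (d / 2) 1.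
have t1 : 0 < t by rewrite lt_min ltr01 divr_gt0.
have [td tt] : t <= d / 2 /\ t <= 1 by rewrite /t !ge_min !lexx orbT.
pose w := s + Complex 0 t.
have ws : cn (w - s) < d.
  rewrite /w addrC addKr (_ : Complex 0 t = Complex 0 1 * t%:C); last exact: ImE_Complex.
  by rewrite cnM cni mul1r cnR gtr0_norm //; lra.
have bw : box w.
  move: bs; rewrite /box /in_box ReD ImD /= addr0 => /andP[-> /andP[h1 h2]] /=.
  by rewrite (le_trans h1) ?lerDl ?(ltW t1) //= /H; lra.
have := Ms w bw; rewrite /phi (Hd w ws) Es eqxx ImD /=; lra.
Qed.

End StripMaximum.

(** * Reduction to a fundamental domain *)

Section FundamentalDomain.
Variable R : realType.
Implicit Types (tau : R[i]) (g : 'M[int]_2).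

Lemma Im_moebius_le tau : Hp tau -> exists2 C : R, 0 < C & forall g, SL2Z g ->
  complex.Im (moebius g tau) <= C.
Proof.
move=> ht; have [c c0 Hc] := lattice_lb ht.
exists (complex.Im tau / c ^+ 2); first by rewrite divr_gt0 // exprn_gt0.
move=> g hg; rewrite Im_moebius // ler_wpM2l ?(ltW ht) // lef_pV2 ?posrE ?exprn_gt0 ?cn_gt0 ?mden_neq0 //.
rewrite lerXn2r ?nnegrE ?cn_ge0 ?(ltW c0) //.
have := Hc (g 1 1) (g 1 0); rewrite /lattice_pt /= addrC; apply: le_trans.
rewrite ler_peMr ?(ltW c0) // ler1n lt0n addn_eq0 !absz_eq0; apply/negP => /andP[/eqP a /eqP b].
by have := SL2Z_det hg; rewrite a b !mulr0 subr0.
Qed.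

(** 43/50 lies slightly below sqrt 3 / 2. The slack makes every inversion step increase the height
    by a definite factor. *)
Definition in_fund tau := `|complex.Re tau| <= 2^-1 /\ 43%:R / 50%:R <= complex.Im tau.

(** After translation to |Re| <= 1/2, a height below 43/50 gives |t|^2 <= 0.9896, so the inversion
    multiplies the height by at least 101/100. Since the heights in an orbit are bounded, this
    growth must stop in the domain. *)
Lemma fund_step k tau : Hp tau -> exists2 g, SL2Z g &
  in_fund (moebius g tau) \/ (101%:R / 100%:R) ^+ k * complex.Im tau <= complex.Im (moebius g tau).
Proof.
move=> ht; elim: k => [|k [g hg [h|h]]].
- by exists 1%:M; [exact: SL2Z1|right; rewrite expr0 mul1r moebius1].
- by exists g => //; left.
pose t := moebius g tau; have h1 : Hp t := Hp_moebius hg ht.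
have [n /andP[n0 n1]] := int_shift (complex.Re t + 2^-1).
pose T := mx22 1 n 0 1; have hT : SL2Z T by apply: mx22_SL2Z; rewrite mulr0 mul1r subr0.
have ET : moebius T t = t + n%:~R.
  by rewrite /moebius !mxE /= mul1r mul0r add0r divr1.
have re : `|complex.Re (moebius T t)| <= 2^-1.
  by rewrite ET ReD intC /= ler_norml; lra.
have im : complex.Im (moebius T t) = complex.Im t by rewrite ET ImD intC /= addr0.
case: (lerP (43%:R / 50%:R) (complex.Im t)) => hy.
  by exists (T *m g); [exact: SL2ZM|left; rewrite moebiusM // /in_fund im].
pose S := mx22 0 (-1) 1 0; have hS : SL2Z S by apply: mx22_SL2Z.
exists (S *m (T *m g)); first by do !apply: SL2ZM.
right; rewrite moebiusM ?moebiusM ?Hp_moebius //; last exact: SL2ZM.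
rewrite -/t Im_moebius ?Hp_moebius // (_ : mden S _ = moebius T t); last first.
  by rewrite /mden !mxE /= mul1r addr0.
have t2 := Hp_moebius hT h1; have cp : 0 < cn (moebius T t) ^+ 2.
  rewrite exprn_gt0 // cn_gt0; apply/eqP => E; move: t2; rewrite /Hp E /= ltxx //.
rewrite ler_pdivlMr // im cn_sqr im exprS -mulrA.
have y0 : 0 < complex.Im t by [].
have r2 : complex.Re (moebius T t) ^+ 2 <= 4^-1.
  have -> : (4^-1 : R) = 2^-1 ^+ 2 by field.
  by rewrite -real_normK ?num_real // lerXn2r ?nnegrE.
have X0 : 0 <= complex.Re (moebius T t) ^+ 2 by exact: sqr_ge0.
have W0 : 0 <= (101%:R / 100%:R) ^+ k * complex.Im tau.
  by rewrite mulr_ge0 ?exprn_ge0 ?divr_ge0 // ltW.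
move: h; rewrite -/t; move: (_ ^+ k * _) W0 => W W0 h.
move: (complex.Re _ ^+ 2) X0 r2 => X X0 r2; move: (complex.Im t) hy y0 h => y hy y0 h.
have y2 : y ^+ 2 <= 7396%:R / 10000%:R by rewrite expr2; clear -hy y0; nra.
have sm : 101%:R / 100%:R * (X + y ^+ 2) <= 1 by clear -y2 r2; lra.
have h2 : W * (101%:R / 100%:R * (X + y ^+ 2)) <= y by apply: le_trans h; rewrite ler_piMr.
by apply: le_trans h2; rewrite le_eqVlt; apply/orP; left; apply/eqP; ring.
Qed.

Lemma fundamental tau : Hp tau -> exists2 g, SL2Z g & in_fund (moebius g tau).
Proof.
move=> ht; have [C C0 HC] := Im_moebius_le ht.
have [k hk] := arch (C / complex.Im tau * 100%:R).
have [g hg [|h]] := fund_step k ht; first by exists g.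
exfalso; have := le_trans h (HC g hg); rewrite -ler_pdivlMr //.
have be : 1 + k%:R / 100%:R <= (101%:R / 100%:R) ^+ k :> R.
  clear; elim: k => [|k IH]; first by rewrite mul0r addr0 expr0.
  rewrite exprS -natr1; have k0 : 0 <= k%:R :> R by [].
  by move: (_ ^+ k) IH k0 => x; move: (k%:R : R) => y IH y0; nra.
move=> /(le_trans be) h2; move: hk; rewrite -ltr_pdivlMr // => hk.
by have : false by move: h2 hk; move: (C / _) (k%:R / _) => x y; lra.
Qed.

End FundamentalDomain.

(** * Siegel's bound for forms of weight 12n *)

Section SiegelBound.
Variables (R : realType) (F : R[i] -> R[i]) (n : nat).
Hypothesis Fholo : forall tau, Hp tau -> holo_at F tau.
Hypothesis Fmod : forall g tau, SL2Z g -> Hp tau -> F (moebius g tau) = mden g tau ^+ (12 * n) * F tau.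
Implicit Types (tau : R[i]).

(** Half the weight as exponent makes this function invariant under SL_2(Z). *)
Let phi tau := cn (F tau) * complex.Im tau ^+ (6 * n).

Lemma phi_moebius g tau : SL2Z g -> Hp tau -> phi (moebius g tau) = phi tau.
Proof.
move=> hg ht; rewrite /phi Fmod // Im_moebius // cnM cnX expr_div_n -exprM.
rewrite (_ : 2 * (6 * n) = 12 * n)%N; last by lia.
have x0 : cn (mden g tau) ^+ (12 * n) != 0 by rewrite expf_neq0 // gt_eqF // cn_gt0 mden_neq0.
by move: (_ ^+ (12 * n)) x0 => x x0; field; rewrite x0.
Qed.

Lemma F_shift tau (k : int) : Hp tau -> F (tau + k%:~R) = F tau.
Proof.
move=> ht; pose T := mx22 1 k 0 1; have hT : SL2Z T by apply: mx22_SL2Z; rewrite mulr0 mul1r subr0.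
have := Fmod hT ht; rewrite /moebius /mden !mxE /= mul1r mul0r add0r divr1 expr1n mul1r //.
Qed.

Lemma pow_le_exp (a y : R) k : 0 < a -> 0 <= y -> y ^+ k <= (k%:R / a) ^+ k * expR (a * y).
Proof.
case: k => [|k] a0 y0; first by rewrite !expr0 mul1r -expR0 ler_expR mulr_ge0 // ltW.
have k0 : 0 < k.+1%:R :> R by [].
have -> : expR (a * y) = expR (a * y / k.+1%:R) ^+ k.+1.
  by rewrite -expRM_natl mulrCA mulfV ?mulr1 // gt_eqF.
have main : y <= k.+1%:R / a * expR (a * y / k.+1%:R).
  rewrite {1}(_ : y = k.+1%:R / a * (a * y / k.+1%:R)); last first.
    by move: k0; move: (k.+1%:R : R) => c c0; field; rewrite !gt_eqF.
  rewrite ler_wpM2l ?divr_ge0 ?(ltW a0) //.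
  by apply: le_trans (expR_ge1Dx _); rewrite lerDr.
by rewrite -exprMn lerXn2r // nnegrE mulr_ge0 ?divr_ge0 ?expR_ge0 // ltW.
Qed.

Variables (V V1 C Y : R).
Hypothesis V0 : 0 <= V.
Hypothesis VV1 : V < V1.
Hypothesis Fdecay : forall tau, Y < complex.Im tau ->
  cn (F tau) <= C * expR (- (2 * pi * V1 * complex.Im tau)).

Lemma phi_bounded : exists S, forall tau, Hp tau -> phi tau <= S.
Proof.
have pi0 : 0 < pi :> R := pi_gt0 R.
have V10 : 0 < V1 by apply: le_lt_trans VV1.
have C0 : 0 <= C.
  have := Fdecay (tau := Complex 0 (Y + 1)); rewrite /= ltrDl ltr01 => /(_ isT) h.
  by have := le_trans (cn_ge0 _) h; rewrite pmulr_lge0 // expR_gt0.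
have a0 : 0 < 2 * pi * V1 by rewrite !mulr_gt0.
set a := 2 * pi * V1 in a0.
pose H := Num.max Y 1.
have HY : Y <= H /\ 1 <= H by rewrite !le_max !lexx orbT.
have [B _ HB] : exists2 B, True & forall w, in_box (- 2^-1) (43%:R / 50%:R) 1 H w -> phi w <= B.
  have H0 : 0 < H by case: HY; lra.
  apply: (@box_bound R (- 2^-1) (43%:R / 50%:R) 1 H phi (fun=> True) ltr01 H0) => // p /andP[_ /andP[p1 p2]]; have hp : Hp p by rewrite /Hp; lra.
  have [r [M [r0 M0 _ HM]]] := holo_at_bound (Fholo hp).
  exists (M * (43%:R / 50%:R + H) ^+ (6 * n)) => //; exists r => // w /andP[_ /andP[w1 w2]] wr.
  have a1 : 0 <= complex.Im w by apply: le_trans w1; rewrite divr_ge0.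
  apply: ler_pM; [exact: cn_ge0|exact: exprn_ge0|exact: HM|].
  by rewrite lerXn2r // nnegrE; apply: le_trans w2.
exists (Num.max B (C * ((6 * n)%:R / a) ^+ (6 * n))) => tau ht.
have [g hg [re im]] := fundamental ht; rewrite -(phi_moebius hg ht).
move: (Hp_moebius hg ht) re im; move: (moebius g tau) => {ht} t ht re im; rewrite le_max.
case: (lerP (complex.Im t) (43%:R / 50%:R + H)) => h.
  rewrite HB // /in_box im h /= andbT; move: re; rewrite ler_norml => /andP[r1 r2].
  by apply/andP; split; lra.
apply/orP; right; have hY : Y < complex.Im t by case: HY; lra.
apply: le_trans (ler_wpM2r _ (Fdecay hY)) _; first by rewrite exprn_ge0 // ltW.
rewrite -(mulrA C) ler_wpM2l // expRN [X in X <= _]mulrC ler_pdivrMr ?expR_gt0 //.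
by apply: pow_le_exp => //; exact: ltW.
Qed.

(** F is compared at height y with its values at height 9y/10. Removing the factor e^(2 pi i V tau)
    and applying [strip_max] above the lower line gains e^(-2 pi V y/10), while the power of the
    height costs (10/9)^(6n); and y/10 >= 43/500. *)
Lemma phi_decay S tau : (forall t, Hp t -> phi t <= S) -> in_fund tau ->
  phi tau <= S * ((10%:R / 9%:R) ^+ (6 * n) * expR (- (2 * pi * V * (43%:R / 500%:R)))).
Proof.
move=> HS [_ im]; set y := complex.Im tau in im.
have pi0 : 0 < pi :> R := pi_gt0 R.
have y0 : 0 < y by lra.
pose y1 := 9%:R / 10%:R * y; have y10 : 0 < y1 by rewrite /y1; lra.
have S0 : 0 <= S by apply: le_trans (HS tau y0); rewrite mulr_ge0 ?cn_ge0 // exprn_ge0 // ltW.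
(* Since V < V1, psi still tends to 0 at infinity; its modulus has period 1 although V need not be
   an integer. *)
pose psi t := F t * cexp2ipi ((- V)%:C * t).
have psiE t : cn (psi t) = cn (F t) * expR (2 * pi * V * complex.Im t).
  rewrite cnM cn_e2; congr (_ * expR _); case: t => a b; simpc.
  by rewrite /= ; ring.
have Hy1 t : y1 <= complex.Im t -> Hp t by exact: lt_le_trans.
pose A := S / y1 ^+ (6 * n) * expR (2 * pi * V * y1).
have A0 : 0 <= A by rewrite mulr_ge0 ?expR_ge0 // divr_ge0 // exprn_ge0 // ltW.
have h : cn (psi tau) <= A.
  apply: (@strip_max R psi y1 A A0).
  - move=> t /Hy1 ht; apply: holo_atM; first exact: Fholo.
    apply: (@holo_at_comp _ (fun t => (- V)%:C * t)); last exact: e2_holo.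
    by apply: holo_atM; [exact: holo_at_cst|exact: holo_at_id].
  - by move=> t k /Hy1 ht; rewrite !psiE F_shift // ImD intC /= addr0.
  - move=> e e0; pose dV := 2 * pi * (V1 - V).
    have dV0 : 0 < dV by rewrite !mulr_gt0 // subr_gt0.
    have C0 : 0 <= C.
      have := Fdecay (tau := Complex 0 (Y + 1)); rewrite /= ltrDl ltr01 => /(_ isT) h.
      by have := le_trans (cn_ge0 _) h; rewrite pmulr_lge0 // expR_gt0.
    have [k hk] := arch (C / e / dV).
    exists (Num.max (Num.max Y 0) k%:R) => t; rewrite !gt_max => /andP[/andP[h1 h0] h2].
    rewrite psiE; apply: le_lt_trans (_ : C * expR (- (dV * complex.Im t)) < _).
      apply: le_trans (ler_wpM2r (expR_ge0 _) (Fdecay h1)) _.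
      by rewrite -[C * _ * _]mulrA -expRD ler_wpM2l // ler_expR /dV; lra.
    rewrite expRN ltr_pdivrMr ?expR_gt0 // -ltr_pdivrMl // mulrC.
    apply: lt_le_trans (expR_ge1Dx _); apply: lt_le_trans (_ : dV * complex.Im t <= _); last by rewrite lerDr.
    by rewrite [X in _ < X]mulrC -ltr_pdivrMr //; apply: lt_trans h2.
  - move=> t ty; rewrite psiE ty /A ler_wpM2r ?expR_ge0 // ler_pdivlMr ?exprn_gt0 //.
    by rewrite -ty; apply: HS; apply: Hy1; rewrite ty.
  - by rewrite -/y /y1; lra.
move: h; rewrite psiE -/y => h.
have -> : phi tau = cn (F tau) * expR (2 * pi * V * y) * (y ^+ (6 * n) * expR (- (2 * pi * V * y))).
  rewrite /phi -/y expRN; have := expR_gt0 (2 * pi * V * y); move: (expR _) => x x0.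
  by field; rewrite gt_eqF.
apply: le_trans (ler_wpM2r _ h) _; first by rewrite mulr_ge0 ?expR_ge0 // exprn_ge0 // ltW.
have -> : A * (y ^+ (6 * n) * expR (- (2 * pi * V * y))) =
    S * ((10%:R / 9%:R) ^+ (6 * n) * expR (- (2 * pi * V * (y / 10%:R)))).
  have e1 : expR (- (2 * pi * V * (y / 10%:R))) = expR (2 * pi * V * y1) * expR (- (2 * pi * V * y)).
    by rewrite -expRD /y1; congr expR; field.
  have e2 : y ^+ (6 * n) = (10%:R / 9%:R) ^+ (6 * n) * y1 ^+ (6 * n).
    by rewrite -exprMn /y1; congr (_ ^+ _); field.
  rewrite e1 e2 /A; have := exprn_gt0 (6 * n) y10; move: (y1 ^+ _) => x x0.
  by field; rewrite gt_eqF.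
rewrite ler_wpM2l // ler_wpM2l ?exprn_ge0 ?divr_ge0 // ler_expR lerN2.
by rewrite ler_wpM2l ?mulr_ge0 ?(ltW pi0) //; lra.
Qed.

(** The supremum of phi over the half plane equals that over the fundamental domain, where
    [phi_decay] bounds it by k < 1 times itself. Hence it is 0. *)
Lemma siegel_zero : (10%:R / 9%:R) ^+ (6 * n) * expR (- (2 * pi * V * (43%:R / 500%:R))) < 1 ->
  forall tau, Hp tau -> F tau = 0.
Proof.
set k := _ * expR _ => k1 tau ht; have [B HB] := phi_bounded.
pose E := [set phi t | t in [set t | Hp t]].
have hs : has_sup E.
  by split; [exists (phi tau), tau|exists B => _ [w hw <-]; exact: HB].
have ub w : Hp w -> phi w <= sup E by move=> hw; apply: ub_le_sup; [case: hs|exists w].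
have dec w : Hp w -> phi w <= sup E * k.
  move=> hw; have [g hg h] := fundamental hw; rewrite -(phi_moebius hg hw).
  exact: phi_decay.
have le : sup E <= sup E * k.
  by apply: ge_sup; [case: hs|move=> _ [w hw <-]; exact: dec].
have S0 : sup E <= 0.
  have : sup E * (1 - k) <= 0 by rewrite mulrBr mulr1 subr_le0.
  by rewrite pmulr_lle0 // subr_gt0.
have := le_trans (ub _ ht) S0; rewrite /phi pmulr_lle0 ?exprn_gt0 // => h.
by apply/eqP; rewrite -cn_eq0 eq_le h cn_ge0.
Qed.

End SiegelBound.

Section SiegelConstant.
Variable R : realType.

(** The factor per unit of n for vanishing order 2n. With pi >= 2 the exponential is at least
    e^0.688 >= (1 + 43/625)^10, and 267/250 is a simpler number below 1 + 43/625; the remaining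
    comparison of rational powers is done by repeated squaring. *)
Lemma kappa_lt1 : (10%:R / 9%:R) ^+ 6 * expR (- (4%:R * pi * (43%:R / 500%:R))) <= (99%:R / 100%:R : R).
Proof.
have p2 : 2 <= pi :> R by have := pihalf_ge1 R; lra.
have e1 : (267%:R / 250%:R) ^+ 10 <= expR (4%:R * pi * (43%:R / 500%:R)) :> R.
  apply: le_trans (_ : expR (43%:R / 625%:R) ^+ 10 <= _).
    rewrite lerXn2r ?nnegrE ?divr_ge0 ?expR_ge0 ?ler0n //; apply: le_trans (expR_ge1Dx _); lra.
  by rewrite -expRM_natl ler_expR; lra.
have x0 := expR_gt0 (4%:R * pi * (43%:R / 500%:R) : R).
rewrite expRN ler_pdivrMr //; move: (expR _) e1 x0 => x e1 x0.
have : (10%:R / 9%:R : R) ^+ 6 <= 99%:R / 100%:R * (267%:R / 250%:R) ^+ 10.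
  clear; pose u : R := 267%:R / 250%:R; rewrite -/u.
  have u0 : 0 <= u by rewrite divr_ge0 ?ler0n.
  have a1 : (57%:R / 50%:R : R) <= u ^+ 2 by rewrite /u expr2; lra.
  have a2 : (113%:R / 87%:R : R) <= u ^+ 4.
    apply: le_trans (_ : (57%:R / 50%:R) ^+ 2 <= _); first by rewrite expr2; lra.
    by rewrite (exprM _ 2 2) lerXn2r ?nnegrE ?exprn_ge0 ?divr_ge0 ?ler0n.
  have a3 : (42%:R / 25%:R : R) <= u ^+ 8.
    apply: le_trans (_ : (113%:R / 87%:R) ^+ 2 <= _); first by rewrite expr2; lra.
    by rewrite (exprM _ 4 2) lerXn2r ?nnegrE ?exprn_ge0 ?divr_ge0 ?ler0n.
  have a4 : (42%:R / 25%:R * (57%:R / 50%:R) : R) <= u ^+ 10.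
    by rewrite (exprD _ 8 2); apply: ler_pM => //; rewrite divr_ge0 ?ler0n.
  have b1 : (10%:R / 9%:R : R) ^+ 2 <= 247%:R / 200%:R by rewrite expr2; lra.
  have b2 : (10%:R / 9%:R : R) ^+ 6 <= (247%:R / 200%:R) ^+ 3.
    by rewrite (exprM _ 2 3) lerXn2r ?nnegrE ?exprn_ge0 ?divr_ge0 ?ler0n.
  apply: le_trans b2 _; apply: le_trans (ler_wpM2l _ a4); last by rewrite divr_ge0 ?ler0n.
  by rewrite exprS expr2; lra.
by move=> h; apply: le_trans h _; rewrite ler_wpM2l //; lra.
Qed.

(* The vanishing order 2n - c exceeds the order allowed by the weight once n is large. *)
Lemma siegel_large (c : nat) : exists n0 : nat, forall n, (n0 <= n)%N ->
  (10%:R / 9%:R) ^+ (6 * n) * expR (- (2 * pi * (2 * n%:R - c%:R) * (43%:R / 500%:R))) < (1 : R).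
Proof.
pose D := expR (2 * pi * c%:R * (43%:R / 500%:R)) : R.
have D0 : 0 < D by exact: expR_gt0.
have [m hm] := arch (D * 99%:R).
exists m => n mn.
have -> : (10%:R / 9%:R) ^+ (6 * n) * expR (- (2 * pi * (2 * n%:R - c%:R) * (43%:R / 500%:R))) =
   ((10%:R / 9%:R) ^+ 6 * expR (- (4%:R * pi * (43%:R / 500%:R)))) ^+ n * D.
  rewrite (exprMn n) -exprM -expRM_natl -[RHS]mulrA -expRD; congr (_ * expR _); ring.
apply: le_lt_trans (_ : (99%:R / 100%:R) ^+ n * D < 1).
  rewrite ler_wpM2r ?(ltW D0) // lerXn2r ?nnegrE ?mulr_ge0 ?exprn_ge0 ?divr_ge0 ?expR_ge0 //.
  exact: kappa_lt1.
have be : 1 + n%:R / 99%:R <= (100%:R / 99%:R) ^+ n :> R.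
  elim: n {mn} => [|n IH]; first by rewrite mul0r addr0 expr0.
  rewrite exprS -natr1; have k0 : 0 <= n%:R :> R by [].
  by move: (_ ^+ n) IH k0 => x; move: (n%:R : R) => y IH y0; nra.
rewrite -[_ / _]invf_div exprVn mulrC ltr_pdivrMr ?exprn_gt0 ?divr_gt0 // mul1r.
apply: lt_le_trans be; have : (m%:R : R) <= n%:R by rewrite ler_nat.
by lra.
Qed.

End SiegelConstant.

(** * Level one functions are rational in E6^2/E4^3 *)

Section LevelOne.
Variables (R : realType) (N : nat).
Hypothesis N0 : (0 < N)%N.
Implicit Types (tau w q : R[i]) (f : R[i] -> R[i]) (g : 'M[int]_2).
Local Notation F4 := (@F4 R N).
Local Notation F6 := (@F6 R N).

Definition sJ tau := F6 tau ^+ 2 / F4 tau ^+ 3.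

Lemma pnear_Hp tau (P : R[i] -> Prop) : Hp tau -> (forall w, Hp w -> P w) -> pnear tau P.
Proof. by move=> ht h; have [r r0 Hr] := Hp_open ht; apply: (pnear_ball r0) => w /Hr /h. Qed.

Lemma pnear_false tau : ~ pnear tau (fun=> False).
Proof. by move=> h; have [w []] := pnear_ex h ltr01. Qed.

Lemma nonzero_at_infinity f : (forall tau, Hp tau -> mero f tau) ->
  (exists Y : R, forall tau, Y < complex.Im tau -> f tau != 0) ->
  forall tau, Hp tau -> pnear tau (fun w => f w != 0).
Proof.
move=> mf [Y HY]; apply: mero_nonzero => //.
have m1 : Y <= Num.max Y 0 /\ 0 <= Num.max Y 0 by rewrite !le_max !lexx orbT.
have y0 : Num.max Y 0 < complex.Im (Complex 0 (Num.max Y 0 + 1) : R[i]) by rewrite /= ltrDl.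
exists (Complex 0 (Num.max Y 0 + 1)); first by rewrite /Hp; case: m1; lra.
move=> h; apply: (@pnear_false (Complex 0 (Num.max Y 0 + 1))).
have near : pnear (Complex 0 (Num.max Y 0 + 1)) (fun w => Y < complex.Im w).
  exists 1 => // w _ hw; have := le_lt_trans (Im_le_cn _) hw; rewrite ImB /= ltr_norml => /andP[].
  by case: m1; lra.
by apply: pnear_imp (pnearI h near) => w [E /HY]; rewrite E eqxx.
Qed.

Lemma neq0_at_cusp (U : R[i] -> R[i]) : holo_at U 0 -> U 0 != 0 ->
  exists Y : R, forall tau, Y < complex.Im tau -> U (qN N tau) != 0.
Proof.
move=> hU U0; have [r r0 Hr] := ccont_neq0 (holo_at_cont hU) U0.
by have [Y _ HY] := qN_small N0 r0; exists Y => tau /HY h; apply: Hr; rewrite subr0.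
Qed.

Lemma cn01 : cn (0 : R[i]) < 1. Proof. by rewrite cn0. Qed.

Lemma F4_neq0 tau : Hp tau -> pnear tau (fun w => F4 w != 0).
Proof.
apply: nonzero_at_infinity => [t ht|]; first by apply: holo_mero; exact: F4_holo.
by apply: (@neq0_at_cusp (E4q N)); [exact: (E4q_holo N0 cn01)|rewrite E4q0 // oner_neq0].
Qed.

Lemma sJ_mero tau : Hp tau -> mero sJ tau.
Proof.
by move=> ht; apply: mero_div; apply: holo_mero; apply: holo_atX; [exact: F6_holo|exact: F4_holo].
Qed.

Lemma horner_mero (p : {poly R[i]}) h tau : mero h tau -> mero (fun w => p.[h w]) tau.
Proof.
move=> mh; elim/poly_ind: p => [|p c IH].
  by apply: mero_pnear (mero_cst 0 tau); apply: pnear_all => w; rewrite horner0.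
apply: mero_pnear (meroD (meroM IH mh) (mero_cst c tau)); apply: pnear_all => w.
by rewrite hornerMXaddC.
Qed.

(** At infinity [sJ] tends to 1, and [sJ] - 1 is minus the discriminant over E4^3, which is nonzero
    near infinity. Splitting off the powers of X - 1 from p leaves a factor that does not vanish at
    1, so p of [sJ] is nonzero there. *)
Lemma poly_sJ_neq0 (p : {poly R[i]}) tau : p != 0 -> Hp tau -> pnear tau (fun w => p.[sJ w] != 0).
Proof.
move=> p0; apply: nonzero_at_infinity => [t ht|]; first exact: (horner_mero _ (sJ_mero ht)).
have [k [r]] := multiplicity_XsubC p 1; rewrite p0 /= => r1 ->.
have [D [hD D0 HD]] := Delta_lead R N0.
have [Y1 H1] := neq0_at_cusp hD D0.
have [|Y2 H2] := neq0_at_cusp (E4q_holo N0 cn01); first by rewrite E4q0 // oner_neq0.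
have hs : holo_at (fun q => E6q N q ^+ 2 / E4q N q ^+ 3) 0.
  apply: holo_atM; first by apply: holo_atX; exact: (E6q_holo N0 cn01).
  by apply: holo_atV; [apply: holo_atX; exact: (E4q_holo N0 cn01)|rewrite E4q0 // expr1n oner_neq0].
have hr : holo_at (fun q => r.[E6q N q ^+ 2 / E4q N q ^+ 3]) 0.
  elim/poly_ind: (r) => [|p' c IH].
    by apply: holo_at_near (holo_at_cst 0 0); exists 1 => // w _; rewrite horner0.
  apply: holo_at_near (holo_atD (holo_atM IH hs) (holo_at_cst c 0)).
  by exists 1 => // w _; rewrite hornerMXaddC.
have [|Y3 H3] := neq0_at_cusp hr.
  by rewrite E4q0 // E6q0 // !expr1n divr1 -rootE.
exists (Num.max Y1 (Num.max Y2 (Num.max Y3 0))) => t; rewrite !gt_max => /and4P[h1 h2 h3 h4].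
rewrite hornerM horner_exp hornerXsubC mulf_neq0 //; first exact: H3.
apply: expf_neq0; rewrite /sJ; have f4 : F4 t != 0 by exact: H2.
have -> : F6 t ^+ 2 / F4 t ^+ 3 - 1 = - (F4 t ^+ 3 - F6 t ^+ 2) / F4 t ^+ 3 by field.
rewrite /F4 /F6 HD ?(qN_lt1 N0) // mulf_neq0 ?invr_eq0 ?expf_neq0 // oppr_eq0 mulf_neq0 ?expf_neq0 ?qN_neq0 //.
exact: H1.
Qed.

(** A product of linear forms in E4^3 and E6^2, of weight 12 times its length. Multiplication by E4
    to the power 3 times the degree turns a polynomial in [sJ] that is split into linear factors
    into such a product. *)
Definition hp (L : seq (R[i] * R[i])) tau : R[i] := \prod_(c <- L) (c.1 * F4 tau ^+ 3 + c.2 * F6 tau ^+ 2).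

Lemma hp_cons c L tau : hp (c :: L) tau = (c.1 * F4 tau ^+ 3 + c.2 * F6 tau ^+ 2) * hp L tau.
Proof. by rewrite [LHS]big_cons. Qed.

Lemma hp_nil tau : hp [::] tau = 1.
Proof. by rewrite [LHS]big_nil. Qed.

Definition pok (L : seq (R[i] * R[i])) := all (fun c => c != (0, 0)) L.

Lemma holo_lin (u v : R[i] -> R[i]) (c : R[i] * R[i]) z : holo_at u z -> holo_at v z ->
  holo_at (fun w => c.1 * u w ^+ 3 + c.2 * v w ^+ 2) z.
Proof.
move=> hu hv; apply: holo_atD; (apply: holo_atM; first exact: holo_at_cst); exact: holo_atX.
Qed.

Lemma holo_hp L tau : Hp tau -> holo_at (hp L) tau.
Proof.
move=> ht; elim: L => [|c L IH].
  by apply: holo_at_near (holo_at_cst 1 tau); exists 1 => // w _; rewrite /hp big_nil.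
have l0 : holo_at (fun w => c.1 * F4 w ^+ 3 + c.2 * F6 w ^+ 2) tau.
  by apply: (holo_lin c); [exact: F4_holo|exact: F6_holo].
by apply: holo_at_near (holo_atM l0 IH); exists 1 => // w _; rewrite /hp big_cons.
Qed.

Lemma hp_cat L L' tau : hp (L ++ L') tau = hp L tau * hp L' tau.
Proof. by rewrite /hp big_cat. Qed.

Lemma hp_moebius L g tau : SL2Z g -> Hp tau -> hp L (moebius g tau) = mden g tau ^+ (12 * size L) * hp L tau.
Proof.
move=> hg ht; elim: L => [|c L IH].
  have E t : hp [::] t = 1 by rewrite /hp big_nil.
  by rewrite !E mulr1 (_ : 12 * size [::] = 0)%N ?expr0.
have e : (12 * size (c :: L) = 12 + 12 * size L)%N by rewrite -mulnS.
have lin : c.1 * F4 (moebius g tau) ^+ 3 + c.2 * F6 (moebius g tau) ^+ 2 =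
    mden g tau ^+ 12 * (c.1 * F4 tau ^+ 3 + c.2 * F6 tau ^+ 2).
  rewrite (F4_moebius N0 hg ht) (F6_moebius N0 hg ht).
  move: (mden g tau) (F4 tau) (F6 tau) => d a b.
  ring.
rewrite !hp_cons e exprD mulrACA.
by congr (_ * _).
Qed.

Section OneFunction.
Variable f : R[i] -> R[i].
Hypothesis fmero : forall tau, Hp tau -> mero f tau.
Hypothesis finv : forall g, SL2Z g -> mero_eq (f \o moebius g) f.
Hypothesis fexp : qlaurent N setT f.

Definition cleared L tau := exists2 h, holo_at h tau & pnear tau (fun w => f w * hp L w = h w).

Lemma cleared_catl L L' tau : Hp tau -> cleared L tau -> cleared (L ++ L') tau.
Proof.
move=> ht [h hh Hh]; exists (fun w => h w * hp L' w); first by apply: holo_atM => //; exact: holo_hp.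
by apply: pnear_imp Hh => w E; rewrite hp_cat mulrA E.
Qed.

Lemma cleared_catr L L' tau : Hp tau -> cleared L' tau -> cleared (L ++ L') tau.
Proof.
move=> ht [h hh Hh]; exists (fun w => h w * hp L w); first by apply: holo_atM => //; exact: holo_hp.
by apply: pnear_imp Hh => w E; rewrite hp_cat -E; ring.
Qed.

Lemma cleared_open L tau : cleared L tau -> exists2 d : R, 0 < d & forall w, cn (w - tau) < d -> cleared L w.
Proof.
move=> c; have [h hh Hh] := c; have [r r0 Hr] := holo_at_open hh; have [s s0 Hs] := pnear_open Hh.
exists (Num.min r s); first by rewrite lt_min r0.
move=> w; rewrite lt_min => /andP[w1 w2]; have [->//|ne] := eqVneq w tau.
by exists h; [exact: Hr|exact: Hs].
Qed.

(** A nonzero linear form in E4^3 and E6^2 that vanishes at p, raised to the order of the pole,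
    clears it. The form is (F6 p)^2 E4^3 - (F4 p)^3 E6^2 unless both values are zero, and then E4^3
    serves. *)
Lemma cleared_local p : Hp p -> exists2 L, pok L & cleared L p.
Proof.
move=> hpp; have [k [u [hu Hu]]] := fmero hpp.
pose c := if (F4 p == 0) && (F6 p == 0) then (1, 0) else (F6 p ^+ 2, - F4 p ^+ 3) : R[i] * R[i].
have c0 : c != (0, 0).
  rewrite /c; case: ifP => h; first by rewrite xpair_eqE oner_eq0.
  by rewrite xpair_eqE oppr_eq0 !expf_eq0 /= andbC h.
pose l w := c.1 * F4 w ^+ 3 + c.2 * F6 w ^+ 2.
have lp : l p = 0.
  rewrite /l /c; case: ifP => [/andP[/eqP -> /eqP ->]|_] /=; last by ring.
  by rewrite !expr0n /= !mulr0 addr0.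
have hl : holo_at l p.
  by apply: (holo_lin c); [exact: F4_holo|exact: F6_holo].
exists (nseq k c); first by apply/allP => x /nseqP[-> _].
exists (fun w => u w * tquo p l w ^+ k).
  by apply: holo_atM => //; apply: holo_atX; exact: holo_at_tquo.
have [r r0 Hr] := Hu; exists r => // w wp /(Hr w wp) ->.
have -> : hp (nseq k c) w = l w ^+ k by rewrite /hp big_nseq iter_mulr_1.
have d0 : w - p != 0 by rewrite subr_eq0.
rewrite {1}(tquoE l p w) lp add0r exprMn.
move: (expf_neq0 k d0); move: ((w - p) ^+ k) (tquo p l w ^+ k) (u w) => x y z x0.
by field; rewrite x0.
Qed.

Lemma expansion_near : exists m H, holo_at H 0 /\ exists2 Y : R, 0 < Y & forall tau, Y < complex.Im tau ->
  holo_at H (qN N tau) /\ pnear tau (fun w => f w = H (qN N w) / qN N w ^+ m).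
Proof.
have [m [H [[hH _] [Y Y0 HY]]]] := fexp; exists m, H; split=> //.
have [r r0 Hr] := holo_at_open hH; have [Y' Y0' HY'] := qN_small N0 r0.
exists (Num.max Y Y'); first by rewrite lt_max Y0.
move=> tau; rewrite gt_max => /andP[h1 h2]; split; last exact: HY.
by apply: Hr; rewrite subr0; exact: HY'.
Qed.

Lemma cleared_moebius L g tau : SL2Z g -> Hp tau -> cleared L (moebius g tau) -> cleared L tau.
Proof.
move=> hg ht [h hh Hh]; exists (fun w => h (moebius g w) * (mden g w ^+ (12 * size L))^-1).
  apply: holo_atM; first by apply: holo_at_comp => //; exact: moebius_holo.
  apply: holo_atV; last by rewrite expf_neq0 // mden_neq0.
  by apply: holo_atX; exists 1 => // w _; exact: mden_cdiff.
have /mero_eqP h1 := finv hg.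
have h2 := pnear_moebius hg ht Hh.
apply: pnear_imp (pnearI (pnear_Hp ht (fun w hw => hw)) (pnearI (h1 _ ht) h2)) => w [hw [E1 E2]].
rewrite -E2 hp_moebius //; move: E1 => /= ->; have := expf_neq0 (12 * size L) (mden_neq0 hg hw).
by move: (mden g w ^+ _) => x x0; field; rewrite x0.
Qed.

(** Compactness provides one list for the truncated fundamental domain, above which the expansion at
    infinity shows that f is already holomorphic. Modularity carries the conclusion to the whole
    half plane. *)
Lemma clear_poles : exists2 L, pok L & forall tau, Hp tau -> cleared L tau.
Proof.
have [m [H [hH [Y Y0 HY]]]] := expansion_near.
have Y1 : 0 < Y + 1 by lra.
have [|||[L okL] HL] := @box_cover R {L | pok L}
    (fun a b => exist _ (sval a ++ sval b) (introT idP (etrans (all_cat _ _ _) (introT andP (conj (svalP a) (svalP b))))))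
    (fun a w => Hp w -> cleared (sval a) w) (- 2^-1) (43%:R / 50%:R) 1 (Y + 1) ltr01 Y1.
- by move=> [a Ga] [b Gb] w /= h hw; apply: cleared_catl => //; exact: h.
- by move=> [a Ga] [b Gb] w /= h hw; apply: cleared_catr => //; exact: h.
- move=> p /andP[_ /andP[p1 _]]; have hpp : Hp p by rewrite /Hp; lra.
  have [L okL cL] := cleared_local hpp; exists (exist _ L okL).
  by have [d d0 Hd] := cleared_open cL; exists d => // w _ /Hd.
exists L => // tau ht; have [g hg [re im]] := fundamental ht.
apply: (cleared_moebius hg ht); have ht' := Hp_moebius hg ht.
move: (moebius g tau) re im ht' => t re im ht'.
case: (lerP (complex.Im t) (43%:R / 50%:R + (Y + 1))) => h.
  apply: HL => //; rewrite /in_box im h /= andbT; move: re; rewrite ler_norml => /andP[r1 r2].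
  by apply/andP; split; lra.
apply: (@cleared_catl [::] L) => //; have [|h1 h2] := HY t; first by lra.
exists (fun w => H (qN N w) * (qN N w ^+ m)^-1).
  apply: holo_atM; first by apply: holo_at_comp => //; exact: qN_holo.
  by apply: holo_atV; [apply: holo_atX; exact: qN_holo|rewrite expf_neq0 // qN_neq0].
by apply: pnear_imp h2 => w ->; rewrite /hp big_nil mulr1.
Qed.

Variable L : seq (R[i] * R[i]).
Hypothesis HL : forall tau, Hp tau -> cleared L tau.

(** The holomorphic form f times [hp L] with its removable singularities filled in: the value at a
    point is that of any local holomorphic representative, and [reg_val] shows that they all
    agree. *)
Definition reg tau : R[i] := xget 0 [set v | exists h, [/\ holo_at h tau, pnear tau (fun w => f w * hp L w = h w) & v = h tau]].

Lemma reg_val tau h : holo_at h tau -> pnear tau (fun w => f w * hp L w = h w) -> reg tau = h tau.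
Proof.
move=> hh Hh; rewrite /reg; case: xgetP => [v _ [h' [hh' Hh' ->]]|/(_ (h tau))]; last by case; exists h.
have [r r0 Hr] := pnearI Hh Hh'.
by apply: (ccont_unique r0 _ (holo_at_cont hh') (holo_at_cont hh)) => w wt /(Hr w wt)[<- <-].
Qed.

Lemma reg_near tau h : holo_at h tau -> pnear tau (fun w => f w * hp L w = h w) -> near_eq tau h reg.
Proof.
move=> hh Hh; have [r r0 Hr] := holo_at_open hh; have [s s0 Hs] := pnear_open Hh.
exists (Num.min r s); first by rewrite lt_min r0.
move=> w; rewrite lt_min => /andP[w1 w2]; have [->|ne] := eqVneq w tau; first by rewrite (reg_val hh Hh).
by rewrite (reg_val (Hr w w1) (Hs w ne w2)).
Qed.

Lemma reg_holo tau : Hp tau -> holo_at reg tau.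
Proof. by move=> /HL [h hh Hh]; apply: holo_at_near (reg_near hh Hh) hh. Qed.

Lemma reg_pnear tau : Hp tau -> pnear tau (fun w => f w * hp L w = reg w).
Proof.
move=> /HL [h hh Hh]; have [r r0 Hr] := reg_near hh Hh.
by apply: pnear_imp (pnearI (pnear_ball r0 Hr) Hh) => w [<- ->].
Qed.

Lemma reg_moebius g tau : SL2Z g -> Hp tau -> reg (moebius g tau) = mden g tau ^+ (12 * size L) * reg tau.
Proof.
move=> hg ht; have ht' := Hp_moebius hg ht.
have h1 : holo_at (fun w => reg (moebius g w)) tau.
  by apply: holo_at_comp; [exact: moebius_holo|exact: reg_holo].
have h2 : holo_at (fun w => mden g w ^+ (12 * size L) * reg w) tau.
  by apply: holo_atM; [apply: holo_atX; exists 1 => // w _; exact: mden_cdiff|exact: reg_holo].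
have /mero_eqP e1 := finv hg.
have [r r0 Hr] := pnearI (pnearI (pnear_Hp ht (fun w hw => hw)) (e1 _ ht))
  (pnearI (pnear_moebius hg ht (reg_pnear ht')) (reg_pnear ht)).
apply: (ccont_unique r0 _ (holo_at_cont h1) (holo_at_cont h2)) => w wt /(Hr w wt)[[hw E1] [<- <-]].
by rewrite hp_moebius //; move: E1 => /= ->; ring.
Qed.

Lemma reg_expansion : exists M H, holo_at H 0 /\ exists2 Y : R, 0 < Y & forall tau, Y < complex.Im tau ->
  reg tau * qN N tau ^+ (N * M) = H (qN N tau).
Proof.
have [m [H [hH [Y Y0 HY]]]] := expansion_near.
pose HL' q := \prod_(c <- L) (c.1 * E4q N q ^+ 3 + c.2 * E6q N q ^+ 2).
have hHL q : cn q < 1 -> holo_at HL' q.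
  move=> q1; rewrite /HL'; elim: (L) => [|c l IH].
    by apply: holo_at_near (holo_at_cst 1 q); exists 1 => // w _; rewrite big_nil.
  have l0 : holo_at (fun w => c.1 * E4q N w ^+ 3 + c.2 * E6q N w ^+ 2) q.
    exact: holo_lin (E4q_holo N0 q1) (E6q_holo N0 q1).
  by apply: holo_at_near (holo_atM l0 IH); exists 1 => // w _; rewrite big_cons.
(* The order m of the pole is padded to a multiple of N, because q^(N m) is a function of e^(2 pi i
   tau) and so has period 1. *)
have NM : (m <= N * m)%N by rewrite leq_pmull.
exists m, (fun q => q ^+ (N * m - m) * (H q * HL' q)); split.
  by apply: holo_atM; [exact: qpow_holo|apply: holo_atM => //; exact: (hHL _ cn01)].
exists Y => // tau hY; have ht : Hp tau by apply: lt_trans hY.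
have [h1 h2] := HY tau hY; have q0 := qN_neq0 N tau.
have hh : holo_at (fun w => H (qN N w) * (qN N w ^+ m)^-1 * hp L w) tau.
  apply: holo_atM; last exact: holo_hp.
  apply: holo_atM; first by apply: holo_at_comp => //; exact: qN_holo.
  by apply: holo_atV; [apply: holo_atX; exact: qN_holo|rewrite expf_neq0 // qN_neq0].
rewrite (reg_val hh); last by apply: pnear_imp h2 => w ->.
rewrite -{1}(subnKC NM) exprD /hp -/(HL' (qN N tau)).
move: (qN N tau) q0 => q q0; have := expf_neq0 m q0; move: (q ^+ m) => x x0.
by field; rewrite x0.
Qed.

End OneFunction.
End LevelOne.

(** * Linearity and scaling of Taylor coefficients *)

Section TaylorLinear.
Variable R : realType.
Implicit Types (F G K : R[i] -> R[i]) (q w : R[i]).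

Lemma tay_lin c F G n : holo_at F 0 -> holo_at G 0 ->
  tay (fun w => F w - c * G w) 0 n = tay F 0 n - c * tay G 0 n.
Proof.
elim: n F G => [//|n IH] F G hF hG; rewrite !tayS (near_eq_tay _ (tquo_lin c hF hG)).
by apply: IH; exact: holo_at_tquo.
Qed.

Lemma tay0 n : tay (fun=> 0 : R[i]) 0 n = 0.
Proof. by elim: n => [//|n IH]; rewrite tayS (near_eq_tay _ (tquo_cst 0)). Qed.

Lemma near_eq_all F G : F =1 G -> near_eq 0 F G.
Proof. by move=> h; exists 1 => // w _; exact: h. Qed.

Lemma tayZ c G n : holo_at G 0 -> tay (fun w => c * G w) 0 n = c * tay G 0 n.
Proof.
move=> hG; have e := @tay_lin (- c) (fun=> 0) G n (holo_at_cst 0 0) hG.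
rewrite tay0 sub0r mulNr opprK in e; rewrite -e.
by apply: near_eq_tay; apply: near_eq_all => w; rewrite sub0r mulNr opprK.
Qed.

Lemma tay_sum (I : Type) (s : seq I) (x : I -> R[i]) (K : I -> R[i] -> R[i]) n :
  (forall u, holo_at (K u) 0) ->
  holo_at (fun w => \sum_(u <- s) x u * K u w) 0 /\
  tay (fun w => \sum_(u <- s) x u * K u w) 0 n = \sum_(u <- s) x u * tay (K u) 0 n.
Proof.
move=> hK; elim: s => [|u s [hs IH]].
  have e : near_eq 0 (fun=> 0) (fun w => \sum_(u <- [::]) x u * K u w).
    by apply: near_eq_all => w; rewrite big_nil.
  split; first exact: holo_at_near e (holo_at_cst 0 0).
  by rewrite -(near_eq_tay _ e) tay0 big_nil.
have e : near_eq 0 (fun w => \sum_(u <- s) x u * K u w - - x u * K u w) (fun w => \sum_(u <- u :: s) x u * K u w).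
  by apply: near_eq_all => w; rewrite big_cons mulNr opprK addrC.
split.
  by apply: holo_at_near e _; apply: holo_atB => //; apply: holo_atM => //; exact: holo_at_cst.
by rewrite -(near_eq_tay _ e) tay_lin // IH big_cons mulNr opprK addrC.
Qed.

Lemma holo_scale (z : R[i]) K : holo_at K 0 -> holo_at (fun q => K (z * q)) 0.
Proof.
move=> hK; apply: (@holo_at_comp _ (fun q => z * q)); last by rewrite mulr0.
by apply: holo_atM; [exact: holo_at_cst|exact: holo_at_id].
Qed.

Lemma tay_scale (z : R[i]) K n : holo_at K 0 -> tay (fun q => K (z * q)) 0 n = z ^+ n * tay K 0 n.
Proof.
elim: n K => [|n IH] K hK; first by rewrite /tay /tayf /= mulr0 expr0 mul1r.
have hT := holo_at_tquo hK; have hS := holo_scale z hT.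
have e : near_eq 0 (tquo 0 (fun q => K (z * q))) (fun q => z * tquo 0 K (z * q)).
  apply: (near_tquo ltr01 (holo_scale z hK)).
    by apply: holo_at_cont; apply: holo_atM => //; exact: holo_at_cst.
  by move=> w _ _; rewrite mulr0 {1}(tquoE K 0 (z * w)) !subr0; ring.
by rewrite !tayS (near_eq_tay _ e) tayZ // IH // exprS mulrA.
Qed.

Lemma order_factor K m : (forall i, (i < m)%N -> tay K 0 i = 0) ->
  forall q, K q = tayf K 0 m q * q ^+ m.
Proof.
move=> h q; rewrite {1}(tayf_expand K 0 m q) big1 ?add0r ?subr0 // => i _.
by rewrite h // mul0r.
Qed.

(** The translation tau -> tau + 1 is q -> zeta q, which multiplies the i-th coefficient by zeta^i;
    this differs from 1 when N does not divide i. *)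
Lemma periodic_tay (N : nat) K (Y : R) : (0 < N)%N -> holo_at K 0 ->
  (forall tau, Y < complex.Im tau -> K (qN N (tau + 1)) = K (qN N tau)) ->
  forall i, ~~ (N %| i)%N -> tay K 0 i = 0.
Proof.
move=> N0 hK HY i Ni; pose z := zeta R N.
have qz tau : qN N (tau + 1) = z * qN N tau.
  by rewrite /qN mulrDl e2D mulrC /z /zeta mul1r.
have hD : holo_at (fun q => K (z * q) - K q) 0 by apply: holo_atB => //; exact: holo_scale.
have D0 : near_eq 0 (fun q => K (z * q)) K.
  have [[r r0 Hr]|[k [h [hh h0 E _]]]] := zero_order hD.
    by exists r => // w /Hr /eqP; rewrite subr_eq0 => /eqP.
  exfalso; have [Y' H'] := neq0_at_cusp N0 hh h0.
  pose y := Num.max Y Y' + 1; have Ym : Y <= Num.max Y Y' /\ Y' <= Num.max Y Y'.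
    by rewrite !le_max !lexx orbT.
  have h1 : Y < complex.Im (Complex 0 y : R[i]) by rewrite /= /y; case: Ym; lra.
  have h2 : Y' < complex.Im (Complex 0 y : R[i]) by rewrite /= /y; case: Ym; lra.
  have := E (qN N (Complex 0 y)); rewrite -qz HY // subrr subr0 => /esym/eqP.
  by rewrite mulf_eq0 expf_eq0 (negbTE (qN_neq0 _ _)) andbF (negbTE (H' _ h2)).
have e := near_eq_tay i D0; rewrite tay_scale // in e.
have z1 : z ^+ i - 1 != 0 by rewrite subr_eq0; exact: (ze_eq1 R N0 Ni).
by apply: (mulfI z1); rewrite mulrBl mul1r e subrr mulr0.
Qed.

End TaylorLinear.

(** * The dimension count *)

Section LevelOneTheorem.
Variables (R : realType) (N : nat).
Hypothesis N0 : (0 < N)%N.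
Implicit Types (tau w q : R[i]) (g : 'M[int]_2).
Variable f : R[i] -> R[i].
Hypothesis fmero : forall tau, Hp tau -> mero f tau.
Hypothesis finv : forall g, SL2Z g -> mero_eq (f \o moebius g) f.
Hypothesis fexp : qlaurent N setT f.

Lemma cn_qN tau k : cn (qN N tau ^+ (N * k)) = expR (- (2 * pi * k%:R * complex.Im tau)).
Proof.
rewrite cnX /qN cn_e2 -expRM_natl; congr expR; rewrite Im_divn natrM.
have n0 : N%:R != 0 :> R by rewrite pnatr_eq0 -lt0n.
by move: n0; move: (N%:R : R) => x x0; field.
Qed.

(** The a + 1 products of [reg] with monomials of weight 12a and the n + 1 monomials of weight 12n
    all have weight 12n. Some nontrivial combination has its first a + n + 1 relevant coefficients
    equal to 0, hence vanishes at infinity to an order close to 2n, and [siegel_zero] shows that it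
    is identically 0. *)
Theorem dimension_count L : (forall tau, Hp tau -> cleared N f L tau) ->
  exists n a (v : 'rV[R[i]]_(a.+1 + n.+1)), [/\ (a + size L)%N = n, v != 0 & forall tau, Hp tau ->
    \sum_(i < a.+1) v 0 (lshift _ i) * (reg N f L tau * (F4 N tau ^+ (3 * (a - i)) * F6 N tau ^+ (2 * i))) +
    \sum_(i < n.+1) v 0 (rshift _ i) * (F4 N tau ^+ (3 * (n - i)) * F6 N tau ^+ (2 * i)) = 0].
Proof.
move=> HL; set m := size L.
have [M [H [hH [Y Y0 HY]]]] := reg_expansion N0 fexp L.
have [n0 Hn0] := siegel_large R (m + M).
pose n := maxn n0 (m + M); pose a := (n - m)%N.
have nm : (m + M <= n)%N by rewrite leq_maxr.
have am : (a + m)%N = n by rewrite /a; lia.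
(* One fewer condition than unknowns. Only the indices divisible by N are imposed, since
   [periodic_tay] gives the others; E conditions thus yield a zero of order N E in q. *)
pose E := (a + n.+1)%N.
pose phi (u : 'I_(a.+1 + n.+1)) (tau : R[i]) : R[i] := match fintype.split u with
  | inl i => reg N f L tau * (F4 N tau ^+ (3 * (a - i)) * F6 N tau ^+ (2 * i))
  | inr i => F4 N tau ^+ (3 * (n - i)) * F6 N tau ^+ (2 * i) end.
pose K (u : 'I_(a.+1 + n.+1)) (q : R[i]) : R[i] := match fintype.split u with
  | inl i => H q * (E4q N q ^+ (3 * (a - i)) * E6q N q ^+ (2 * i))
  | inr i => q ^+ (N * M) * (E4q N q ^+ (3 * (n - i)) * E6q N q ^+ (2 * i)) end.
have h4 := E4q_holo N0 (cn01 R); have h6 := E6q_holo N0 (cn01 R).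
have hEE k l : holo_at (fun q => E4q N q ^+ k * E6q N q ^+ l : R[i]) 0.
  by apply: holo_atM; exact: holo_atX.
have hK u : holo_at (K u) 0.
  rewrite /K; case: (fintype.split u) => i.
    by apply: holo_atM; [exact: hH|exact: (hEE (3 * (a - i))%N (2 * i)%N)].
  by apply: holo_atM; [exact: qpow_holo|exact: (hEE (3 * (n - i))%N (2 * i)%N)].
have hFF k l tau : Hp tau -> holo_at (fun w => F4 N w ^+ k * F6 N w ^+ l : R[i]) tau.
  by move=> ht; apply: holo_atM; apply: holo_atX; [exact: F4_holo|exact: F6_holo].
have hphi u tau : Hp tau -> holo_at (phi u) tau.
  move=> ht; rewrite /phi; case: (fintype.split u) => i; last exact: hFF.
  by apply: holo_atM; [exact: (reg_holo HL)|exact: hFF].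
have phiK u tau : Y < complex.Im tau -> phi u tau * qN N tau ^+ (N * M) = K u (qN N tau).
  move=> hY; rewrite /phi /K; case: (fintype.split u) => i; last by rewrite mulrC.
  by rewrite mulrAC HY.
have FFmod k l g tau : SL2Z g -> Hp tau -> F4 N (moebius g tau) ^+ (3 * k) * F6 N (moebius g tau) ^+ (2 * l) =
    mden g tau ^+ (12 * (k + l)) * (F4 N tau ^+ (3 * k) * F6 N tau ^+ (2 * l)).
  move=> hg ht; rewrite (F4_moebius N0 hg ht) (F6_moebius N0 hg ht).
  move: (mden g tau) (F4 N tau) (F6 N tau) => d x y.
  have aux (z t : R[i]) i j : (z ^+ i * t) ^+ j = z ^+ (i * j) * t ^+ j by rewrite exprMn exprM.
  rewrite !aux mulrACA -exprD; congr (_ ^+ _ * _); lia.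
have phimod u g tau : SL2Z g -> Hp tau -> phi u (moebius g tau) = mden g tau ^+ (12 * n) * phi u tau.
  move=> hg ht; rewrite /phi; case: (fintype.split u) => i; have li := ltn_ord i.
    have e1 := FFmod (a - i)%N i g tau hg ht.
    transitivity (mden g tau ^+ (12 * size L) * reg N f L tau *
      (mden g tau ^+ (12 * (a - i + i)) * (F4 N tau ^+ (3 * (a - i)) * F6 N tau ^+ (2 * i)))).
      exact: (f_equal2 (fun x y => x * y) (reg_moebius N0 finv HL hg ht) e1).
    have e2 : (12 * n = 12 * size L + 12 * (a - i + i))%N by rewrite -/m; lia.
    rewrite e2 exprD; move: (reg N f L tau) (F4 N tau ^+ _ * F6 N tau ^+ _) => X1 X2.
    by rewrite mulrACA.
  have e1 := FFmod (n - i)%N i g tau hg ht.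
  have e2 : (12 * n = 12 * (n - i + i))%N by lia.
  by rewrite e2.
pose A := \matrix_(u < a.+1 + n.+1, k < E) tay (K u) 0 (N * k).
have [v v0 vA] : exists2 v : 'rV[R[i]]_(a.+1 + n.+1), v != 0 & v *m A = 0.
  have /rowV0Pn[v] : kermx A != 0.
    by rewrite kermx_eq0 /row_free neq_ltn (leq_ltn_trans (rank_leq_col A)).
  by move=> /sub_kermxP h v0; exists v.
exists n, a, v; split=> //.
pose G tau := \sum_u v 0 u * phi u tau; pose KK q := \sum_u v 0 u * K u q.
suff Gz tau : Hp tau -> G tau = 0.
  move=> tau ht; rewrite -[RHS](Gz tau ht) /G big_split_ord /=; congr (_ + _).
    by apply: eq_bigr => i _; rewrite /phi (unsplitK (inl i)).
  by apply: eq_bigr => i _; rewrite /phi (unsplitK (inr i)).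
have hG t : Hp t -> holo_at G t.
  move=> ht; rewrite /G; elim: (index_enum _) => [|u s IH].
    by apply: holo_at_near (holo_at_cst 0 t); exists 1 => // w _; rewrite big_nil.
  apply: holo_at_near (holo_atD (holo_atM (holo_at_cst (v 0 u) t) (hphi u t ht)) IH).
  by exists 1 => // w _; rewrite big_cons.
have Gmod g t : SL2Z g -> Hp t -> G (moebius g t) = mden g t ^+ (12 * n) * G t.
  by move=> hg ht; rewrite /G mulr_sumr; apply: eq_bigr => u _; rewrite phimod // mulrCA.
have GK t : Y < complex.Im t -> G t * qN N t ^+ (N * M) = KK (qN N t).
  by move=> hY; rewrite /G mulr_suml; apply: eq_bigr => u _; rewrite -mulrA phiK.
have Hq t : Y < complex.Im t -> Hp t by apply: lt_trans.
have hKK : holo_at KK 0 by have [] := tay_sum (index_enum _) (fun u => v 0 u) 0 hK.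
have qN1 (t : R[i]) : qN N (t + 1) ^+ (N * M) = qN N t ^+ (N * M).
  have e z : qN N z ^+ N = cexp2ipi (z : R[i]).
    by rewrite qN_pow mulrAC mulfV ?mul1r // pnatr_eq0 -lt0n.
  have e' z : qN N z ^+ (N * M) = cexp2ipi (z : R[i]) ^+ M.
    by rewrite exprM; congr (_ ^+ M); exact: e.
  by rewrite (e' (t + 1)) (e' t) e2D e2_1 mulr1.
have van i : (i < N * E)%N -> tay KK 0 i = 0.
  move=> iE; case: (boolP (N %| i)%N) => [/dvdnP[k ek]|Ni]; last first.
    apply: (periodic_tay (Y := Y) N0 hKK _ Ni) => t hY.
    have e1 : G (t + 1) = G t by exact: (F_shift Gmod 1 (Hq t hY)).
    have h1 : Y < complex.Im (t + 1) by rewrite ImD /= addr0.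
    exact: (etrans (esym (GK _ h1)) (etrans (f_equal2 (fun x y => x * y) e1 (qN1 t)) (GK t hY))).
  have kE : (k < E)%N by move: iE; rewrite ek mulnC ltn_mul2l => /andP[].
  have [_ e] := tay_sum (index_enum _) (fun u => v 0 u) i hK; apply: (etrans e).
  have E0 : (v *m A) 0 (Ordinal kE) = 0 by rewrite vA mxE.
  rewrite mxE in E0; apply: (etrans _ E0); apply: eq_bigr => u _.
  by congr (_ * _); rewrite /A mxE /= ek mulnC.
have [r [B [r0 B0 _ HB]]] := holo_at_bound (holo_at_tayf (N * E) hKK).
have [Y2 _ HY2] := qN_small N0 r0.
have V0 : 0 <= 2 * n%:R - (m + M)%:R :> R.
  by have : (m + M)%:R <= n%:R :> R; [rewrite ler_nat|have : 0 <= n%:R :> R by []; lra].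
(* Dividing by q^(N M) loses M from the order. The last unit is the gap between V and V1 that the
   decay hypothesis requires. *)
have EM : (E - M)%:R = 2 * n%:R - (m + M)%:R + 1 :> R.
  rewrite natrB; last by rewrite /E; lia.
  have -> : E = (a + (a + m) + 1)%N by rewrite /E; lia.
  rewrite -am !natrD; ring.
apply: (@siegel_zero R G n hG Gmod (2 * n%:R - (m + M)%:R) (E - M)%:R B (Num.max Y Y2) V0).
- by rewrite EM; lra.
- move=> t; rewrite gt_max => /andP[h1 h2].
  have q0 : qN N t ^+ (N * M) != 0 by rewrite expf_neq0 // qN_neq0.
  have -> : G t = tayf KK 0 (N * E) (qN N t) * qN N t ^+ (N * (E - M)).
    apply: (mulIf q0); rewrite (GK t h1) (order_factor van (qN N t)) -mulrA -exprD; congr (_ * _ ^+ _).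
    by rewrite -mulnDr subnK // /E; lia.
  rewrite cnM cn_qN ler_wpM2r ?expR_ge0 //; apply: HB; rewrite subr0; exact: HY2.
- by apply: Hn0; rewrite leq_maxl.
Qed.

(** Dividing the relation by E4^(3n) makes it f times a polynomial in [sJ] plus another such
    polynomial. The first is nonzero: otherwise the second would vanish at [sJ], hence be zero by
    [poly_sJ_neq0], and so would be the vector v. *)
Theorem level_one_rational : exists P Q : {poly R[i]}, P != 0 /\
  forall tau, Hp tau -> pnear tau (fun w => f w * P.[sJ N w] = Q.[sJ N w]).
Proof.
have [L okL HL] := clear_poles N0 fmero finv fexp.
have [n [a [v [an v0 rel]]]] := dimension_count HL.
pose p := \poly_(i < a.+1) v 0 (lshift n.+1 (inord i)).
pose s := \poly_(i < n.+1) v 0 (rshift a.+1 (inord i)).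
(* The dehomogenisation of [hp L]; it is nonzero since no linear form in the list is zero. *)
pose l : {poly R[i]} := \prod_(c <- L) (c.1%:P + c.2 *: 'X).
have l0 : l != 0.
  rewrite /l; elim: (L) okL => [|c l' IH] /=; first by rewrite big_nil oner_neq0.
  move=> /andP[c0 /IH h]; rewrite big_cons mulf_neq0 //.
  apply: contra c0 => /eqP E; have e0 : (c.1%:P + c.2 *: 'X)`_0 = 0 by rewrite E coef0.
  have e1 : (c.1%:P + c.2 *: 'X)`_1 = 0 by rewrite E coef0.
  move: e0 e1; rewrite !coefD !coefC !coefZ !coefX /= mulr0 addr0 add0r mulr1 => a0 b0.
  by case: c {E} a0 b0 => x y /= -> ->.
have pE x : p.[x] = \sum_(i < a.+1) v 0 (lshift n.+1 i) * x ^+ i.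
  by rewrite horner_poly; apply: eq_bigr => i _; rewrite inord_val.
have sE x : s.[x] = \sum_(i < n.+1) v 0 (rshift a.+1 i) * x ^+ i.
  by rewrite horner_poly; apply: eq_bigr => i _; rewrite inord_val.
have key tau : Hp tau -> pnear tau (fun w => f w * (l * p).[sJ N w] = (- s).[sJ N w]).
  move=> ht; apply: pnear_imp (pnearI (pnear_Hp ht (fun w hw => hw)) (pnearI (F4_neq0 N0 ht) (reg_pnear HL ht))).
  move=> w [hw [f4 E]]; have := rel w hw; rewrite -E.
  have hl : hp N L w = F4 N w ^+ (3 * size L) * l.[sJ N w].
    rewrite /l; elim: (L) => [|c l' IH]; first by rewrite hp_nil big_nil muln0 expr0 mul1r hornerC.
    rewrite hp_cons big_cons hornerM IH hornerD hornerZ hornerX hornerC [size _]/= mulnS exprD /sJ.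
    move: f4; move: (F4 N w) (F6 N w) => x y x0.
    have -> : c.1 * x ^+ 3 + c.2 * y ^+ 2 = x ^+ 3 * (c.1 + c.2 * (y ^+ 2 / x ^+ 3)) by field.
    by rewrite mulrACA.
  rewrite hl hornerN hornerM pE sE.
  have split3 (b i : nat) : (i <= b)%N -> F4 N w ^+ (3 * (b - i)) * F6 N w ^+ (2 * i) = F4 N w ^+ (3 * b) * sJ N w ^+ i.
    move=> ib; rewrite /sJ; move: f4; move: (F4 N w) (F6 N w) => x y x0.
    rewrite expr_div_n -!exprM -{2}(subnK ib) mulnDr exprD.
    by field; rewrite expf_neq0.
  rewrite (eq_bigr (fun i : 'I_a.+1 => (F4 N w ^+ (3 * n) * (f w * l.[sJ N w])) * (v 0 (lshift n.+1 i) * sJ N w ^+ i))); last first.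
    move=> i _; rewrite split3; last by have := ltn_ord i.
    have e3 : F4 N w ^+ (3 * n) = F4 N w ^+ (3 * a) * F4 N w ^+ (3 * size L).
      by rewrite -exprD -mulnDr an.
    rewrite e3; move: (F4 N w ^+ _) (F4 N w ^+ _) (sJ N w ^+ i) (v _ _) => x1 x2 x3 x4.
    by ring.
  rewrite -mulr_sumr (eq_bigr (fun i : 'I_n.+1 => F4 N w ^+ (3 * n) * (v 0 (rshift a.+1 i) * sJ N w ^+ i))); last first.
    move=> i _; rewrite split3; last by have := ltn_ord i.
    by rewrite mulrCA.
  rewrite -mulr_sumr -mulrA -mulrDr => /eqP; rewrite mulf_eq0 expf_eq0 (negbTE f4) andbF /= => /eqP h.
  by apply/eqP; rewrite -addr_eq0 mulrA h.
exists (l * p), (- s); split=> //; rewrite mulf_neq0 //; apply: contra v0 => /eqP p0.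
have hi : Hp (Complex 0 1 : R[i]) by rewrite /Hp /= ltr01.
have s0 : s = 0.
  apply/eqP/negPn/negP => s0; apply: (@pnear_false R (Complex 0 1)).
  apply: pnear_imp (pnearI (key _ hi) (poly_sJ_neq0 N0 s0 hi)) => w [].
  by rewrite p0 mulr0 horner0 mulr0 hornerN => /eqP; rewrite eq_sym oppr_eq0 => ->.
apply/eqP/rowP => u; rewrite mxE; case: (split_ordP u) => i ->.
  by have := congr1 (fun P : {poly R[i]} => P`_i) p0; rewrite coef_poly coef0 ltn_ord inord_val.
by have := congr1 (fun P : {poly R[i]} => P`_i) s0; rewrite coef_poly coef0 ltn_ord inord_val.
Qed.

End LevelOneTheorem.

(** * Lagrange interpolation over the conjugates of Lambda *)

Section Lagrange.
Variables (R : realType) (n : nat).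
Local Notation N := n.+2.
Local Notation Z := 'Z_n.+2.
Local Notation MZ := 'M[Z]_2.
Implicit Types (tau w : R[i]) (f h : R[i] -> R[i]) (g : 'M[int]_2) (x y : MZ).

Definition redm g : MZ := map_mx (intmul (1 : Z)) g.

Lemma redmM g g' : redm (g *m g') = redm g *m redm g'.
Proof. by rewrite /redm map_mxM. Qed.

Lemma redm1 : redm 1%:M = 1%:M.
Proof. by rewrite /redm map_mx1. Qed.

Lemma Zint_dvd (z : int) : (z%:~R : Z) = 0 -> (N %| z)%Z.
Proof.
by move=> h; have := Zint_mod n z; rewrite h => /eqP; rewrite eq_sym eqz_mod_dvd subr0.
Qed.

Lemma redm_Gamma g : SL2Z g -> redm g = 1%:M -> Gamma N g.
Proof.
move=> hg h; split=> // i k; apply/eqP; rewrite eqz_mod_dvd; apply: Zint_dvd.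
rewrite rmorphB /=; have := congr1 (fun A : MZ => A i k) h; rewrite !mxE => ->.
by case: (i == k); rewrite /= ?subrr.
Qed.

(** The conjugates are indexed by the image of SL_2(Z) in the matrices over Z/N, a finite set stable
    under right multiplication by reductions. Both x and -x are kept, although they give the same
    conjugate. *)
Definition in_red x := `[< exists2 g, SL2Z g & redm g = x >].
Definition lft x : 'M[int]_2 := xget 1%:M [set g | SL2Z g /\ redm g = x].

Lemma lft_SL2Z x : SL2Z (lft x).
Proof. by rewrite /lft; case: xgetP => [g _ []|_] //; exact: SL2Z1. Qed.

Lemma lft_red x : in_red x -> redm (lft x) = x.
Proof.
by move=> /asboolP[g hg E]; rewrite /lft; case: xgetP => [h _ []|/(_ g)] //; case.
Qed.

Lemma in_red1 : in_red 1%:M.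
Proof. by apply/asboolP; exists 1%:M; [exact: SL2Z1|exact: redm1]. Qed.

Lemma in_red_mul x g : SL2Z g -> in_red (x *m redm g) = in_red x.
Proof.
move=> hg; have [ha [hb hc]] := SL2ZV hg; apply/asboolP/asboolP => -[h hh E].
  exists (h *m \adj g); first exact: SL2ZM.
  by rewrite redmM E -mulmxA -redmM hb redm1 mulmx1.
by exists (h *m g); [exact: SL2ZM|rewrite redmM E].
Qed.

Lemma moebius_opp g tau : moebius (- g) tau = moebius g tau.
Proof. by rewrite /moebius !mxE !rmorphN /= !mulNr -!opprD invrN mulrNN. Qed.

Lemma SL2Z_opp g : SL2Z g -> SL2Z (- g).
Proof. by rewrite /SL2Z /= !det2 !mxE !mulrNN. Qed.

Lemma redm_opp g : redm (- g) = - redm g.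
Proof. by apply/matrixP => i k; rewrite !mxE rmorphN. Qed.

Section Conjugates.
Variable f : R[i] -> R[i].
Hypothesis fG : forall g, Gamma N g -> mero_eq (f \o moebius g) f.

Lemma conj_eq a b : SL2Z a -> SL2Z b -> redm a = redm b -> mero_eq (f \o moebius a) (f \o moebius b).
Proof.
move=> ha hb E; have [hv [e1 e2]] := SL2ZV hb.
have hab : SL2Z (a *m \adj b) by exact: SL2ZM.
have G : Gamma N (a *m \adj b) by apply: redm_Gamma => //; rewrite redmM E -redmM e1 redm1.
have /mero_eqP h := mero_eq_moebius hb (fG G); apply/mero_eqP => tau ht.
apply: pnear_imp (pnearI (pnear_Hp ht (fun w hw => hw)) (h _ ht)) => w [hw] /= <-.
by rewrite -moebiusM // -mulmxA e2 mulmx1.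
Qed.

Lemma conj_eq_opp a b : SL2Z a -> SL2Z b -> redm a = - redm b -> mero_eq (f \o moebius a) (f \o moebius b).
Proof.
move=> ha hb E; have h := conj_eq ha (SL2Z_opp hb); rewrite redm_opp in h.
have /mero_eqP h' := h E; apply/mero_eqP => tau ht; apply: pnear_imp (h' _ ht) => w /= ->.
by rewrite moebius_opp.
Qed.

Definition cj x w := f (moebius (lft x) w).

Lemma cj_moebius x g tau : in_red x -> SL2Z g -> Hp tau ->
  pnear tau (fun w => cj x (moebius g w) = cj (x *m redm g) w).
Proof.
move=> hx hg ht; have hx' : in_red (x *m redm g) by rewrite in_red_mul.
have /mero_eqP h := conj_eq (SL2ZM (lft_SL2Z x) hg) (lft_SL2Z (x *m redm g))
  (etrans (redmM _ _) (esym (etrans (lft_red hx') (congr1 (fun y => y *m redm g) (esym (lft_red hx)))))).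
apply: pnear_imp (pnearI (pnear_Hp ht (fun w hw => hw)) (h _ ht)) => w [hw] /= E.
by rewrite /cj -E moebiusM //; exact: lft_SL2Z.
Qed.

Lemma cj1 tau : Hp tau -> pnear tau (fun w => cj 1%:M w = f w).
Proof.
move=> ht; have /mero_eqP h := conj_eq (lft_SL2Z 1%:M) SL2Z1 (etrans (lft_red in_red1) (esym redm1)).
by apply: pnear_imp (h _ ht) => w /=; rewrite moebius1.
Qed.

Lemma cjN1 tau : Hp tau -> in_red (- 1%:M) -> pnear tau (fun w => cj (- 1%:M) w = f w).
Proof.
move=> ht hm; have E : redm (lft (- 1%:M)) = - redm 1%:M by rewrite redm1 lft_red.
have /mero_eqP h := conj_eq_opp (lft_SL2Z _) SL2Z1 E.
by apply: pnear_imp (h _ ht) => w /=; rewrite moebius1.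
Qed.

End Conjugates.

(** Modular functions without the invariance. Coefficients of the interpolation polynomial are built
    inside this class by field operations, and their invariance of level one is proved separately by
    permuting the conjugates. *)
Definition Cls f := (forall tau, Hp tau -> mero f tau) /\
  forall g, SL2Z g -> qlaurent N setT (f \o moebius g).

Let KT := is_subfieldT R.
Let N0 : (0 < N)%N := isT.

Lemma ClsD f h : Cls f -> Cls h -> Cls (fun w => f w + h w).
Proof.
move=> [m1 q1] [m2 q2]; split=> [tau ht|g hg]; first by apply: meroD; [exact: m1|exact: m2].
exact: (qlaurentD KT (q1 g hg) (q2 g hg)).
Qed.

Lemma ClsM f h : Cls f -> Cls h -> Cls (fun w => f w * h w).
Proof.
move=> [m1 q1] [m2 q2]; split=> [tau ht|g hg]; first by apply: meroM; [exact: m1|exact: m2].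
exact: (qlaurentM N0 KT (q1 g hg) (q2 g hg)).
Qed.

Lemma Cls_cst c : Cls (fun=> c).
Proof. by split=> [tau ht|g hg]; [exact: mero_cst|exact: qlaurent_cst]. Qed.

Lemma ClsN f : Cls f -> Cls (fun w => - f w).
Proof.
move=> h; have := ClsM (Cls_cst (-1)) h; congr Cls; apply/funext => w.
by rewrite mulN1r.
Qed.

Lemma Cls_sum (I : Type) (s : seq I) (P : pred I) (F : I -> R[i] -> R[i]) :
  (forall i, Cls (F i)) -> Cls (fun w => \sum_(i <- s | P i) F i w).
Proof.
move=> h; elim: s => [|i s IH].
  by have := Cls_cst 0; congr Cls; apply/funext => w; rewrite big_nil.
case Pi : (P i); last by move: IH; congr Cls; apply/funext => w; rewrite big_cons Pi.
by have := ClsD (h i) IH; congr Cls; apply/funext => w; rewrite big_cons Pi.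
Qed.

Lemma Cls_cj f x : modular_function N f -> Cls (cj f x).
Proof.
move=> /(modular_functionP N0)[m1 _ q1]; split=> [tau ht|g hg].
  by apply: mero_moebius; [exact: lft_SL2Z|exact: ht|apply: m1; apply: Hp_moebius => //; exact: lft_SL2Z].
apply: qlaurent_Hp (q1 _ (SL2ZM (lft_SL2Z x) hg)) => tau ht.
by rewrite /= /cj moebiusM //; exact: lft_SL2Z.
Qed.

Definition PCls (P : R[i] -> {poly R[i]}) := forall k, Cls (fun w => (P w)`_k).

Lemma PClsM P Q : PCls P -> PCls Q -> PCls (fun w => P w * Q w).
Proof.
move=> hP hQ k; have := Cls_sum (index_enum _) xpredT (fun j : 'I_k.+1 => ClsM (hP j) (hQ (k - j)%N)).
by congr Cls; apply/funext => w; rewrite coefM.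
Qed.

Lemma PCls_prod (I : Type) (s : seq I) (Q : pred I) (P : I -> R[i] -> {poly R[i]}) :
  (forall i, PCls (P i)) -> PCls (fun w => \prod_(i <- s | Q i) P i w).
Proof.
move=> h; elim: s => [|i s IH].
  move=> k; have := Cls_cst (1 : {poly R[i]})`_k; congr Cls; apply/funext => w.
  by rewrite big_nil.
case Qi : (Q i); last first.
  by move=> k; have := IH k; congr Cls; apply/funext => w; rewrite big_cons Qi.
by move=> k; have := PClsM (h i) IH k; congr Cls; apply/funext => w; rewrite big_cons Qi.
Qed.

Lemma PCls_XsubC h : Cls h -> PCls (fun w => 'X - (h w)%:P).
Proof.
move=> hh [|k].
  have := ClsN hh; congr Cls; apply/funext => w.
  by rewrite coefB coefX coefC sub0r.
have := Cls_cst ('X : {poly R[i]})`_k.+1; congr Cls; apply/funext => w.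
by rewrite coefB coefC subr0.
Qed.

Variable lam : MZ -> R[i] -> R[i].

(** The Lagrange polynomial before division by the products of differences of nodes. Factors with y
    = -x are omitted together with y = x because their nodes coincide. *)
Definition apoly (F : MZ -> R[i] -> R[i]) w : {poly R[i]} :=
  \sum_(x | in_red x) F x w *: \prod_(y | in_red y && (y != x) && (y != - x)) ('X - (lam y w)%:P).

Lemma apoly_Cls F : (forall x, Cls (F x)) -> (forall x, Cls (lam x)) -> PCls (apoly F).
Proof.
move=> hF hl k; have hp x := PCls_prod (index_enum _) (fun y => in_red y && (y != x) && (y != - x)) (fun y => PCls_XsubC (hl y)).
have := Cls_sum (index_enum _) in_red (fun x => ClsM (hF x) (hp x k)).
congr Cls; apply/funext => w; rewrite /apoly coef_sum; apply: eq_bigr => x _.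
by rewrite coefZ.
Qed.

Lemma apoly_moebius F g tau : SL2Z g -> Hp tau ->
  (forall x, in_red x -> pnear tau (fun w => F x (moebius g w) = F (x *m redm g) w)) ->
  (forall x, in_red x -> pnear tau (fun w => lam x (moebius g w) = lam (x *m redm g) w)) ->
  pnear tau (fun w => apoly F (moebius g w) = apoly F w).
Proof.
move=> hg ht hF hl.
have all_near (P : MZ -> R[i] -> Prop) : (forall x, in_red x -> pnear tau (P x)) ->
    pnear tau (fun w => forall x, in_red x -> P x w).
  move=> H; have : forall s : seq MZ, pnear tau (fun w => forall x, x \in s -> in_red x -> P x w).
    elim=> [|x s IH]; first by apply: pnear_all.
    case hx : (in_red x).
      apply: pnear_imp (pnearI (H x hx) IH) => w [h1 h2] y; rewrite inE => /predU1P[->//|ys] hy.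
      exact: h2.
    apply: pnear_imp IH => w h2 y; rewrite inE => /predU1P[->|ys] hy; first by rewrite hx in hy.
    exact: h2.
  by move=> /(_ (enum MZ)); apply: pnear_imp => w h x hx; apply: h => //; rewrite mem_enum.
apply: pnear_imp (pnearI (all_near _ hF) (all_near _ hl)) => w [eF el].
have [ha [hb hc]] := SL2ZV hg.
have bij : bijective (fun x : MZ => x *m redm g).
  by exists (fun x => x *m redm (\adj g)) => x; rewrite -mulmxA -redmM ?hb ?hc redm1 mulmx1.
have inj := bij_inj bij.
rewrite /apoly [RHS](reindex (fun x : MZ => x *m redm g)) /=; last exact: onW_bij.
apply: eq_big => [x|x hx]; first by rewrite in_red_mul.
rewrite eF //; congr (_ *: _).
rewrite [RHS](reindex (fun x : MZ => x *m redm g)) /=; last exact: onW_bij.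
apply: eq_big => [y|y /andP[/andP[hy _] _]].
  by rewrite in_red_mul // (inj_eq inj) -mulNmx (inj_eq inj).
by rewrite el.
Qed.

(** At the node of the identity only x = 1 and x = -1 survive. The remaining product does not depend
    on F, so it cancels between [cj f] and the constant family 1. *)
Lemma apoly_eval F w : in_red 1%:M ->
  (apoly F w).[lam 1%:M w] = (\sum_(x | in_red x && ((x == 1%:M) || (x == - 1%:M))) F x w) *
    \prod_(y | in_red y && (y != 1%:M) && (y != - 1%:M)) (lam 1%:M w - lam y w).
Proof.
move=> h1; rewrite /apoly horner_sum (bigID (fun x => (x == 1%:M) || (x == - 1%:M))) /=.
rewrite [X in _ + X]big1 ?addr0; last first.
  move=> x /andP[hx]; rewrite negb_or => /andP[x1 x2].
  rewrite hornerZ horner_prod (bigD1 1%:M) /=; last first.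
    by rewrite h1 eq_sym x1 -eqr_oppLR eq_sym.
  by rewrite hornerXsubC subrr mul0r mulr0.
rewrite mulr_suml; apply: eq_bigr => x /andP[hx h].
rewrite hornerZ horner_prod; congr (_ * _).
apply: eq_big => [y|y _]; last by rewrite hornerXsubC.
by case/orP: h => /eqP -> //; rewrite opprK andbAC.
Qed.

Lemma apoly_size F w : (size (apoly F w) <= #|{: MZ}|.+1)%N.
Proof.
apply: (leq_trans (size_sum _ _ _)); apply/bigmax_leqP => x _.
apply: (leq_trans (size_scale_leq _ _)); rewrite -big_filter size_prod_XsubC ltnS.
by rewrite size_filter (leq_trans (count_size _ _)) // /index_enum -enumT -cardT.
Qed.

End Lagrange.

(** * Rational expression in Lambda and E6^2/E4^3 over the complex numbers *)

Section OverC.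
Variables (R : realType) (n : nat).
Local Notation N := n.+2.
Local Notation Z := 'Z_n.+2.
Local Notation MZ := 'M[Z]_2.
Implicit Types (tau w : R[i]) (f h : R[i] -> R[i]) (g : 'M[int]_2).

Lemma common_denominator (h : nat -> R[i] -> R[i]) d :
  (forall k, exists P Q : {poly R[i]}, P != 0 /\
     forall tau, Hp tau -> pnear tau (fun w => h k w * P.[sJ N w] = Q.[sJ N w])) ->
  exists P (U : nat -> {poly R[i]}), P != 0 /\
    forall k tau, (k < d)%N -> Hp tau -> pnear tau (fun w => h k w * P.[sJ N w] = (U k).[sJ N w]).
Proof.
move=> H; elim: d => [|d [P [U [P0 HU]]]]; first by exists 1, (fun=> 0); rewrite oner_neq0.
have [P' [Q [P0' HQ]]] := H d.
exists (P * P'), (fun k => if k == d then P * Q else U k * P'); split; first by rewrite mulf_neq0.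
move=> k tau; rewrite ltnS leq_eqVlt; case: eqP => [->|_] /= kd ht.
  by apply: pnear_imp (HQ tau ht) => w E; rewrite !hornerM -E; ring.
by apply: pnear_imp (HU k tau kd ht) => w E; rewrite !hornerM -E; ring.
Qed.

Variables (Q1 Q2 : Z * Z).
Hypothesis N6 : N != 6%N.
Hypothesis Qu : unitdet Q1 Q2.
Variable f : R[i] -> R[i].
Hypothesis fmod : modular_function N f.
Local Notation L := (@LamT R n Q1 Q2).
Local Notation cj := (@cj R n).

Lemma Lmod : modular_function N L.
Proof. by have [] := LamT_modular R Qu. Qed.

Lemma level_one_coef (F : MZ -> R[i] -> R[i]) k : (forall x, Cls n (F x)) ->
  (forall g tau x, SL2Z g -> Hp tau -> in_red x -> pnear tau (fun w => F x (moebius g w) = F (x *m redm n g) w)) ->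
  exists P Q : {poly R[i]}, P != 0 /\
    forall tau, Hp tau -> pnear tau (fun w => (apoly (cj L) F w)`_k * P.[sJ N w] = Q.[sJ N w]).
Proof.
move=> hF Finv; have hl x : Cls n (cj L x) by apply: Cls_cj; exact: Lmod.
have [m q] := apoly_Cls hF hl k.
have LG g : Gamma N g -> mero_eq (L \o moebius g) L.
  by have /(modular_functionP (isT : (0 < N)%N))[_ h _] := Lmod; exact: h.
have inv g : SL2Z g -> mero_eq ((fun w => (apoly (cj L) F w)`_k) \o moebius g) (fun w => (apoly (cj L) F w)`_k).
  move=> hg; apply/mero_eqP => tau ht.
  apply: pnear_imp (apoly_moebius hg ht (fun x hx => Finv g tau x hg ht hx) (fun x hx => cj_moebius LG hx hg ht)).
  by move=> w /= ->.
have q1 : qlaurent N setT (fun w => (apoly (cj L) F w)`_k).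
  by apply: (qlaurent_Hp _ (q _ SL2Z1)) => tau ht; rewrite /= moebius1.
exact: (@level_one_rational R N isT _ m inv q1).
Qed.

(** If the difference vanished near one point it would vanish everywhere by [mero_identity]; then
    Lambda would be fixed by the lift of x, and [LamT_injective] would give x = 1 or x = -1. *)
Lemma Lam_neq x tau : in_red x -> x != 1%:M -> x != - 1%:M -> Hp tau ->
  pnear tau (fun w => cj L 1%:M w - cj L x w != 0).
Proof.
move=> hx x1 xm ht; have [m1 _] := Cls_cj 1%:M Lmod; have [mx _] := Cls_cj x Lmod.
have mm t : Hp t -> mero (fun w => cj L 1%:M w - cj L x w) t by move=> h; apply: meroB; [exact: m1|exact: mx].
have [z|//] := mero_dich (mm _ ht); exfalso.
have LG g : Gamma N g -> mero_eq (L \o moebius g) L.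
  by have /(modular_functionP (isT : (0 < N)%N))[_ h _] := Lmod; exact: h.
have E : mero_eq (L \o moebius (lft x)) L.
  apply/mero_eqP => t hT; apply: pnear_imp (pnearI (cj1 LG hT) (mero_identity mm ht z hT)) => w [<- e].
  by apply/eqP; rewrite eq_sym -subr_eq0 e.
have [eps he H] := LamT_injective N6 Qu (lft_SL2Z x) E.
have EX : x = eps *: 1%:M.
  by rewrite -[LHS](lft_red hx); apply/matrixP => i k; rewrite !mxE H !mxE; case: (i == k).
by case: he EX x1 xm => -> ->; rewrite ?scale1r ?scaleN1r ?eqxx.
Qed.

(** f is the quotient of the values at Lambda of the two polynomials [apoly (cj L) (cj f)] and
    [apoly (cj L) one]. Their coefficients have level one, hence are rational in [sJ], and common
    denominators turn them into polynomials. *)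
Theorem rational_expression : exists d (U V : nat -> {poly R[i]}), forall tau, Hp tau ->
  pnear tau (fun w => f w * \sum_(k < d) (V k).[sJ N w] * L w ^+ k = \sum_(k < d) (U k).[sJ N w] * L w ^+ k) /\
  pnear tau (fun w => \sum_(k < d) (V k).[sJ N w] * L w ^+ k != 0).
Proof.
have fG g : Gamma N g -> mero_eq (f \o moebius g) f.
  by have /(modular_functionP (isT : (0 < N)%N))[_ h _] := fmod; exact: h.
have LG g : Gamma N g -> mero_eq (L \o moebius g) L.
  by have /(modular_functionP (isT : (0 < N)%N))[_ h _] := Lmod; exact: h.
pose d := #|{: MZ}|.+1.
pose one (x : MZ) (w : R[i]) : R[i] := 1.
have [P [U [P0 HU]]] := @common_denominator (fun k w => (apoly (cj L) (cj f) w)`_k) d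
  (fun k => level_one_coef k (fun x => Cls_cj x fmod) (fun g tau x hg ht hx => cj_moebius fG hx hg ht)).
have [P' [V [P0' HV]]] := @common_denominator (fun k w => (apoly (cj L) one w)`_k) d
  (fun k => level_one_coef k (fun x => Cls_cst n 1) (fun g tau x hg ht hx => pnear_all tau (fun w => erefl))).
exists d, (fun k => U k * P'), (fun k => V k * P) => tau ht.
have all_near (H : nat -> R[i] -> Prop) m : (forall k, (k < m)%N -> pnear tau (H k)) ->
    pnear tau (fun w => forall k, (k < m)%N -> H k w).
  elim: m => [|m IH] h; first by apply: pnear_all.
  apply: pnear_imp (pnearI (h m (ltnSn m)) (IH (fun k km => h k (ltnW km)))) => w [h1 h2] k.
  by rewrite ltnS leq_eqVlt => /orP[/eqP ->|/h2].
have nU := all_near _ _ (fun k kd => HU k tau kd ht); have nV := all_near _ _ (fun k kd => HV k tau kd ht).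
have evalE (F : MZ -> R[i] -> R[i]) (S : {poly R[i]}) (T : nat -> {poly R[i]}) (C : {poly R[i]}) w :
    (forall k, (k < d)%N -> (apoly (cj L) F w)`_k * S.[sJ N w] = (T k).[sJ N w]) ->
    cj L 1%:M w = L w ->
    \sum_(k < d) (T k * C).[sJ N w] * L w ^+ k = (apoly (cj L) F w).[cj L 1%:M w] * S.[sJ N w] * C.[sJ N w].
  move=> h e; rewrite e (horner_coef_wide _ (apoly_size _ F w)) !mulr_suml; apply: eq_bigr => k _.
  by rewrite hornerM -h //; ring.
pose D w := \prod_(y | in_red y && (y != 1%:M) && (y != - 1%:M)) (cj L 1%:M w - cj L y w).
have nD : pnear tau (fun w => D w != 0).
  have : forall s : seq MZ, pnear tau (fun w => \prod_(y <- s | in_red y && (y != 1%:M) && (y != - 1%:M)) (cj L 1%:M w - cj L y w) != 0).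
    elim=> [|y s IH]; first by apply: pnear_all => w; rewrite big_nil oner_neq0.
    case h : (in_red y && (y != 1%:M) && (y != - 1%:M)); last first.
      by apply: pnear_imp IH => w; rewrite big_cons h.
    have /andP[/andP[hy y1] ym] := h.
    by apply: pnear_imp (pnearI (Lam_neq hy y1 ym ht) IH) => w [h1 h2]; rewrite big_cons h mulf_neq0.
  exact.
(* The number of indices among 1 and -1, which coincide at level 2; it multiplies both numerator and
   denominator. *)
pose c := #|[pred x : MZ | in_red x && ((x == 1%:M) || (x == - 1%:M))]|.
have c0 : (c%:R : R[i]) != 0.
  by rewrite pnatr_eq0 -lt0n; apply/card_gt0P; exists 1%:M; rewrite inE /= in_red1 eqxx.
have nF : pnear tau (fun w => \sum_(x | in_red x && ((x == 1%:M) || (x == - 1%:M))) cj f x w = c%:R * f w).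
  case hm : (in_red (- 1%:M : MZ)).
    apply: pnear_imp (pnearI (cj1 fG ht) (cjN1 fG ht hm)) => w [e1 e2].
    rewrite (eq_bigr (fun=> f w)); last by move=> x /andP[_ /orP[] /eqP ->].
    by rewrite sumr_const mulr_natl.
  apply: pnear_imp (cj1 fG ht) => w e1.
  rewrite (eq_bigr (fun=> f w)); last first.
    by move=> x /andP[hx /orP[] /eqP E]; rewrite E // in hx *; rewrite hm in hx.
  by rewrite sumr_const mulr_natl.
have one1 w : \sum_(x | in_red x && ((x == 1%:M) || (x == - 1%:M))) one x w = c%:R :> R[i].
  by rewrite /one sumr_const.
split.
  apply: pnear_imp (pnearI (pnearI nU nV) (pnearI nF (cj1 LG ht))) => w [[hU hV] [eF eL]].
  rewrite (evalE one P' V P w hV eL) (evalE (cj f) P U P' w hU eL).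
  by rewrite !apoly_eval ?in_red1 // one1 eF; ring.
have N0 : (0 < N)%N by [].
have nP := poly_sJ_neq0 N0 P0 ht; have nP' := poly_sJ_neq0 N0 P0' ht.
apply: (pnear_imp _ (pnearI (pnearI nV (cj1 LG ht)) (pnearI nD (pnearI nP nP')))).
move=> w [[hV eL] [d0 [p0 p0']]].
by rewrite (evalE one P' V P w hV eL) apoly_eval ?in_red1 // one1 !mulf_neq0.
Qed.

End OverC.

(** * Descent of the coefficients to Q(zeta) *)

Section SpanBasis.
Variables (R : realType) (K : set R[i]).
Hypothesis KF : is_subfield K.

Definition indep r (al : nat -> R[i]) := forall z : nat -> R[i], (forall t, K (z t)) ->
  \sum_(t < r) z t * al t = 0 -> forall t, (t < r)%N -> z t = 0.

(** The list is scanned and an element is kept exactly when it is not in the K-span of those kept so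
    far. *)
Lemma span_basis (s : seq R[i]) : exists r al, indep r al /\
  forall x, x \in s -> exists2 y : nat -> R[i], (forall t, K (y t)) & x = \sum_(t < r) y t * al t.
Proof.
elim: s => [|x s [r [al [H2 H1]]]]; first by exists 0%N, (fun=> 0); split.
have [[y Ky E]|nx] := pselect (exists2 y : nat -> R[i], (forall t, K (y t)) & x = \sum_(t < r) y t * al t).
  by exists r, al; split=> // x'; rewrite inE => /predU1P[->|/H1 //]; exists y.
exists r.+1, (fun t => if t == r then x else al t).
have al' (z : nat -> R[i]) : \sum_(t < r.+1) z t * (if (t : nat) == r then x else al t) =
    \sum_(t < r) z t * al t + z r * x.
  by rewrite big_ord_recr /= eqxx; congr (_ + _); apply: eq_bigr => t _; rewrite ltn_eqF.
split.
  move=> z Kz; rewrite al' => e; have zr : z r = 0.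
    apply/eqP/negPn/negP => z0; apply: nx; exists (fun t => - z t / z r).
      by move=> t; apply: Kdiv => //; exact: KN.
    apply: (mulfI z0); rewrite mulr_sumr (eq_bigr (fun t : 'I_r => - (z t * al t))); last first.
      by move=> t _; field.
    by rewrite sumrN; apply/eqP; rewrite -addr_eq0 addrC e.
  move=> t; rewrite ltnS leq_eqVlt => /predU1P[->//|]; apply: H2 => //.
  by rewrite zr mul0r addr0 in e.
move=> x'; rewrite inE => /predU1P[->|/H1[y Ky E]].
  exists (fun t => (t == r)%:R); first by move=> t; exact: Knat.
  apply: (etrans _ (esym (al' (fun t => (t == r)%:R)))).
  by rewrite eqxx mul1r big1 ?add0r // => t _; rewrite ltn_eqF // mul0r.
exists (fun t => if t == r then 0 else y t); first by move=> t; case: ifP => // _; exact: K0.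
apply: (etrans _ (esym (al' (fun t => if t == r then 0 else y t)))).
by rewrite eqxx mul0r addr0 E; apply: eq_bigr => t _; rewrite ltn_eqF.
Qed.

End SpanBasis.

Section Descent.
Variable R : realType.
Implicit Types (tau w q : R[i]) (f : R[i] -> R[i]).

Lemma tay_eq0 (F : R[i] -> R[i]) : holo_at F 0 -> (forall i, tay F 0 i = 0) -> near_eq 0 F (fun=> 0).
Proof.
move=> hF F0; have [[r r0 Hr]|[k [h [hh h0 E _]]]] := zero_order hF.
  by exists r => // w /Hr.
exfalso; pose T := tayf F 0 k.+1; have hT : holo_at T 0 := holo_at_tayf k.+1 hF.
have hG : holo_at (fun q => h q - q * T q) 0.
  by apply: holo_atB => //; apply: holo_atM => //; exact: holo_at_id.
have G0 : h 0 - 0 * T 0 != 0 by rewrite mul0r subr0.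
have [r r0 Hr] := ccont_neq0 (holo_at_cont hG) G0.
have [q [q0 qr _]] := pnear_ex (@pnear_all R 0 (fun=> True) (fun=> I)) r0.
have := Hr q qr; have := E q; rewrite (order_factor (m := k.+1) (fun i _ => F0 i)) -/T subr0 exprS.
have qk : q ^+ k != 0 by rewrite expf_neq0.
move=> e /negP; apply; rewrite subr_eq0; apply/eqP; apply: (mulfI qk).
by rewrite -e; ring.
Qed.

Lemma pnear_forall (I : finType) (P : I -> R[i] -> Prop) tau : (forall i, pnear tau (P i)) ->
  pnear tau (fun w => forall i, P i w).
Proof.
move=> H; have : forall s : seq I, pnear tau (fun w => forall i, i \in s -> P i w).
  elim=> [|i s IH]; first by apply: pnear_all.
  by apply: pnear_imp (pnearI (H i) IH) => w [h1 h2] l; rewrite inE => /predU1P[->|/h2].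
by move=> /(_ (enum I)); apply: pnear_imp => w h i; apply: h; rewrite mem_enum.
Qed.

(** A half plane above height Y is a translate of the upper half plane, so [Hp_open] provides the
    neighbourhood. *)
Lemma pnear_Im (Y : R) tau (P : R[i] -> Prop) : Y < complex.Im tau ->
  (forall w, Y < complex.Im w -> P w) -> pnear tau P.
Proof.
move=> hY h; have ht : Hp (tau + Complex 0 (- Y)) by rewrite /Hp ImD /=; lra.
have [r r0 Hr] := Hp_open ht; apply: (pnear_ball r0) => w hw; apply: h.
have := Hr (w + Complex 0 (- Y)); rewrite (_ : w + _ - _ = w - tau); last by ring.
by move=> /(_ hw); rewrite /Hp ImD /=; lra.
Qed.

Variables (n : nat) (K : set R[i]).
Local Notation N := n.+2.
Hypothesis KF : is_subfield K.

Lemma common_expansion (I : finType) (ph : I -> R[i] -> R[i]) : (forall i, qlaurent N K (ph i)) ->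
  exists m (H : I -> R[i] -> R[i]), (forall i, kser K (H i)) /\ exists Y : R, forall i tau,
    Y < complex.Im tau -> pnear tau (fun w => ph i w * qN N w ^+ m = H i (qN N w)).
Proof.
move=> hq; have /choice[p Hp'] : forall i, exists p : nat * (R[i] -> R[i]) * R, kser K p.1.2 /\
    forall tau, p.2 < complex.Im tau -> pnear tau (fun w => ph i w = p.1.2 (qN N w) / qN N w ^+ p.1.1).
  by move=> i; have [m [H [hH [Y Y0 HY]]]] := hq i; exists (m, H, Y).
pose m := (\sum_i (p i).1.1)%N; have lm i : ((p i).1.1 <= m)%N by rewrite /m (bigD1 i) //= leq_addr.
exists m, (fun i q => (p i).1.2 q * q ^+ (m - (p i).1.1)); split.
  by move=> i; apply: kserM => //; [have [] := Hp' i|apply: kserX => //; exact: kser_id].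
exists (\sum_i `|(p i).2|) => i tau hY; have [_ h] := Hp' i.
have hi : (p i).2 < complex.Im tau.
  apply: le_lt_trans hY; apply: (le_trans (ler_norm _)).
  by rewrite (bigD1 i) //= lerDl sumr_ge0.
apply: pnear_imp (h _ hi) => w ->; rewrite -{1}(subnK (lm i)) exprD.
have q0 : qN N w ^+ (p i).1.1 != 0 by rewrite expf_neq0 // qN_neq0.
by rewrite -mulrA; congr (_ * _); rewrite mulrCA mulVf // mulr1.
Qed.

(* Comparing Taylor coefficients in q turns the relation into one between the [al t]
   with coefficients in [K]. *)
Lemma descent (I : finType) (ph : I -> R[i] -> R[i]) r al (y : I -> nat -> R[i]) :
  (forall i tau, Hp tau -> mero (ph i) tau) -> (forall i, qlaurent N K (ph i)) ->
  indep K r al -> (forall i t, K (y i t)) ->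
  (forall tau, Hp tau -> pnear tau (fun w => \sum_i (\sum_(t < r) y i t * al t) * ph i w = 0)) ->
  forall t tau, (t < r)%N -> Hp tau -> pnear tau (fun w => \sum_i y i t * ph i w = 0).
Proof.
move=> phm phq ind Ky rel t tau tr ht.
have [m [H [hH [Y HY]]]] := common_expansion phq.
have N0 : (0 < N)%N by [].
have holoH i : holo_at (H i) 0 by have [] := hH i.
have HH tau' : Y < complex.Im tau' -> pnear tau' (fun w => forall i, ph i w * qN N w ^+ m = H i (qN N w)).
  by move=> hY; apply: pnear_forall => i; exact: HY.
pose x i := \sum_(t < r) y i t * al t.
have sumE (c : I -> R[i]) w : (forall i, ph i w * qN N w ^+ m = H i (qN N w)) ->
    \sum_i c i * H i (qN N w) = (\sum_i c i * ph i w) * qN N w ^+ m.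
  by move=> h; rewrite mulr_suml; apply: eq_bigr => i _; rewrite -h mulrA.
have hx k := tay_sum (index_enum I) x k holoH.
have x0 : near_eq 0 (fun q => \sum_i x i * H i q) (fun=> 0).
  have [hX _] := hx 0%N; have [[r' r0 Hr]|[k [h [hh h0 E _]]]] := zero_order hX.
    by exists r' => // w /Hr.
  exfalso; have [Y' H'] := neq0_at_cusp N0 hh h0.
  pose Y2 := Num.max 0 (Num.max Y Y').
  have h1 : Y2 < complex.Im (Complex 0 (Y2 + 1) : R[i]) by rewrite /=; lra.
  have [a [b c]] : 0 <= Y2 /\ Y <= Y2 /\ Y' <= Y2 by rewrite /Y2 !le_max !lexx !orbT.
  have hp1 : Hp (Complex 0 (Y2 + 1) : R[i]) by exact: le_lt_trans a h1.
  have hw : pnear (Complex 0 (Y2 + 1)) (fun w => h (qN N w) != 0).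
    by apply: (pnear_Im (le_lt_trans c h1)) => w; exact: H'.
  apply: (@pnear_false R (Complex 0 (Y2 + 1))).
  apply: pnear_imp (pnearI hw (pnearI (HH _ (le_lt_trans b h1)) (rel _ hp1))) => w [w0 [e1 e2]].
  have := E (qN N w); rewrite (sumE x w e1) e2 mul0r subr0 => /esym/eqP.
  by rewrite mulf_eq0 expf_eq0 (negbTE (qN_neq0 _ _)) andbF (negbTE w0).
have yt k : forall t, (t < r)%N -> \sum_i y i t * tay (H i) 0 k = 0.
  apply: (ind (fun t => \sum_i y i t * tay (H i) 0 k)).
    move=> t'; elim: (index_enum I) => [|i s IH]; first by rewrite big_nil; exact: K0.
    by rewrite big_cons; apply: KD => //; apply: KM => //; have [] := hH i.
  have [_ e] := hx k; rewrite (near_eq_tay _ x0) tay0 in e; rewrite [RHS]e.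
  under eq_bigr do rewrite mulr_suml.
  rewrite exchange_big /=; apply: eq_bigr => i _; rewrite /x mulr_suml.
  by apply: eq_bigr => t' _; rewrite mulrAC.
have hy k := tay_sum (index_enum I) (fun i => y i t) k holoH.
have [r' r0 Hr] : near_eq 0 (fun q => \sum_i y i t * H i q) (fun=> 0).
  apply: tay_eq0; first by have [] := hy 0%N.
  by move=> k; have [_ e] := hy k; apply: (etrans e); exact: yt.
have [Y' Y0 H'] := qN_small N0 r0.
pose Y2 := Num.max Y Y'.
have h1 : Y2 < complex.Im (Complex 0 (Y2 + 1) : R[i]) by rewrite /=; lra.
have [b c] : Y <= Y2 /\ Y' <= Y2 by rewrite /Y2 !le_max !lexx !orbT.
have hp1 : Hp (Complex 0 (Y2 + 1) : R[i]) by exact: lt_trans Y0 (le_lt_trans c h1).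
have mm t' : Hp t' -> mero (fun w => \sum_i y i t * ph i w) t'.
  by move=> h; apply: mero_sum => i _; apply: meroM; [exact: mero_cst|exact: phm].
apply: (mero_identity mm hp1 _ ht).
have near0 : pnear (Complex 0 (Y2 + 1)) (fun w => \sum_i y i t * H i (qN N w) = 0).
  by apply: (pnear_Im (le_lt_trans c h1)) => w hw; apply: Hr; rewrite subr0; exact: H'.
apply: pnear_imp (pnearI near0 (HH _ (le_lt_trans b h1))) => w [e1 e2].
rewrite (sumE _ w e2) in e1; move/eqP: e1.
by rewrite mulf_eq0 expf_eq0 (negbTE (qN_neq0 _ _)) andbF orbF => /eqP.
Qed.

End Descent.

Section SubfieldClosure.
Variables (R : realType) (F : set (R[i] -> R[i])).
Hypothesis FF : mero_subfield F.
Implicit Types f g : R[i] -> R[i].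

Lemma mfB f g : F f -> F g -> F (fun w => f w - g w). Proof. by have [_ _ _ h _] := FF; exact: h. Qed.
Lemma mf_div f g : F f -> F g -> F (fun w => f w / g w). Proof. by have [_ _ _ _ h] := FF; exact: h. Qed.
Lemma mf1 : F (fun=> 1). Proof. by have [_ _ h _ _] := FF. Qed.
Lemma mf0 : F (fun=> 0).
Proof. by have := mfB mf1 mf1; congr F; apply/funext => w; rewrite subrr. Qed.
Lemma mfN f : F f -> F (fun w => - f w).
Proof. by move=> h; have := mfB mf0 h; congr F; apply/funext => w; rewrite sub0r. Qed.
Lemma mfD f g : F f -> F g -> F (fun w => f w + g w).
Proof. by move=> hf hg; have := mfB hf (mfN hg); congr F; apply/funext => w; rewrite opprK. Qed.
Lemma mfM f g : F f -> F g -> F (fun w => f w * g w).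
Proof.
move=> hf hg; have := mf_div hf (mf_div mf1 hg); congr F; apply/funext => w.
by rewrite div1r invrK.
Qed.
Lemma mfX f k : F f -> F (fun w => f w ^+ k).
Proof.
move=> hf; elim: k => [|k IH]; first by have := mf1; congr F; apply/funext => w; rewrite expr0.
by have := mfM hf IH; congr F; apply/funext => w; rewrite exprS.
Qed.
Lemma mf_sum (I : Type) (s : seq I) (G : I -> R[i] -> R[i]) : (forall i, F (G i)) ->
  F (fun w => \sum_(i <- s) G i w).
Proof.
move=> h; elim: s => [|i s IH]; first by have := mf0; congr F; apply/funext => w; rewrite big_nil.
by have := mfD (h i) IH; congr F; apply/funext => w; rewrite big_cons.
Qed.
Lemma mf_mero_eq f g : mero_eq f g -> F f -> F g. Proof. by have [_ h _ _ _] := FF; exact: h. Qed.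

End SubfieldClosure.

(** * The modular invariant *)

Section JInvariant.
Variables (R : realType) (n : nat).
Local Notation N := n.+2.
Let N0 : (0 < N)%N := isT.
Implicit Types (tau w : R[i]).

Lemma Delta_neq0 tau : Hp tau -> pnear tau (fun w => F4 N w ^+ 3 - F6 N w ^+ 2 != 0).
Proof.
apply: (nonzero_at_infinity (f := fun w => F4 N w ^+ 3 - F6 N w ^+ 2)).
  move=> t ht; apply: holo_mero; apply: holo_atB; apply: holo_atX.
    exact: (F4_holo N0 ht).
  exact: (F6_holo N0 ht).
have [G [hG G0 E]] := Delta_lead R N0; have [Y HY] := neq0_at_cusp N0 hG G0.
exists (Num.max 0 Y) => t; rewrite gt_max => /andP[t0 tY].
have e := E _ (qN_lt1 N0 t0); rewrite -/(F4 N t) -/(F6 N t) in e; rewrite e.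
by rewrite mulf_neq0 ?HY // expf_neq0 // qN_neq0.
Qed.

Lemma sJ_j : mero_eq (fun w => 1 - 12%:R ^+ 3 / j_invariant w) (sJ N : R[i] -> R[i]).
Proof.
apply/mero_eqP => tau ht.
apply: pnear_imp (pnearI (pnear_Hp ht (fun w hw => hw)) (pnearI (F4_neq0 N0 ht) (Delta_neq0 ht))).
move=> w [hw [f4 d]]; rewrite (j_invariantE N0 hw) -/(F4 N w) -/(F6 N w) /sJ.
move: f4 d; move: (F4 N w) (F6 N w) => x y x0 d0.
have c0 : (12 : R[i]) != 0 by rewrite pnatr_eq0.
move: c0; move: (12 : R[i]) => c c0.
by field; rewrite x0 c0 d0.
Qed.

Variable K : set R[i].
Hypothesis KF : is_subfield K.

Lemma sJ_qlaurent : qlaurent N K (sJ N).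
Proof.
have h4 := E4q_kser N0 KF; have h6 := E6q_kser N0 KF.
have k4 := kserX KF 3 h4; have k6 := kserX KF 2 h6.
have e0 : E4q N (0 : R[i]) ^+ 3 != 0 by rewrite (E4q0 R N0) expr1n oner_neq0.
exact: (qlaurent_kser n (kserV KF k6 k4 e0)).
Qed.

Lemma j_qlaurent : qlaurent N K (j_invariant : R[i] -> R[i]).
Proof.
have h4 := E4q_kser N0 KF; have h6 := E6q_kser N0 KF.
have k4 := kserX KF 3 h4; have k6 := kserX KF 2 h6.
have kc : kser K (fun=> 12%:R ^+ 3) by apply: kser_cst => //; apply: KX => //; exact: Knat.
have q1 := qlaurent_kser n (kserM KF kc k4).
have q2 := qlaurent_kser n (kserB KF k4 k6).
by apply: (qlaurent_Hp _ (qlaurentV N0 KF q1 q2)) => tau ht; rewrite (j_invariantE N0 ht).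
Qed.

Lemma j_moebius g tau : SL2Z g -> Hp tau -> j_invariant (moebius g tau) = j_invariant tau.
Proof.
move=> hg ht; have hm := Hp_moebius hg ht; have d0 := mden_neq0 hg ht.
have e4 := F4_moebius N0 hg ht; have e6 := F6_moebius N0 hg ht.
rewrite (j_invariantE N0 hm) (j_invariantE N0 ht) -!/(F4 N _) -!/(F6 N _) e4 e6.
move: d0; move: (mden g tau) (F4 N tau) (F6 N tau) => d x y d0.
have -> : (d ^+ 4 * x) ^+ 3 - (d ^+ 6 * y) ^+ 2 = d ^+ 12 * (x ^+ 3 - y ^+ 2) by ring.
have -> : 12 ^+ 3 * (d ^+ 4 * x) ^+ 3 = d ^+ 12 * (12 ^+ 3 * x ^+ 3).
  by move: (12 : R[i]) => c; ring.
by rewrite -mulf_div divff ?mul1r // expf_neq0.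
Qed.

Lemma j_mero tau : Hp tau -> mero j_invariant tau.
Proof.
move=> ht; have h4 := holo_atX 3 (F4_holo N0 ht); have h6 := holo_atX 2 (F6_holo N0 ht).
have := mero_div (holo_mero (holo_atM (holo_at_cst (12%:R ^+ 3) tau) h4)) (holo_mero (holo_atB h4 h6)).
by apply: mero_pnear; apply: (pnear_Hp ht) => w hw; rewrite (j_invariantE N0 hw).
Qed.

End JInvariant.

Lemma j_modular (R : realType) n (K : set R[i]) : is_subfield K ->
  modular_function_over n.+2 K (j_invariant : R[i] -> R[i]).
Proof.
move=> KF; have N0 : (0 < n.+2)%N by [].
split; last by apply/(fourierP N0); exact: j_qlaurent.
apply/(modular_functionP N0); split=> [tau|g hg|g hg]; first exact: j_mero.
  apply/mero_eqP => tau ht; apply: (pnear_Hp ht) => w hw.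
  by rewrite /= j_moebius //; exact: SL2Z_Gamma hg.
apply: (qlaurent_Hp _ (qlaurentW (j_qlaurent n KF))) => tau ht.
by rewrite /= j_moebius.
Qed.

(** The relation over the complex numbers is expanded in a basis [al] of the K-span of its
    coefficients, for K = Q(zeta). Each component is a relation f A + B = 0 with A and B in F, and
    at least one A is nonzero because together they make up the nonzero denominator. *)
Theorem modular_generated (R : realType) n (Q1 Q2 : 'Z_n.+2 * 'Z_n.+2) (F : set (R[i] -> R[i])) f :
  n.+2 != 6%N -> unitdet Q1 Q2 -> mero_subfield F ->
  (forall c, Qzeta R n.+2 c -> F (fun=> c)) -> F (LamT Q1 Q2) -> F j_invariant ->
  modular_function_over n.+2 (Qzeta R n.+2) f -> F f.
Proof.
move=> N6 Qu FF Fc FL Fj [fm fe]; set N := n.+2; have N0 : (0 < N)%N by [].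
have KF : is_subfield (Qzeta R N) by exact: Qzeta_subfield.
have fq : qlaurent N (Qzeta R N) f by apply/(fourierP N0).
have Fs : F (sJ N).
  apply: (mf_mero_eq FF (@sJ_j R n)); apply: (mfB FF (mf1 FF)); apply: (mf_div FF _ Fj).
  exact: (Fc _ (KX KF 3 (Knat KF 12))).
have fmer tau : Hp tau -> mero f tau by have /(modular_functionP N0)[h _ _] := fm; exact: h.
have [d [U [V rat]]] := rational_expression N6 Qu fm.
set L := LamT Q1 Q2 in rat FL.
pose D := (\sum_(k < d) (size (U k) + size (V k)))%N.
have sD k : (k < d)%N -> (size (U k) <= D)%N /\ (size (V k) <= D)%N.
  move=> kd; have : (size (U k) + size (V k) <= D)%N by rewrite /D (bigD1 (Ordinal kd)) //= leq_addr.
  by move=> h; split; apply: leq_trans h; rewrite ?leq_addr ?leq_addl.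
pose M (p : 'I_d * 'I_D) w : R[i] := L w ^+ p.1 * sJ N w ^+ p.2.
(* The left summand indexes the multiples of f by monomials and the right one the monomials
   themselves; [x] below collects the coefficients, with a sign on the numerator. *)
pose ph (i : 'I_d * 'I_D + 'I_d * 'I_D) w : R[i] :=
  match i with inl p => f w * M p w | inr p => M p w end.
pose x (i : 'I_d * 'I_D + 'I_d * 'I_D) : R[i] :=
  match i with inl p => (V p.1)`_p.2 | inr p => - (U p.1)`_p.2 end.
have MF p : F (M p) by apply: (mfM FF); apply: (mfX FF).
have Lmer tau : Hp tau -> mero L tau by exact: LamT_mero.
have Mm p tau : Hp tau -> mero (M p) tau.
  by move=> ht; have [h _ _ _ _] := FF; apply/meromorphic_atP; apply: h (MF p) _ ht.
have Lq : qlaurent N (Qzeta R N) L by exact: LamT_qlaurent.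
have sq : qlaurent N (Qzeta R N) (sJ N) by exact: sJ_qlaurent.
have Xq (g : R[i] -> R[i]) k : qlaurent N (Qzeta R N) g -> qlaurent N (Qzeta R N) (fun w => g w ^+ k).
  move=> gq; elim: k => [|k IH].
    apply: (@qlaurent_Hp R n _ (fun=> 1) (fun w => g w ^+ 0)) => [w _|]; first by rewrite expr0.
    by apply: qlaurent_cst => //; exact: K1.
  apply: (@qlaurent_Hp R n _ (fun w => g w * g w ^+ k) (fun w => g w ^+ k.+1)) => [w _|].
    by rewrite exprS.
  exact: (qlaurentM N0 KF gq IH).
have Mq p : qlaurent N (Qzeta R N) (M p) by exact: (qlaurentM N0 KF (Xq _ _ Lq) (Xq _ _ sq)).
have phm i tau : Hp tau -> mero (ph i) tau.
  by move=> ht; case: i => p; [apply: meroM; [exact: fmer|exact: Mm]|exact: Mm].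
have phq i : qlaurent N (Qzeta R N) (ph i).
  by case: i => p; [exact: (qlaurentM N0 KF fq (Mq p))|exact: Mq].
have [r [al [ind Hal]]] := span_basis KF (codom x).
have /choice[y Hy] : forall i, exists y : nat -> R[i], (forall t, Qzeta R N (y t)) /\ x i = \sum_(t < r) y t * al t.
  by move=> i; have [y Ky E] := Hal (x i) (codom_f x i); exists y.
have polyE (W : nat -> {poly R[i]}) w : (forall k, (k < d)%N -> (size (W k) <= D)%N) ->
    \sum_(k < d) (W k).[sJ N w] * L w ^+ k = \sum_(p : 'I_d * 'I_D) (W (nat_of_ord p.1))`_p.2 * M p w.
  move=> h; rewrite -(pair_big xpredT xpredT (fun (k : 'I_d) (l : 'I_D) => (W k)`_l * M (k, l) w)) /=.
  apply: eq_bigr => k _; rewrite (horner_coef_wide _ (h _ (ltn_ord k))) mulr_suml.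
  by apply: eq_bigr => l _; rewrite /M /= -mulrA [L w ^+ _ * _]mulrC.
have VE w := polyE V w (fun k kd => (sD k kd).2); have UE w := polyE U w (fun k kd => (sD k kd).1).
have rel tau : Hp tau -> pnear tau (fun w => \sum_i (\sum_(t < r) y i t * al t) * ph i w = 0).
  move=> ht; have [h _] := rat tau ht; apply: pnear_imp h => w.
  rewrite VE UE => e; rewrite (eq_bigr (fun i => x i * ph i w)); last by move=> i _; have [_ ->] := Hy i.
  rewrite big_sumType /= (eq_bigr (fun p : 'I_d * 'I_D => f w * ((V (nat_of_ord p.1))`_p.2 * M p w))); last first.
    by move=> p _; rewrite mulrCA.
  rewrite -mulr_sumr e [X in _ + X](eq_bigr (fun p : 'I_d * 'I_D => - ((U (nat_of_ord p.1))`_p.2 * M p w))); last first.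
    by move=> p _; rewrite mulNr.
  by rewrite sumrN subrr.
have des t tau : (t < r)%N -> Hp tau -> pnear tau (fun w => \sum_i y i t * ph i w = 0).
  by move=> tr ht; apply: (descent KF phm phq ind (fun i => (Hy i).1) rel tr ht).
pose A t w := \sum_p y (inl p) t * M p w; pose B t w := \sum_p y (inr p) t * M p w.
have AF t : F (A t).
  by apply: (mf_sum FF) => p; apply: (mfM FF (Fc _ _) (MF p)); exact: (Hy (inl p)).1.
have BF t : F (B t).
  by apply: (mf_sum FF) => p; apply: (mfM FF (Fc _ _) (MF p)); exact: (Hy (inr p)).1.
have fAB t tau : (t < r)%N -> Hp tau -> pnear tau (fun w => f w * A t w + B t w = 0).
  move=> tr ht; apply: pnear_imp (des t tau tr ht) => w; rewrite big_sumType /= => e.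
  by rewrite -[RHS]e /A mulr_sumr; congr (_ + _); apply: eq_bigr => p _; rewrite mulrCA.
have hi : Hp (Complex 0 1 : R[i]) by rewrite /Hp /= ltr01.
have [[t tr nA]|allA] := pselect (exists2 t, (t < r)%N & ~ pnear (Complex 0 1 : R[i]) (fun w => A t w = 0)).
  have Am tau : Hp tau -> mero (A t) tau.
    by move=> ht; apply: mero_sum => p _; apply: meroM; [exact: mero_cst|exact: Mm].
  apply: (mf_mero_eq FF _ (mf_div FF (mfN FF (BF t)) (AF t))); apply/mero_eqP => tau ht.
  have nz : exists2 t0, Hp t0 & ~ pnear t0 (fun w => A t w = 0) by exists (Complex 0 1).
  have nA' := mero_nonzero Am nz ht.
  apply: pnear_imp (pnearI nA' (fAB t tau tr ht)) => w [a0 e].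
  by apply: (mulIf a0); rewrite divfK //; apply/eqP; rewrite eq_sym -addr_eq0 e.
(* If every A t vanished near the point, so would their combination with coefficients [al t], which
   is the denominator of the rational expression. *)
exfalso; apply: (@pnear_false R (Complex 0 1)).
have allA' : pnear (Complex 0 1 : R[i]) (fun w => forall t : 'I_r, A t w = 0).
  apply: pnear_forall => t; have [//|h] := pselect (pnear (Complex 0 1 : R[i]) (fun w => A t w = 0)).
  by case: allA; exists (nat_of_ord t).
have [_ h] := rat _ hi; apply: pnear_imp (pnearI h allA') => w [+ a0].
rewrite VE => /eqP; apply.
rewrite (eq_bigr (fun p : 'I_d * 'I_D => \sum_(t < r) al t * (y (inl p) t * M p w))); last first.
  move=> p _; have [_ E] := Hy (inl p); rewrite /= in E; rewrite E mulr_suml.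
  by apply: eq_bigr => t _; rewrite mulrAC mulrC.
rewrite exchange_big big1 //= => t _; rewrite -mulr_sumr.
by have := a0 t; rewrite /A => ->; rewrite mulr0.
Qed.

Theorem theorem3p3 (R : realType) (N : nat) (Q1 Q2 : 'Z_N * 'Z_N)
    (hN : (2 <= N)%N) (hN6 : N <> 6%N) (hQ : is_basis Q1 Q2) :
  modular_function_over N (Qzeta R N) =
  mero_adjoin (Qzeta R N) [set Lambda Q1 Q2; j_invariant].
Proof.
case: N Q1 Q2 hN hN6 hQ => [//|[//|n]] Q1 Q2 _ N6 hQ.
have N0 : (0 < n.+2)%N by []; have KF : is_subfield (Qzeta R n.+2) by exact: Qzeta_subfield.
have Qu := basis_unitdet hQ.
have LE : Lambda Q1 Q2 = (LamT Q1 Q2 : R[i] -> R[i]) by apply/funext => tau; exact: Lambda_LamT.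
rewrite LE; apply/seteqP; split=> [f hf F [FF sub]|].
  apply: (@modular_generated R n Q1 Q2 F f _ Qu FF _ _ _ hf).
  - by apply/eqP.
  - by move=> c Kc; apply: sub; left; exists c.
  - by apply: sub; right; left.
  - by apply: sub; right; right.
apply: smallest_sub; first exact: modular_function_over_subfield.
move=> _ [[c Kc <-]|[->|->]]; first exact: modular_over_cst.
  exact: LamT_modular.
exact: j_modular.
Qed.
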